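(* Let $K$ be a number field and let \[ Y: \quad a_0x_0^3 + a_1x_1^3 + a_2x_2^3 + a_3x_3^3 = 0 \quad \subset \mathbb{P}^3_K \times \mathbb{P}^3_K, \] where $(a_0:a_1:a_2:a_3)$ are the coordinates on the first factor and $(x_0:x_1:x_2:x_3)$ the coordinates on the second factor. For any dense open subset $U \subset Y$ and any anticanonical height function $H$ on $Y$ we have \[ N_{U,H}(B) \gg_{U,H} \begin{cases} B(\log B)^6, & \text{if } \mathbb{Q}(\sqrt{-3}) \subseteq K,\\ B(\log B)^3, & \text{if } \mathbb{Q}(\sqrt{-3}) \not\subset K. \end{cases} \]
   Context: An anticanonical height function on $Y$ is a height function on $Y(K)$ associated to the anticanonical divisor $-K_Y$ via the Weil height machine. For an open subset $U \subset Y$ and $B>0$, $N_{U,H}(B) = \#\{y \in U(K) : H(y) \leq B\}$. *)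

(* Defs.v *)
(* Number fields are [fieldExtType rat]
   (finite-dimensional field extensions of Q); archimedean places are taken
   through field embeddings into the complex numbers [R[i]] over an abstract
   [R : realType]. *)
From HB Require Import structures.
From mathcomp Require Import all_boot all_order all_algebra all_field.
From mathcomp Require Import all_classical all_reals all_analysis.
From mathcomp Require mpoly.
From mathcomp Require Import complex finmap.

Set Implicit Arguments.
Unset Strict Implicit.
Unset Printing Implicit Defensive.

Import Order.TTheory GRing.Theory Num.Theory.
Local Open Scope classical_set_scope.
Local Open Scope ring_scope.

Section Defs.
Variables (R : realType) (K : fieldExtType rat).

Definition cabs (z : R[i]) : R := Num.sqrt (complex.Re z ^+ 2 + complex.Im z ^+ 2).

Definition embeddings : set (K -> R[i]) :=
  [set s | s 1 = 1 /\ (forall u v, s (u + v) = s u + s v)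
                   /\ (forall u v, s (u * v) = s u * s v)].

Definition ring_of_integers : set K :=
  [set u | exists p : {poly int}, p \is monic /\ root (map_poly intr p) u].

Definition coords := 'I_4 -> K.

Definition nonzero_coords (v : coords) := exists i, v i != 0.

Definition coord_ideal (v : coords) : set K :=
  [set u | exists r : 'I_4 -> K, (forall i, ring_of_integers (r i)) /\
                                  u = \sum_(i < 4) r i * v i].

(** Index [A : B] of an additive subgroup B of A : the number of cosets
    (0 if infinite; it is always finite in the uses below). *)
Definition group_index (A B : set K) : nat :=
  (#|` fset_set [set [set (a + b)%R | b in B] | a in A] |)%fset.

Definition ideal_norm (a : set K) : R :=
  (group_index ring_of_integers (a `&` ring_of_integers))%:R /
  (group_index a (a `&` ring_of_integers))%:R.

(** Archimedean part: product over all embeddings sigma of max_i |sigma(v_i)|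
   (complex places thus counted twice, i.e. with local degree 2). *)
Definition arch_part (v : coords) : R :=
  \big[*%R/1]_(s \in embeddings) \big[Num.max/0]_(i < 4) cabs (s (v i)).

(** Standard (relative to K, multiplicative) Weil height on P^3(K):
      H_K(v) = prod_{v | oo} max |v_i|_v^{n_v} * prod_{p} max |v_i|_p^{n_p}
             = arch_part v / N(ideal generated by the v_i). *)
Definition heightK (v : coords) : R := arch_part v / ideal_norm (coord_ideal v).

Definition rep := (coords * coords)%type.

Definition proj_equiv (y z : rep) :=
  exists l m : K, l != 0 /\ m != 0 /\
    z.1 = (fun i => l * y.1 i) /\ z.2 = (fun i => m * y.2 i).

Definition on_Y (y : rep) :=
  nonzero_coords y.1 /\ nonzero_coords y.2 /\
  \sum_(i < 4) y.1 i * y.2 i ^+ 3 = 0.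

Definition concat8 (T : Type) (a x : 'I_4 -> T) : 'I_8 -> T :=
  fun i => if (i < 4)%N then a (inord i) else x (inord (i - 4)).

Definition bihomog (d1 d2 : nat) (p : mpoly.mpoly 8 K) :=
  forall mo : mpoly.multinom 8, mpoly.mcoeff mo p != 0 ->
    (\sum_(i < 8 | (i < 4)%N) tnth (mpoly.multinom_val mo) i)%N = d1 /\
    (\sum_(i < 8 | (4 <= i)%N) tnth (mpoly.multinom_val mo) i)%N = d2.

(** The open subset U = Y \ V(f_1, ..., f_m) (f_j bihomogeneous over K):
    its K-points. *)
Definition in_U (m : nat) (f : 'I_m -> mpoly.mpoly 8 K) (y : rep) :=
  on_Y y /\ exists j, mpoly.meval (concat8 y.1 y.2) (f j) != 0.

(** U is dense in Y, i.e. (Y being geometrically irreducible) U is nonempty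
    as a variety: it has a point over C (for some embedding of K into C). *)
Definition open_dense (m : nat) (f : 'I_m -> mpoly.mpoly 8 K) :=
  exists s, embeddings s /\
  exists a x : 'I_4 -> R[i], (exists i, a i != 0) /\ (exists i, x i != 0) /\
    \sum_(i < 4) a i * x i ^+ 3 = 0 /\
    exists j, mpoly.mmap s (concat8 a x) (f j) != 0.

(** Anticanonical divisor of Y (bidegree (1,3) hypersurface in P^3 x P^3,
    adjunction) : -K_Y = O(3,1)|_Y.  Reference anticanonical height: *)
Definition std_anticanonical_height (y : rep) : R :=
  heightK y.1 ^+ 3 * heightK y.2.

(** An anticanonical height function in the sense of the Weil height machine:
    a function on Y(K) (i.e. invariant under rescaling the representatives)
    differing from the reference one by a bounded multiplicative factor
    (log H = h_{-K_Y} + O(1)). *)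
Definition anticanonical_height (H : rep -> R) :=
  (forall y z, on_Y y -> proj_equiv y z -> H z = H y) /\
  exists C : R, 0 < C /\ forall y, on_Y y ->
    std_anticanonical_height y <= C * H y /\
    H y <= C * std_anticanonical_height y.

(** N_{U,H}(B) = #{ y in U(K) : H(y) <= B } (number of points, i.e. of
    equivalence classes of representatives; 0 if infinite, which does not
    happen by Northcott). *)
Definition N_UH (m : nat) (f : 'I_m -> mpoly.mpoly 8 K) (H : rep -> R) (B : R) : R :=
  ((#|` fset_set [set [set z | proj_equiv y z] | y in
                    [set y | in_U f y /\ H y <= B]] |)%fset)%:R.

End Defs.

(* Main.v *)
Require Import Defs.
From HB Require Import structures.
From mathcomp Require Import all_boot all_order all_algebra all_field.
From mathcomp Require Import all_classical all_reals all_analysis.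
From mathcomp Require mpoly.
From mathcomp Require Import complex finmap.
From mathcomp Require Import ring lra zify.

(** The points are found on a single fibre a_i = b_i^3 with positive integers b_i, chosen so that
    the fibre meets U; there the equation becomes x_0^3 + x_1^3 + x_2^3 + x_3^3 = 0.  With w a
    primitive cube root of unity, alpha = a_0 + a_1 w, beta = b_0 + b_1 w and
    gamma = alpha N(alpha) + beta N(beta), Euler's solutions are x_0 + x_1 w = (1 - w) alpha conj(gamma),
    x_2 + x_3 w = (1 - w) beta conj(gamma).  If pairwise coprime g_1, ..., g_5 divide
    alpha + beta, beta + w alpha, beta + w^2 alpha, alpha, beta respectively, and g_1, g_2, g_3, g_5, g_4
    divide the same forms in (conj alpha, conj beta), then the product g_1 ... g_5 divides gamma and
    conj(gamma), hence all x_i, and dividing by it lowers the height.  The congruences cost a factor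
    1 / |g_1 ... g_5|^2, the choice of the g_i gains |g_1 ... g_5|, and the lower height gains the rest:
    every dyadic box of values |g_i| contributes >> B points of height <= B.

    If w lies in K, then s = (alpha, beta) and p = (conj alpha, conj beta) are independent pairs, and
    the five sizes |g_i| and the ratio of the sizes of s and p are six free logarithmic parameters.
    Otherwise one works over K(w) with p = conj(s) and g = (g_1, g_2, conj g_2, g_4, conj g_4), g_1 in K,
    which leaves three.  Coprimality conditions, holding up to a fixed integer T (so that class
    numbers and units never intervene), make each point arise from boundedly many data: two data
    with the same point differ by scalars lambda, mu of s and p, and coprimality bounds lambda, mu
    and the ratios of the g_i together with their inverses. *)

Set Implicit Arguments.
Unset Strict Implicit.
Unset Printing Implicit Defensive.

Import Order.TTheory GRing.Theory Num.Theory.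
Local Open Scope ring_scope.

(** * Norms and boxes in orders *)

Section Pigeonhole.

(** All elements are kept balanced ([cond] bounded), that is, of comparable size at all archimedean
    places: each is chosen near a natural number or near a natural multiple of a fixed vector. One
    norm then serves all places, and the axioms [is_order] cover both O_K and O_K + O_K w. No local
    density is computed. If coprimality up to T fails for a large T, there is a common factor nu,
    balanced and of norm at least U0; its share of the main term is essentially at most nrm nu ^
    -(n+1), and these shares sum to O(1 / U0). So T is enlarged until every exceptional set is a
    small proportion. The order in which the constants are fixed matters, since each T depends on
    the proportions fixed before it. The error terms are dominated only if the sizes S of s and P of
    p exceed a power of G = prod |g_i|. Hence the logarithmic parameters range up to a small
    multiple of log B, which costs only a constant factor. In the split case a box has about G^n
    choices of g, S^(2n) / G^n of s and P^(2n) / G^n of p. The product is X^n with X = S^2 P^2 / G,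
    the size of the coordinates x_i after division, and their height is O(X^n). *)

Lemma pigeonhole (T U : eqType) (f : T -> U) (s : seq T) (t : seq U) :
  uniq s -> {in s, forall x, f x \in t} -> (size t < size s)%N ->
  exists x y, [/\ x \in s, y \in s, x != y & f x = f y].
Proof.
move=> us fst lt_ts; apply: contrapT => H.
have inj : {in s &, injective f}.
  move=> x y xs ys fxy; apply/eqP; apply: contrapT => /negP xy.
  by apply: H; exists x, y.
have := uniq_leq_size (s1 := map f s) (s2 := t).
rewrite map_inj_in_uniq // us size_map leqNgt lt_ts => /(_ isT) H1.
by have // : false by apply: H1 => _ /mapP [x xs ->]; apply: fst.
Qed.

Lemma count_has_le (T U : Type) (P : U -> pred T) (t : seq U) (s : seq T) :
  (count (fun x => has (P^~ x) t) s <= \sum_(u <- t) count (P u) s)%N.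
Proof.
elim: t => [|u t IH]; first by rewrite big_nil count_pred0.
rewrite big_cons /=.
have -> : count (fun x => P u x || has (P^~ x) t) s =
          count (predU (P u) (fun x => has (P^~ x) t)) s by apply: eq_count.
apply: leq_trans (_ : count (P u) s + count (fun x => has (P^~ x) t) s <= _)%N.
  by rewrite -count_predUI leq_addr.
by rewrite leq_add2l.
Qed.

(** The fibres over [t] cover [s], so the largest one has at least the average size; the inner
    induction on [t] finds a value that maximises the count. *)
Lemma pigeonhole_fibre (T U : eqType) (f : T -> U) (s : seq T) (t : seq U) :
  s != [::] -> {in s, forall x, f x \in t} ->
  exists u, (size s <= size t * count (fun x => f x == u) s)%N.
Proof.
move=> s0 fst.
have : (size s <= \sum_(u <- t) count (fun x => f x == u) s)%N.
  apply: leq_trans (count_has_le _ _ _).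
  rewrite -{1}count_predT; apply: eq_leq; apply: eq_in_count => x xs /=.
  by apply/esym/hasP; exists (f x); rewrite ?eqxx ?fst.
case: t fst => [|u0 t _].
  by case: s s0 => // x s _ /(_ x); rewrite in_cons eqxx in_nil => /(_ isT).
suff [u Hu] : exists u, (\sum_(v <- u0 :: t) count (fun x => f x == v) s
     <= size (u0 :: t) * count (fun x => f x == u) s)%N.
  by move=> /leq_trans/(_ Hu); exists u.
elim: t u0 => [|u1 t IH] u0; first by exists u0; rewrite big_seq1 mul1n.
have [u Hu] := IH u1; rewrite big_cons.
case: (leqP (count (fun x => f x == u0) s) (count (fun x => f x == u) s)) => c.
  by exists u; rewrite /= mulSn leq_add.
exists u0; rewrite /= mulSn leq_add2l (leq_trans Hu) //=.
by rewrite leq_mul2l ltnW ?orbT.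
Qed.

Lemma seq_argmin (R : realType) (T : eqType) (h : T -> R) (s : seq T) x0 :
  x0 \in s -> exists2 x, x \in s & forall y, y \in s -> h x <= h y.
Proof.
elim: s x0 => // x s IH x0 _.
case: s IH => [_|z s IH]; first by exists x; rewrite ?mem_head // => y; rewrite inE => /eqP ->.
have [y ys Hy] := IH z (mem_head _ _).
case: (leP (h x) (h y)) => hxy.
  exists x; first exact: mem_head.
  by move=> w; rewrite inE => /orP[/eqP -> //|/Hy]; apply: le_trans.
exists y; first by rewrite inE ys orbT.
by move=> w; rewrite inE => /orP[/eqP -> |/Hy //]; apply: ltW.
Qed.

End Pigeonhole.

(** * Axioms of a normed order, approximate division and packing *)

Section Order.
Variables (R : realType) (F : fieldType) (O : subringClosed F).
Variables (nrm : F -> R) (box : R -> seq F) (n : nat) (C : R).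

(** What the counting uses of an order of rank [n]: discreteness ([nrm_int]), cocompactness
    ([nrm_round]) and box counts of order X^n. The norm is only submultiplicative, and homogeneous
    for natural scalars; [nrm 1] may exceed 1. A single constant [C] serves all bounds. *)
Record is_order : Prop := IsOrder {
  order_const : 1 <= C;
  order_rank : (0 < n)%N;
  nrmD : forall x y, nrm (x + y) <= nrm x + nrm y;
  nrmN : forall x, nrm (- x) = nrm x;
  nrmM : forall x y, nrm (x * y) <= nrm x * nrm y;
  nrmZ : forall k x, nrm (k%:R * x) = k%:R * nrm x;
  nrm_int : forall x, x \in O -> x != 0 -> 1 <= nrm x;
  nrm_round : forall z, exists2 x, x \in O & nrm (z - x) <= C;
  box_uniq : forall X, uniq (box X);
  boxE : forall X x, (x \in box X) = (x \in O) && (nrm x <= X);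
  box_lb : forall X, 1 <= X -> X ^+ n <= C * (size (box X))%:R;
  box_ub : forall X, 1 <= X -> (size (box X))%:R <= C * X ^+ n }.

Hypothesis HO : is_order.

Let C1 : 1 <= C := order_const HO.
Let C0 : 0 < C.
Proof. exact: lt_le_trans C1. Qed.

Lemma nrm0 : nrm 0 = 0.
Proof. by have := nrmZ HO 0 0; rewrite !mul0r. Qed.

Lemma nrm_ge0 x : 0 <= nrm x.
Proof.
have := nrmD HO x (- x); rewrite subrr nrm0 (nrmN HO) -mulr2n.
by rewrite pmulrn_lge0.
Qed.

Lemma nrmB x y : nrm (x - y) <= nrm x + nrm y.
Proof. by rewrite -(nrmN HO y) (nrmD HO). Qed.

Lemma nrm1_ge1 : 1 <= nrm 1.
Proof. by apply: (nrm_int HO); rewrite ?rpred1 ?oner_neq0. Qed.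

Lemma nrm1_gt0 : 0 < nrm 1.
Proof. exact: lt_le_trans nrm1_ge1. Qed.

(** Characteristic 0 is not among the axioms; it follows from [nrmZ], since k = 0 in F would give k
    * nrm 1 = 0. *)
Lemma natF_neq0 k : (0 < k)%N -> k%:R != 0 :> F.
Proof.
move=> k0; apply/eqP => H; have := nrmZ HO k 1; rewrite H mul0r nrm0 => /eqP.
by rewrite eq_sym mulf_eq0 pnatr_eq0 (gt_eqF nrm1_gt0) orbF -leqn0 leqNgt k0.
Qed.

Lemma nrm_gt0 x : x != 0 -> 0 < nrm x.
Proof.
move=> x0; rewrite lt_neqAle nrm_ge0 andbT; apply/eqP => H.
have := nrmM HO x x^-1; rewrite mulfV // -H mul0r.
by move=> /(le_trans nrm1_ge1); rewrite ler10.
Qed.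

Lemma nrmZV k x : (0 < k)%N -> nrm (x / k%:R) = nrm x / k%:R.
Proof.
move=> k0; have := nrmZ HO k (x / k%:R).
rewrite mulrCA mulfV ?natF_neq0 // mulr1 => ->.
by rewrite [RHS]mulrAC mulfV ?mul1r // pnatr_eq0 -lt0n.
Qed.

(** A condition number: for a number field it is, up to constants, the ratio of the largest to the
    smallest archimedean absolute value of [x]. Bounding it replaces reduction modulo units. *)
Definition cond x := nrm x * nrm x^-1.

Lemma condE x : cond x = nrm x * nrm x^-1. Proof. by []. Qed.

Lemma condV x : cond x^-1 = cond x.
Proof. by rewrite /cond invrK mulrC. Qed.

Lemma condM x y : cond (x * y) <= cond x * cond y.
Proof.
rewrite /cond invfM mulrACA.
by apply: ler_pM; rewrite ?nrm_ge0 ?(nrmM HO).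
Qed.

Lemma condZ k x : (0 < k)%N -> cond (k%:R * x) = cond x.
Proof.
move=> k0; rewrite /cond invfM (nrmZ HO) [_^-1 * _]mulrC nrmZV //.
by rewrite [_ / k%:R]mulrC mulrACA mulfV ?mul1r // pnatr_eq0 -lt0n.
Qed.

Lemma box_ub_max X : (size (box X))%:R <= C * Num.max 1 X ^+ n.
Proof.
case: (leP 1 X) => X1; first exact: box_ub.
apply: le_trans (box_ub HO (lexx 1)); rewrite ler_nat.
apply: uniq_leq_size (box_uniq HO _) _ => x; rewrite !(boxE HO) => /andP[-> h].
by rewrite (le_trans h (ltW X1)).
Qed.

Lemma box0 X : 0 <= X -> 0 \in box X.
Proof. by move=> X0; rewrite (boxE HO) rpred0 nrm0. Qed.

Definition rnd z : F := sval (cid2 (nrm_round HO z)).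

Lemma rnd_int z : rnd z \in O.
Proof. by rewrite /rnd; case: cid2. Qed.

Lemma rnd_near z : nrm (z - rnd z) <= C.
Proof. by rewrite /rnd; case: cid2. Qed.

(** Remainder of an approximate division by [g]. It is not canonical, but equal remainders imply
    congruence, and all remainders lie in a box with O(nrm g ^ n) elements. *)
Definition res g x := x - g * rnd (x / g).

Lemma res_box g x : g \in O -> g != 0 -> x \in O -> res g x \in box (C * nrm g).
Proof.
move=> gO g0 xO; rewrite (boxE HO) rpredB ?rpredM ?rnd_int //=.
have -> : res g x = (x / g - rnd (x / g)) * g.
  by rewrite mulrBl mulfVK // [rnd _ * _]mulrC.
by apply: le_trans (nrmM HO _ _) _; rewrite ler_wpM2r ?nrm_ge0 ?rnd_near.
Qed.

Lemma res_eq g x y : g != 0 -> res g x = res g y -> (x - y) / g \in O.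
Proof.
move=> g0; rewrite /res => H.
have -> : x - y = g * (rnd (x / g) - rnd (y / g)).
  apply/eqP; rewrite -subr_eq0.
  have -> : x - y - g * (rnd (x / g) - rnd (y / g)) =
      (x - g * rnd (x / g)) - (y - g * rnd (y / g)) by ring.
  by rewrite H subrr.
by rewrite mulrAC mulfV // mul1r rpredB ?rnd_int.
Qed.

(** This number plays the part of the norm of [g]. Among 0, 1, 2, ... two have the same remainder as
    soon as they outnumber the remainders, and [g] divides their difference. *)
Lemma int_multiple g : g \in O -> g != 0 ->
  exists m, [/\ (0 < m)%N, m%:R <= C * (C * nrm g) ^+ n & m%:R / g \in O].
Proof.
move=> gO g0; set t := box (C * nrm g).
have [] := @pigeonhole nat F (fun j => res g j%:R) (iota 0 (size t).+1) t.
- exact: iota_uniq.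
- by move=> j _; apply: res_box; rewrite ?rpred_nat.
- by rewrite size_iota.
have bnd : (size t)%:R <= C * (C * nrm g) ^+ n.
  by apply: (box_ub HO); rewrite -[1]mulr1 ler_pM ?ler01 ?C1 ?(nrm_int HO).
move=> i [j []]; wlog lt_ij : i j / (j < i)%N => [hw|].
  move=> hi hj ij eqr; have := ij; rewrite neq_ltn => /orP[] h.
    by apply: (hw j i h) => //; rewrite eq_sym.
  exact: (hw i j h).
rewrite !mem_iota !add0n /= !ltnS => hi hj _ /res_eq => /(_ g0) H.
exists (i - j)%N; split; first by rewrite subn_gt0.
  by apply: le_trans bnd; rewrite ler_nat (leq_trans (leq_subr _ _)).
by rewrite natrB ?(ltnW lt_ij).
Qed.

(* Rescaling by a rational close to [2C/rho] makes the roundings of the points distinct. *)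
Lemma packing (s : seq F) (Y rho : R) : uniq s -> 0 < rho -> 0 <= Y ->
  {in s, forall z, nrm z <= Y} ->
  {in s &, forall z w, z != w -> rho <= nrm (z - w)} ->
  (size s)%:R <= C * (4 * C * Y / rho + C) ^+ n.
Proof.
move=> us rho0 Y0 hY hrho.
(* The scale is a rational k / l between 2 C / rho and 4 C / rho. Taking l > rho keeps 2 C l / rho
   at least 1, so rounding it up to [k] at most doubles it. *)
have [l lgt] : exists l : nat, rho < l%:R by exists (Num.trunc rho).+1; apply: truncnS_gt.
have lR0 : 0 < l%:R :> R by apply: lt_trans lgt.
have l0 : (0 < l)%N by move: lR0; rewrite ltr0n.
have ge1 : 1 <= 2 * C * l%:R / rho.
  rewrite ler_pdivlMr // mul1r (le_trans (ltW lgt)) // ler_peMl ?ler0n //.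
  by move: C1; lra.
have [k kgt kle] : exists2 k : nat, 2 * C * l%:R / rho < k%:R &
    k%:R <= 4 * C * l%:R / rho.
  exists (Num.trunc (2 * C * l%:R / rho)).+1; first exact: truncnS_gt.
  have -> : 4 * C * l%:R / rho = 2 * C * l%:R / rho + 2 * C * l%:R / rho by ring.
  rewrite -natr1; apply: (lerD _ ge1).
  by case/andP: (truncn_itv (le_trans ler01 ge1)).
pose q (z : F) := k%:R * (z / l%:R).
have qn z : nrm (q z) = k%:R * nrm z / l%:R by rewrite (nrmZ HO) nrmZV // mulrA.
set t := box (4 * C * Y / rho + C).
have hb : {in s, forall z, rnd (q z) \in t}.
  move=> z zs; rewrite (boxE HO) rnd_int /=.
  rewrite -[rnd (q z)](subKr (q z)); apply: le_trans (nrmB _ _) _.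
  apply: lerD; last exact: rnd_near.
  rewrite qn ler_pdivrMr //.
  have -> : 4 * C * Y / rho * l%:R = 4 * C * l%:R / rho * Y by ring.
  by apply: ler_pM; rewrite ?nrm_ge0 ?ler0n ?hY.
have : (size s <= size t)%N.
  rewrite leqNgt; apply/negP => lt_ts.
  have [z [w [zs ws zw E]]] := pigeonhole us hb lt_ts.
  have := hrho _ _ zs ws zw.
  have : nrm (q (z - w)) <= 2 * C.
    have -> : q (z - w) = (q z - rnd (q z)) - (q w - rnd (q w)).
      by rewrite E /q; ring.
    by apply: le_trans (nrmB _ _) _; rewrite mulr2n mulrDl mul1r lerD ?rnd_near.
  rewrite qn ler_pdivrMr // => h1 h2.
  have : k%:R * rho <= 2 * C * l%:R by apply: le_trans h1; rewrite ler_wpM2l ?ler0n.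
  by move: kgt; rewrite ltr_pdivrMr // => /lt_le_trans h /h; rewrite ltxx.
rewrite -(ler_nat R) => h; apply: le_trans h _; apply: (box_ub HO).
have : 0 <= 4 * C * Y / rho by rewrite divr_ge0 ?mulr_ge0 // ltW.
by move=> h; rewrite (le_trans C1) // lerDr.
Qed.

End Order.

(** * Coprimality up to an integer, and common factors when it fails *)

Section Coprime.
Variables (R : realType) (F : fieldType) (O : subringClosed F).
Variables (nrm : F -> R) (box : R -> seq F) (n : nat) (C : R).
Hypothesis HO : is_order O nrm box n C.
Local Notation cond := (cond nrm).

Let C1 : 1 <= C := order_const HO.
Let C0 : 0 < C.
Proof. exact: lt_le_trans C1. Qed.
Let N1 := nrm 1.
Let N11 : 1 <= N1 := nrm1_ge1 HO.

(** The ideal (a, b) contains [T]. Allowing T > 1 is what makes gcd arguments available when ideals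
    need not be principal. *)
Definition cop (T : nat) (a b : F) :=
  exists u v, [/\ u \in O, v \in O & a * u + b * v = T%:R].

Definition dv (D : nat) (N z : F) := D%:R * z / N \in O.

Lemma dvE D N z : dv D N z = (D%:R * z / N \in O). Proof. by []. Qed.

Lemma cop_sym T a b : cop T a b -> cop T b a.
Proof. by case=> u [v [uO vO E]]; exists v, u; split=> //; rewrite addrC. Qed.

Lemma cop_dvdn T T' a b : (T %| T')%N -> cop T a b -> cop T' a b.
Proof.
case/dvdnP=> k -> [u [v [uO vO E]]].
exists (k%:R * u), (k%:R * v); rewrite !rpredM ?rpred_nat //; split=> //.
by rewrite natrM -E; ring.
Qed.

Lemma cop_mul T T' a b c : a \in O -> b \in O -> c \in O ->
  cop T a c -> cop T' b c -> cop (T * T') (a * b) c.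
Proof.
move=> aO bO cO [u [v [uO vO E]]] [w [z [wO zO E']]].
exists (u * w), (a * u * z + v * b * w + c * v * z).
split; rewrite ?(rpredD, rpredM) //.
by rewrite natrM -E -E'; ring.
Qed.

Lemma cop_dv T D a b N : D%:R * b / N \in O -> N != 0 -> cop T a b -> a \in O ->
  cop (D * T) a N.
Proof.
move=> bN N0 [u [v [uO vO E]]] aO.
exists (D%:R * u), (D%:R * b / N * v); split; first by rewrite rpredM ?rpred_nat.
  by rewrite rpredM.
by rewrite natrM -E; field.
Qed.

Lemma dv_mul D D' T M N z : M != 0 -> N != 0 -> cop T M N ->
  dv D M z -> dv D' N z -> dv (D * D' * T) (M * N) z.
Proof.
move=> M0 N0 [u [v [uO vO E]]]; rewrite /dv => zM zN.
have -> : (D * D' * T)%:R * z / (M * N) =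
   D%:R * u * (D'%:R * z / N) + D'%:R * v * (D%:R * z / M).
  by rewrite !natrM -E; field; rewrite M0 N0.
by apply: rpredD; apply: rpredM => //; rewrite rpredM ?rpred_nat.
Qed.

Lemma dv_cop D T N a z : N != 0 -> a \in O -> z \in O ->
  cop T a N -> dv D N (a * z) -> dv (D * T) N z.
Proof.
move=> N0 aO zO [u [v [uO vO E]]]; rewrite /dv => h.
have -> : (D * T)%:R * z / N = D%:R * (a * z) / N * u + D%:R * z * v.
  by rewrite natrM -E; field.
by apply: rpredD; apply: rpredM => //; rewrite rpredM ?rpred_nat.
Qed.

(** The multipliers form the inverse of the ideal (a, b), which contains 1. A shortest one exists
    because l a ranges over a finite box. *)
Lemma min_multiplier a b : a \in O -> a != 0 -> b \in O ->
  exists l, [/\ l != 0, l * a \in O, l * b \in O, nrm l <= N1 &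
    forall l', l' != 0 -> l' * a \in O -> l' * b \in O -> nrm l <= nrm l'].
Proof.
move=> aO a0 bO.
pose s := [seq z / a | z <- box (N1 * nrm a) & (z != 0) && (z / a * b \in O)].
have inS l : l != 0 -> l * a \in O -> l * b \in O -> nrm l <= N1 -> l \in s.
  move=> l0 la lb lN; apply/mapP; exists (l * a); last by rewrite mulfK.
  rewrite mem_filter mulf_neq0 ?mulfK // lb (boxE HO) la /=.
  by apply: le_trans (nrmM HO _ _) _; rewrite ler_wpM2r // (nrm_ge0 HO).
have s1 : 1 \in s by apply: inS; rewrite ?oner_neq0 ?mul1r.
have [l ls lmin] := seq_argmin nrm s1.
have lN : nrm l <= N1 by apply: lmin.
move: (ls) => /mapP [z]; rewrite mem_filter => /andP[/andP[z0 zb]].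
rewrite (boxE HO) => /andP[zO _] El.
exists l; split=> //; rewrite ?El ?mulfVK // ?mulf_neq0 ?invr_neq0 //.
move=> l' l'0 l'a l'b; rewrite -El; case: (leP (nrm l') N1) => h.
  by apply: lmin; apply: inS.
exact: le_trans (ltW h).
Qed.

(* If [l^-1] were much longer than [1 / nrm l], the roundings of its small
   multiples would give too many short elements of the lattice. *)
Lemma min_multiplier_cond : exists2 K : R, 1 <= K &
  forall a b l, a != 0 -> l != 0 -> l * a \in O -> l * b \in O -> nrm l <= N1 ->
    (forall l', l' != 0 -> l' * a \in O -> l' * b \in O -> nrm l <= nrm l') ->
    a \in O -> b \in O -> cond l <= K.
Proof.
pose C2 := C * (4 * C * (N1 + C) + C) ^+ n.
have C2p : 0 <= C2.
  by rewrite mulr_ge0 ?exprn_ge0 ?addr_ge0 ?mulr_ge0 ?addr_ge0 // ?(le_trans ler01) // ltW.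
have N0 : 0 <= N1 by apply: le_trans N11.
have CC2 : 0 <= C * C2 by rewrite mulr_ge0 // ltW.
have CN : 0 <= C * N1 by rewrite mulr_ge0 // ltW.
exists (3 * C * N1 + 6 * C * C2 + 1); first lra.
move=> a b l a0 l0 la lb lN lmin aO bO.
have r0 : 0 < nrm l by apply: (nrm_gt0 HO).
set r := nrm l in lN lmin r0 *; set R' := nrm l^-1.
rewrite /cond -/r -/R'; case: (leP R' (3 * C)) => hR.
  have : r * R' <= N1 * (3 * C) by apply: ler_pM; rewrite ?(nrm_ge0 HO).
  move=> h; apply: le_trans h _; lra.
have C30 : 0 < 3 * C by rewrite mulr_gt0.
set L := Num.trunc (R' / (3 * C)).
have /andP[Lle Lgt] : L%:R <= R' / (3 * C) < L.+1%:R.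
  by apply: truncn_itv; rewrite divr_ge0 ?(nrm_ge0 HO) // ltW.
have L0 : (0 < L)%N.
  by rewrite -ltnS -(ltr_nat R) (lt_trans _ Lgt) // ltr_pdivlMr // mul1r.
have L0R : 0 < L%:R :> R by rewrite ltr0n.
move: Lle Lgt; rewrite ler_pdivlMr // ltr_pdivrMr // => Lle Lgt.
pose M := Num.trunc (r * L%:R).
have /andP[Mle Mgt] : M%:R <= r * L%:R < M.+1%:R.
  by apply: truncn_itv; rewrite mulr_ge0 // ltW.
pose q (j : nat) := j%:R * (l^-1 / L%:R) : F.
have qn j : nrm (q j) = j%:R * (R' / L%:R) by rewrite (nrmZ HO) (nrmZV HO).
have RL : 3 * C <= R' / L%:R by rewrite ler_pdivlMr // mulrC.
(* These elements belong to the lattice of multipliers and lie near j / L. The spacing R' / L of the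
   [q j] is at least 3 C, more than twice the rounding error, so they are distinct; by minimality of
   [l] they are [r] apart, and [packing] bounds their number. *)
pose f j := l * rnd HO (q j).
have fJ j : f j * a \in O /\ f j * b \in O.
  by rewrite /f; split; rewrite mulrAC rpredM ?(rnd_int HO).
have finj : {in iota 0 M.+1 &, injective f}.
  move=> i j _ _ /(mulfI l0) Eij; apply/eqP; apply: contrapT => /negP.
  wlog lt_ij : i j Eij / (i < j)%N => [hw|].
    by rewrite neq_ltn => /orP[] h; [apply: (hw i j)|apply: (hw j i)]; rewrite // neq_ltn h ?orbT.
  move=> _.
  have h1 : nrm (q (j - i)%N) <= C + C.
    have -> : q (j - i)%N = (q j - rnd HO (q j)) - (q i - rnd HO (q i)).
      by rewrite Eij /q natrB ?(ltnW lt_ij) //; ring.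
    by apply: le_trans (nrmB HO _ _) _; rewrite lerD ?(rnd_near HO).
  have h2 : R' / L%:R <= nrm (q (j - i)%N).
    rewrite qn ler_peMl ?(le_trans _ RL) // ?ler1n ?subn_gt0 //; lra.
  lra.
pose s := map f (iota 0 M.+1).
have us : uniq s by rewrite map_inj_in_uniq // iota_uniq.
have : (size s)%:R <= C * (4 * C * (r * (N1 + C)) / r + C) ^+ n.
  apply: (packing HO) => //.
  - by rewrite mulr_ge0 ?addr_ge0 // ltW.
  - move=> z /mapP [j]; rewrite mem_iota add0n /= ltnS => jM ->.
    have -> : f j = j%:R * (1 / L%:R) - l * (q j - rnd HO (q j)).
      have <- : l * q j = j%:R * (1 / L%:R).
        by rewrite /q; field; rewrite l0 (natF_neq0 HO).
      by rewrite /f; ring.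
    apply: le_trans (nrmB HO _ _) _; rewrite [r * _]mulrDr lerD //.
      rewrite (nrmZ HO) (nrmZV HO) // mulrA ler_pdivrMr // mulrAC ler_wpM2r //.
      by apply: le_trans Mle; rewrite ler_nat.
    apply: le_trans (nrmM HO _ _) _.
    by rewrite ler_wpM2l ?(nrm_ge0 HO) ?(rnd_near HO).
  - move=> z w /mapP [i _ ->] /mapP [j _ ->] ij; apply: lmin; first by rewrite subr_eq0.
      by rewrite mulrBl rpredB //; [case: (fJ i)|case: (fJ j)].
    by rewrite mulrBl rpredB //; [case: (fJ i)|case: (fJ j)].
rewrite size_map size_iota.
have -> : 4 * C * (r * (N1 + C)) / r = 4 * C * (N1 + C) by field; rewrite gt_eqF.
rewrite -/C2 => h.
have h1 : r * L%:R <= C2 by apply: le_trans (ltW Mgt) h.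
have h2 : R' <= 6 * C * L%:R.
  apply: le_trans (ltW Lgt) _; rewrite -natr1.
  have : 1 <= L%:R :> R by rewrite ler1n.
  move=> h2; have : C <= C * L%:R by rewrite ler_peMr // ltW.
  lra.
have h3 : r * R' <= 6 * C * (r * L%:R).
  by rewrite mulrCA ler_wpM2l // ltW.
have : 6 * C * (r * L%:R) <= 6 * C * C2 by rewrite ler_wpM2l //; lra.
lra.
Qed.

(** Thue's pigeonhole: the elements j + b v, with j < M and v in a box of size about nrm a,
    outnumber the remainders modulo [a]. A collision with distinct j puts a nonzero integer below M
    into (a, b); a collision with equal j gives a multiplier that is too short. *)
Lemma cop_of_lattice_min (K : R) : 1 <= K -> exists2 T : nat, (0 < T)%N &
  forall a b, a \in O -> a != 0 -> b \in O -> cond a <= K ->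
    (forall l', l' != 0 -> l' * a \in O -> l' * b \in O -> 1 <= nrm l') ->
    cop T a b.
Proof.
move=> K1; have K0 : 0 < K by apply: lt_le_trans K1.
pose A := C * C * (4 * C * K) ^+ n + 1.
pose M := (Num.trunc A).+1.
exists (M`!) => [|a b aO a0 bO ca lmin]; first exact: fact_gt0.
have na : 1 <= nrm a by apply: (nrm_int HO).
have na0 : 0 < nrm a by apply: lt_le_trans na.
have nv0 : 0 < nrm a^-1 by rewrite (nrm_gt0 HO) ?invr_neq0.
(* The largest size for which differences in [box V], divided by [a], have norm at most 2 V nrm a^-1
   = 1/2. Balance of [a] makes V at least nrm a / (4 K). *)
set V := (4 * nrm a^-1)^-1.
have V0 : 0 < V by rewrite invr_gt0 mulr_gt0.
have VK : nrm a <= 4 * K * V.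
  rewrite -(ler_pM2r nv0); apply: le_trans ca _.
  suff -> : 4 * K * V * nrm a^-1 = K by [].
  by rewrite /V; field; rewrite gt_eqF.
have bV : V ^+ n <= C * (size (box V))%:R.
  case: (leP 1 V) => hV; first exact: (box_lb HO).
  apply: le_trans (_ : 1 <= _); first by rewrite exprn_ile1 // ltW.
  apply: (le_trans C1); rewrite ler_peMr ?(ltW C0) // ler1n lt0n.
  have := box0 HO (ltW V0); by case: (box V).
pose t := box (C * nrm a).
pose s := [seq (j, v) | j <- iota 0 M, v <- box V].
have us : uniq s by rewrite allpairs_uniq ?iota_uniq ?(box_uniq HO) // => -[? ?] [? ?].
have lt_ts : (size t < size s)%N.
  rewrite -(ltr_nat R) size_allpairs size_iota natrM.
  apply: le_lt_trans (_ : _ <= C * (C * nrm a) ^+ n) _.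
    by apply: (box_ub HO); rewrite -[1]mulr1 ler_pM.
  have MA : A < M%:R by apply: truncnS_gt.
  rewrite -(ltr_pM2l C0).
  apply: le_lt_trans (_ : A * (C * (size (box V))%:R) < _); last first.
    rewrite [C * (M%:R * _)]mulrCA ltr_pM2r //; apply: lt_le_trans bV; exact: exprn_gt0.
  apply: le_trans (_ : A * V ^+ n <= _); last first.
    by rewrite ler_wpM2l // addr_ge0 ?mulr_ge0 ?exprn_ge0 ?mulr_ge0 // ltW.
  apply: le_trans (_ : C * C * (4 * C * K) ^+ n * V ^+ n <= _); last first.
    by rewrite ler_wpM2r ?exprn_ge0 ?(ltW V0) // lerDl.
  rewrite -[C * C * _ * _]mulrA -exprMn mulrA ler_wpM2l ?mulr_ge0 ?(ltW C0) //.
  apply: lerXn2r; rewrite ?nnegrE ?mulr_ge0 ?(ltW C0) ?(ltW V0) ?(ltW na0) ?(ltW K0) //.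
  have -> : 4 * C * K * V = C * (4 * K * V) by ring.
  by rewrite ler_wpM2l // ltW.
have [] := @pigeonhole _ _ (fun p : nat * F => res HO a (p.1%:R + b * p.2)) s t us _ lt_ts.
  move=> [j v] /allpairsP [[j' v'] [/= _ + [-> ->]]]; rewrite (boxE HO) => /andP[vO _].
  by apply: (res_box HO); rewrite // rpredD ?rpred_nat ?rpredM.
move=> [i v] [[j w] [/allpairsP [[i' v'] [/= hi hv [Ei Ev]]]
  /allpairsP [[j' w'] [/= hj hw [Ej Ew]]] ne /= E]].
move: hi hv hj hw E; rewrite -Ei -Ev -Ej -Ew => hi hv hj hw /(res_eq a0) E {i' v' j' w' Ei Ev Ej Ew}.
move: hv hw; rewrite !(boxE HO) => /andP[vO hv] /andP[wO hw].
case: (eqVneq i j) E ne => [-> | ne] E.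
  (* Equal j: (v - w) / a is a multiplier of norm at most 1/2, against [lmin]. *)
  rewrite xpair_eqE eqxx /= => vw; exfalso.
  have := lmin ((v - w) / a).
  rewrite mulf_neq0 ?invr_neq0 ?subr_eq0 // mulfVK // rpredB //.
  have -> : (v - w) / a * b = (j%:R + b * v - (j%:R + b * w)) / a by ring.
  move=> /(_ isT isT E).
  have : nrm ((v - w) / a) <= (V + V) * nrm a^-1.
    apply: le_trans (nrmM HO _ _) _; rewrite ler_wpM2r ?(nrm_ge0 HO) //.
    by apply: le_trans (nrmB HO _ _) _; rewrite lerD.
  have -> : (V + V) * nrm a^-1 = 2^-1 by rewrite /V; field; rewrite gt_eqF.
  lra.
move=> _ {lmin}; wlog lt_ij : i j v w hi hj E ne vO wO hv hw / (j < i)%N => [hwl|].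
  case: (ltngtP j i) => h; [exact: (hwl i j v w)| |by rewrite h eqxx in ne].
  apply: (hwl j i w v) => //; last by rewrite eq_sym.
  have -> : j%:R + b * w - (i%:R + b * v) = - (i%:R + b * v - (j%:R + b * w)) by ring.
  by rewrite mulNr rpredN.
(* The difference lies between 1 and M, so it divides M!, which no longer depends on the pair. *)
apply: (@cop_dvdn (i - j)).
  apply: dvdn_fact; rewrite subn_gt0 lt_ij /=; move: hi.
  by rewrite -[_ :: _]/(iota 0 M) mem_iota add0n => /ltnW; apply: leq_trans (leq_subr _ _).
exists ((i%:R + b * v - (j%:R + b * w)) / a), (w - v); rewrite rpredB //; split=> //.
by rewrite natrB ?(ltnW lt_ij) //; field.
Qed.

(** Dividing out a common factor without principal ideals: after multiplication by a shortest
    multiplier l the pair is coprime up to T0, so nu = T0 / l lies in (a, b) and divides T0 a and T0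
    b. It is balanced because l is. *)
Lemma bad_factor (K : R) : 1 <= K -> exists t0 (K' : R), [/\ (0 < t0)%N, 1 <= K' &
  forall U0 : R, exists2 T : nat, (0 < T)%N &
  forall a b, a \in O -> a != 0 -> b \in O -> cond a <= K -> ~ cop T a b ->
  exists nu, [/\ nu \in O, nu != 0, cond nu <= K', U0 <= nrm nu & (dv t0 nu a /\ dv t0 nu b)]].
Proof.
move=> K1.
have [K' K'1 HK'] := min_multiplier_cond.
have KK1 : 1 <= K * K' by rewrite -[1]mulr1 ler_pM.
have [T0 T0p HT0] := cop_of_lattice_min KK1.
exists T0, K'; split=> // U0.
pose M := Num.trunc (C * (C * Num.max 1 U0) ^+ n).
exists (M`!) => [|a b aO a0 bO ca ncop]; first exact: fact_gt0.
have [l [l0 la lb lN lmin]] := min_multiplier aO a0 bO.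
have cl : cond l <= K' by apply: (HK' a b).
have np : 0 < nrm l by apply: (nrm_gt0 HO).
have [|||||u [v [uO vO E]]] := HT0 (l * a) (l * b) => //.
- by rewrite mulf_neq0.
- by rewrite mulrC; apply: le_trans (condM HO _ _) _; rewrite ler_pM // ?mulr_ge0 ?(nrm_ge0 HO).
- move=> l' l'0; rewrite !mulrA => l'a l'b.
  have := lmin (l' * l); rewrite mulf_neq0 // => /(_ isT l'a l'b).
  by move=> /le_trans/(_ (nrmM HO _ _)); rewrite ler_pMl.
exists (T0%:R / l).
have T0F : T0%:R != 0 :> F by apply: (natF_neq0 HO).
have En : T0%:R / l = a * u + b * v by rewrite -E; field.
have nuO : T0%:R / l \in O by rewrite En rpredD ?rpredM.
have nu0 : T0%:R / l != 0 by rewrite mulf_neq0 ?invr_neq0.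
split=> //.
- by rewrite (condZ HO) // condV.
(* If nu were shorter than U0, a natural number at most M would be a multiple of nu = a u + b v, so
   (a, b) would contain M!, against [ncop]. *)
- rewrite leNgt; apply/negP => ltU; apply: ncop.
  have [m [m0 mle mO]] := int_multiple HO nuO nu0.
  apply: (@cop_dvdn m).
    apply: dvdn_fact; rewrite m0 /= -(ler_nat R).
    have mle2 : m%:R <= C * (C * Num.max 1 U0) ^+ n.
      apply: le_trans mle _; rewrite ler_wpM2l ?(ltW C0) //.
      apply: lerXn2r; rewrite ?nnegrE ?mulr_ge0 ?(ltW C0) ?(nrm_ge0 HO) ?le_max ?ler01 //.
      by rewrite ler_wpM2l ?(ltW C0) // le_max (ltW ltU) orbT.
    by rewrite ler_nat truncn_ge_nat // (le_trans _ mle2).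
  exists (u * (m%:R / (T0%:R / l))), (v * (m%:R / (T0%:R / l))).
  split; [exact: rpredM | exact: rpredM |].
  by rewrite [a * _]mulrA [b * _]mulrA -mulrDl -En mulrC mulfVK.
- rewrite /dv; split.
    have -> : T0%:R * a / (T0%:R / l) = l * a by field; rewrite l0 T0F.
    by [].
  have -> : T0%:R * b / (T0%:R / l) = l * b by field; rewrite l0 T0F.
  by [].
Qed.

End Coprime.

(** A bad pair has a witness v in [r], and for a fixed v the conditions on the two components are
    independent. *)
Lemma count_pairs_le (T1 T2 U : eqType) (s : seq T1) (t : seq T2) (r : seq U)
    (P : T1 -> T2 -> bool) (A : U -> pred T1) (B : U -> pred T2) :
  (forall a x, a \in s -> x \in t -> P a x -> has (fun v => A v a && B v x) r) ->
  (\sum_(a <- s) count (P a) t <= \sum_(v <- r) count (A v) s * count (B v) t)%N.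
Proof.
move=> H; pose h a v := (A v a * count (B v) t)%N.
apply: leq_trans (_ : \sum_(a <- s) \sum_(v <- r) h a v <= _)%N; last first.
  rewrite exchange_big /=; apply: eq_leq; apply: eq_bigr => v _.
  by rewrite /h -big_distrl /=; congr (_ * _)%N; rewrite -sumn_count sumnE big_map.
rewrite big_seq [X in (_ <= X)%N]big_seq; apply: leq_sum => a aS.
apply: leq_trans (_ : count (fun x => has (fun v => A v a && B v x) r) t <= _)%N.
  rewrite (@eq_in_count _ _ (predI (P a) (fun x => has (fun v => A v a && B v x) r))).
    by apply: sub_count => x /andP[].
  by move=> x xt /=; case Px: (P a x) => //=; rewrite H.
apply: leq_trans (count_has_le _ _ _) _; apply: leq_sum => v _; rewrite /h.
by case: (A v a); rewrite ?mul1n //= count_pred0.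
Qed.

(** * Sieving: pairs that are not coprime are rare *)

Section CountPairs.
Variables (R : realType) (F : fieldType) (O : subringClosed F).
Variables (nrm : F -> R) (box : R -> seq F) (n : nat) (C : R).
Hypothesis HO : is_order O nrm box n C.
Local Notation cond := (cond nrm).
Local Notation cop := (cop O).
Local Notation dv := (dv O).

Let C1 : 1 <= C := order_const HO.
Let C0 : 0 < C.
Proof. exact: lt_le_trans C1. Qed.

(** Subtracting one element and dividing by N maps a class modulo N into a box. The maximum with 1
    accounts for classes with a single short element. *)
Lemma ap_count (s : seq F) (D : nat) (N : F) (Y : R) : uniq s -> (0 < D)%N -> N != 0 ->
  {in s, forall z, nrm z <= Y} -> {in s &, forall z w, dv D N (z - w)} ->
  (size s)%:R <= C * Num.max 1 (2 * D%:R * Y * nrm N^-1) ^+ n.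
Proof.
move=> us D0 N0 hY hdv.
case: s us hY hdv => [_ _ _|z0 s us hY hdv].
  by rewrite mulr_ge0 ?exprn_ge0 ?le_max ?ler01 ?(ltW C0).
pose f z := D%:R * (z - z0) / N.
have DF : D%:R != 0 :> F by apply: (natF_neq0 HO).
have finj : injective f.
  move=> z w E; apply: (addIr (- z0)); apply: (mulfI DF).
  by apply: (mulIf (invr_neq0 N0)).
apply: le_trans (box_ub_max HO (2 * D%:R * Y * nrm N^-1)).
rewrite ler_nat -(size_map f); apply: uniq_leq_size; first by rewrite map_inj_uniq.
move=> _ /mapP [z zs ->]; rewrite (boxE HO); apply/andP; split.
  by apply: hdv; rewrite ?mem_head.
apply: le_trans (nrmM HO _ _) _; rewrite ler_wpM2r ?(nrm_ge0 HO) // (nrmZ HO).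
rewrite [2 * _]mulrC -mulrA ler_wpM2l //.
by apply: le_trans (nrmB HO _ _) _; rewrite mulr2n mulrDl mul1r lerD ?hY ?mem_head.
Qed.

Lemma dvB D N z w : dv D N z -> dv D N w -> dv D N (z - w).
Proof. by rewrite !dvE => h1 h2; rewrite mulrBr mulrBl rpredB. Qed.

Lemma dv_nrm D N z (K' : R) : z \in O -> z != 0 -> (0 < D)%N -> N != 0 -> cond N <= K' ->
  dv D N z -> nrm N <= D%:R * K' * nrm z.
Proof.
move=> zO z0 D0 N0 cN h.
have Np : 0 < nrm N by apply: (nrm_gt0 HO).
have DF : D%:R != 0 :> F by apply: (natF_neq0 HO).
have := nrm_int HO h; rewrite !mulf_neq0 ?invr_neq0 // => /(_ isT).
move=> /le_trans/(_ (nrmM HO _ _)); rewrite (nrmZ HO) => h1.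
have : nrm N * 1 <= nrm N * (D%:R * nrm z * nrm N^-1) by rewrite ler_pM2l.
rewrite mulr1 => /le_trans; apply.
have -> : nrm N * (D%:R * nrm z * nrm N^-1) = D%:R * nrm z * cond N.
  by rewrite condE; ring.
by rewrite mulrAC ler_wpM2r ?(nrm_ge0 HO) // ler_wpM2l.
Qed.

(** Leaving out 0 removes the maximum with 1 of [ap_count]: one nonzero multiple of N in the box
    already forces nrm N = O(Y). *)
Lemma dv_count (D : nat) (N : F) (Y K' : R) : (0 < D)%N -> N != 0 -> 1 <= K' -> 0 <= Y ->
  cond N <= K' ->
  (count (fun x : F => (x != 0%R) && dv D N x) (box Y))%:R <= C * (2 * D%:R * K' * Y / nrm N) ^+ n.
Proof.
move=> D0 N0 K'1 Y0 cN; rewrite -size_filter; set s := seq.filter _ _.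
have Np : 0 < nrm N by apply: (nrm_gt0 HO).
have sP x : x \in s -> [/\ x \in O, x != 0, dv D N x & nrm x <= Y].
  by rewrite mem_filter (boxE HO) => /and3P[/andP[? ?] ? ?].
have us : uniq s by rewrite filter_uniq ?(box_uniq HO).
have K'0 : 0 <= K' by apply: le_trans K'1.
have [->|[x0 x0s]] : s = [::] \/ exists x, x \in s.
- by case: (s) => [|x s0]; [left | right; exists x; rewrite mem_head].
- by rewrite mulr_ge0 ?exprn_ge0 ?divr_ge0 ?mulr_ge0 ?(ltW C0) ?(ltW Np).
have NY : nrm N <= D%:R * K' * Y.
  have [xO xn0 xd xY] := sP _ x0s.
  apply: le_trans (dv_nrm xO xn0 D0 N0 cN xd) _.
  by rewrite ler_wpM2l // mulr_ge0.
apply: le_trans (ap_count (D := D) (N := N) (Y := Y) us _ _ _ _) _ => //.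
- by move=> z /sP[].
- by move=> z w /sP[_ _ hz _] /sP[_ _ hw _]; apply: dvB.
rewrite ler_wpM2l ?(ltW C0) //; apply: lerXn2r; rewrite ?nnegrE ?le_max ?ler01 //.
  by rewrite divr_ge0 ?mulr_ge0 ?(ltW Np).
have cN' : nrm N^-1 <= K' / nrm N by rewrite ler_pdivlMr // mulrC.
rewrite ge_max; apply/andP; split.
  rewrite ler_pdivlMr // mul1r (le_trans NY) //.
  by rewrite -!mulrA ler_peMl ?ler1n // !mulr_ge0.
have -> : 2 * D%:R * K' * Y / nrm N = 2 * D%:R * Y * (K' / nrm N) by ring.
by rewrite ler_wpM2l // !mulr_ge0.
Qed.

(** Dyadic shells: each has at most C (2^(k+1) U0)^n elements, each contributing at most (2^k
    U0)^-(n+1). The exponent n + 1 is the least integer for which the sum over the rank [n] lattice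
    converges. *)
Lemma tail_sum : exists2 K : R, 0 < K & forall U0 Y : R, 1 <= U0 ->
  \sum_(x <- box Y | U0 <= nrm x) (nrm x) ^- n.+1 <= K / U0.
Proof.
exists (C + C * 2 ^+ n * 2); first by rewrite addr_gt0 ?mulr_gt0 ?exprn_gt0.
move=> U0 Y U01; have U00 : 0 < U0 by apply: lt_le_trans U01.
pose S k := \sum_(x <- box Y | U0 <= nrm x <= 2 ^+ k * U0) (nrm x) ^- n.+1.
have shell (a b : R) : 1 <= a -> 1 <= b ->
    \sum_(x <- box Y | (a <= nrm x) && (nrm x <= b)) (nrm x) ^- n.+1 <= C * b ^+ n / a ^+ n.+1.
  move=> a1 b1; have a0 : 0 < a by apply: lt_le_trans a1.
  apply: le_trans (_ : \sum_(x <- box Y | (a <= nrm x) && (nrm x <= b)) a ^- n.+1 <= _).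
    apply: ler_sum => x /andP[h _].
    have nx : 0 < nrm x by apply: lt_le_trans h.
    by rewrite lef_pV2 ?posrE ?exprn_gt0 //; apply: lerXn2r; rewrite ?nnegrE ?(ltW a0) ?(ltW nx).
  rewrite big_const_seq iter_addr_0 -[X in X <= _]mulr_natr mulrC ler_wpM2r ?invr_ge0 ?exprn_ge0 ?(ltW a0) //.
  apply: le_trans (box_ub HO b1); rewrite ler_nat -size_filter.
  apply: uniq_leq_size; first by rewrite filter_uniq ?(box_uniq HO).
  by move=> x; rewrite mem_filter !(boxE HO) => /andP[/andP[_ ->] /andP[-> _]].
(* The factor 2 - 2 * 2^-k is the partial sum of the geometric series over the shells. *)
have Sk k : S k <= (C + C * 2 ^+ n * (2 - 2 * 2 ^- k)) / U0.
  elim: k => [|k IH].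
    apply: le_trans (_ : C * U0 ^+ n / U0 ^+ n.+1 <= _).
      by rewrite /S expr0 mul1r; apply: shell.
    rewrite expr0 invr1 mulr1 subrr mulr0 addr0 exprS.
    suff -> : C * U0 ^+ n / (U0 * U0 ^+ n) = C / U0 by [].
    by field; rewrite gt_eqF //= expf_neq0 // gt_eqF.
  apply: le_trans (_ : S k + \sum_(x <- box Y | (2 ^+ k * U0 <= nrm x) && (nrm x <= 2 ^+ k.+1 * U0)) (nrm x) ^- n.+1 <= _).
    rewrite /S big_mkcond [X in _ <= X + _]big_mkcond [X in _ <= _ + X]big_mkcond -big_split /=.
    apply: ler_sum => x _; have nx : 0 <= (nrm x) ^- n.+1 by rewrite invr_ge0 exprn_ge0 ?(nrm_ge0 HO).
    case: (leP U0 (nrm x)) => h1 /=; last by rewrite add0r; case: ifP.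
    case: (leP (nrm x) (2 ^+ k.+1 * U0)) => h2 /=; last first.
      by rewrite andbF addr0; case: ifP.
    case: (leP (nrm x) (2 ^+ k * U0)) => h3; last by rewrite andbT (ltW h3) add0r.
    by rewrite lerDl; case: ifP.
  have -> : (C + C * 2 ^+ n * (2 - 2 * 2 ^- k.+1)) / U0 =
    (C + C * 2 ^+ n * (2 - 2 * 2 ^- k)) / U0 + C * (2 ^+ k.+1 * U0) ^+ n / (2 ^+ k * U0) ^+ n.+1.
    have h2 : 2 != 0 :> R by rewrite pnatr_eq0.
    have -> : 2 ^+ k.+1 * U0 = 2 * (2 ^+ k * U0) by rewrite exprS mulrA.
    rewrite [2 ^+ k.+1]exprS exprMn [_ ^+ n.+1]exprS.
    have : (2 ^+ k * U0) ^+ n != 0 by rewrite expf_neq0 // mulf_neq0 ?expf_neq0 // gt_eqF.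
    have : (2 ^+ k) != 0 :> R by rewrite expf_neq0.
    move: (2 ^+ n) ((2 ^+ k * U0) ^+ n) (2 ^+ k) => P W Q' hQ hW.
    by field; rewrite hW hQ gt_eqF.
  by apply: lerD => //; apply: shell; rewrite mulr_ege1 // exprn_ege1 // ler1n.
pose k := Num.trunc Y.
have hk : Y <= 2 ^+ k.+1 * U0.
  have : Y < k.+1%:R by apply: truncnS_gt.
  move=> /ltW /le_trans; apply; apply: le_trans (_ : 2 ^+ k.+1 <= _).
    by rewrite -natrX ler_nat ltnW // ltn_expl.
  by rewrite ler_peMr ?exprn_ge0.
apply: le_trans (_ : S k.+1 <= _).
  rewrite /S big_seq_cond [X in _ <= X]big_seq_cond.
  rewrite (eq_bigl (fun x => (x \in box Y) && (U0 <= nrm x <= 2 ^+ k.+1 * U0))) // => x.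
  case E: (x \in box Y) => //=; case: (U0 <= nrm x) => //=.
  by move: E; rewrite (boxE HO) => /andP[_ /le_trans/(_ hk)] ->.
apply: le_trans (Sk _) _; rewrite ler_pM2r ?invr_gt0 // lerD2l ler_wpM2l ?mulr_ge0 ?exprn_ge0 ?(ltW C0) //.
by rewrite gerBl mulr_ge0 ?invr_ge0 ?exprn_ge0.
Qed.

(** The full box saves nrm nu ^ n for a common factor nu, so the family [s] has to save only one
    further power of nrm nu to reach the convergent exponent n + 1. This weak requirement also
    covers sparse families, such as elements of a subring or coordinates of lattice points. *)
Lemma bad_pairs (K : R) : 1 <= K -> exists t0 (K' K2 : R), [/\ (0 < t0)%N, 1 <= K', 0 < K2 &
  forall U0 : R, 1 <= U0 -> exists2 T : nat, (0 < T)%N &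
  forall (s : seq F) (M Y : R), 0 <= M -> 1 <= Y ->
   {in s, forall a, [/\ a \in O, a != 0 & cond a <= K]} ->
   (forall nu, nu \in O -> nu != 0 -> cond nu <= K' -> (count (dv t0 nu) s)%:R <= M / nrm nu) ->
   (\sum_(a <- s) count (fun x : F => (x != 0%R) && ~~ `[< cop T a x >]) (box Y))%:R <= K2 / U0 * M * Y ^+ n].
Proof.
move=> K1; have [t0 [K' [t00 K'1 HT]]] := bad_factor HO K1.
have [Kt Kt0 tail] := tail_sum.
have K'0 : 0 <= K' by apply: le_trans K'1.
have K'p : 0 < K' by apply: lt_le_trans K'1.
have tp : 0 < t0%:R :> R by rewrite ltr0n.
exists t0, K', (Kt * (C * (2 * t0%:R * K') ^+ n)); split=> //.
  by rewrite !mulr_gt0 // exprn_gt0 // !mulr_gt0.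
move=> U0 U01; have [T T0 HT0] := HT U0; exists T => // s M Y M0 Y1 sP sM.
have Y0 : 0 <= Y by apply: le_trans Y1.
pose r := [seq nu <- box (t0%:R * K' * Y) | [&& nu != 0, cond nu <= K' & U0 <= nrm nu]].
have key := @count_pairs_le _ _ _ s (box Y) r
  (fun a x : F => (x != 0) && ~~ `[< cop T a x >]) (fun nu a => dv t0 nu a)
  (fun nu x : F => (x != 0) && dv t0 nu x).
rewrite -(ler_nat R) in key; apply: le_trans (key _) _ => [a x aS|].
  rewrite (boxE HO) => /andP[xO xY] /andP[x0 /asboolPn nc]; apply/hasP.
  have [aO a0 ca] := sP _ aS.
  have [nu [nuO nu0 cnu Unu [da dx]]] := HT0 a x aO a0 xO ca nc.
  exists nu; last by rewrite da x0 dx.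
  rewrite mem_filter nu0 cnu Unu (boxE HO) nuO /=.
  by apply: le_trans (dv_nrm xO x0 t00 nu0 cnu dx) _; rewrite ler_wpM2l // mulr_ge0.
rewrite natr_sum.
apply: le_trans (_ : \sum_(nu <- r) M * (C * (2 * t0%:R * K' * Y) ^+ n) * (nrm nu) ^- n.+1 <= _).
  rewrite big_seq [X in _ <= X]big_seq; apply: ler_sum => nu.
  rewrite mem_filter (boxE HO) => /andP[/and3P[nu0 cnu Unu] /andP[nuO _]].
  have Np : 0 < nrm nu by apply: (nrm_gt0 HO).
  rewrite natrM; apply: le_trans (ler_pM _ _ (sM _ nuO nu0 cnu) (dv_count t00 nu0 K'1 Y0 cnu)) _ => //.
  rewrite expr_div_n exprS invfM.
  by rewrite le_eqVlt; apply/predU1P; left; ring.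
rewrite -mulr_sumr big_filter_cond /=.
apply: le_trans (_ : M * (C * (2 * t0%:R * K' * Y) ^+ n) * (Kt / U0) <= _).
  rewrite ler_wpM2l ?mulr_ge0 ?exprn_ge0 ?mulr_ge0 ?(ltW C0) //.
  apply: le_trans (tail U0 (t0%:R * K' * Y) U01).
  rewrite big_mkcond [X in _ <= X]big_mkcond /=; apply: ler_sum => x _.
  have nx : 0 <= (nrm x) ^- n.+1 by rewrite invr_ge0 exprn_ge0 ?(nrm_ge0 HO).
  by case: (U0 <= nrm x) => /=; rewrite ?andbT ?andbF //=; case: ifP.
by rewrite exprMn le_eqVlt; apply/predU1P; left; ring.
Qed.

Lemma bad_pairs_box (K eps : R) : 1 <= K -> 0 < eps -> exists2 T : nat, (0 < T)%N &
  forall A Y : R, 1 <= A -> 1 <= Y ->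
   (\sum_(a <- box A | (a != 0%R) && (cond a <= K)%R)
      count (fun x : F => (x != 0%R) && ~~ `[< cop T a x >]) (box Y))%:R <= eps * A ^+ n * Y ^+ n.
Proof.
move=> K1 e0; have [t0 [K' [K2 [t00 K'1 K20 H]]]] := bad_pairs K1.
have K'0 : 0 <= K' by apply: le_trans K'1.
pose Q := C * (2 * t0%:R * K' * 1) ^+ n * (t0%:R * K').
have Q0 : 0 <= Q by rewrite !mulr_ge0 ?exprn_ge0 ?mulr_ge0 ?(ltW C0).
have U1 : 1 <= Num.max 1 (K2 * Q / eps) by rewrite le_max lexx.
have [T T0 HT] := H _ U1.
exists T => // A Y A1 Y1; have A0 : 0 <= A by apply: le_trans A1.
rewrite -big_filter; set s := seq.filter _ _.
apply: le_trans (HT s (Q * A ^+ n) Y _ Y1 _ _) _.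
- by rewrite mulr_ge0 ?exprn_ge0.
- by move=> a; rewrite mem_filter (boxE HO) => /andP[/andP[? ?] /andP[? ?]].
- move=> nu nuO nu0 cnu; have Np : 0 < nrm nu by apply: (nrm_gt0 HO).
  have cs : (count (dv t0 nu) s)%:R <= C * (2 * t0%:R * K' * A / nrm nu) ^+ n.
    apply: le_trans (dv_count t00 nu0 K'1 A0 cnu); rewrite ler_nat count_filter.
    by apply: sub_count => x /= /andP[-> /andP[-> _]].
  have [c0|[a aS]] : count (dv t0 nu) s = 0%N \/ exists2 a, a \in s & dv t0 nu a.
    case: (posnP (count (dv t0 nu) s)) => [->|]; first by left.
    by rewrite -has_count => /hasP[a aS da]; right; exists a.
    by rewrite c0 divr_ge0 ?(ltW Np) // mulr_ge0 // exprn_ge0.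
  move: aS; rewrite mem_filter (boxE HO) => /andP[/andP[a0 _] /andP[aO aA]] da.
  have nuA := dv_nrm aO a0 t00 nu0 cnu da.
  have nuA' : nrm nu <= t0%:R * K' * A by apply: le_trans nuA _; rewrite ler_wpM2l // mulr_ge0.
  have nu1 := nrm_int HO nuO nu0.
  apply: le_trans cs _; rewrite /Q mulr1 !exprMn exprVn.
  (* The box saves n powers; since n >= 1 and nrm nu >= 1, they give the one power that is required
     of [s]. *)
  have e1 : (nrm nu) ^- n <= 1 / nrm nu.
    rewrite div1r lef_pV2 ?posrE ?exprn_gt0 //.
    by rewrite -[X in X <= _]expr1; apply: ler_weXn2l; rewrite ?(order_rank HO).
  have -> : C * (2 ^+ n * t0%:R ^+ n * K' ^+ n) * (t0%:R * K') * A ^+ n / nrm nu =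
     C * (2 ^+ n * t0%:R ^+ n * K' ^+ n) * A ^+ n * (t0%:R * K' * (1 / nrm nu)) by ring.
  have -> : C * (2 ^+ n * t0%:R ^+ n * K' ^+ n * A ^+ n * (nrm nu) ^- n) =
     C * (2 ^+ n * t0%:R ^+ n * K' ^+ n) * A ^+ n * (nrm nu) ^- n by ring.
  rewrite ler_wpM2l ?mulr_ge0 ?exprn_ge0 ?(ltW C0) //.
  apply: le_trans e1 _; rewrite ler_peMl ?divr_ge0 ?(ltW Np) //.
  by rewrite mulr_ege1 ?ler1n.
rewrite mulrA ler_wpM2r ?exprn_ge0 ?(le_trans ler01 Y1) //.
rewrite ler_wpM2r ?exprn_ge0 //.
have mp : 0 < Num.max 1 (K2 * Q / eps) by rewrite lt_max ltr01.
rewrite mulrAC ler_pdivrMr // [eps * _]mulrC -ler_pdivrMr //.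
by rewrite le_max lexx orbT.
Qed.

End CountPairs.

(** * Lattices cut out by congruences on linear forms *)

Lemma prod_ge1 (R : realType) (I : finType) (p : pred I) (G : I -> R) :
  (forall i, 1 <= G i) -> 1 <= \prod_(i | p i) G i.
Proof.
move=> G1; elim/big_ind: _ => // x y; exact: mulr_ege1.
Qed.

Lemma max_scale (R : realType) (c x : R) : 1 <= c -> 0 <= x ->
  Num.max 1 (c * x) <= c * Num.max 1 x.
Proof.
move=> c1 x0; have c0 : 0 <= c by apply: le_trans c1.
rewrite ge_max ler_wpM2l ?le_max ?lexx ?orbT // andbT.
by rewrite mulr_ege1 // le_max lexx.
Qed.

Section Forms.
Variables (R : realType) (F : fieldType) (O : subringClosed F).
Variables (nrm : F -> R) (box : R -> seq F) (n : nat) (C : R).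
Hypothesis HO : is_order O nrm box n C.
Local Notation cond := (cond nrm).
Local Notation cop := (cop O).
Local Notation dv := (dv O).

Let C1 : 1 <= C := order_const HO.
Let C0 : 0 < C.
Proof. exact: lt_le_trans C1. Qed.

Lemma cop_prod (T1 : nat) (I : eqType) (g : I -> F) (r : seq I) (c : F) :
  c \in O -> (forall i, g i \in O) -> {in r, forall k, cop T1 (g k) c} ->
  cop (T1 ^ size r) (\prod_(k <- r) g k) c.
Proof.
move=> cO gO; elim: r => [|k r IH] H.
  by rewrite big_nil expn0; exists 1, 0; rewrite rpred0 rpred1; split=> //; ring.
rewrite big_cons /= expnS; apply: cop_mul => //.
- by apply: rpred_prod.
- by apply: H; rewrite mem_head.
- by apply: IH => i ir; apply: H; rewrite in_cons ir orbT.
Qed.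

Lemma dv_prod (T1 D : nat) (I : eqType) (g : I -> F) (r : seq I) (z : F) :
  z \in O -> uniq r -> (forall i, g i \in O) -> (forall i, g i != 0) ->
  {in r &, forall i k, i != k -> cop T1 (g i) (g k)} ->
  {in r, forall k, dv D (g k) z} ->
  dv (D ^ size r * T1 ^ (size r * size r)) (\prod_(k <- r) g k) z.
Proof.
move=> zO ur gO g0; elim: r ur => [|k r IH] /= ur Hc Hd.
  by rewrite big_nil !dvE mul0n !expn0 muln1 mul1r divr1.
case/andP: ur => kr ur; rewrite big_cons.
have IH' : dv (D ^ size r * T1 ^ (size r * size r)) (\prod_(k <- r) g k) z.
  apply: IH => // [i j ir jr|i ir]; first by apply: Hc; rewrite in_cons ?ir ?jr orbT.
  by apply: Hd; rewrite in_cons ir orbT.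
have cp : cop (T1 ^ size r) (g k) (\prod_(k <- r) g k).
  apply: cop_sym; apply: cop_prod => // i ir; apply: Hc; rewrite ?mem_head //.
    by rewrite in_cons ir orbT.
  by apply: contraNneq kr => <-.
have Dk : dv D (g k) z by apply: Hd; rewrite mem_head.
have p0 : \prod_(k <- r) g k != 0 by rewrite prodf_seq_neq0; apply/allP => i _; rewrite g0.
have := dv_mul (g0 k) p0 cp Dk IH'.
rewrite !dvE; set a := (X in X%:R * z / _ \in _ -> _); set b := (X in _ -> X%:R * z / _ \in _).
(* The induction produces the exponent r^2 + r of T1; the stated (r + 1)^2 leaves the slack T1^(r +
   1). *)
have -> : b = (a * T1 ^ (size r + 1))%N.
  rewrite /a /b !mulSn !mulnS addnA expnS !expnD expn1.
  rewrite expnS; move: (T1 ^ size r)%N (D ^ size r)%N (T1 ^ (size r * size r))%N.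
  by move=> X Y Z; lia.
by move=> h; rewrite natrM [_ * _%:R]mulrC -mulrA -mulrA rpredM ?rpred_nat // mulrA.
Qed.

Lemma nrm_prodV (I : eqType) (g : I -> F) (G : I -> R) (K : R) (r : seq I) :
  (forall i, nrm (g i)^-1 <= K / G i) -> (forall i, 1 <= G i) -> 0 <= K ->
  nrm (\prod_(k <- r) g k)^-1 <= nrm 1 * K ^+ size r / \prod_(k <- r) G k.
Proof.
move=> Hg G1 K0; elim: r => [|k r IH].
  by rewrite !big_nil invr1 expr0 mulr1 divr1.
rewrite !big_cons !invfM /=; apply: le_trans (nrmM HO _ _) _.
apply: le_trans (ler_pM _ _ (Hg k) IH) _; rewrite ?(nrm_ge0 HO) //.
by rewrite exprS le_eqVlt; apply/predU1P; left; ring.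
Qed.

Variables (I : finType) (oth : I -> I) (c : I -> F * F) (D0 : nat) (v0 : F * F) (eta : R).
Hypothesis othP : forall j, oth j != j.
Hypothesis cO : forall i, (c i).1 \in O /\ (c i).2 \in O.
Definition fdet i j := (c i).1 * (c j).2 - (c i).2 * (c j).1.
Hypothesis D00 : (0 < D0)%N.
Hypothesis detP : forall i j, i != j -> fdet i j != 0 /\ D0%:R / fdet i j \in O.
Definition ell i (s : F * F) := (c i).1 * s.1 + (c i).2 * s.2.
Hypothesis v0O : v0.1 \in O /\ v0.2 \in O.
Hypothesis v0P : forall i, ell i v0 != 0.
Hypothesis eta0 : 0 < eta.
Hypothesis etaP : forall i, eta * (nrm (c i).1 + nrm (c i).2) * nrm (ell i v0)^-1 <= 2^-1.

(** Keeping [s] near the ray of natural multiples of [v0] keeps every value [ell i s] near m * ell i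
    v0, hence nonzero, of size about S and balanced, all forms at once. *)
Definition nearp (S : R) (s : F * F) (m : nat) : Prop :=
  [/\ S <= m%:R, m%:R <= 2 * S, nrm (s.1 - m%:R * v0.1) <= eta * S
    & nrm (s.2 - m%:R * v0.2) <= eta * S].

(** A perturbation estimate: the relative error of [z] against m w is at most 1/2, so [z] is
    invertible and its inverse has the order of (m w)^-1. *)
Lemma near_bal (S x : R) (z w : F) (m : nat) : 0 < S -> w != 0 ->
  S <= m%:R -> m%:R <= 2 * S -> nrm (z - m%:R * w) <= x * S -> x * nrm w^-1 <= 2^-1 ->
  [/\ z != 0, nrm z <= (2 * nrm w + x) * S & nrm z^-1 <= 2 * nrm w^-1 / S].
Proof.
move=> S0 w0 Sm mS hz hx.
have m0 : (0 < m)%N by rewrite -(ltr_nat R) (lt_le_trans S0).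
have mR : 0 < m%:R :> R by rewrite ltr0n.
have mF : m%:R != 0 :> F by apply: (natF_neq0 HO).
have nz : nrm z <= (2 * nrm w + x) * S.
  rewrite -[z](subrK (m%:R * w)) addrC; apply: le_trans (nrmD HO _ _) _.
  rewrite mulrDl; apply: lerD => //.
  by rewrite (nrmZ HO) mulrAC ler_wpM2r ?(nrm_ge0 HO).
have key y : nrm ((z - m%:R * w) * y / (m%:R * w)) <= 2^-1 * nrm y.
  have -> : (z - m%:R * w) * y / (m%:R * w) = ((z - m%:R * w) * w^-1 * y) / m%:R.
    by field; rewrite mF w0.
  rewrite (nrmZV HO) // ler_pdivrMr //.
  apply: le_trans (nrmM HO _ _) _; rewrite -mulrA [nrm y * _]mulrC mulrA.
  rewrite ler_wpM2r ?(nrm_ge0 HO) //; apply: le_trans (nrmM HO _ _) _.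
  apply: le_trans (_ : x * S * nrm w^-1 <= _); first by rewrite ler_wpM2r ?(nrm_ge0 HO).
  rewrite mulrAC; apply: ler_pM => //; last exact: ltW.
  apply: le_trans (_ : 0 <= x * nrm w^-1) => //.
  rewrite mulr_ge0 ?(nrm_ge0 HO) //.
  by rewrite -(pmulr_lge0 _ S0) (le_trans _ hz) ?(nrm_ge0 HO).
have z0 : z != 0.
  apply/eqP => z0; have := key 1; rewrite z0 sub0r mulr1 mulNr mulfV ?mulf_neq0 // (nrmN HO).
  by have := nrm1_gt0 HO; lra.
split=> //.
have : nrm z^-1 <= nrm w^-1 / m%:R + 2^-1 * nrm z^-1.
  (* The last term has norm at most half that of z^-1 and is absorbed into the left-hand side. *)
  have {1}-> : z^-1 = w^-1 / m%:R - (z - m%:R * w) * z^-1 / (m%:R * w).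
    by field; rewrite mF w0 z0.
  apply: le_trans (nrmB HO _ _) _; apply: lerD; last exact: key.
  by rewrite (nrmZV HO).
have : nrm w^-1 / m%:R <= nrm w^-1 / S.
  by rewrite ler_wpM2l ?(nrm_ge0 HO) // lef_pV2 ?posrE.
move: (nrm w^-1 / m%:R) (nrm z^-1) => A B; rewrite -mulrA; lra.
Qed.

Lemma ellB i s t : ell i (s.1 - t.1, s.2 - t.2) = ell i s - ell i t.
Proof. by rewrite /ell /=; ring. Qed.

Lemma ell_int i s : s.1 \in O -> s.2 \in O -> ell i s \in O.
Proof. by case: (cO i) => *; rewrite rpredD ?rpredM. Qed.

Lemma plucker i j k s : fdet i j * ell k s = fdet k j * ell i s + fdet i k * ell j s.
Proof. by rewrite /fdet /ell; ring. Qed.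

Lemma ell_inj i j s t : i != j -> ell i s = ell i t -> ell j s = ell j t -> s = t.
Proof.
move=> /detP[d0 _] Ei Ej.
have e1 : fdet i j * (s.1 - t.1) = (c j).2 * (ell i s - ell i t) - (c i).2 * (ell j s - ell j t).
  by rewrite /fdet /ell; ring.
have e2 : fdet i j * (s.2 - t.2) = (c i).1 * (ell j s - ell j t) - (c j).1 * (ell i s - ell i t).
  by rewrite /fdet /ell; ring.
move: e1 e2; rewrite Ei Ej !subrr !mulr0 subrr => /eqP + /eqP.
rewrite !mulf_eq0 (negPf d0) /= !subr_eq0 => /eqP h1 /eqP h2.
by case: s t h1 h2 {Ei Ej} => [? ?] [? ?] /= -> ->.
Qed.

Lemma near_ell : exists2 Kb : R, 1 <= Kb & forall S s m i, 1 <= S -> nearp S s m ->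
  [/\ ell i s != 0, nrm (ell i s) <= Kb * S & cond (ell i s) <= Kb].
Proof.
pose x i := eta * (nrm (c i).1 + nrm (c i).2).
pose B i := 2 * nrm (ell i v0) + x i.
pose A i := B i * (2 * nrm (ell i v0)^-1).
have x0 i : 0 <= x i by rewrite mulr_ge0 ?addr_ge0 ?(nrm_ge0 HO) // ltW.
have B0 i : 0 <= B i by rewrite addr_ge0 ?x0 // mulr_ge0 ?(nrm_ge0 HO).
have A0 i : 0 <= A i by rewrite mulr_ge0 ?B0 // mulr_ge0 ?(nrm_ge0 HO).
exists (1 + \sum_i (A i + B i)).
  by rewrite lerDl sumr_ge0 // => i _; rewrite addr_ge0.
move=> S s m i S1 [Sm mS h1 h2]; have S0 : 0 < S by apply: lt_le_trans S1.
have hs : nrm (ell i s - m%:R * ell i v0) <= x i * S.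
  have -> : ell i s - m%:R * ell i v0 = (c i).1 * (s.1 - m%:R * v0.1) + (c i).2 * (s.2 - m%:R * v0.2).
    by rewrite /ell; ring.
  apply: le_trans (nrmD HO _ _) _.
  have -> : x i * S = nrm (c i).1 * (eta * S) + nrm (c i).2 * (eta * S) by rewrite /x; ring.
  by apply: lerD; apply: le_trans (nrmM HO _ _) _; rewrite ler_wpM2l ?(nrm_ge0 HO).
have [z0 hz hv] := near_bal S0 (v0P i) Sm mS hs (etaP i).
have leAB : A i + B i <= \sum_i (A i + B i).
  by rewrite (bigD1 i) //= lerDl sumr_ge0 // => k _; rewrite addr_ge0.
have [hA hB] : A i <= 1 + \sum_i (A i + B i) /\ B i <= 1 + \sum_i (A i + B i).
  by move: (A0 i) (B0 i) leAB; split; lra.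
split=> //.
  by apply: le_trans hz _; rewrite ler_wpM2r ?(ltW S0).
apply: le_trans hA; rewrite condE.
apply: le_trans (ler_pM _ _ hz hv) _; rewrite ?(nrm_ge0 HO) //.
by rewrite /A -/(B i) le_eqVlt; apply/predU1P; left; field; rewrite gt_eqF.
Qed.

Definition ellK : R := sval (cid2 near_ell).

Lemma ellK_ge1 : 1 <= ellK.
Proof. by rewrite /ellK; case: cid2. Qed.

Lemma ellK_ge0 : 0 <= ellK.
Proof. exact: le_trans ellK_ge1. Qed.

Lemma ellKP S s m i : 1 <= S -> nearp S s m ->
  [/\ ell i s != 0, nrm (ell i s) <= ellK * S & cond (ell i s) <= ellK].
Proof. by rewrite /ellK; case: cid2 => K /= _ H; apply: H. Qed.

Definition lamP (g : I -> F) (S : R) (s : F * F) : bool :=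
  `[< exists m, nearp S s m >] && [forall i, ell i s / g i \in O].

Definition kap := 2 * (nrm v0.1 + nrm v0.2) + eta.

(** The surrounding box only makes the list finite: [lamE] shows that nearness to the ray already
    implies it. *)
Definition lam g S := [seq s <- [seq (x, y) | x <- box (kap * S), y <- box (kap * S)] | lamP g S s].

Lemma lam_uniq g S : uniq (lam g S).
Proof.
by rewrite filter_uniq // allpairs_uniq ?(box_uniq HO) // => -[? ?] [? ?].
Qed.

Lemma lamE g S s : 0 <= S -> reflect ([/\ s.1 \in O, s.2 \in O, exists m, nearp S s m &
  forall i, ell i s / g i \in O]) (s \in lam g S).
Proof.
move=> S0; rewrite mem_filter; apply: (iffP andP).
  move=> [/andP[/asboolP h1 /forallP h2] /allpairsP [[x y] [/=]]].
  by rewrite !(boxE HO) => /andP[xO _] /andP[yO _] Es; split=> //; rewrite Es.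
move=> [s1 s2 hm hl]; split; first by apply/andP; split; [apply/asboolP|apply/forallP].
have bnd (x w w' : F) (m : nat) : m%:R <= 2 * S -> nrm (x - m%:R * w) <= eta * S ->
    nrm x <= (2 * (nrm w + nrm w') + eta) * S.
  move=> mS h; rewrite -[x](subrK (m%:R * w)) addrC; apply: le_trans (nrmD HO _ _) _.
  rewrite mulrDl lerD // (nrmZ HO) mulrAC ler_pM ?(nrm_ge0 HO) ?mulr_ge0 ?(nrm_ge0 HO) //.
  by rewrite lerDl (nrm_ge0 HO).
case: hm => m [_ mS h1 h2]; apply/allpairsP; exists s; split; rewrite ?(boxE HO) ?s1 ?s2 /=.
- exact: bnd h1.
- by rewrite /kap [nrm v0.1 + _]addrC; apply: bnd h2.
- by case: (s).
Qed.

Definition gdata (Kg : R) (G : I -> R) (g : I -> F) := forall i,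
  [/\ 1 <= G i, g i \in O, g i != 0, nrm (g i) <= Kg * G i & nrm (g i)^-1 <= Kg / G i].

Definition pcop (T1 : nat) (g : I -> F) := forall i k, i != k -> cop T1 (g i) (g k).

Definition xcoord (g : I -> F) i s := ell i s / g i.

Lemma gdata_ge1 Kg G g : gdata Kg G g -> forall i, 1 <= G i.
Proof. by move=> H i; case: (H i). Qed.

Lemma xcoord_bounds (Kb Kg S : R) G g s i : 0 <= Kb -> 0 <= Kg -> 0 <= S -> gdata Kg G g ->
  nrm (ell i s) <= Kb * S -> cond (ell i s) <= Kb ->
  nrm (xcoord g i s) <= Kb * Kg * S / G i /\ cond (xcoord g i s) <= Kb * (Kg * Kg).
Proof.
move=> Kb0 Kg0 S0 H h1 h2; case: (H i) => G1 _ g0 gn gv.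
have G0 : 0 < G i by apply: lt_le_trans G1.
split.
  apply: le_trans (nrmM HO _ _) _; apply: le_trans (ler_pM _ _ h1 gv) _; rewrite ?(nrm_ge0 HO) //.
  by rewrite le_eqVlt; apply/predU1P; left; ring.
apply: le_trans (condM HO _ _) _; apply: ler_pM => //; rewrite ?mulr_ge0 ?(nrm_ge0 HO) //.
rewrite condV; apply: le_trans (ler_pM _ _ gn gv) _; rewrite ?(nrm_ge0 HO) //.
by rewrite le_eqVlt; apply/predU1P; left; field; rewrite gt_eqF.
Qed.

Definition wprod (G : I -> R) j := \prod_(k | k != j) G k.

Lemma wprod_seq (G : I -> R) (p : pred I) : \prod_(k | p k) G k = \prod_(k <- enum p) G k.
Proof. by rewrite -big_enum. Qed.

Lemma gprod_wprod (G : I -> R) j : \prod_k G k = G j * wprod G j.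
Proof. by rewrite (bigD1 j). Qed.

(** Where the form j vanishes, the Pluecker relation makes the forms i and k proportional up to a
    determinant dividing D0, so a factor of [ell k s] becomes a factor of D0 times [ell i s]. *)
Lemma ell_dv (g : I -> F) i j k s : i != j -> k != j -> s.1 \in O -> s.2 \in O ->
  ell j s = 0 -> dv 1 (g k) (ell k s) -> dv D0 (g k) (ell i s).
Proof.
move=> ij kj s1 s2 Ej; rewrite !dvE mul1r => H.
have [d0 dO] := detP kj; have [e0 eO] := detP ij.
have E := plucker i j k s; rewrite Ej mulr0 addr0 in E.
have -> : D0%:R * ell i s / g k = D0%:R / fdet k j * fdet i j * (ell k s / g k).
  have -> : D0%:R / fdet k j * fdet i j * (ell k s / g k) =
      D0%:R / fdet k j * (fdet i j * ell k s) / g k by ring.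
  by rewrite E mulrA mulfVK.
rewrite rpredM // rpredM // /fdet; case: (cO i) (cO j) => [? ?] [? ?].
by rewrite rpredB ?rpredM.
Qed.

Lemma nrm_prodV_enum Kg G g (p : pred I) : gdata Kg G g -> 0 <= Kg -> 
  nrm (\prod_(k <- enum p) g k)^-1 <= nrm 1 * Kg ^+ #|p| / \prod_(k | p k) G k.
Proof.
move=> H Kg0; rewrite wprod_seq cardE; apply: nrm_prodV => // i; case: (H i) => //.
Qed.

(** With [ell j] fixed, one free value [ell i] remains. By [ell_dv] applied to differences, all
    values lie in one class modulo the product of the [g k] with k != j, up to a constant. *)
Lemma fibre_count (Kg : R) (T1 : nat) : 1 <= Kg -> (0 < T1)%N -> exists2 Cf : R, 1 <= Cf &
  forall G g S j x, gdata Kg G g -> pcop T1 g -> 1 <= S ->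
  (count (fun s => ell j s == x) (lam g S))%:R <= Cf * Num.max 1 (S / wprod G j) ^+ n.
Proof.
move=> Kg1 T10; have Kg0 : 0 <= Kg by apply: le_trans Kg1.
have Kb1 := ellK_ge1; have Kb0 := ellK_ge0; have Hb := ellKP; set Kb := ellK in Kb1 Kb0 Hb.
pose DD (j : I) := (D0 ^ size (enum (fun k => k != j)) *
   T1 ^ (size (enum (fun k => k != j)) * size (enum (fun k => k != j))))%N.
pose c1 (j : I) := 2 * (DD j)%:R * Kb * (nrm 1 * Kg ^+ #|(fun k : I => k != j)|).
have DD0 j : (0 < DD j)%N by rewrite muln_gt0 !expn_gt0 D00 T10.
have c11 j : 1 <= c1 j.
  by rewrite !mulr_ege1 ?ler1n // ?exprn_ege1 ?(nrm1_ge1 HO).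
pose cc := \prod_j c1 j.
have cc1 : 1 <= cc by apply: prod_ge1.
have ccj j : c1 j <= cc.
  by rewrite /cc (bigD1 j) //= ler_peMr ?(le_trans ler01) // prod_ge1.
exists (C * cc ^+ n); first by rewrite mulr_ege1 // exprn_ege1.
move=> G g S j x Hg Hc S1; have S0 : 0 <= S by apply: le_trans S1.
have W1 : 1 <= wprod G j by apply: prod_ge1; apply: gdata_ge1 Hg.
have W0 : 0 < wprod G j by apply: lt_le_trans W1.
rewrite -size_filter; set s := seq.filter _ _.
pose i := oth j; have ij : i != j by apply: othP.
have sP t : t \in s -> [/\ t.1 \in O, t.2 \in O, exists m, nearp S t m,
    forall k, ell k t / g k \in O & ell j t = x].
  by rewrite mem_filter => /andP[/eqP Ej /(lamE _ _ S0)[]].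
have us : uniq s by rewrite filter_uniq // lam_uniq.
have inj : {in s &, injective (ell i)}.
  move=> t u ts us' Et; apply: (ell_inj ij Et).
  by case: (sP t ts) => _ _ _ _ ->; case: (sP u us') => _ _ _ _ ->.
have p0 : \prod_(k <- enum (fun k => k != j)) g k != 0.
  by rewrite prodf_seq_neq0; apply/allP => k _ /=; case: (Hg k).
rewrite -(size_map (ell i)).
apply: le_trans (ap_count HO (D := DD j) (Y := Kb * S) _ (DD0 j) p0 _ _) _.
- by rewrite map_inj_in_uniq.
- move=> _ /mapP [t ts ->]; case: (sP t ts) => _ _ [m hm] _ _.
  by case: (Hb S t m i S1 hm).
- move=> _ _ /mapP [t ts ->] /mapP [u us' ->].
  case: (sP t ts) => t1 t2 _ td Et; case: (sP u us') => u1 u2 _ ud Eu.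
  rewrite -ellB; apply: dv_prod.
  + by apply: ell_int; rewrite /= rpredB.
  + exact: enum_uniq.
  + by move=> k; case: (Hg k).
  + by move=> k; case: (Hg k).
  + by move=> k l _ _; apply: Hc.
  + move=> k; rewrite mem_enum => kj; apply: (ell_dv ij kj); rewrite /= ?rpredB //.
      by rewrite ellB Et Eu subrr.
    by rewrite !dvE mul1r ellB mulrBl rpredB.
rewrite -[C * _ * _]mulrA ler_wpM2l ?(ltW C0) // -exprMn.
apply: lerXn2r; rewrite ?nnegrE ?mulr_ge0 ?le_max ?ler01 ?(le_trans ler01 cc1) //.
apply: le_trans (max_scale cc1 _); last by rewrite divr_ge0 ?(ltW W0).
rewrite le_max2 //; apply: le_trans (_ : c1 j * (S / wprod G j) <= _); last first.
  by rewrite ler_wpM2r ?divr_ge0 ?(ltW W0).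
have -> : c1 j * (S / wprod G j) = 2 * (DD j)%:R * (Kb * S) * (nrm 1 * Kg ^+ #|(fun k : I => k != j)| / wprod G j).
  by rewrite /c1; ring.
by rewrite ler_wpM2l ?mulr_ge0 //; apply: nrm_prodV_enum.
Qed.

Lemma xcoord_lam Kg S G g s i : 0 <= Kg -> 1 <= S -> gdata Kg G g -> s \in lam g S ->
  [/\ xcoord g i s \in O, xcoord g i s != 0, nrm (xcoord g i s) <= ellK * Kg * S / G i
    & cond (xcoord g i s) <= ellK * (Kg * Kg)].
Proof.
move=> Kg0 S1 H; have S0 : 0 <= S by apply: le_trans S1.
move=> /(lamE _ _ S0) [s1 s2 [m hm] sd]; have [e0 en ec] := ellKP i S1 hm.
have [xn xc] := xcoord_bounds ellK_ge0 Kg0 S0 H en ec.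
case: (H i) => _ _ g0 _ _; split=> //; first exact: sd.
by rewrite mulf_neq0 ?invr_neq0.
Qed.

(** Transfers a count over lattice points to a count over a plain box of values x, where the sieve
    estimates apply. *)
Lemma fibre_sum (Kg : R) (T1 : nat) : 1 <= Kg -> (0 < T1)%N -> exists2 Cf : R, 1 <= Cf &
  forall G g S j (P : pred F), gdata Kg G g -> pcop T1 g -> 1 <= S ->
  (count (fun s => P (xcoord g j s)) (lam g S))%:R <=
   (count (fun x : F => (x != 0%R) && P x) (box (ellK * Kg * S / G j)%R))%:R *
   (Cf * Num.max 1 (S / wprod G j) ^+ n).
Proof.
move=> Kg1 T10; have Kg0 : 0 <= Kg by apply: le_trans Kg1.
have [Cf Cf1 HC] := fibre_count Kg1 T10; exists Cf => // G g S j P Hg Hc S1.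
rewrite -[in X in _ <= X]size_filter; set r := seq.filter _ _.
apply: le_trans (_ : (count (fun s => has (fun x => ell j s == g j * x) r) (lam g S))%:R <= _).
  rewrite ler_nat -!size_filter; apply: uniq_leq_size.
    by rewrite filter_uniq ?lam_uniq.
  move=> s; rewrite mem_filter => /andP[Px sl]; rewrite mem_filter sl andbT.
  have [xO x0 xn _] := xcoord_lam j Kg0 S1 Hg sl.
  apply/hasP; exists (xcoord g j s); first by rewrite mem_filter x0 Px (boxE HO) xO.
  by rewrite /xcoord mulrCA mulfV ?mulr1 //; case: (Hg j).
have H := count_has_le (fun x s => ell j s == g j * x) r (lam g S).
rewrite -(ler_nat R) in H; apply: le_trans H _; rewrite natr_sum.
apply: le_trans (_ : \sum_(x <- r) (Cf * Num.max 1 (S / wprod G j) ^+ n) <= _).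
  by apply: ler_sum => x _; apply: HC.
by rewrite big_const_seq iter_addr_0 count_predT mulr_natl.
Qed.

(** Each modulus is treated in turn, keeping the largest residue class; the loss is the product of
    the numbers of remainders. No independence of the congruences is involved, since only a lower
    bound is wanted. *)
Lemma pigeonhole_seq (U : eqType) (A : seq U) (f : I -> U -> F) (g : I -> F) (r : seq I) :
  uniq A -> A != [::] -> (forall i, g i \in O) -> (forall i, g i != 0) ->
  (forall i x, x \in A -> f i x \in O) ->
  exists B, [/\ uniq B, {subset B <= A}, B != [::],
    {in B &, forall x y i, i \in r -> (f i x - f i y) / g i \in O} &
    (size A <= \prod_(i <- r) size (box (C * nrm (g i))%R) * size B)%N].
Proof.
move=> uA A0 gO g0 fO; elim: r => [|i r [B [uB BA B0 BP Bs]]].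
  by exists A; split=> //; rewrite big_nil mul1n.
have [|u Hu] := @pigeonhole_fibre _ _ (fun x => res HO (g i) (f i x)) B (box (C * nrm (g i))) B0.
  by move=> x /BA xA; apply: (res_box HO) => //; apply: fO.
exists [seq x <- B | res HO (g i) (f i x) == u]; split.
- exact: filter_uniq.
- by move=> x; rewrite mem_filter => /andP[_ /BA].
- move: Hu; rewrite -size_filter; case: [seq x <- B | _] => //=.
  by rewrite muln0 leqn0 size_eq0 (negPf B0).
- move=> x y; rewrite !mem_filter => /andP[/eqP Ex xB] /andP[/eqP Ey yB] j.
  rewrite in_cons => /orP[/eqP -> | jr]; last exact: BP.
  by apply: (res_eq (HO := HO) (g0 i)); rewrite Ex Ey.
- apply: leq_trans Bs _; rewrite size_filter big_cons.
  by rewrite [(size _ * \prod_(_ <- _) _)%N]mulnC -mulnA leq_mul2l Hu orbT.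
Qed.

(** A class of points that agree modulo all [g i] is found in a small box by pigeonhole; the
    differences from one member satisfy the congruences. Adding m v0, with m divisible by all [g i],
    moves them near the ray. *)
Lemma lam_lower (Kg : R) : 1 <= Kg -> exists cl Cs : R, [/\ 0 < cl, 1 <= Cs &
  forall G g S, gdata Kg G g -> Cs * (\prod_i G i) ^+ n <= S ->
  cl * (S ^+ n * S ^+ n) / (\prod_i G i) ^+ n <= (size (lam g S))%:R].
Proof.
move=> Kg1; have Kg0 : 0 <= Kg by apply: le_trans Kg1.
pose E := C * (C * Kg) ^+ n; have E1 : 1 <= E by rewrite mulr_ege1 ?exprn_ege1 ?mulr_ege1.
have E0 : 0 < E by apply: lt_le_trans E1.
pose b := (eta / 2) ^+ n / C.
have b0 : 0 < b by rewrite divr_gt0 ?exprn_gt0 ?divr_gt0.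
exists (b * b / E ^+ #|I|), (E ^+ #|I| + 2 / eta); split.
- exact: divr_gt0 (mulr_gt0 b0 b0) (exprn_gt0 _ E0).
- by rewrite (le_trans (exprn_ege1 #|I| E1)) // lerDl divr_ge0 // ltW.
move=> G g S Hg; set P := \prod_i G i => hS.
have G1 := gdata_ge1 Hg.
have P1 : 1 <= P by apply: prod_ge1.
have Pn1 : 1 <= P ^+ n by apply: exprn_ege1.
have EP : E ^+ #|I| * P ^+ n <= S.
  by apply: le_trans hS; rewrite ler_wpM2r ?(le_trans ler01) // lerDl divr_ge0 // ltW.
have S1 : 1 <= S by apply: le_trans EP; rewrite mulr_ege1 ?exprn_ege1.
have S0 : 0 <= S by apply: le_trans S1.
have S2 : 1 <= eta / 2 * S.
  have : 2 / eta <= S.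
    apply: le_trans (_ : 2 / eta * P ^+ n <= _); first by rewrite ler_peMr // divr_ge0 // ltW.
    apply: le_trans hS; rewrite ler_wpM2r ?(le_trans ler01) // lerDr exprn_ge0 //; exact: ltW.
  move=> h; have : eta / 2 * (2 / eta) <= eta / 2 * S by rewrite ler_wpM2l // divr_ge0 // ltW.
  suff -> : eta / 2 * (2 / eta) = 1 by [].
  by field; rewrite gt_eqF.
have gO i : g i \in O by case: (Hg i).
have g0 i : g i != 0 by case: (Hg i).
have CK i : C * nrm (g i) <= C * Kg * G i.
  by rewrite -mulrA ler_wpM2l ?(ltW C0) //; case: (Hg i).
have CKn i : C * (C * nrm (g i)) ^+ n <= E * G i ^+ n.
  rewrite /E -mulrA ler_wpM2l ?(ltW C0) // -exprMn; apply: lerXn2r; rewrite ?nnegrE //.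
    by rewrite mulr_ge0 ?(nrm_ge0 HO) ?(ltW C0).
  by rewrite !mulr_ge0 ?(ltW C0) // (le_trans _ (G1 i)).
have prodE : \prod_i (E * G i ^+ n) = E ^+ #|I| * P ^+ n.
  by rewrite big_split /= prodr_const prodrXl.
(* The lower bound on S makes it exceed a natural number M divisible by every [g i], so a multiple m
   of M lies between S and 2 S. *)
have [M [M0 MS MO]] : exists M : nat, [/\ (0 < M)%N, M%:R <= S & forall i, M%:R / g i \in O].
  have [mf Hm] := choice (fun i => int_multiple HO (gO i) (g0 i)).
  exists (\prod_i mf i)%N; split.
  - by apply: prodn_gt0 => i; case: (Hm i).
  - apply: le_trans EP; rewrite -prodE natr_prod; apply: ler_prod => i _.
    by rewrite ler0n /=; case: (Hm i) => _ h _; apply: le_trans h (CKn i).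
  - move=> i; rewrite (bigD1 i) //= natrM mulrAC rpredM ?rpred_nat //.
    by case: (Hm i).
have M0R : 0 < M%:R :> R by rewrite ltr0n.
pose m := (M * (Num.trunc (S / M%:R)).+1)%N.
have /andP[Sm mS] : S <= m%:R <= 2 * S.
  have /andP[h1 h2] := truncn_itv (divr_ge0 S0 (ltW M0R)).
  rewrite natrM; apply/andP; split; first by rewrite mulrC -ler_pdivrMr // ltW.
  rewrite -natr1 mulrDr mulr1 mulr2n mulrDl mul1r lerD //.
  by rewrite mulrC -ler_pdivlMr.
pose A := [seq (x, y) | x <- box (eta / 2 * S), y <- box (eta / 2 * S)].
have uA : uniq A by rewrite allpairs_uniq ?(box_uniq HO) // => -[? ?] [? ?].
have AP s : s \in A -> [/\ s.1 \in O, s.2 \in O, nrm s.1 <= eta / 2 * S & nrm s.2 <= eta / 2 * S].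
  move=> /allpairsP [[x y] [/=]]; rewrite !(boxE HO) => /andP[? ?] /andP[? ?] Es.
  by split; rewrite Es.
have A0 : A != [::].
  have : (0, 0) \in A.
    by apply/allpairsP; exists (0, 0); rewrite (box0 HO) ?mulr_ge0 ?divr_ge0 // ltW.
  by case: (A).
have [B [uB BA B0 BP Bs]] := @pigeonhole_seq _ A ell g (enum I) uA A0 gO g0
  (fun i x xA => let: And4 a b _ _ := AP x xA in ell_int i a b).
have [s0 s0B] : exists s, s \in B by case: (B) B0 => // s l _; exists s; rewrite mem_head.
pose h (s : F * F) := (s.1 - s0.1 + m%:R * v0.1, s.2 - s0.2 + m%:R * v0.2).
have hinj : injective h.
  by move=> [s1 s2] [t1 t2] [/addIr/addIr -> /addIr/addIr ->].
have sub : (size B <= size (lam g S))%N.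
  rewrite -(size_map h B); apply: uniq_leq_size; first by rewrite map_inj_uniq.
  move=> _ /mapP [s sB ->]; case: (AP _ (BA _ sB)) => s1 s2 n1 n2.
  case: (AP _ (BA _ s0B)) => t1 t2 k1 k2; case: v0O => w1 w2.
  have half x : x / 2 * S + x / 2 * S = x * S by field.
  apply/(lamE _ _ S0); split.
  - by rewrite rpredD ?rpredB ?rpredM ?rpred_nat.
  - by rewrite rpredD ?rpredB ?rpredM ?rpred_nat.
  - exists m; split=> //=; rewrite addrK -half.
      by apply: le_trans (nrmB HO _ _) _; rewrite lerD.
    by apply: le_trans (nrmB HO _ _) _; rewrite lerD.
  - move=> i; have -> : ell i (h s) / g i = (ell i s - ell i s0) / g i + m%:R / g i * ell i v0.
      by rewrite /ell /h /=; ring.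
    rewrite rpredD ?BP ?mem_enum // rpredM //; last exact: ell_int.
    by rewrite /m natrM mulrAC rpredM ?rpred_nat.
have size1 : b * S ^+ n <= (size (box (eta / 2 * S)))%:R.
  have -> : b * S ^+ n = (eta / 2 * S) ^+ n / C by rewrite /b [(_ * S) ^+ n]exprMn; ring.
  by rewrite ler_pdivrMr // [_ * C]mulrC (box_lb HO).
have sizeA : b * b * (S ^+ n * S ^+ n) <= (size A)%:R.
  rewrite size_allpairs natrM mulrACA.
  by apply: ler_pM => //; rewrite mulr_ge0 ?exprn_ge0 ?(ltW b0).
have sizeP : (\prod_(i <- enum I) size (box (C * nrm (g i))%R))%:R <= E ^+ #|I| * P ^+ n.
  rewrite big_enum /= (eq_bigl predT) // -prodE natr_prod; apply: ler_prod => i _; rewrite ler0n /=.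
  apply: le_trans (CKn i); apply: (box_ub HO).
  by rewrite mulr_ege1 // (nrm_int HO).
have Pn0 : 0 < P ^+ n by apply: lt_le_trans Pn1.
have EI0 : 0 < E ^+ #|I| by rewrite exprn_gt0.
have -> : b * b / E ^+ #|I| * (S ^+ n * S ^+ n) / P ^+ n = b * b * (S ^+ n * S ^+ n) / (E ^+ #|I| * P ^+ n).
  by rewrite invfM; ring.
rewrite ler_pdivrMr ?mulr_gt0 //; apply: le_trans sizeA _.
move: Bs; rewrite -(ler_nat R) natrM => /le_trans; apply.
rewrite mulrC; apply: ler_pM => //.
by rewrite ler_nat.
Qed.

Variable th : {rmorphism F -> F}.
Hypothesis thK : involutive th.
Hypothesis thO : forall x, x \in O -> th x \in O.
Hypothesis thn : forall x, nrm (th x) = nrm x.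

Lemma dv_th D N z : dv D N (th z) -> dv D (th N) z.
Proof.
rewrite !dvE => /thO; rewrite fmorph_div rmorphM rmorph_nat thK.
by [].
Qed.

(* For fixed [nu], the pairs [(x_i0, x_j0)] with [nu | x_i0] and [th nu | x_j0] form a
   lattice whose index exceeds that of [lam] by the factor [nrm nu ^ (2 n)]. *)
Lemma nu_count (Kg K' : R) (T1 T2 t0 : nat) : 1 <= Kg -> 1 <= K' ->
  (0 < T1)%N -> (0 < T2)%N -> (0 < t0)%N -> exists2 Cn : R, 1 <= Cn &
  forall G g S i0 j0 nu, i0 != j0 -> gdata Kg G g -> pcop T1 g -> 1 <= S ->
  nu \in O -> nu != 0 -> cond nu <= K' ->
  (count (fun s => [&& [forall i, (i != j0) ==> `[< cop T2 (g i) (xcoord g j0 s) >]],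
      dv t0 nu (xcoord g i0 s) & dv t0 nu (th (xcoord g j0 s))]) (lam g S))%:R <=
  Cn * (Num.max 1 (S / (G i0 * nrm nu)) ^+ n * Num.max 1 (S / (wprod G i0 * nrm nu)) ^+ n).
Proof.
move=> Kg1 K'1 T10 T20 t00.
have Kg0 : 0 <= Kg by apply: le_trans Kg1.
have K'0 : 0 <= K' by apply: le_trans K'1.
pose ix (p : I * I) := enum (fun k => (k != p.1) && (k != p.2)).
pose DD p := ((D0 * T1) ^ size (ix p) * T1 ^ (size (ix p) * size (ix p)))%N.
pose EE p := (t0 * DD p * ((t0 * T2) ^ size (ix p)))%N.
have DD0 p : (0 < DD p)%N by rewrite muln_gt0 !expn_gt0 muln_gt0 D00 T10.
have EE0 p : (0 < EE p)%N by rewrite muln_gt0 muln_gt0 t00 DD0 expn_gt0 muln_gt0 t00 T20.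
have [a Ea] : exists a, a = ellK * Kg by eexists.
have a1 : 1 <= a by rewrite Ea mulr_ege1 ?ellK_ge1.
pose c1 p := 2 * (EE p)%:R * a * K' * (nrm 1 * Kg ^+ #|fun k : I => (k != p.1) && (k != p.2)|).
have c11 p : 1 <= c1 p.
  by rewrite !mulr_ege1 ?ler1n // ?exprn_ege1 ?(nrm1_ge1 HO).
pose cc := \prod_p c1 p.
have cc1 : 1 <= cc by apply: prod_ge1.
have ccj p : c1 p <= cc.
  by rewrite /cc (bigD1 p) //= ler_peMr ?(le_trans ler01) // prod_ge1.
pose c2 := 2 * t0%:R * a * K'.
have c21 : 1 <= c2 by rewrite !mulr_ege1 ?ler1n.
have c20 : 0 <= c2 by apply: le_trans c21.
have cc0 : 0 <= cc by apply: le_trans cc1.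
exists (C * c2 ^+ n * (C * cc ^+ n)); first by rewrite !mulr_ege1 ?exprn_ege1.
move=> G g S i0 j0 nu ij Hg Hc S1 nuO nu0 cnu.
have G1 := gdata_ge1 Hg; have S0 : 0 <= S by apply: le_trans S1.
have Gp i : 0 < G i by apply: lt_le_trans (G1 i).
have Np : 0 < nrm nu by apply: (nrm_gt0 HO).
have W0 : 0 < wprod G i0 by apply: lt_le_trans ltr01 (prod_ge1 _ G1).
have cN' : nrm nu^-1 <= K' / nrm nu by rewrite ler_pdivlMr // mulrC.
have a0 : 0 <= a by apply: le_trans a1.
have gO i : g i \in O by case: (Hg i).
have g0 i : g i != 0 by case: (Hg i).
rewrite -size_filter; set s := seq.filter _ _.
have sP t : t \in s -> [/\ t \in lam g S, forall i, i != j0 -> cop T2 (g i) (xcoord g j0 t),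
    dv t0 nu (xcoord g i0 t) & dv t0 (th nu) (xcoord g j0 t)].
  rewrite mem_filter => /andP[/and3P[/forallP h1 h2 /dv_th h3] tl]; split=> // i ij0.
  by have /implyP/(_ ij0)/asboolP := h1 i.
have us : uniq s by rewrite filter_uniq // lam_uniq.
(* The first coordinate ranges over a single class modulo nu in a box of size about S / G i0. *)
pose X := undup (map (xcoord g i0) s).
have XP x : x \in X -> [/\ dv t0 nu x & nrm x <= a * S / G i0].
  rewrite mem_undup => /mapP [t ts ->]; case: (sP t ts) => tl _ td _.
  by rewrite Ea; have [_ _ ? _] := xcoord_lam i0 Kg0 S1 Hg tl.
have Xs : (size X)%:R <= C * c2 ^+ n * Num.max 1 (S / (G i0 * nrm nu)) ^+ n.
  apply: le_trans (ap_count HO (D := t0) (N := nu) (Y := a * S / G i0) (undup_uniq _) t00 nu0 _ _) _.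
  - by move=> x /XP[].
  - by move=> x y /XP[hx _] /XP[hy _]; apply: dvB.
  rewrite -[C * _ * _]mulrA ler_wpM2l ?(ltW C0) // -exprMn.
  apply: lerXn2r; rewrite ?nnegrE ?mulr_ge0 ?le_max ?ler01 //.
  apply: le_trans (max_scale c21 _); last by rewrite divr_ge0 // mulr_ge0 ?(ltW Np) ?(ltW (Gp _)).
  rewrite le_max2 //.
  have -> : c2 * (S / (G i0 * nrm nu)) = 2 * t0%:R * (a * S / G i0) * (K' / nrm nu).
    by rewrite /c2 invfM; ring.
  by rewrite ler_wpM2l // !mulr_ge0 // invr_ge0 ltW.
(* Given the first coordinate, the second lies in one class modulo th nu times the product of the
   remaining [g k]: with [ell i0] fixed, [ell_dv] yields the [g k], and [g j0] is cancelled because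
   it is coprime to each of them. *)
have fib x : (count (fun t => xcoord g i0 t == x) s)%:R <=
    C * cc ^+ n * Num.max 1 (S / (wprod G i0 * nrm nu)) ^+ n.
  rewrite -size_filter; set s' := seq.filter _ _.
  have s'P t : t \in s' -> t \in s /\ ell i0 t = x * g i0.
    by rewrite mem_filter => /andP[/eqP <- ts]; split=> //; rewrite /xcoord mulfVK.
  have [->|[t0' t0s]] : s' = [::] \/ exists t, t \in s'.
  - by case: (s') => [|t s0]; [left | right; exists t; rewrite mem_head].
  - by rewrite mulr_ge0 ?exprn_ge0 ?le_max ?ler01 // mulr_ge0 ?exprn_ge0 // ltW.
  have us' : uniq s' by rewrite filter_uniq.
  have inj : {in s' &, injective (xcoord g j0)}.
    move=> t u ts us'' Et; apply: (ell_inj ij).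
      by case: (s'P t ts) => _ ->; case: (s'P u us'') => _ ->.
    by move: Et; rewrite /xcoord => /(mulIf (invr_neq0 (g0 j0))).
  set p := (i0, j0); set M := \prod_(k <- ix p) g k.
  have pM : M != 0 by rewrite prodf_seq_neq0; apply/allP => k _ /=.
  have MO : M \in O by apply: rpred_prod.
  have tn0 : th nu != 0 by rewrite fmorph_eq0.
  have pN : th nu * M != 0 by rewrite mulf_neq0.
  (* th nu divides t0 x_j0, and x_j0 is coprime to the [g k]; so the two moduli are coprime up to a
     constant and can be multiplied. *)
  have cpN : cop ((t0 * T2) ^ size (ix p)) (th nu) M.
    apply: cop_sym; apply: cop_prod => //; first exact: thO.
    move=> k; rewrite mem_enum => /andP[_ kj].
    have [_ /(_ k kj) hk _ hd] := sP _ (s'P _ t0s).1.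
    exact: cop_dv hk _.
  rewrite -(size_map (xcoord g j0)).
  apply: le_trans (ap_count HO (D := EE p) (Y := a * S / G j0) _ (EE0 p) pN _ _) _.
  - by rewrite map_inj_in_uniq.
  - move=> _ /mapP [t ts ->]; have [tl _ _ _] := sP _ (s'P _ ts).1.
    by rewrite Ea; have [_ _ ? _] := xcoord_lam j0 Kg0 S1 Hg tl.
  - move=> _ _ /mapP [t ts ->] /mapP [u us'' ->].
    have [ts1 Et] := s'P _ ts; have [us1 Eu] := s'P _ us''.
    have [tl _ _ td] := sP _ ts1; have [ul _ _ ud] := sP _ us1.
    have [tO _ _ _] := xcoord_lam j0 Kg0 S1 Hg tl.
    have [uO _ _ _] := xcoord_lam j0 Kg0 S1 Hg ul.
    move: tl ul => /(lamE _ _ S0)[t1 t2 _ tdv] /(lamE _ _ S0)[u1 u2 _ udv].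
    rewrite /EE; apply: dv_mul => //; first exact: dvB.
    apply: dv_prod => //; first by rewrite rpredB.
    + exact: enum_uniq.
    + by move=> k l _ _; apply: Hc.
    + move=> k; rewrite mem_enum => /andP[ki kj].
      apply: (@dv_cop _ O D0 T1 (g k) (g j0)) => //; first by rewrite rpredB.
        by apply: Hc; rewrite eq_sym.
      have -> : g j0 * (xcoord g j0 t - xcoord g j0 u) = ell j0 (t.1 - u.1, t.2 - u.2).
        by rewrite ellB mulrBr /xcoord ![g j0 * _]mulrC !mulfVK.
      have ji : j0 != i0 by rewrite eq_sym.
      apply: (ell_dv ji ki); rewrite /= ?rpredB //.
        by rewrite ellB Et Eu subrr.
      by rewrite !dvE mul1r ellB mulrBl rpredB // ?tdv ?udv.
  rewrite -[C * _ * _]mulrA ler_wpM2l ?(ltW C0) // -exprMn.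
  apply: lerXn2r; rewrite ?nnegrE ?mulr_ge0 ?le_max ?ler01 //.
  apply: le_trans (max_scale cc1 _); last by rewrite divr_ge0 // mulr_ge0 ?(ltW Np) ?(ltW W0).
  rewrite le_max2 //; apply: le_trans (_ : c1 p * (S / (wprod G i0 * nrm nu)) <= _); last first.
    by rewrite ler_wpM2r // divr_ge0 // mulr_ge0 ?(ltW Np) ?(ltW W0).
  set Q := \prod_(k | (k != i0) && (k != j0)) G k.
  have EW : wprod G i0 = G j0 * Q by rewrite /wprod (bigD1 j0) // eq_sym.
  have Q0 : 0 < Q by apply: lt_le_trans ltr01 (prod_ge1 _ G1).
  have -> : c1 p * (S / (wprod G i0 * nrm nu)) = 2 * (EE p)%:R * (a * S / G j0) *
     ((K' / nrm nu) * (nrm 1 * Kg ^+ #|(fun k : I => (k != i0) && (k != j0))| / Q)).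
    by rewrite /c1 EW /=; field; rewrite !gt_eqF.
  rewrite ler_wpM2l ?mulr_ge0 ?invr_ge0 ?(ltW (Gp _)) // invfM.
  apply: le_trans (nrmM HO _ _) _; apply: ler_pM; rewrite ?(nrm_ge0 HO) //.
    by rewrite -fmorphV thn.
  by apply: nrm_prodV_enum.
apply: le_trans (_ : (count (fun t => has (fun x => xcoord g i0 t == x) X) s)%:R <= _).
  rewrite ler_nat -{1}count_predT; apply: eq_leq; apply: eq_in_count => t ts /=.
  apply/esym/hasP; exists (xcoord g i0 t) => //.
  by rewrite mem_undup; apply: map_f.
have H := count_has_le (fun x t => xcoord g i0 t == x) X s.
rewrite -(ler_nat R) in H; apply: le_trans H _; rewrite natr_sum.
apply: le_trans (_ : \sum_(x <- X) (C * cc ^+ n * Num.max 1 (S / (wprod G i0 * nrm nu)) ^+ n) <= _).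
  by apply: ler_sum => x _; apply: fib.
rewrite big_const_seq iter_addr_0 count_predT -[X in X <= _]mulr_natl mulrACA.
apply: ler_wpM2r => //.
by rewrite mulr_ge0 ?exprn_ge0 ?le_max ?ler01 // mulr_ge0 ?exprn_ge0 // ltW.
Qed.

(** Sums [nu_count] over all possible common factors. Here [th] is the identity for a relation
    within one pair s, and the conjugation for a relation between s and its conjugate. *)
Lemma bad_in_lam (Kg eps : R) (T1 T2 : nat) : 1 <= Kg -> 0 < eps ->
  (0 < T1)%N -> (0 < T2)%N -> exists (T : nat) (Cs : R), [/\ (0 < T)%N, 1 <= Cs &
  forall G g S i0 j0, i0 != j0 -> gdata Kg G g -> pcop T1 g -> Cs * (\prod_i G i) ^+ n.+1 <= S ->
  (count (fun s => [forall i, (i != j0) ==> `[< cop T2 (g i) (xcoord g j0 s) >]] &&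
      ~~ `[< cop T (xcoord g i0 s) (th (xcoord g j0 s)) >]) (lam g S))%:R <=
  eps * (S ^+ n * S ^+ n) / (\prod_i G i) ^+ n].
Proof.
move=> Kg1 e0 T10 T20; have Kg0 : 0 <= Kg by apply: le_trans Kg1.
have [a Ea] : exists a, a = ellK * Kg by eexists.
have a1 : 1 <= a by rewrite Ea mulr_ege1 ?ellK_ge1.
have a0 : 0 <= a by apply: le_trans a1.
have cK1 : 1 <= ellK * (Kg * Kg) by rewrite !mulr_ege1 ?ellK_ge1.
have [t0 [K' [t00 K'1 HT]]] := bad_factor HO cK1.
have K'0 : 0 <= K' by apply: le_trans K'1.
have [Cn Cn1 HC] := nu_count Kg1 K'1 T10 T20 t00.
have [Kt Kt0 tail] := tail_sum HO.
pose z := t0%:R * K' * a; have z1 : 1 <= z by rewrite !mulr_ege1 ?ler1n.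
have z0 : 0 < z by apply: lt_le_trans z1.
pose C2 := Cn * (z ^+ n * z ^+ n); have C21 : 1 <= C2 by rewrite !mulr_ege1 ?exprn_ege1.
have C20 : 0 < C2 by apply: lt_le_trans C21.
pose U0 := Num.max 1 (2 * C2 * Kt / eps).
have U01 : 1 <= U0 by rewrite le_max lexx.
have [T T0 HT0] := HT U0.
exists T, U0; split=> // G g S i0 j0 ij Hg Hc; set P := \prod_i G i => hS.
have G1 := gdata_ge1 Hg.
have Gp i : 0 < G i by apply: lt_le_trans (G1 i).
have P1 : 1 <= P by apply: prod_ge1.
have P0 : 0 < P by apply: lt_le_trans P1.
have PS : U0 * P ^+ n * P <= S by apply: le_trans hS; rewrite exprSr mulrA.
have S1 : 1 <= S by apply: le_trans PS; rewrite !mulr_ege1 ?exprn_ege1.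
have S0 : 0 < S by apply: lt_le_trans S1.
have V1 : 1 <= S / P.
  rewrite ler_pdivlMr // mul1r; apply: le_trans PS.
  by rewrite ler_peMl ?(ltW P0) // mulr_ege1 ?exprn_ege1.
pose r := [seq nu <- box (z * S) | [&& nu != 0, cond nu <= K' & U0 <= nrm nu]].
pose pr nu s := [&& [forall i, (i != j0) ==> `[< cop T2 (g i) (xcoord g j0 s) >]],
      dv t0 nu (xcoord g i0 s) & dv t0 nu (th (xcoord g j0 s))].
apply: le_trans (_ : (count (fun s => has (pr^~ s) r) (lam g S))%:R <= _).
  rewrite ler_nat -!size_filter; apply: uniq_leq_size; first by rewrite filter_uniq ?lam_uniq.
  move=> s; rewrite mem_filter => /andP[/andP[hc /asboolPn nc] sl]; rewrite mem_filter sl andbT.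
  have [xO x0 xn xc] := xcoord_lam i0 Kg0 S1 Hg sl; rewrite -Ea in xn.
  have [yO y0 _ _] := xcoord_lam j0 Kg0 S1 Hg sl.
  have [nu [nuO nu0 cnu Unu [d1 d2]]] := HT0 _ _ xO x0 (thO yO) xc nc.
  apply/hasP; exists nu; last by rewrite /pr hc d1 d2.
  rewrite mem_filter nu0 cnu Unu (boxE HO) nuO /=.
  apply: le_trans (dv_nrm HO xO x0 t00 nu0 cnu d1) _.
  have -> : z * S = t0%:R * K' * (a * S) by rewrite /z; ring.
  rewrite ler_wpM2l ?mulr_ge0 //; apply: le_trans xn _.
  by rewrite ler_pdivrMr // ler_peMr // mulr_ge0 // ltW.
have H := count_has_le pr r (lam g S).
rewrite -(ler_nat R) in H; apply: le_trans H _; rewrite natr_sum.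
pose SS := S ^+ n * S ^+ n.
have SS0 : 0 <= SS by rewrite mulr_ge0 ?exprn_ge0 ?(ltW S0).
(* Two ranges. Below S / P both maxima of [nu_count] are ratios and give the main term times nrm nu
   ^ -(2n). Above it each is only bounded by z S / nrm nu; the missing factor P^-n comes from the
   tail beyond S / P, because S >= U0 P^(n+1). *)
apply: le_trans (_ : \sum_(nu <- box (z * S) | U0 <= nrm nu) C2 * SS / P ^+ n * (nrm nu) ^- n.+1 +
    \sum_(nu <- box (z * S) | S / P <= nrm nu) C2 * SS * (nrm nu) ^- n.+1 <= _); last first.
  rewrite -!mulr_sumr.
  have h1 := tail U0 (z * S) U01; have h2 := tail (S / P) (z * S) V1.
  have U0p : 0 < U0 by apply: lt_le_trans U01.
  have Pn0 : 0 < P ^+ n by rewrite exprn_gt0.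
  have hU : 2 * C2 * Kt / U0 <= eps.
    by rewrite ler_pdivrMr // [eps * _]mulrC -ler_pdivrMr // le_max lexx orbT.
  have hS2 : 2 * C2 * Kt / (S / P) <= eps / P ^+ n.
    have -> : 2 * C2 * Kt / (S / P) = 2 * C2 * Kt * P / S by field; rewrite !gt_eqF.
    rewrite ler_pdivrMr // [eps / _ * S]mulrAC ler_pdivlMr //.
    have -> : 2 * C2 * Kt * P * P ^+ n = 2 * C2 * Kt * (P * P ^+ n) by ring.
    have hA : 2 * C2 * Kt <= eps * U0 by move: hU; rewrite ler_pdivrMr.
    apply: le_trans (_ : eps * U0 * (P * P ^+ n) <= _).
      by rewrite ler_wpM2r // mulr_ge0 ?(ltW P0) // ltW.
    have -> : eps * U0 * (P * P ^+ n) = eps * (U0 * P ^+ n * P) by ring.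
    by rewrite ler_wpM2l ?(ltW e0).
  have CS0 : 0 <= C2 * SS by rewrite mulr_ge0 // ltW.
  have e1 : C2 * SS / P ^+ n * (\sum_(i <- box (z * S) | U0 <= nrm i) (nrm i) ^- n.+1) <= SS / P ^+ n * (eps / 2).
    apply: le_trans (ler_wpM2l _ h1) _; first by rewrite divr_ge0 // ltW.
    have -> : C2 * SS / P ^+ n * (Kt / U0) = SS / P ^+ n * (2 * C2 * Kt / U0 / 2) by field; rewrite !gt_eqF.
    by rewrite ler_wpM2l ?divr_ge0 ?(ltW Pn0) // ler_pM2r ?invr_gt0.
  have e2 : C2 * SS * (\sum_(i <- box (z * S) | S / P <= nrm i) (nrm i) ^- n.+1) <= SS * (eps / P ^+ n / 2).
    apply: le_trans (ler_wpM2l CS0 h2) _.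
    have -> : C2 * SS * (Kt / (S / P)) = SS * (2 * C2 * Kt / (S / P) / 2) by field; rewrite !gt_eqF.
    by rewrite ler_wpM2l // ler_pM2r ?invr_gt0.
  apply: le_trans (lerD e1 e2) _; rewrite le_eqVlt; apply/predU1P; left.
  by rewrite -/SS; field; rewrite gt_eqF.
rewrite /r big_filter big_mkcond [X in _ <= X + _]big_mkcond [X in _ <= _ + X]big_mkcond -big_split /=.
rewrite big_seq [X in _ <= X]big_seq; apply: ler_sum => nu; rewrite (boxE HO) => /andP[nuO nuS].
have n1 : 0 <= C2 * SS / P ^+ n * (nrm nu) ^- n.+1.
  exact: divr_ge0 (divr_ge0 (mulr_ge0 (ltW C20) SS0) (ltW (exprn_gt0 _ P0))) (exprn_ge0 _ (nrm_ge0 HO _)).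
have n2 : 0 <= C2 * SS * (nrm nu) ^- n.+1.
  exact: divr_ge0 (mulr_ge0 (ltW C20) SS0) (exprn_ge0 _ (nrm_ge0 HO _)).
case: ifP => [/and3P[nu0 cnu Unu]|_]; last by rewrite addr_ge0 //; case: ifP.
rewrite Unu; have Np : 0 < nrm nu by apply: (nrm_gt0 HO).
have nu1 := nrm_int HO nuO nu0.
apply: le_trans (HC G g S i0 j0 nu ij Hg Hc S1 nuO nu0 cnu) _.
set W := wprod G i0.
have EP : P = G i0 * W by rewrite /P (gprod_wprod _ i0).
have W1 : 1 <= W by apply: prod_ge1.
have W0 : 0 < W by apply: lt_le_trans W1.
(* Both coordinates save n powers, and 2 n >= n + 1. *)
have nn : (nrm nu) ^- n * (nrm nu) ^- n <= (nrm nu) ^- n.+1.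
  rewrite -invfM lef_pV2 ?posrE ?exprn_gt0 ?mulr_gt0 ?exprn_gt0 // -exprD.
  by apply: ler_weXn2l => //; rewrite -addn1 leq_add2l (order_rank HO).
case: (leP (S / P) (nrm nu)) => h.
  rewrite -[X in X <= _]add0r; apply: lerD => //.
  have m x : 1 <= x -> Num.max 1 (S / (x * nrm nu)) <= z * S / nrm nu.
    move=> x1; have x0 : 0 < x by apply: lt_le_trans x1.
    rewrite ge_max ler_pdivlMr // mul1r nuS /= invfM mulrA ler_wpM2r ?invr_ge0 ?(ltW Np) //.
    apply: le_trans (_ : S <= _); first by rewrite ler_pdivrMr // ler_peMr // ltW.
    by rewrite ler_peMl // ltW.
  have mn x : 1 <= x -> Num.max 1 (S / (x * nrm nu)) ^+ n <= (z * S / nrm nu) ^+ n.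
    move=> x1; apply: lerXn2r; rewrite ?nnegrE ?le_max ?ler01 ?m //.
    exact: divr_ge0 (mulr_ge0 (ltW z0) (ltW S0)) (ltW Np).
  apply: le_trans (_ : Cn * ((z * S / nrm nu) ^+ n * (z * S / nrm nu) ^+ n) <= _).
    rewrite ler_wpM2l ?(le_trans ler01 Cn1) //.
    by apply: ler_pM; rewrite ?exprn_ge0 ?le_max ?ler01 ?mn.
  rewrite expr_div_n exprMn.
  have -> : Cn * (z ^+ n * S ^+ n / nrm nu ^+ n * (z ^+ n * S ^+ n / nrm nu ^+ n)) =
     C2 * SS * ((nrm nu) ^- n * (nrm nu) ^- n) by rewrite /C2 /SS; ring.
  by rewrite ler_wpM2l // mulr_ge0 // ltW.
rewrite addr0.
have m x : 1 <= x -> x <= P -> Num.max 1 (S / (x * nrm nu)) = S / (x * nrm nu).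
  move=> x1 xP; have x0 : 0 < x by apply: lt_le_trans x1.
  apply/max_idPr; rewrite ler_pdivlMr ?mulr_gt0 // mul1r.
  apply: le_trans (_ : P * nrm nu <= _); first by rewrite ler_pM2r.
  by move: h; rewrite ltr_pdivlMr // mulrC => /ltW.
rewrite !m //; [|by rewrite EP ler_peMl // ltW|by rewrite EP ler_peMr // ltW].
have -> : Cn * ((S / (G i0 * nrm nu)) ^+ n * (S / (W * nrm nu)) ^+ n) =
   Cn * (SS / P ^+ n * ((nrm nu) ^- n * (nrm nu) ^- n)).
  by rewrite EP /SS !expr_div_n !exprMn !invfM; ring.
have -> : C2 * SS / P ^+ n * (nrm nu) ^- n.+1 = C2 * (SS / P ^+ n * (nrm nu) ^- n.+1) by ring.
have SP0 : 0 <= SS / P ^+ n by rewrite divr_ge0 ?exprn_ge0 // ltW.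
apply: ler_pM; rewrite ?(le_trans ler01 Cn1) //.
- by rewrite mulr_ge0 // divr_ge0 ?invr_ge0 ?exprn_ge0 ?(ltW Np).
- by rewrite ler_peMr ?(le_trans ler01 Cn1) // mulr_ege1 ?exprn_ege1.
- by rewrite ler_wpM2l.
Qed.

End Forms.

(** * Heights over a number field *)

Local Open Scope classical_set_scope.

Lemma finite_of_inj_seq (T : choiceType) (U : eqType) (A : set T) (f : T -> U) (r : seq U) :
  (forall x, A x -> f x \in r) -> (forall x y, A x -> A y -> f x = f y -> x = y) ->
  finite_set A /\ (#|` fset_set A| <= size r)%N.
Proof.
move=> fr inj; have [[x0 Ax0]|A0] := pselect (exists x, A x); last first.
  have -> : A = set0 by apply/seteqP; split=> // x Ax; exfalso; apply: A0; exists x.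
  by rewrite fset_set0 cardfs0; split=> //; apply: finite_set0.
pose g u := if pselect (exists x, A x /\ f x = u) is left h then sval (cid h) else x0.
have gK x : A x -> g (f x) = x.
  move=> Ax; rewrite /g; case: pselect => [h|[]]; last by exists x.
  by case: (cid h) => y /= [Ay E]; apply: inj.
have sub : A `<=` [set` map g r].
  by move=> x Ax /=; rewrite -(gK x Ax); apply: map_f; apply: fr.
have fin : finite_set A by apply: sub_finite_set sub _; apply: finite_seq.
split=> //; rewrite -(size_map g r); apply: uniq_leq_size; first exact: fset_uniq.
by move=> x; rewrite in_fset_set // => /set_mem /sub.
Qed.

(** The commuting matrices preserve an eigenspace of A and still commute on it, so over an
    algebraically closed field they share an eigenvector there. *)
Lemma common_eigen_mx (L : numClosedFieldType) (d : nat) (I : finType) (A : 'M[L]_d) (Bs : I -> 'M[L]_d) a :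
  (forall i, comm_mx A (Bs i)) -> (forall i j, comm_mx (Bs i) (Bs j)) -> eigenvalue A a ->
  exists2 v : 'rV[L]_d, v != 0 & v *m A = a *: v /\ forall i, exists c, v *m Bs i = c *: v.
Proof.
move=> cA cB; rewrite /eigenvalue; set W := eigenspace A a => Wn0.
pose As := [seq restrictmx W (Bs i) | i : I].
have r0 : (0 < \rank W)%N by rewrite lt0n mxrank_eq0.
have sW i : stablemx W (Bs i) by apply: comm_mx_stable_eigenspace.
have [|v v0 /allP /= vP] := @common_eigenvector L _ As r0.
  move=> _ _ /mapP [i _ ->] /mapP [j _ ->].
  by rewrite /comm_mx -!conjmxM ?inE ?stablemx_row_base // cB.
exists (v *m row_base W); first by rewrite mulmx_free_eq0 ?row_base_free.
have vW : (v *m row_base W <= W)%MS by rewrite mulmx_sub // eq_row_base.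
split; first exact/eigenspaceP.
move=> i; have : stablemx (v *m row_base W) (Bs i).
  by rewrite -stablemx_restrict ?vP //; apply/mapP; exists i; rewrite ?mem_enum.
by case/eigenvectorP => c /eigenspaceP E; exists c.
Qed.

(** * Embeddings, traces and integrality through the regular representation *)

Section NumberField.
Variables (R : realType) (K : fieldExtType rat).
Local Notation L := R[i].
Local Notation d := (\dim {:K}).
Local Notation rL := (ratr : rat -> L).

Let b : d.-tuple K := vbasis {:K}.
Let cb (x : K) (i : 'I_d) : rat := coord b i x.

Lemma cbE x : x = \sum_i cb x i *: b`_i.
Proof. exact: (coord_vbasis (memvf x)). Qed.

Lemma d_gt0 : (0 < d)%N.
Proof. by rewrite adim_gt0. Qed.

Definition mulK (x : K) : 'M[rat]_d := \matrix_(i, j) cb (x * b`_i) j.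

Lemma mulKE x (i : 'I_d) : x * b`_i = \sum_j mulK x i j *: b`_j.
Proof. by rewrite {1}(cbE (x * b`_i)); apply: eq_bigr => j _; rewrite mxE. Qed.

Lemma b_inj (c c' : 'I_d -> rat) : \sum_i c i *: b`_i = \sum_i c' i *: b`_i -> c =1 c'.
Proof.
move=> E i; have fb : free b by apply: (basis_free (vbasisP _)).
by rewrite -(coord_sum_free c i fb) E coord_sum_free.
Qed.

Lemma mulKM x y : mulK (x * y) = mulK x *m mulK y.
Proof.
apply/matrixP => i; apply: b_inj.
rewrite -mulKE -mulrA [y * _]mulrC mulrA mulKE mulr_suml.
transitivity (\sum_j \sum_k (mulK x i j * mulK y j k) *: b`_k).
  apply: eq_bigr => j _; rewrite -scalerAl [_ * y]mulrC mulKE scaler_sumr.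
  by apply: eq_bigr => k _; rewrite scalerA.
rewrite exchange_big; apply: eq_bigr => k _; rewrite mxE scaler_suml.
by [].
Qed.

Lemma mulK1 : mulK 1 = 1%:M.
Proof.
apply/matrixP => i; apply: b_inj; rewrite -mulKE mul1r.
rewrite (bigD1 i) //= mxE eqxx scale1r big1 ?addr0 // => j ji.
by rewrite mxE eq_sym (negPf ji) scale0r.
Qed.

Lemma mulKD x y : mulK (x + y) = mulK x + mulK y.
Proof. by apply/matrixP => i j; rewrite !mxE mulrDl /cb linearD. Qed.

Lemma mulKZ c x : mulK (c *: x) = c *: mulK x.
Proof. by apply/matrixP => i j; rewrite !mxE -scalerAl /cb linearZ. Qed.

Definition mulL x : 'M[L]_d := map_mx rL (mulK x).

Lemma mulLM x y : mulL (x * y) = mulL x *m mulL y.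
Proof. by rewrite /mulL mulKM map_mxM. Qed.

Lemma mulLD x y : mulL (x + y) = mulL x + mulL y.
Proof. by rewrite /mulL mulKD map_mxD. Qed.

Lemma mulL1 : mulL 1 = 1%:M.
Proof. by rewrite /mulL mulK1 map_mx1. Qed.

Lemma mulL_sum x : mulL x = \sum_i rL (cb x i) *: mulL b`_i.
Proof.
apply/matrixP => j k; rewrite {1}(cbE x) summxE !mxE.
rewrite mulr_suml /cb linear_sum rmorph_sum; apply: eq_bigr => i _.
by rewrite !mxE -scalerAl linearZ rmorphM.
Qed.

Lemma mulL_comm x y : mulL x *m mulL y = mulL y *m mulL x.
Proof. by rewrite -!mulLM mulrC. Qed.

Lemma common_eigen x a : eigenvalue (mulL x) a ->
  exists2 v : 'rV[L]_d, v != 0 & v *m mulL x = a *: v /\ forall i : 'I_d, exists c, v *m mulL b`_i = c *: v.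
Proof.
by apply: common_eigen_mx => *; apply: mulL_comm.
Qed.

(** All multiplication matrices commute, so an eigenvector for x can be taken common to all of them;
    sending y to its eigenvalue on that vector is a ring homomorphism. *)
Lemma embedding_of_eigenvalue x a : eigenvalue (mulL x) a ->
  exists2 s : K -> R[i], embeddings s & s x = a.
Proof.
case/common_eigen => v v0 [vx vb].
have H y : exists c, v *m mulL y = c *: v.
  have [c Hc] := choice vb.
  exists (\sum_i rL (cb y i) * c i).
  rewrite mulL_sum mulmx_sumr scaler_suml; apply: eq_bigr => i _.
  by rewrite -scalemxAr Hc scalerA.
have [s Hs] := choice H.
have inj c c' : c *: v = c' *: v -> c = c'.
  move=> E; apply/eqP; rewrite -subr_eq0; apply: contraTT v0 => c0.
  by rewrite negbK; move/eqP: E; rewrite -subr_eq0 -scalerBl scaler_eq0 (negPf c0).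
exists s; last by apply: inj; rewrite -Hs.
split; first by apply: inj; rewrite -Hs mulL1 mulmx1 scale1r.
split=> y z; apply: inj; rewrite -Hs.
  by rewrite mulLD mulmxDr !Hs scalerDl.
by rewrite mulLM mulmxA Hs -scalemxAl Hs scalerA.
Qed.

Lemma embedding_rmorph (s : K -> R[i]) : embeddings s ->
  exists f : {rmorphism K -> R[i]}, forall x, f x = s x.
Proof.
case=> s1 [sD sM].
have s0 : s 0 = 0 by apply: (addIr (s 0)); rewrite -sD !add0r.
have sN x : s (- x) = - s x by apply: (addIr (s x)); rewrite -sD !addNr.
have zs : zmod_morphism s by move=> x y; rewrite sD sN.
have ms : monoid_morphism s by split.
pose A := GRing.isZmodMorphism.Build K R[i] s zs.
pose M := GRing.isMonoidMorphism.Build K R[i] s ms.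
pose f : {rmorphism K -> R[i]} := HB.pack s A M.
by exists f.
Qed.

Lemma rmorph_ratr (f : {rmorphism K -> R[i]}) c x : f (c *: x) = rL c * f x.
Proof.
by rewrite -mulr_algl rmorphM; congr (_ * _); apply: (fmorph_eq_rat (f \o in_alg K)).
Qed.

(** An embedding is determined by the image of a primitive element, which is a root of a polynomial
    of degree d. Finiteness is essential: the archimedean height is a product over this set. *)
Lemma embeddings_finite : finite_set (@embeddings R K) /\
  (#|` fset_set (@embeddings R K)| <= d)%N.
Proof.
pose th := separable_generator 1 {:K}.
have sep : separable 1 {:K}.
  by apply/separableP => u _; apply: pcharf0_separable => p; rewrite pchar_lalg; apply: pchar_num.
have gen x : exists2 p : {poly K}, p \is a polyOver 1%VS & x = p.[th].
  apply/Fadjoin_polyP; rewrite -eq_adjoin_separable_generator ?sub1v ?memvf //.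
(* Transposed, because the row of the f b_i is an eigenvector of the transpose with eigenvalue f
   th. *)
pose P := char_poly (mulL th)^T.
have [r Er] := closed_field_poly_normal P.
rewrite (monicP (char_poly_monic _)) scale1r in Er.
have sr : size r = d.
  by have := size_char_poly (mulL th)^T; rewrite -/P Er size_prod_XsubC => -[].
rewrite -sr; apply: (finite_of_inj_seq (f := fun s => s th)).
  move=> s /embedding_rmorph [f Ef].
  rewrite -root_prod_XsubC -Er -eigenvalue_root_char.
  apply/eigenvalueP; exists (\row_i f b`_i).
    apply/rowP => i; rewrite !mxE -Ef -rmorphM mulKE rmorph_sum; apply: eq_bigr => j _.
    by rewrite !mxE rmorph_ratr mulrC.
  apply/eqP => u0; have := rmorph1 f; rewrite (cbE 1) rmorph_sum big1 => [/eqP|i _].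
    by rewrite eq_sym oner_eq0.
  by rewrite rmorph_ratr; move/rowP/(_ i): u0; rewrite !mxE => ->; rewrite mulr0.
move=> s t /embedding_rmorph [f Ef] /embedding_rmorph [g Eg] E.
apply/funext => x; have [p /polyOverP p1 ->] := gen x.
rewrite -Ef -Eg in E; rewrite -Ef -Eg -!horner_map /= E; congr (_.[_]).
apply/polyP => i; rewrite !coef_map /=; have /vlineP [c ->] := p1 i.
by rewrite !rmorph_ratr !rmorph1.
Qed.

(** Combined with [embedding_of_eigenvalue], the trace is a sum of values of embeddings; this gives
    both its integrality and its archimedean bound. *)
Lemma trace_eigen x : exists r : seq L, [/\ size r = d, all (eigenvalue (mulL x)) r &
  rL (\tr (mulK x)) = \sum_(z <- r) z].
Proof.
have [r Er] := closed_field_poly_normal (char_poly (mulL x)).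
rewrite (monicP (char_poly_monic _)) scale1r in Er.
have sr : size r = d.
  by have := size_char_poly (mulL x); rewrite Er size_prod_XsubC => -[].
exists r; split=> //.
  by apply/allP => z zr; rewrite eigenvalue_root_char Er root_prod_XsubC.
have r0 : size r != 0%N by rewrite sr -lt0n d_gt0.
have := coefPn_prod_XsubC r0; rewrite -Er sr char_poly_trace ?d_gt0 // => /oppr_inj <-.
by rewrite /mulL trace_map_mx.
Qed.

Lemma integralE x : ring_of_integers x <-> integralOver (intr : int -> K) x.
Proof. by split=> [[p [pm pr]]|[p pm pr]]; exists p. Qed.

(** The integral equation descends to the rationals and is then read in [algC], where rational
    algebraic integers are known to be integers. *)
Lemma rat_integral (q : rat) : integralOver (intr : int -> L) (rL q) -> q \is a Num.int.
Proof.
case=> p pm pr.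
have pq : root (map_poly (intr : int -> algC) p) (ratr q).
  have : root (map_poly (intr : int -> rat) p) q.
    rewrite -(fmorph_root (ratr : {rmorphism rat -> L})) -map_poly_comp.
    by rewrite (eq_map_poly (g := intr)) // => m /=; rewrite rmorph_int.
  rewrite -(fmorph_root (ratr : {rmorphism rat -> algC})) -map_poly_comp.
  by rewrite (eq_map_poly (g := intr)) // => m /=; rewrite rmorph_int.
have /intrP [m Em] : (ratr q : algC) \is a Num.int.
  apply: Cint_rat_Aint; first exact: Crat_rat.
  apply: root_monic_Aint pq _ _; first exact: monic_map.
  by apply/polyOverP => i; rewrite coef_map /= rpred_int.
apply/intrP; exists m; apply: (fmorph_inj (ratr : {rmorphism rat -> algC})).
by apply: (etrans Em); rewrite rmorph_int.
Qed.

Lemma embedding_integral (s : K -> R[i]) x : embeddings s -> ring_of_integers x ->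
  integralOver (intr : int -> L) (s x).
Proof.
move=> /embedding_rmorph [f Ef] [p [pm pr]]; exists p => //; rewrite -Ef.
rewrite -(fmorph_root f) -map_poly_comp in pr.
by rewrite (eq_map_poly (g := intr)) // in pr => m /=; rewrite rmorph_int.
Qed.

Lemma trace_int x : ring_of_integers x -> \tr (mulK x) \is a Num.int.
Proof.
move=> xO; apply: rat_integral; have [r [_ /allP rE ->]] := trace_eigen x.
rewrite big_seq; apply: (big_ind (integralOver (intr : int -> L))).
- exact: (mxpoly.integral0 (intr : {rmorphism int -> L})).
- by move=> u v; apply: (integral_add (RtoK := (intr : {rmorphism int -> L}))).
- by move=> z /rE /embedding_of_eigenvalue [s sE <-]; apply: embedding_integral.
Qed.

Lemma cabsE (z : R[i]) : `|z| = (cabs z)%:C%C.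
Proof. by rewrite normc_def. Qed.

Lemma cabsD (y z : R[i]) : cabs (y + z) <= cabs y + cabs z.
Proof. by have := ler_normD y z; rewrite !cabsE -rmorphD /= lecR. Qed.

Lemma cabsM (y z : R[i]) : cabs (y * z) = cabs y * cabs z.
Proof. by have := normrM y z; rewrite !cabsE -rmorphM /= => -[]. Qed.

Lemma cabs_ge0 (z : R[i]) : 0 <= cabs z.
Proof. exact: sqrtr_ge0. Qed.

Lemma cabs_rat (q : rat) : cabs (rL q) = `|ratr q|.
Proof.
have E : rL q = (ratr q)%:C%C by rewrite (fmorph_rat (real_complex R)).
by have := cabsE (rL q); rewrite E normc_def /cabs /= expr0n addr0 sqrtr_sqr.
Qed.

Lemma cabs_sum (I : Type) (r : seq I) (P : pred I) (F : I -> R[i]) :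
  cabs (\sum_(i <- r | P i) F i) <= \sum_(i <- r | P i) cabs (F i).
Proof.
elim/big_rec2: _ => [|i y z _ H]; last by apply: le_trans (cabsD _ _) _; rewrite lerD2l.
by rewrite /cabs /= expr0n addr0 sqrtr0.
Qed.

Lemma trace_bound x (B : R) : (forall s : K -> R[i], embeddings s -> cabs (s x) <= B) ->
  `|ratr (\tr (mulK x)) : R| <= d%:R * B.
Proof.
move=> H; rewrite -cabs_rat; have [r [sr /allP rE ->]] := trace_eigen x.
apply: le_trans (cabs_sum _ _ _) _.
apply: le_trans (_ : \sum_(z <- r) B <= _).
  rewrite big_seq [X in _ <= X]big_seq; apply: ler_sum => z /rE /embedding_of_eigenvalue [s sE <-].
  exact: H.
by rewrite big_const_seq iter_addr_0 count_predT sr mulr_natl.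
Qed.

End NumberField.

(** * The ring of integers as a subring predicate *)

Section RingOfIntegers.
Variable K : fieldExtType rat.

Definition intO : {pred K} := fun x => `[< ring_of_integers x >].

Lemma intOE x : (x \in intO) = `[< ring_of_integers x >].
Proof. by []. Qed.

Lemma intOP x : x \in intO -> integralOver (intr : int -> K) x.
Proof. by rewrite intOE => /asboolP /integralE. Qed.

Lemma intO_integral x : integralOver (intr : int -> K) x -> x \in intO.
Proof. by move=> h; rewrite intOE; apply/asboolP/integralE. Qed.

Lemma intO_subring : subring_closed intO.
Proof.
split.
- by apply: intO_integral; apply: (integral1 (intr : {rmorphism int -> K})).
- move=> x y /intOP xO /intOP yO; apply: intO_integral.
  exact: (integral_sub (RtoK := (intr : {rmorphism int -> K})) xO yO).
- move=> x y /intOP xO /intOP yO; apply: intO_integral.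
  exact: (integral_mul (RtoK := (intr : {rmorphism int -> K})) xO yO).
Qed.

HB.instance Definition _ := GRing.isSubringClosed.Build K intO intO_subring.

End RingOfIntegers.

(** * The ring of integers as a normed order of rank [K : Q] *)

Section NormK.
Variables (R : realType) (K : fieldExtType rat).
Local Notation d := (\dim {:K}).
Local Notation b := (vbasis {:K}).
Local Notation O := (@intO K).
Local Notation rR := (ratr : rat -> R).

(** [x] is an eigenvalue of its own multiplication matrix, with the basis as eigenvector, so it is a
    root of a monic integral characteristic polynomial. *)
Lemma integral_of_int_matrix (M : 'M[int]_d) (x : K) : map_mx intr M = mulK x -> x \in O.
Proof.
move=> E; apply: intO_integral; exists (char_poly M^T); first exact: char_poly_monic.
rewrite (map_char_poly (intr : {rmorphism int -> K})) -eigenvalue_root_char.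
have EM i j : (M i j)%:~R = mulK x i j :> rat by rewrite -E mxE.
apply/eigenvalueP; exists (\row_i b`_i).
  apply/rowP => i; rewrite !mxE mulKE; apply: eq_bigr => j _.
  by rewrite -EM !mxE scaler_int mulrzr.
apply/eqP => u0; have := oner_neq0 K; rewrite (cbE 1) big1 ?eqxx // => i _.
by move/rowP/(_ i): u0; rewrite !mxE => ->; rewrite scaler0.
Qed.

Lemma integral_multiple (x : K) : exists2 N : int, N != 0 & N%:~R *: x \in O.
Proof.
pose N := \prod_(i < d) \prod_(j < d) denq (mulK x i j).
have N0 : N != 0 by apply/prodf_neq0 => i _; apply/prodf_neq0 => j _; apply: denq_neq0.
exists N => //.
have dvN i j : N%:~R * mulK x i j \is a Num.int.
  have [q ->] : exists q : int, N = denq (mulK x i j) * q.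
    by rewrite /N (bigD1 i) //= (bigD1 j) //= -mulrA; eexists.
  by rewrite rmorphM mulrAC [_ * mulK x i j]mulrC -numqE rpredM // rpred_int.
apply: (@integral_of_int_matrix (\matrix_(i, j) numq (N%:~R * mulK x i j))).
rewrite mulKZ; apply/matrixP => i j; rewrite !mxE.
by move: (dvN i j); rewrite mxE => /intrP [m ->]; rewrite numq_int.
Qed.

(** Only a rational basis made of integers, not an integral basis of O: bounded denominators
    ([ic_den]) are enough for counting up to constants. *)
Lemma int_basis_ex : exists e : 'I_d -> K,
  (forall i, e i \in O) /\ exists c : K -> 'I_d -> rat,
  [/\ forall x, x = \sum_i c x i *: e i,
      forall x y i, c (x + y) i = c x i + c y i,
      forall q x i, c (q *: x) i = q * c x i &
      forall (q : 'I_d -> rat) i, c (\sum_j q j *: e j) i = q i].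
Proof.
have /choice [N HN] (i : 'I_d) : exists N : int, N != 0 /\ N%:~R *: b`_i \in O.
  by have [N] := integral_multiple b`_i; exists N.
have N0 i : (N i)%:~R != 0 :> rat by rewrite intr_eq0; case: (HN i).
exists (fun i => (N i)%:~R *: b`_i); split=> [i|]; first by case: (HN i).
exists (fun x i => coord b i x / (N i)%:~R); split.
- move=> x; rewrite {1}(cbE x); apply: eq_bigr => i _; rewrite scalerA.
  by rewrite -mulrA mulVf ?mulr1.
- by move=> x y i; rewrite linearD mulrDl.
- by move=> q x i; rewrite linearZ /= mulrA.
- move=> q i; under eq_bigr do rewrite scalerA.
  by rewrite coord_sum_free ?(basis_free (vbasisP _)) // mulfK.
Qed.

Definition ie : 'I_d -> K := sval (cid int_basis_ex).
Definition ic : K -> 'I_d -> rat := sval (cid (proj2 (svalP (cid int_basis_ex)))).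

Lemma ieO i : ie i \in O.
Proof. by have [] := svalP (cid int_basis_ex). Qed.

Lemma icP : [/\ forall x, x = \sum_i ic x i *: ie i,
      forall x y i, ic (x + y) i = ic x i + ic y i,
      forall q x i, ic (q *: x) i = q * ic x i &
      forall (q : 'I_d -> rat) i, ic (\sum_j q j *: ie j) i = q i].
Proof. exact: (svalP (cid (proj2 (svalP (cid int_basis_ex))))). Qed.

Lemma icE x : x = \sum_i ic x i *: ie i. Proof. by have [] := icP. Qed.
Lemma icD x y i : ic (x + y) i = ic x i + ic y i. Proof. by have [] := icP. Qed.
Lemma icZ q x i : ic (q *: x) i = q * ic x i. Proof. by have [] := icP. Qed.
Lemma icK q i : ic (\sum_j q j *: ie j) i = q i. Proof. by have [] := icP. Qed.
Lemma icN x i : ic (- x) i = - ic x i. Proof. by rewrite -scaleN1r icZ mulN1r. Qed.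
Lemma icB x y i : ic (x - y) i = ic x i - ic y i. Proof. by rewrite icD icN. Qed.
Lemma ic0 i : ic 0 i = 0. Proof. by rewrite -(scale0r 0) icZ mul0r. Qed.
Lemma ic_sum (J : finType) (F : J -> K) i : ic (\sum_j F j) i = \sum_j ic (F j) i.
Proof. by apply: (big_morph (ic^~ i)) => [x y|]; rewrite ?icD ?ic0. Qed.

Lemma trK_sum (J : finType) (F : J -> K) : \tr (mulK (\sum_j F j)) = \sum_j \tr (mulK (F j)).
Proof.
apply: (big_morph (fun x => \tr (mulK x))) => [x y|]; first by rewrite mulKD mxtraceD.
by rewrite -(scale0r 0) mulKZ scale0r mxtrace0.
Qed.

Lemma trKZ q (x : K) : \tr (mulK (q *: x)) = q * \tr (mulK x).
Proof. by rewrite mulKZ mxtraceZ. Qed.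

Definition gram : 'M[rat]_d := \matrix_(i, j) \tr (mulK (ie i * ie j)).

Lemma gramE x j : \sum_i ic x i * gram i j = \tr (mulK (x * ie j)).
Proof.
rewrite {2}(icE x) mulr_suml trK_sum; apply: eq_bigr => i _.
by rewrite !mxE -scalerAl trKZ.
Qed.

(** A kernel vector would give y != 0 with tr (y z) = 0 for all z; but z = y^-1 gives the trace d of
    the identity. *)
Lemma gram_det : \det gram != 0.
Proof.
apply/negP => /det0P [v v0 vG].
pose y := \sum_i v 0 i *: ie i.
have ty j : \tr (mulK (y * ie j)) = 0.
  rewrite -gramE; move/rowP/(_ j): vG; rewrite !mxE => E; rewrite -[RHS]E.
  by apply: eq_bigr => i _; rewrite /y icK.
have y0 : y != 0.
  apply: contraNneq v0 => y0; apply/eqP/rowP => i.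
  by rewrite mxE -(icK (fun i => v 0 i) i) -/y y0 ic0.
have : \tr (mulK (y * y^-1)) = 0.
  rewrite (icE y^-1) mulr_sumr trK_sum big1 // => i _.
  by rewrite -scalerAr trKZ ty mulr0.
rewrite divff // mulK1 mxtrace1 => /eqP; rewrite pnatr_eq0.
by apply/negP; rewrite -lt0n d_gt0.
Qed.

Lemma gram_int i j : gram i j \is a Num.int.
Proof. by rewrite mxE; apply: (trace_int R); apply/asboolP; rewrite -intOE rpredM ?ieO. Qed.

(** Cramer's rule: the traces tr (x e_j) are integers and determine the coordinates through the Gram
    matrix, so its determinant clears all denominators. *)
Lemma ic_den : exists2 D : nat, (0 < D)%N & forall x i, x \in O -> D%:R * ic x i \is a Num.int.
Proof.
have adjZ i j : (\adj gram) i j \is a Num.int.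
  rewrite mxE /cofactor; apply: rpredM; first by apply: rpredX; apply: rpredN1.
  rewrite /determinant; apply: rpred_sum => s _; apply: rpredM.
    by apply: rpredX; apply: rpredN1.
  by apply: rpred_prod => k _; rewrite 2!mxE gram_int.
have /intrP [m Em] : \det gram \is a Num.int.
  rewrite /determinant; apply: rpred_sum => s _; apply: rpredM.
    by apply: rpredX; apply: rpredN1.
  by apply: rpred_prod => k _; rewrite gram_int.
have m0 : m != 0 by have := gram_det; rewrite Em intr_eq0.
exists `|m|%N; first by rewrite absz_gt0.
move=> x i xO.
have H : \det gram * ic x i \is a Num.int.
  pose v := \row_i ic x i.
  have : v *m gram *m \adj gram = \det gram *: v.
    by rewrite -mulmxA mul_mx_adj mul_mx_scalar.
  move/rowP/(_ i); rewrite !mxE => <-; apply: rpred_sum => j _; apply: rpredM => //.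
  rewrite mxE (eq_bigr (fun i => ic x i * gram i j)) => [|k _]; last by rewrite mxE.
  rewrite gramE; apply: (trace_int R); apply/asboolP; rewrite -intOE rpredM ?ieO //.
have [E|E] : (`|m|%N%:R = m%:~R :> rat) \/ (`|m|%N%:R = - m%:~R :> rat).
  have [m1|m1] := leP 0 m; [left|right].
    by rewrite natr_absz ger0_norm.
  by rewrite natr_absz ltr0_norm // rmorphN.
  by rewrite E -Em.
by rewrite E -Em mulNr rpredN.
Qed.

Definition icden : nat := s2val (cid2 ic_den).
Lemma icden_gt0 : (0 < icden)%N. Proof. exact: (s2valP (cid2 ic_den)). Qed.
Lemma icdenP x i : x \in O -> icden%:R * ic x i \is a Num.int.
Proof. exact: (s2valP' (cid2 ic_den)). Qed.

Definition nrm1 (x : K) : R := \sum_i `|rR (ic x i)|.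
(** Dominates the structure constants of the basis, which makes the norm submultiplicative, and the
    common denominator [icden], which gives nonzero integers norm at least 1. *)
Definition nrmc : nat := (icden + \sum_i \sum_j \sum_l (Num.truncn `|ic (ie i * ie j) l|).+1)%N.
Definition nrmK (x : K) : R := nrmc%:R * nrm1 x.

Lemma nrm1_ge0 x : 0 <= nrm1 x.
Proof. by apply: sumr_ge0. Qed.

Lemma nrmc_gt0 : (0 < nrmc)%N.
Proof. by rewrite addn_gt0 icden_gt0. Qed.

Lemma nrm1M x y : nrm1 (x * y) <= nrmc%:R * (nrm1 x * nrm1 y).
Proof.
have E l : ic (x * y) l = \sum_i \sum_j ic x i * ic y j * ic (ie i * ie j) l.
  rewrite {1}(icE x) mulr_suml ic_sum; apply: eq_bigr => i _.
  rewrite {1}(icE y) mulr_sumr ic_sum; apply: eq_bigr => j _.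
  by rewrite -scalerAl -scalerAr !icZ mulrA.
have sc i j : \sum_l `|rR (ic (ie i * ie j) l)| <= nrmc%:R :> R.
  rewrite /nrmc natrD; apply: ler_wpDl => //.
  rewrite natr_sum [leRHS](bigD1 i) //=; apply: ler_wpDr; first exact: sumr_ge0.
  rewrite natr_sum [leRHS](bigD1 j) //=; apply: ler_wpDr; first exact: sumr_ge0.
  rewrite natr_sum; apply: ler_sum => l _.
  rewrite -ratr_norm -(ratr_nat R) ler_rat ltW //.
  by have /andP [_] := truncn_itv (normr_ge0 (ic (ie i * ie j) l)).
rewrite /nrm1.
apply: le_trans (_ : \sum_l \sum_i \sum_j `|rR (ic x i)| * `|rR (ic y j)| * `|rR (ic (ie i * ie j) l)| <= _).
  apply: ler_sum => l _; rewrite E rmorph_sum; apply: le_trans (ler_norm_sum _ _ _) _.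
  apply: ler_sum => i _; rewrite rmorph_sum; apply: le_trans (ler_norm_sum _ _ _) _.
  by apply: ler_sum => j _; rewrite !rmorphM !normrM.
rewrite exchange_big /= mulr_suml mulr_sumr; apply: ler_sum => i _.
rewrite exchange_big /= !mulr_sumr; apply: ler_sum => j _.
by rewrite -mulr_sumr mulrC ler_wpM2r ?mulr_ge0.
Qed.

Lemma nrmK_round z : exists2 x, x \in O & nrmK (z - x) <= nrmc%:R * d%:R.
Proof.
exists (\sum_i (Num.floor (ic z i))%:~R *: ie i).
  by apply: rpred_sum => i _; rewrite scaler_int rpredMz ?ieO.
rewrite /nrmK ler_wpM2l ?ler0n // -[X in X%:R]card_ord -sum1_card natr_sum.
apply: ler_sum => i _; rewrite icB icK -ratr_norm -(ratr_nat R) ler_rat.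
have := floor_itv (ic z i); rewrite rmorphD /= => /andP [h1 h2].
by rewrite ger0_norm ?subr_ge0 // lerBlDl ltW.
Qed.

(** All vectors with coordinates in (1 / icden) Z and numerators between -N and N; [boxK] selects
    from this finite list. *)
Definition box_cand (N : nat) : seq K :=
  [seq (\sum_i ((m i : nat)%:~R - N%:~R) / icden%:R *: ie i)%R | m : {ffun 'I_d -> 'I_(2 * N).+1}].

Definition boxK (X : R) : seq K :=
  undup (seq.filter (fun x => (x \in O) && (nrmK x <= X)) (box_cand (Num.truncn X))).

Lemma nrmK_ic x i : `|rR (icden%:R * ic x i)| <= nrmK x.
Proof.
rewrite rmorphM normrM /nrmK /nrm1 mulr_sumr (bigD1 i) //= ler_wpDr //.
  by apply: sumr_ge0 => j _; rewrite mulr_ge0.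
rewrite ler_wpM2r // rmorph_nat ger0_norm ?ler0n // ler_nat.
by rewrite leq_addr.
Qed.

Lemma boxKE X x : (x \in boxK X) = (x \in O) && (nrmK x <= X).
Proof.
rewrite mem_undup mem_filter andb_idr // => /andP [xO xX].
set N := Num.truncn X.
have /choice [z Hz] i : exists z : int, icden%:R * ic x i = z%:~R.
  by have /intrP [z] := icdenP i xO; exists z.
have X0 : 0 <= X by apply: le_trans xX; rewrite mulr_ge0 ?nrm1_ge0.
have zN i : (`|z i| <= N)%N.
  have h := le_trans (nrmK_ic x i) xX; rewrite Hz ratr_int -intr_norm -natr_absz in h.
  by rewrite /N truncn_ge_nat.
have zb i : (absz (z i + N%:Z)%R < (2 * N).+1)%N by have := zN i; lia.
apply/mapP; exists [ffun i => Ordinal (zb i)]; rewrite ?mem_enum //.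
rewrite {1}(icE x); apply: eq_bigr => i _; congr (_ *: _).
have -> : ic x i = (z i)%:~R / icden%:R.
  by rewrite -Hz mulrAC mulfV ?mul1r // pnatr_eq0 -lt0n icden_gt0.
rewrite ffunE /=; congr (_ / _); rewrite -rmorphB /=; congr (_%:~R).
by have := zN i; lia.
Qed.

Lemma boxK_ub X : 1 <= X -> (size (boxK X))%:R <= (3 ^ d)%:R * X ^+ d.
Proof.
move=> X1; have X0 : 0 <= X by rewrite (le_trans _ X1).
apply: le_trans (_ : ((2 * Num.truncn X).+1 ^ d)%:R <= _).
  rewrite ler_nat /boxK; apply: leq_trans (size_undup _) _.
  rewrite size_filter; apply: leq_trans (count_size _ _) _.
  by rewrite size_map -cardE card_ffun !card_ord.
rewrite !natrX -exprMn ler_pXn2r ?nnegrE ?mulr_ge0 ?d_gt0 //.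
have /andP [h _] := truncn_itv X0.
by rewrite -addn1 natrD natrM; lra.
Qed.

Lemma boxK_lb X : 1 <= X -> X ^+ d <= ((nrmc * d) ^ d)%:R * (size (boxK X))%:R.
Proof.
move=> X1; have X0 : 0 <= X by rewrite (le_trans _ X1).
have kd0 : 0 < (nrmc * d)%:R :> R by rewrite ltr0n muln_gt0 nrmc_gt0 d_gt0.
set M := Num.truncn (X / (nrmc * d)%:R).
have XM : 0 <= X / (nrmc * d)%:R by rewrite divr_ge0.
have /andP [M1 M2] := truncn_itv XM; rewrite -/M in M1 M2.
apply: le_trans (_ : ((nrmc * d)%:R * M.+1%:R) ^+ d <= _).
  by rewrite ler_pXn2r ?nnegrE ?mulr_ge0 ?d_gt0 //; rewrite ltW // -ltr_pdivrMl // mulrC.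
rewrite exprMn natrX; apply: ler_wpM2l; first by rewrite exprn_ge0 // ltW.
rewrite -natrX ler_nat.
pose g (m : {ffun 'I_d -> 'I_M.+1}) : K := \sum_i ((m i : nat)%:R : rat) *: ie i.
have -> : (M.+1 ^ d)%N = size [seq g m | m : {ffun 'I_d -> 'I_M.+1}].
  by rewrite size_map -cardE card_ffun !card_ord.
apply: uniq_leq_size.
  rewrite map_inj_uniq ?enum_uniq // => m m' E; apply/ffunP => i; apply/val_inj/eqP.
  by rewrite -(eqr_nat rat) -(icK (fun i => (m i : nat)%:R)) -/(g m) E icK.
move=> x /mapP [m _ ->]; rewrite boxKE; apply/andP; split.
  by apply: rpred_sum => i _; rewrite scaler_nat rpredMn ?ieO.
rewrite /nrmK /nrm1.
apply: le_trans (_ : nrmc%:R * \sum_(i < d) M%:R <= _).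
  rewrite ler_wpM2l //; apply: ler_sum => i _; rewrite icK ratr_nat ger0_norm ?ler0n //.
  by rewrite ler_nat -ltnS.
rewrite sumr_const card_ord -(mulr_natl M%:R) mulrA -natrM.
by rewrite -ler_pdivlMl // mulrC.
Qed.

Definition constK : R := (nrmc * d)%:R + (3 ^ d)%:R + ((nrmc * d) ^ d)%:R.

Lemma orderK : is_order O nrmK boxK d constK.
Proof.
have k0 : 0 < nrmc%:R :> R by rewrite ltr0n nrmc_gt0.
have c1 : (nrmc * d)%:R <= constK by rewrite /constK -addrA ler_wpDr ?addr_ge0.
have c2 : (3 ^ d)%:R <= constK by rewrite /constK -addrA addrCA ler_wpDr ?addr_ge0.
have c3 : ((nrmc * d) ^ d)%:R <= constK by rewrite /constK ler_wpDl ?addr_ge0.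
split.
- by apply: le_trans c2; rewrite ler1n expn_gt0.
- exact: d_gt0.
- move=> x y; rewrite /nrmK -mulrDr ler_wpM2l ?(ltW k0) // /nrm1 -big_split /=.
  by apply: ler_sum => i _; rewrite icD rmorphD ler_normD.
- by move=> x; rewrite /nrmK /nrm1; congr (_ * _); apply: eq_bigr => i _; rewrite icN rmorphN normrN.
- by move=> x y; rewrite /nrmK mulrACA -mulrA ler_wpM2l ?(ltW k0) // nrm1M.
- move=> k x; rewrite /nrmK mulrCA; congr (_ * _); rewrite /nrm1 mulr_sumr; apply: eq_bigr => i _.
  by rewrite mulr_natl -scaler_nat icZ rmorphM rmorph_nat normrM ger0_norm ?ler0n.
- move=> x xO x0; have [i ci] : exists i, ic x i != 0.
    apply/existsP; apply: contraNT x0 => /existsPn h; rewrite (icE x) big1 // => i _.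
    by have := h i; rewrite negbK => /eqP ->; rewrite scale0r.
  apply: le_trans (nrmK_ic x i).
  have /intrP [z Ez] := icdenP i xO.
  rewrite Ez ratr_int; apply: norm_intr_ge1; first exact: rpred_int.
  by rewrite intr_eq0 -(intr_eq0 rat) -Ez mulf_neq0 // pnatr_eq0 -lt0n icden_gt0.
- by move=> z; have [x xO h] := nrmK_round z; exists x => //; apply: le_trans h _; rewrite -natrM.
- by move=> X; rewrite undup_uniq.
- exact: boxKE.
- by move=> X X1; apply: le_trans (boxK_lb X1) _; rewrite ler_wpM2r.
- by move=> X X1; apply: le_trans (boxK_ub X1) _; rewrite ler_wpM2r ?exprn_ge0 ?(le_trans _ X1).
Qed.

Lemma cabs_le_nrmK : exists2 c : R, 0 < c &
  forall (s : K -> R[i]) x, embeddings s -> cabs (s x) <= c * nrmK x.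
Proof.
pose E := fset_set (@embeddings R K).
exists (1 + \sum_(s <- E) \sum_i cabs (s (ie i))).
  by rewrite ltr_wpDr // sumr_ge0 // => s _; rewrite sumr_ge0 // => i _; apply: cabs_ge0.
move=> s x sE; have [f Ef] := embedding_rmorph sE.
rewrite -Ef {1}(icE x) rmorph_sum; apply: le_trans (cabs_sum _ _ _) _.
rewrite /nrmK /nrm1 !mulr_sumr; apply: ler_sum => i _.
rewrite rmorph_ratr cabsM cabs_rat mulrCA mulrC.
rewrite -[X in X <= _]mul1r ler_pM ?mulr_ge0 ?cabs_ge0 //; first by rewrite ler1n nrmc_gt0.
rewrite ler_wpM2r //; apply: ler_wpDl => //.
have sin : s \in E by have [fE _] := embeddings_finite R K; rewrite in_fset_set // mem_set.
rewrite (big_rem s) //= ler_wpDr //.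
  by rewrite sumr_ge0 // => t _; rewrite sumr_ge0 // => j _; apply: cabs_ge0.
by rewrite (bigD1 i) //= Ef ler_wpDr // sumr_ge0 // => j _; apply: cabs_ge0.
Qed.

End NormK.

(** * Weil heights: upper bounds and Northcott's theorem *)

Section Heights.
Variables (R : realType) (K : fieldExtType rat).
Local Notation d := (\dim {:K}).
Local Notation O := (@intO K).
Local Notation rR := (ratr : rat -> R).
Local Notation nrm := (@nrmK R K).
Local Notation RO := (@ring_of_integers K).

Lemma intO_set x : RO x <-> x \in O.
Proof. by rewrite intOE; split=> [h|/asboolP]; first exact/asboolP. Qed.

Lemma coset_eq (B : set K) (x y : K) :
  (forall u v, B u -> B v -> B (u + v)) -> B (x - y) -> B (y - x) ->
  [set x + b | b in B] = [set y + b | b in B].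
Proof.
move=> BD h1 h2; apply/seteqP; split=> z [b Bb <-].
  by exists (x - y + b); [apply: BD | ring].
by exists (y - x + b); [apply: BD | ring].
Qed.

Lemma group_index_self (A : set K) : (exists x, A x) -> 
  (forall u v, A u -> A v -> A (u + v)) -> (forall u, A u -> A (- u)) -> group_index A A = 1%N.
Proof.
move=> [x0 Ax0] AD AN; rewrite /group_index.
have -> : [set [set a + b | b in A] | a in A] = [set [set x0 + b | b in A]].
  apply/seteqP; split=> [S [a Aa <-]|S ->] /=; last by exists x0.
  by apply: coset_eq => //; apply: AD => //; apply: AN.
by rewrite fset_set1 cardfs1.
Qed.

Section CoordIdeal.
Variable v : coords K.

Lemma coord_idealP i : coord_ideal v (v i).
Proof.
exists (fun j => (j == i)%:R); split=> [j|]; first by apply/intO_set; rewrite rpred_nat.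
by rewrite (bigD1 i) //= eqxx mul1r big1 ?addr0 // => j /negPf ->; rewrite mul0r.
Qed.

Lemma coord_idealD x y : coord_ideal v x -> coord_ideal v y -> coord_ideal v (x + y).
Proof.
move=> [r [rO ->]] [t [tO ->]]; exists (fun i => r i + t i); split.
  by move=> i; apply/intO_set; rewrite rpredD //; apply/intO_set.
by rewrite -big_split; apply: eq_bigr => i _; rewrite mulrDl.
Qed.

Lemma coord_idealM a x : a \in O -> coord_ideal v x -> coord_ideal v (a * x).
Proof.
move=> aO [r [rO ->]]; exists (fun i => a * r i); split.
  by move=> i; apply/intO_set; rewrite rpredM //; apply/intO_set.
by rewrite mulr_sumr; apply: eq_bigr => i _; rewrite mulrA.
Qed.

Lemma coord_idealN x : coord_ideal v x -> coord_ideal v (- x).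
Proof. by rewrite -mulN1r; apply: coord_idealM; rewrite rpredN1. Qed.

End CoordIdeal.

Lemma arch_factor_ge0 (s : K -> R[i]) (v : coords K) : 0 <= \big[Num.max/0]_(i < 4) cabs (s (v i)).
Proof. by elim/big_ind: _ => // [x y x0 y0|i _]; [rewrite le_max x0 | apply: cabs_ge0]. Qed.

Lemma arch_factor_ge (s : K -> R[i]) (v : coords K) i : cabs (s (v i)) <= \big[Num.max/0]_(i < 4) cabs (s (v i)).
Proof. by rewrite (bigD1 i) //= le_max lexx. Qed.

Lemma arch_partE (v : coords K) : arch_part R v =
  \prod_(s <- fset_set (@embeddings R K)) \big[Num.max/0]_(i < 4) cabs (s (v i)).
Proof. by rewrite /arch_part fsbig_finite //; case: (embeddings_finite R K). Qed.

(** For integral coordinates the ideal lies in O, so its norm is an index, a natural number, and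
    dividing by it does not increase the archimedean part. *)
Lemma heightK_le (v : coords K) : (forall i, v i \in O) -> heightK R v <= arch_part R v.
Proof.
move=> vO; rewrite /heightK /ideal_norm.
have sub : coord_ideal v `<=` RO.
  move=> x [r [rO ->]]; apply/intO_set; apply: rpred_sum => i _.
  by apply: rpredM; [apply/intO_set/rO|apply: vO].
have -> : coord_ideal v `&` RO = coord_ideal v by apply/setIidPl.
rewrite [group_index (coord_ideal v) _]group_index_self ?divr1.
- have A0 : 0 <= arch_part R v by rewrite arch_partE prodr_ge0 // => s _; apply: arch_factor_ge0.
  (* An index recorded as 0 (the value for infinite sets) makes the height 0, since the inverse of 0
     is 0; the bound still holds. *)
  case: (group_index _ _) => [|q]; first by rewrite invr0 mulr0.
  by rewrite ler_pdivrMr ?ltr0n // ler_peMr // ler1n.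
- by exists (v ord0); apply: coord_idealP.
- exact: coord_idealD.
- exact: coord_idealN.
Qed.

Lemma height_upper : exists2 c : R, 1 <= c & forall (v : coords K) X, 1 <= X ->
  (forall i, v i \in O /\ nrm (v i) <= X) -> heightK R v <= (c * X) ^+ d.
Proof.
have [c c0 Hc] := cabs_le_nrmK R K; exists (1 + c); first by rewrite lerDl ltW.
move=> v X X1 Hv; apply: le_trans (heightK_le _) _; first by move=> i; case: (Hv i).
rewrite arch_partE; have [fE cE] := embeddings_finite R K.
have cX : 1 <= (1 + c) * X by rewrite mulr_ege1 // lerDl ltW.
apply: le_trans (_ : \prod_(s <- fset_set (@embeddings R K)) ((1 + c) * X) <= _).
  rewrite big_seq [leRHS]big_seq; apply: ler_prod => s.
  rewrite in_fset_set // => /set_mem sE.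
  rewrite arch_factor_ge0 /=; elim/big_ind: _ => [|x y hx hy|i _].
  - by rewrite (le_trans _ cX).
  - by rewrite ge_max hx hy.
  - apply: le_trans (Hc s (v i) sE) _; apply: ler_pM; rewrite ?lerDr ?(ltW c0) //.
      exact: (nrm_ge0 (orderK R K)).
    by case: (Hv i).
rewrite big_const_seq iter_mulr_1 count_predT; apply: ler_weXn2l => //.
Qed.

(** The coordinates of x are recovered from the traces tr (x e_j) by the adjugate of the Gram
    matrix, and traces are bounded by the embeddings. *)
Lemma nrmK_of_cabs : exists2 c : R, 0 <= c & forall (x : K) B, 0 <= B ->
  (forall s : K -> R[i], embeddings s -> cabs (s x) <= B) -> nrm x <= c * B.
Proof.
have [c c0 Hc] := cabs_le_nrmK R K.
have n0 x : 0 <= nrm x by apply: (nrm_ge0 (orderK R K)).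
pose m := `|rR (\det (gram K))|^-1.
pose w (i j : 'I_d) : R := m * (`|rR ((\adj (gram K)) j i)| * (d%:R * (c * nrm (ie j)))).
have w0 i j : 0 <= w i j by rewrite /w /m mulr_ge0 ?invr_ge0 // mulr_ge0 // mulr_ge0 // mulr_ge0 // ltW.
exists ((nrmc R K)%:R * \sum_i \sum_j w i j).
  by rewrite mulr_ge0 // sumr_ge0 // => i _; rewrite sumr_ge0.
move=> x B B0 H; rewrite /nrmK /nrm1 -mulrA ler_wpM2l //.
rewrite mulr_suml; apply: ler_sum => i _.
have E : ic x i = (\det (gram K))^-1 * \sum_j \tr (mulK (x * ie j)) * (\adj (gram K)) j i.
  have : (\row_i ic x i) *m gram K *m \adj (gram K) = \det (gram K) *: (\row_i ic x i).
    by rewrite -mulmxA mul_mx_adj mul_mx_scalar.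
  move/rowP/(_ i); rewrite !mxE => E; rewrite -[LHS](mulKf (gram_det K)) -E.
  congr (_ * _); apply: eq_bigr => j _; congr (_ * _).
  by rewrite mxE -gramE; apply: eq_bigr => k _; rewrite mxE.
rewrite E rmorphM normrM fmorphV normfV -/m /w.
under [X in _ <= X * _]eq_bigr do [].
rewrite mulr_suml rmorph_sum.
apply: le_trans (_ : m * \sum_j `|rR ((\adj (gram K)) j i)| * (d%:R * (c * nrm (ie j))) * B <= _); last first.
  by rewrite mulr_sumr; apply: ler_sum => j _; rewrite !mulrA.
apply: ler_wpM2l; first by rewrite invr_ge0.
apply: le_trans (ler_norm_sum _ _ _) _; apply: ler_sum => j _.
rewrite rmorphM normrM mulrC -mulrA ler_wpM2l //.
apply: le_trans (trace_bound (B := B * (c * nrm (ie j))) _) _.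
  move=> s sE; have [_ [_ ->]] := sE; rewrite cabsM ler_pM ?cabs_ge0 //; first exact: H.
  exact: Hc.
by rewrite [leRHS]mulrAC -!mulrA.
Qed.

Section Normalised.
Variables (v : coords K) (i0 : 'I_4).
Hypothesis vi0 : v i0 = 1.

Lemma ideal_sup x : x \in O -> coord_ideal v x.
Proof. by move=> xO; rewrite -[x]mulr1 -vi0; apply: coord_idealM => //; apply: coord_idealP. Qed.

Definition coset_set := [set [set a + b | b in RO] | a in coord_ideal v].

(** The ideal lies in M^-1 O for a natural number M. Finiteness has to be known because the cardinal
    of an infinite set would be recorded as 0. *)
Lemma coset_set_finite : finite_set coset_set.
Proof.
have /choice [N HN] (i : 'I_4) : exists N : int, N != 0 /\ N%:~R *: v i \in O.
  by have [N] := integral_multiple (v i); exists N.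
pose M := (\prod_i absz (N i))%N.
have M0 : (0 < M)%N by apply: prodn_gt0 => i; rewrite absz_gt0; case: (HN i).
have MO i : M%:R * v i \in O.
  rewrite /M (bigD1 i) //= natrM mulrAC mulrC rpredM ?rpred_nat //.
  have [_] := HN i; rewrite scaler_int => h.
  have [E|E] : N i = absz (N i) :> int \/ N i = - (absz (N i) : int) by lia.
    by rewrite mulr_natl pmulrn -E.
  by rewrite mulr_natl -rpredN pmulrn -mulrNz -E.
have aO u : coord_ideal v u -> M%:R * u \in O.
  move=> [r [rO ->]]; rewrite mulr_sumr; apply: rpred_sum => i _.
  by rewrite mulrCA; apply: rpredM; [apply/intO_set/rO|apply: MO].
set D := icden R K; have D0 : (0 < D)%N := icden_gt0 R K.
have DM0 : (0 < D * M)%N by rewrite muln_gt0 D0.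
have DMq : (D * M)%:R != 0 :> rat by rewrite pnatr_eq0 -lt0n.
have cint u i : coord_ideal v u -> (D * M)%:R * ic u i \is a Num.int.
  move=> /aO h; have := icdenP R i h; rewrite -/D.
  by rewrite [M%:R * u]mulr_natl -scaler_nat icZ natrM mulrA.
have /choice [z Hz] (ui : K * 'I_d) : exists z : int, coord_ideal v ui.1 -> (D * M)%:R * ic ui.1 ui.2 = z%:~R.
  case: ui => u i /=; have [h|h] := pselect (coord_ideal v u); last by exists 0.
  by have /intrP [z ->] := cint u i h; exists z.
have zlt ui : (absz (z ui %% (D * M)%:Z)%Z < (D * M - 1).+1)%N.
  have : (0 <= (z ui %% (D * M)%:Z)%Z < (D * M)%:Z) by rewrite modz_ge0 ?ltz_pmod //; lia.
  by lia.
(* A coset is determined by the coordinates of D M u modulo D M: if they agree, the difference has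
   integral coordinates in the basis [ie]. *)
pose f u : {ffun 'I_d -> 'I_(D * M - 1).+1} := [ffun i => Ordinal (zlt (u, i))].
pose rep S : K := if pselect (exists a, coord_ideal v a /\ [set a + b | b in RO] = S) is left h then sval (cid h) else 0.
have repP S : coset_set S -> coord_ideal v (rep S) /\ [set rep S + b | b in RO] = S.
  by move=> [a Aa E]; rewrite /rep; case: pselect => [h|[]]; [case: (cid h)|exists a].
have [] // := @finite_of_inj_seq _ _ coset_set (f \o rep) (enum {: {ffun 'I_d -> 'I_(D * M - 1).+1}}).
  by move=> S _; rewrite mem_enum.
move=> S T /repP [aS ES] /repP [aT ET] /= E; rewrite -ES -ET.
set x := rep S in aS E *; set y := rep T in aT E *.
suff h : x - y \in O.
  apply: coset_eq; [|exact/intO_set|by apply/intO_set; rewrite -opprB rpredN].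
  by move=> u w /intO_set uO /intO_set wO; apply/intO_set; rewrite rpredD.
rewrite (icE (x - y)); apply: rpred_sum => i _.
have /dvdzP [q Eq] : ((D * M)%:Z %| z (x, i) - z (y, i))%Z.
  rewrite -eqz_mod_dvd; apply/eqP.
  move/ffunP/(_ i): E; rewrite !ffunE => /(congr1 val) /= E.
  have := modz_ge0 (z (x, i)) (d := (D * M)%:Z); have := modz_ge0 (z (y, i)) (d := (D * M)%:Z).
  by lia.
have -> : ic (x - y) i = q%:~R.
  apply: (mulfI DMq); rewrite icB mulrBr (Hz (x, i)) // (Hz (y, i)) // -rmorphB Eq rmorphM /=.
  by rewrite mulrC.
by rewrite scaler_int rpredMz ?ieO.
Qed.

Definition kidx : nat := #|` fset_set coset_set|.

Lemma kidx_gt0 : (0 < kidx)%N.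
Proof.
rewrite /kidx cardfs_gt0; apply/fset0Pn; exists [set v ord0 + b | b in RO].
by rewrite in_fset_set ?mem_set //; [exists (v ord0) => //; apply: coord_idealP | apply: coset_set_finite].
Qed.

(** A coordinate equal to 1 puts O inside the ideal, so only the denominator of [ideal_norm] differs
    from 1. *)
Lemma heightK_norm : heightK R v = arch_part R v * kidx%:R.
Proof.
rewrite /heightK /ideal_norm.
have -> : coord_ideal v `&` RO = RO.
  by apply/setIidPr => x /intO_set; apply: ideal_sup.
rewrite group_index_self; first by rewrite div1r invrK.
- by exists 1; apply/intO_set; rewrite rpred1.
- by move=> x y /intO_set xO /intO_set yO; apply/intO_set; rewrite rpredD.
- by move=> x /intO_set xO; apply/intO_set; rewrite rpredN.
Qed.

Lemma arch_factor_ge1 (s : K -> R[i]) : embeddings s -> 1 <= \big[Num.max/0]_(i < 4) cabs (s (v i)).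
Proof.
move=> sE; apply: le_trans (arch_factor_ge s v i0).
by rewrite vi0; case: sE => -> _; rewrite /cabs /= expr1n expr0n addr0 sqrtr1.
Qed.

Lemma arch_ge1 : 1 <= arch_part R v.
Proof.
rewrite arch_partE big_seq; have [fE _] := embeddings_finite R K.
elim/big_ind: _ => // [x y x1 y1|s]; first by rewrite mulr_ege1.
by rewrite in_fset_set // => /set_mem; apply: arch_factor_ge1.
Qed.

Lemma heightK_ge1 : 1 <= heightK R v.
Proof. by rewrite heightK_norm mulr_ege1 ?arch_ge1 // ler1n kidx_gt0. Qed.

Lemma arch_le_height : arch_part R v <= heightK R v.
Proof. by rewrite heightK_norm ler_peMr ?ler1n ?kidx_gt0 // (le_trans _ arch_ge1). Qed.

Lemma kidx_le_height : kidx%:R <= heightK R v.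
Proof. by rewrite heightK_norm ler_peMl ?arch_ge1. Qed.

Lemma coord_le_height (s : K -> R[i]) i : embeddings s -> cabs (s (v i)) <= heightK R v.
Proof.
move=> sE; apply: le_trans (arch_factor_ge s v i) _; apply: le_trans arch_le_height.
have [fE _] := embeddings_finite R K.
have sin : s \in fset_set (@embeddings R K) by rewrite in_fset_set ?mem_set.
rewrite arch_partE (big_rem s) //= ler_peMr ?arch_factor_ge0 //.
rewrite big_seq; elim/big_ind: _ => // [x y x1 y1|t /mem_rem]; first by rewrite mulr_ege1.
by rewrite in_fset_set // => /set_mem; apply: arch_factor_ge1.
Qed.

(** The multiples n v_i for n = 0, ..., kidx outnumber the cosets of O in the ideal. *)
Lemma kidx_multiple i : exists n, [/\ (0 < n)%N, (n <= kidx)%N & n%:R * v i \in O].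
Proof.
pose f (n : nat) := [set n%:R * v i + b | b in RO].
have [||x [y [xs ys xy E]]] := @pigeonhole _ _ f (iota 0 kidx.+1) (fset_set coset_set) (iota_uniq _ _).
- move=> n _; rewrite in_fset_set ?mem_set //; last exact: coset_set_finite.
  by exists (n%:R * v i) => //; apply: coord_idealM (coord_idealP _ _); rewrite rpred_nat.
- by rewrite size_iota.
wlog lt : x y xs ys xy E / (x < y)%N.
  move=> H; have [l|l|e] := ltngtP x y; first exact: (H x y).
    by apply: (H y x) => //; rewrite eq_sym.
  by rewrite e eqxx in xy.
exists (y - x)%N; rewrite subn_gt0 lt; split=> //.
  by move: ys; rewrite mem_iota; lia.
have : f x (y%:R * v i + 0) by rewrite E; exists 0 => //; apply/intO_set; rewrite rpred0.
move=> [b /intO_set bO Eb]; rewrite natrB ?(ltnW lt) // mulrBl.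
by have -> : y%:R * v i - x%:R * v i = b by rewrite addr0 in Eb; rewrite -Eb; ring.
Qed.

End Normalised.

(** The index bounds the denominators: the factorial of the integer part of B clears all of them.
    The embeddings are bounded by the height, so the cleared coordinates lie in a fixed box. *)
Lemma normalised_finite (B : R) :
  finite_set [set v : coords K | (exists i0, v i0 = 1) /\ heightK R v <= B].
Proof.
have [c c0 Hc] := nrmK_of_cabs.
pose M := (Num.truncn B)`!.
have M0 : (0 < M)%N by apply: fact_gt0.
pose L := [seq x / M%:R | x <- boxK K (c * (M%:R * B))].
pose f (v : coords K) : {ffun 'I_4 -> K} := finfun v.
pose r := [seq [ffun i => nth 0 L (m i)] | m : {ffun 'I_4 -> 'I_(size L)}].
have [] // := @finite_of_inj_seq _ _ [set v : coords K | (exists i0, v i0 = 1) /\ heightK R v <= B] f r.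
- move=> v [[i0 vi0] vB].
  have B1 : 1 <= B by apply: le_trans vB; apply: heightK_ge1 vi0.
  have B0 : 0 <= B by apply: le_trans B1.
  have vL i : v i \in L.
    have [n [n0 nk nO]] := kidx_multiple v i.
    have nM : (n %| M)%N.
      apply: dvdn_fact; rewrite n0 /= truncn_ge_nat //.
      apply: le_trans vB; apply: le_trans (kidx_le_height vi0); rewrite ler_nat //.
    apply/mapP; exists (M%:R * v i); last first.
      by rewrite mulrAC mulfV ?mul1r //; apply: (natF_neq0 (orderK R K)).
    rewrite boxKE; apply/andP; split.
      by have /dvdnP [q ->] := nM; rewrite natrM -mulrA rpredM ?rpred_nat.
    apply: Hc => [|s sE]; first by rewrite mulr_ge0.
    have [f' Ef] := embedding_rmorph sE.
    rewrite -Ef rmorphM rmorph_nat cabsM -(ratr_nat R[i]) cabs_rat ratr_nat ger0_norm //.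
    by rewrite ler_wpM2l // Ef; apply: le_trans vB; apply: (coord_le_height vi0).
  have iL i : (index (v i) L < size L)%N by rewrite index_mem; apply: vL.
  apply/mapP; exists [ffun i => Ordinal (iL i)]; rewrite ?mem_enum //.
  apply/ffunP => i; rewrite [LHS]ffunE [RHS]ffunE ffunE /= nth_index //; exact: vL.
- by move=> v w _ _ /ffunP E; apply/funext => i; have := E i; rewrite !ffunE.
Qed.

Definition pclass (y : rep K) := [set z | proj_equiv y z].

Lemma pclass_eq (y z : rep K) : proj_equiv y z -> pclass y = pclass z.
Proof.
move=> [l [m [l0 [m0 [E1 E2]]]]]; apply/seteqP; split=> w [l' [m' [l'0 [m'0 [F1 F2]]]]].
  exists (l' / l), (m' / m); rewrite !mulf_neq0 ?invr_eq0 //; split=> //; split=> //.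
  by rewrite F1 F2 E1 E2; split; apply/funext => i; rewrite mulrA divfK.
exists (l' * l), (m' * m); rewrite !mulf_neq0 //; split=> //; split=> //.
by rewrite F1 F2 E1 E2; split; apply/funext => i; rewrite mulrA.
Qed.

(** Needed for a lower bound as well: [N_UH] would be 0 for an infinite set. Both factors are
    normalised to have a coordinate 1, where each height is at least 1 and thus bounded by the
    product. *)
Lemma northcott (H : rep K -> R) (B : R) : anticanonical_height H ->
  finite_set [set pclass y | y in [set y | on_Y y /\ H y <= B]].
Proof.
move=> [Hinv [C [C0 HC]]].
pose N := [set v : coords K | (exists i0, v i0 = 1) /\ heightK R v <= C * B].
have fN : finite_set N := normalised_finite _.
apply: (@sub_finite_set _ _ (pclass @` (N `*` N))); last first.
  by apply: finite_image; apply: finite_setX.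
move=> S [y [yY yB] <-].
have [[i yi] [[j yj] _]] := yY.
pose z : rep K := ((fun k => (y.1 i)^-1 * y.1 k), (fun k => (y.2 j)^-1 * y.2 k)).
have yz : proj_equiv y z by exists (y.1 i)^-1, (y.2 j)^-1; rewrite !invr_eq0.
have zY : on_Y z.
  split; first by exists i; rewrite /= mulVf ?oner_neq0.
  split; first by exists j; rewrite /= mulVf ?oner_neq0.
  have [_ [_ E]] := yY; transitivity ((y.1 i)^-1 * (y.2 j)^-1 ^+ 3 * \sum_(k < 4) y.1 k * y.2 k ^+ 3).
    by rewrite mulr_sumr; apply: eq_bigr => k _ /=; ring.
  by rewrite E mulr0.
have hz : std_anticanonical_height R z <= C * B.
  have [h _] := HC z zY; apply: le_trans h _; rewrite ler_wpM2l ?(ltW C0) //.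
  by rewrite (Hinv y z).
have z1 : z.1 i = 1 by rewrite /= mulVf.
have z2 : z.2 j = 1 by rewrite /= mulVf.
have h1 := heightK_ge1 z1; have h2 := heightK_ge1 z2.
exists z; last by rewrite (pclass_eq yz).
split; split.
- by exists i.
- apply: le_trans hz; rewrite /std_anticanonical_height; apply: le_trans (_ : heightK R z.1 ^+ 3 <= _).
    by rewrite -[leLHS]expr1 ler_weXn2l.
  by rewrite ler_peMr // exprn_ge0 // (le_trans _ h1).
- by exists j.
- by apply: le_trans hz; rewrite ler_peMl ?exprn_ege1 // (le_trans _ h2).
Qed.

End Heights.

Local Close Scope classical_set_scope.

(** * Product families and Schwartz-Zippel *)

Section TupleLists.
Variable T : eqType.
Implicit Types (fs : seq (seq T)) (t : seq T).

Definition tup fs : seq (seq T) := foldr (fun s acc => [seq x :: t | x <- s, t <- acc]) [:: [::]] fs.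

Lemma tup_size fs : size (tup fs) = (\prod_(s <- fs) size s)%N.
Proof. by elim: fs => [|s fs IH]; rewrite ?big_nil // big_cons size_allpairs IH. Qed.

Lemma tup_uniq fs : all uniq fs -> uniq (tup fs).
Proof.
elim: fs => //= s fs IH /andP [us /IH ufs]; apply: allpairs_uniq => //.
by move=> [x t] [y t'] _ _ /= [-> ->].
Qed.

Lemma tupP x0 fs t : reflect (size t = size fs /\ forall j, (j < size fs)%N -> nth x0 t j \in nth [::] fs j)
  (t \in tup fs).
Proof.
apply: (iffP idP); elim: fs t => [|s fs IH] t /=.
- by rewrite inE => /eqP ->.
- by case/allpairsP => -[x u] /= [xs /IH [su h] ->]; split=> [|[|j]] //=; rewrite ?su //; apply: h.
- by case: t => [|? ?] [].
- case: t => [|x t] [] // [st] h; apply/allpairsP; exists (x, t); split=> //; first exact: (h 0).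
  by apply: IH; split=> // j js; apply: (h j.+1).
Qed.

Lemma count_allpairs_cons (P : pred (seq T)) (s : seq T) (acc : seq (seq T)) :
  count P [seq x :: t | x <- s, t <- acc] = (\sum_(x <- s) count (fun t => P (x :: t)) acc)%N.
Proof.
elim: s => [|x s IH]; first by rewrite big_nil.
by rewrite big_cons allpairs_cons count_cat IH count_map.
Qed.

Variables (R : realType) (x0 : T).

(** The proportion of a condition on one coordinate is unchanged in the product; written without
    division so that empty factors are allowed. *)
Lemma tup_count1E (P : pred T) fs j : (j < size fs)%N ->
  (count (fun t => P (nth x0 t j)) (tup fs) * size (nth [::] fs j) =
   count P (nth [::] fs j) * size (tup fs))%N.
Proof.
elim: fs j => [|s fs IH] [|j] //= js; rewrite count_allpairs_cons size_allpairs /=.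
  rewrite (_ : (\sum_(x <- s) _)%N = (count P s * size (tup fs))%N); first by rewrite mulnA mulnAC.
  elim: s => [|x s IHs]; first by rewrite big_nil.
  rewrite big_cons IHs /= mulnDl; congr (_ + _)%N.
  by case: (P x) => /=; rewrite ?count_predT ?count_pred0 ?mul1n.
rewrite big_const_seq count_predT iter_addn_0 mulnAC IH //.
by rewrite mulnAC mulnA.
Qed.

Lemma tup_count1 (P : pred T) fs j (e : R) : (j < size fs)%N -> 0 <= e ->
  (count P (nth [::] fs j))%:R <= e * (size (nth [::] fs j))%:R ->
  (count (fun t => P (nth x0 t j)) (tup fs))%:R <= e * (size (tup fs))%:R.
Proof.
move=> js e0 H; have E := tup_count1E P js.
have [z|z] := posnP (size (nth [::] fs j)).
  have -> : tup fs = [::].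
    by apply/nilP; rewrite /nilp tup_size (big_nth [::]) big_mkord (bigD1 (Ordinal js)) //= z.
  by rewrite mulr0.
have z' : 0 < (size (nth [::] fs j))%:R :> R by rewrite ltr0n.
rewrite -(ler_pM2r z') -natrM E natrM mulrAC ler_wpM2r //.
Qed.

Lemma tup_count2 (P : T -> T -> bool) fs j k (e : R) : (j < k)%N -> (k < size fs)%N -> 0 <= e ->
  (\sum_(x <- nth [::] fs j) count (P x) (nth [::] fs k))%:R <=
     e * ((size (nth [::] fs j))%:R * (size (nth [::] fs k))%:R) ->
  (count (fun t => P (nth x0 t j) (nth x0 t k)) (tup fs))%:R <= e * (size (tup fs))%:R.
Proof.
move=> + + e0; elim: fs j k => [|s fs IH] [|j] [|k] //=; rewrite ?ltnS => jk ks H; last first.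
  rewrite count_allpairs_cons size_allpairs /= big_const_seq count_predT iter_addn_0 !natrM.
  by rewrite mulrC mulrCA ler_wpM2l // IH.
rewrite count_allpairs_cons size_allpairs /=.
have [z|z] := posnP (size (nth [::] fs k)).
  have -> : tup fs = [::].
    by apply/nilP; rewrite /nilp tup_size (big_nth [::]) big_mkord (bigD1 (Ordinal ks)) //= z.
  by rewrite big1_seq // muln0 mulr0.
have z' : 0 < (size (nth [::] fs k))%:R :> R by rewrite ltr0n.
rewrite -(ler_pM2r z') -natrM big_distrl /=.
rewrite (eq_bigr (fun x => (count (P x) (nth [::] fs k) * size (tup fs))%N)); last first.
  by move=> x _; rewrite -tup_count1E.
rewrite -big_distrl /= !natrM; apply: le_trans (ler_wpM2r _ H) _ => //.
by rewrite le_eqVlt; apply/predU1P; left; ring.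
Qed.

Lemma count_markov (U : eqType) (w : U -> nat) (s : seq U) (M e : R) : 0 < M ->
  (\sum_(x <- s) w x)%:R <= e * M * (size s)%:R ->
  (count (fun x => M < (w x)%:R)%R s)%:R <= e * (size s)%:R.
Proof.
move=> M0 H; rewrite -(ler_pM2r M0) [leRHS]mulrAC; apply: le_trans H.
rewrite -sum1_count !natr_sum mulr_suml big_mkcond /=; apply: ler_sum => x _.
by case: ltP => [/ltW h|_]; [rewrite mul1r | exact: ler0n].
Qed.

Lemma count_union (U : eqType) (I : eqType) (P : I -> pred U) (r : seq I) (s : seq U) (e : R) :
  (forall i, i \in r -> (count (P i) s)%:R <= e * (size s)%:R) ->
  (count (fun x => has (P^~ x) r) s)%:R <= (size r)%:R * e * (size s)%:R.
Proof.
move=> H; apply: le_trans (_ : (\sum_(i <- r) count (P i) s)%:R <= _).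
  by rewrite ler_nat count_has_le.
rewrite natr_sum big_seq; apply: le_trans (ler_sum _ H) _.
by rewrite -big_seq big_const_seq count_predT iter_addr_0 -[X in X <= _]mulr_natl mulrA.
Qed.

End TupleLists.

(** * Functions polynomial along lines, and a Schwartz-Zippel bound *)

Section SchwartzZippel.
Variable F : fieldType.

Lemma count_roots (p : {poly F}) (D : nat) (s : seq F) : uniq s -> p != 0 -> (size p <= D.+1)%N ->
  (count (root p) s <= D)%N.
Proof.
move=> us p0 pD; rewrite -size_filter -ltnS; apply: leq_trans pD.
by apply: max_poly_roots; rewrite ?filter_all ?filter_uniq.
Qed.

(** Bounded degree on every line is all that the zero count needs, and it is stable under the
    operations that build the relevant functions, without multivariate polynomials. *)
Definition lines_poly (V : lmodType F) (D : nat) (f : V -> F) :=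
  forall u w, exists2 p : {poly F}, (size p <= D.+1)%N & forall t, f (u + t *: w) = p.[t].

Lemma count_line (V : lmodType F) D (f : V -> F) (u w : V) (s : seq F) t0 : uniq s -> lines_poly D f ->
  f (u + t0 *: w) != 0 -> (count (fun t : F => f (u + t *: w)%R == 0%R) s <= D)%N.
Proof.
move=> us H; have [p pD E] := H u w; rewrite E => pt.
rewrite (eq_count (a2 := root p)); last by move=> t; rewrite E.
by apply: count_roots => //; apply: contraNneq pt => ->; rewrite horner0.
Qed.

Definition comb (V : lmodType F) (ws : seq V) (t : seq F) : V := \sum_(p <- zip t ws) p.1 *: p.2.

(** The sum, over the factors, of the product of the sizes of all the other factors. *)
Fixpoint zero_bound (fs : seq (seq F)) : nat :=
  if fs is s :: fs' then (\prod_(u <- fs') size u + size s * zero_bound fs')%N else 0%N.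

(** Induction on the factors, moving along one direction at a time. The nonzero value at [t0] leaves
    at most D bad first coordinates; for these everything is counted, and for the others the
    induction applies at the same remaining [t0]. *)
Lemma schwartz_zippel (V : lmodType F) D (f : V -> F) (ws : seq V) (fs : seq (seq F)) (u : V) (t0 : seq F) :
  lines_poly D f -> all uniq fs -> size ws = size fs -> size t0 = size fs -> f (u + comb ws t0) != 0 ->
  (count (fun t => f (u + comb ws t)%R == 0%R) (tup fs) <= D * zero_bound fs)%N.
Proof.
move=> H; elim: fs ws t0 u => [|s fs IH] [|w ws] [|x0 t0] //= u.
  by move=> _ _ _ h; rewrite (negPf h).
move=> /andP [us ufs] [sw] [st] h.
have cE x t v : v + comb (w :: ws) (x :: t) = (v + x *: w) + comb ws t.
  by rewrite /comb /= big_cons addrA.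
rewrite count_allpairs_cons.
pose Z (x : F) := f ((u + x *: w) + comb ws t0) == 0.
have hZ : (count Z s <= D)%N.
  rewrite (eq_count (a2 := fun x : F => f ((u + comb ws t0) + x *: w)%R == 0%R)); last first.
    by move=> x; rewrite /Z addrAC.
  by apply: (count_line (t0 := x0)) => //; rewrite addrAC -cE.
apply: (@leq_trans (\sum_(x <- s) (Z x * \prod_(v <- fs) size v + D * zero_bound fs))%N).
  apply: leq_sum => x _; rewrite (eq_count (a2 := fun t => f ((u + x *: w) + comb ws t)%R == 0%R)); last first.
    by move=> t; rewrite cE.
  have [zx|zx] := boolP (Z x).
    by rewrite mul1n; apply: leq_trans (count_size _ _) _; rewrite tup_size leq_addr.
  by rewrite mul0n add0n; apply: (IH ws t0).
rewrite big_split /= -big_distrl /= big_const_seq count_predT iter_addn_0.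
have -> : (\sum_(x <- s) Z x)%N = count Z s.
  by elim: (s) => [|x r IHr]; rewrite ?big_nil // big_cons IHr.
by rewrite mulnDr leq_add ?leq_mul2r ?hZ ?orbT // mulnCA mulnC mulnA.
Qed.

(** Coordinates are replaced one at a time: on each line at most D naturals are zeros, so one among
    0, ..., D is not. *)
Lemma nonzero_at_nat (V : lmodType F) (f : V -> F) (D : nat) (ws : seq V) (u : V) (t0 : seq F) :
  (forall k, (0 < k)%N -> k%:R != 0 :> F) -> lines_poly D f -> size t0 = size ws -> f (u + comb ws t0) != 0 ->
  exists2 ms : seq nat, size ms = size ws & f (u + comb ws [seq m%:R | m <- ms]) != 0.
Proof.
move=> ch H; elim: ws t0 u => [|w ws IH] [|x0 t0] //= u.
  by move=> _ h; exists [::].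
move=> [st].
have cE x t v : v + comb (w :: ws) (x :: t) = (v + x *: w) + comb ws t.
  by rewrite /comb /= big_cons addrA.
rewrite cE addrAC => h.
have inj : injective (fun m : nat => m%:R : F).
  move=> a b; wlog ab : a b / (a <= b)%N.
    by move=> W; have [l|l] := leqP a b; [exact: W | move/esym => E; apply/esym/W => //; apply: ltnW].
  move=> /esym/eqP; rewrite -subr_eq0 -natrB // => /eqP z; apply/eqP; rewrite eqn_leq ab /= -subn_eq0.
  by apply: contraT; rewrite -lt0n => /ch; rewrite z eqxx.
have us : uniq [seq (m%:R : F) | m <- iota 0 D.+1] by rewrite (map_inj_uniq inj) iota_uniq.
have := count_line us H h; rewrite count_map => le.
have /hasP [m _ hm] : has (fun m : nat => f ((u + comb ws t0) + m%:R *: w)%R != 0%R) (iota 0 D.+1).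
  rewrite has_predC all_count size_iota; apply: contraL le => /eqP E.
  by rewrite -ltnNge; apply: (eq_leq (esym E)).
have [|ms sm hm'] := IH t0 (u + m%:R *: w) st; first by rewrite addrAC.
by exists (m :: ms); rewrite /= ?sm // cE.
Qed.

Definition polyfun (V : lmodType F) (f : V -> F) := exists D, lines_poly D f.

Section PolyFun.
Variable V : lmodType F.
Implicit Types f g : V -> F.

Lemma polyfun_ext f g : f =1 g -> polyfun f -> polyfun g.
Proof. by move=> e [D H]; exists D => u w; have [p pD E] := H u w; exists p => // t; rewrite -e. Qed.

Lemma polyfunC c : polyfun (fun _ : V => c).
Proof. by exists 0 => u w; exists c%:P => [|t]; rewrite ?size_polyC_leq1 ?hornerC. Qed.

Lemma polyfunD f g : polyfun f -> polyfun g -> polyfun (fun v => f v + g v).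
Proof.
move=> [D H] [D' H']; exists (maxn D D') => u w.
have [p pD E] := H u w; have [q qD E'] := H' u w; exists (p + q) => [|t]; last by rewrite hornerD E E'.
by apply: leq_trans (size_polyD _ _) _; rewrite geq_max; apply/andP; split; lia.
Qed.

Lemma polyfunM f g : polyfun f -> polyfun g -> polyfun (fun v => f v * g v).
Proof.
move=> [D H] [D' H']; exists (D + D')%N => u w.
have [p pD E] := H u w; have [q qD E'] := H' u w; exists (p * q) => [|t]; last by rewrite hornerM E E'.
by apply: leq_trans (size_polyMleq _ _) _; lia.
Qed.

Lemma polyfunX f k : polyfun f -> polyfun (fun v => f v ^+ k).
Proof.
move=> h; elim: k => [|k IH]; first exact: polyfunC.
by apply: polyfun_ext (polyfunM h IH) => v; rewrite exprS.
Qed.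

Lemma polyfun_sum (I : Type) (r : seq I) (P : pred I) (f : I -> V -> F) :
  (forall i, polyfun (f i)) -> polyfun (fun v => \sum_(i <- r | P i) f i v).
Proof.
move=> h; elim: r => [|i r IH].
  by apply: polyfun_ext (polyfunC 0) => v; rewrite big_nil.
case Pi : (P i).
  by apply: polyfun_ext (polyfunD (h i) IH) => v; rewrite big_cons Pi.
by apply: polyfun_ext IH => v; rewrite big_cons Pi.
Qed.

Lemma polyfun_prod (I : Type) (r : seq I) (P : pred I) (f : I -> V -> F) :
  (forall i, polyfun (f i)) -> polyfun (fun v => \prod_(i <- r | P i) f i v).
Proof.
move=> h; elim: r => [|i r IH].
  by apply: polyfun_ext (polyfunC 1) => v; rewrite big_nil.
case Pi : (P i).
  by apply: polyfun_ext (polyfunM (h i) IH) => v; rewrite big_cons Pi.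
by apply: polyfun_ext IH => v; rewrite big_cons Pi.
Qed.

Lemma polyfun_linear (f : {linear V -> F^o}) : polyfun (f : V -> F).
Proof.
exists 1 => u w; exists ((f u)%:P + (f w) *: 'X) => [|t].
  apply: leq_trans (size_polyD _ _) _; rewrite geq_max; apply/andP; split.
    by apply: leq_trans (size_polyC_leq1 _) _.
  by apply: leq_trans (size_scale_leq _ _) _; rewrite size_polyX.
by rewrite linearD linearZ !hornerE mulrC.
Qed.

End PolyFun.

Lemma polyfun_coord n (i : 'I_n) : polyfun (fun v : 'rV[F]_n => v 0 i).
Proof.
exists 1 => u w; exists ((u 0 i)%:P + (w 0 i) *: 'X) => [|t].
  apply: leq_trans (size_polyD _ _) _; rewrite geq_max; apply/andP; split.
    by apply: leq_trans (size_polyC_leq1 _) _.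
  by apply: leq_trans (size_scale_leq _ _) _; rewrite size_polyX.
by rewrite !mxE !hornerE mulrC.
Qed.

End SchwartzZippel.

(** * Families of balanced elements of given size *)

Section Families.
Variables (R : realType) (F : fieldType) (O : subringClosed F).
Variables (nrm : F -> R) (box : R -> seq F) (n : nat) (C : R).
Hypothesis HO : is_order O nrm box n C.
Local Notation cond := (cond nrm).
Local Notation cop := (cop O).
Local Notation dv := (dv O).

Let C1 : 1 <= C := order_const HO.
Let N1 := nrm 1.
Let N11 : 1 <= N1 := nrm1_ge1 HO.

Definition feta : R := (2 * nrm 1)^-1.
(** Elements near a natural number of size about G. By [near_bal] they are balanced, and they still
    number at least a constant times G^n. *)
Definition fam (G : R) : seq F := [seq (Num.truncn G).+1%:R + u | u <- box (feta * G)].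

Lemma fam_uniq G : uniq (fam G).
Proof. by rewrite map_inj_uniq ?(box_uniq HO) // => x y /addrI. Qed.

Lemma feta_gt0 : 0 < feta.
Proof. by rewrite /feta invr_gt0 mulr_gt0 // (lt_le_trans _ N11). Qed.

Definition famK : R := 2 * nrm 1 + feta + 2 * nrm 1.

Lemma famK_ge1 : 1 <= famK.
Proof. by have h1 : 1 <= nrm 1 := N11; have := feta_gt0; rewrite /famK; lra. Qed.

Lemma famP G g : 1 <= G -> g \in fam G ->
  [/\ g \in O, g != 0, nrm g <= famK * G, nrm g^-1 <= famK / G & cond g <= famK * famK].
Proof.
move=> G1 /mapP [u]; rewrite (boxE HO) => /andP [uO un] ->.
have G0 : 0 < G by rewrite (lt_le_trans _ G1).
set m := (Num.truncn G).+1.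
have /andP [m1 m2] := truncn_itv (ltW G0).
have Gm : G <= m%:R by rewrite ltW.
have mG : m%:R <= 2 * G by rewrite /m -addn1 natrD; move: m1 G1; lra.
have [||[z0 zn zV]] := near_bal HO (m := m) (z := m%:R + u) (w := 1) (x := feta) G0 (oner_neq0 _) Gm mG.
- by rewrite mulr1 addrAC subrr add0r.
- by rewrite /feta invr1 invfM -mulrA mulVf ?mulr1 // gt_eqF // (lt_le_trans _ N11).
have e0 := feta_gt0; have n0 : 0 < nrm 1 := lt_le_trans ltr01 N11.
have h1 : nrm (m%:R + u) <= famK * G.
  by apply: le_trans zn _; rewrite ler_wpM2r ?(ltW G0) // /famK lerDl mulr_ge0 ?(ltW n0).
have h2 : nrm (m%:R + u)^-1 <= famK / G.
  apply: le_trans zV _; rewrite invr1 ler_wpM2r ?invr_ge0 ?(ltW G0) // /famK lerDr addr_ge0 ?(ltW e0) //.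
  by rewrite mulr_ge0 ?(ltW n0).
split=> //; first by rewrite rpredD ?rpred_nat.
rewrite /cond; apply: le_trans (ler_pM (nrm_ge0 HO _) (nrm_ge0 HO _) h1 h2) _.
by rewrite mulrACA divff ?mulr1 // gt_eqF.
Qed.

Lemma fam_lb G : 1 <= G -> (feta * G) ^+ n <= C * (size (fam G))%:R.
Proof.
move=> G1; rewrite size_map; have e0 := feta_gt0.
have x0 : 0 <= feta * G by rewrite mulr_ge0 ?(ltW e0) ?(le_trans _ G1).
have [x1|x1] := leP 1 (feta * G); first exact: (box_lb HO).
apply: le_trans (_ : 1 <= _); first by rewrite exprn_ile1 ?(ltW x1).
rewrite mulr_ege1 // ler1n; case E : (box (feta * G)) => [|//].
by have := box0 HO x0; rewrite E.
Qed.

Definition famc : R := (feta ^+ n / C).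

Lemma famc_gt0 : 0 < famc.
Proof. by rewrite /famc divr_gt0 ?exprn_gt0 ?feta_gt0 // (lt_le_trans _ C1). Qed.

Lemma fam_lb' G : 1 <= G -> famc * G ^+ n <= (size (fam G))%:R.
Proof.
move=> G1; have C0 : 0 < C := lt_le_trans ltr01 C1.
by rewrite /famc mulrAC ler_pdivrMr // -exprMn [leRHS]mulrC fam_lb.
Qed.

Lemma sum_sub_uniq (U : eqType) (w : U -> nat) (s t : seq U) (P : pred U) : uniq s ->
  (forall x, x \in s -> x \in t /\ P x) -> (\sum_(x <- s) w x <= \sum_(x <- t | P x) w x)%N.
Proof.
move=> us H; rewrite -[X in (_ <= X)%N]big_filter.
have {H} : {subset s <= seq.filter P t} by move=> x /H [xt Px]; rewrite mem_filter Px.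
elim: s (seq.filter P t) us => [|x s IH] r /=; first by rewrite big_nil.
move=> /andP [xs us] sub; have xr : x \in r by apply: sub; rewrite mem_head.
rewrite big_cons (perm_big _ (perm_to_rem xr)) big_cons leq_add2l; apply: IH => // y ys.
have : y \in r by apply: sub; rewrite inE ys orbT.
rewrite (perm_mem (perm_to_rem xr)) inE => /predU1P [e|//].
by rewrite -e ys in xs.
Qed.

(** The family sits among the balanced elements of a box of comparable cardinality, so a small
    proportion of the box is a small proportion of the family. *)
Lemma fam_bad_box (eps : R) : 0 < eps -> exists2 T : nat, (0 < T)%N & forall G Y, 1 <= G -> 1 <= Y ->
  (\sum_(g <- fam G) count (fun x : F => (x != 0%R) && ~~ `[< cop T g x >]) (box Y))%:R
     <= eps * (size (fam G))%:R * Y ^+ n.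
Proof.
move=> e0; have k1 := famK_ge1; have k0 : 0 < famK := lt_le_trans ltr01 k1.
have c0 := famc_gt0.
have [||T T0 H] := bad_pairs_box HO (K := famK * famK) (eps := eps * famc / famK ^+ n).
- by rewrite mulr_ege1.
- by rewrite divr_gt0 ?exprn_gt0 // mulr_gt0.
exists T => // G Y G1 Y1.
apply: le_trans (_ : (\sum_(a <- box (famK * G) | (a != 0%R) && (cond a <= famK * famK)%R)
      count (fun x : F => (x != 0%R) && ~~ `[< cop T a x >]) (box Y))%:R <= _).
  rewrite ler_nat; apply: sum_sub_uniq; first exact: fam_uniq.
  move=> g /(famP G1) [gO g0 gn _ gc].
  by rewrite (boxE HO) gO gn g0 gc.
apply: le_trans (H _ _ _ Y1) _; first by rewrite mulr_ege1.
rewrite ler_wpM2r ?exprn_ge0 ?(le_trans _ Y1) // exprMn.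
rewrite mulrA divfK ?expf_neq0 ?gt_eqF // -mulrA ler_wpM2l ?(ltW e0) //.
exact: fam_lb'.
Qed.

Lemma fam_bad_fam (eps : R) : 0 < eps -> exists2 T : nat, (0 < T)%N & forall G G', 1 <= G -> 1 <= G' ->
  (\sum_(g <- fam G) count (fun x : F => ~~ `[< cop T g x >]) (fam G'))%:R
     <= eps * ((size (fam G))%:R * (size (fam G'))%:R).
Proof.
move=> e0; have k1 := famK_ge1; have k0 : 0 < famK := lt_le_trans ltr01 k1.
have c0 := famc_gt0.
have [|T T0 H] := fam_bad_box (eps := eps * famc / famK ^+ n).
  by rewrite divr_gt0 ?exprn_gt0 // mulr_gt0.
exists T => // G G' G1 G1'.
have kG : 1 <= famK * G' by rewrite mulr_ege1.
apply: le_trans (le_trans (H _ _ G1 kG) _).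
  rewrite ler_nat; apply: leq_sum => g _; rewrite -!size_filter; apply: uniq_leq_size.
    by rewrite filter_uniq ?fam_uniq.
  move=> x; rewrite !mem_filter => /andP [-> /(famP G1') [xO x0 xn _ _]].
  by rewrite x0 (boxE HO) xO xn.
have kn : famK ^+ n != 0 by rewrite expf_neq0 // gt_eqF.
have -> : eps * famc / famK ^+ n * (size (fam G))%:R * (famK * G') ^+ n =
    eps * ((size (fam G))%:R * (famc * G' ^+ n)).
  by rewrite exprMn; move: kn; move: (famK ^+ n) (G' ^+ n) => a b a0; field.
by rewrite ler_wpM2l ?(ltW e0) // ler_wpM2l // fam_lb'.
Qed.

End Families.

(** * Adjoining a cube root of unity *)

Section QuadField.
Variables (K : fieldType) (noroot : forall z : K, z ^+ 2 + z + 1 != 0).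

(* The pair (a, b) stands for a + b w with w^2 + w + 1 = 0. *)
Definition quad of (forall z : K, z ^+ 2 + z + 1 != 0) : Type := (K * K)%type.
Local Notation E := (quad noroot).

HB.instance Definition _ := GRing.Zmodule.copy E (K * K)%type.

Definition qmul (x y : E) : E := (x.1 * y.1 - x.2 * y.2, x.1 * y.2 + x.2 * y.1 - x.2 * y.2).
Definition qone : E := (1, 0).
Definition qnorm (x : E) : K := x.1 ^+ 2 - x.1 * x.2 + x.2 ^+ 2.
Definition qinv (x : E) : E := ((x.1 - x.2) / qnorm x, - x.2 / qnorm x).

Fact qmulA : associative qmul.
Proof. by move=> [a b] [c e] [g h]; congr pair; rewrite /=; ring. Qed.
Fact qmulC : commutative qmul.
Proof. by move=> [a b] [c e]; congr pair; rewrite /=; ring. Qed.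
Fact qmul1 : left_id qone qmul.
Proof. by move=> [a b]; congr pair; rewrite /=; ring. Qed.
Fact qmulD : left_distributive qmul +%R.
Proof. by move=> [a b] [c e] [g h]; congr pair; rewrite /=; ring. Qed.
Fact qone_neq0 : qone != 0.
Proof. by apply/eqP => -[/eqP]; rewrite oner_eq0. Qed.

HB.instance Definition _ := GRing.Zmodule_isComNzRing.Build E qmulA qmulC qmul1 qmulD qone_neq0.

Lemma qnorm_neq0 (x : E) : x != 0 -> qnorm x != 0.
Proof.
case: x => a b x0; rewrite /qnorm /=; have [b0|b0] := eqVneq b 0.
  rewrite b0 mulr0 subr0 expr0n addr0 sqrf_eq0; apply: contraNneq x0 => a0.
  by rewrite a0 b0.
have -> : a ^+ 2 - a * b + b ^+ 2 = b ^+ 2 * ((- a / b) ^+ 2 + (- a / b) + 1) by field.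
by rewrite mulf_neq0 ?sqrf_eq0 ?noroot // expf_neq0.
Qed.

Fact qmulV (x : E) : x != 0 -> qmul (qinv x) x = 1.
Proof.
by move=> /qnorm_neq0; case: x => a b; rewrite /qmul /qinv /qnorm /= => N0; congr pair; rewrite /=; field.
Qed.
Fact qinv0 : qinv 0 = 0.
Proof. by congr pair; rewrite /= ?subrr ?oppr0 mul0r. Qed.

HB.instance Definition _ := GRing.ComNzRing_isField.Build E qmulV qinv0.

Definition qconj (x : E) : E := (x.1 - x.2, - x.2).
Fact qconj_zmod : zmod_morphism qconj.
Proof. by move=> [a b] [c e]; congr pair; rewrite /=; ring. Qed.
Fact qconj_monoid : monoid_morphism qconj.
Proof. by split=> [|[a b] [c e]]; congr pair; rewrite /=; ring. Qed.
HB.instance Definition _ := GRing.isZmodMorphism.Build E E qconj qconj_zmod.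
HB.instance Definition _ := GRing.isMonoidMorphism.Build E E qconj qconj_monoid.

Definition qemb (a : K) : E := (a, 0).
Fact qemb_zmod : zmod_morphism qemb.
Proof. by move=> a b; congr pair; rewrite /=; ring. Qed.
Fact qemb_monoid : monoid_morphism qemb.
Proof. by split=> [|a b]; congr pair; rewrite /=; ring. Qed.
HB.instance Definition _ := GRing.isZmodMorphism.Build K E qemb qemb_zmod.
HB.instance Definition _ := GRing.isMonoidMorphism.Build K E qemb qemb_monoid.

Definition qw : E := (0, 1).

Lemma qwP : qw ^+ 2 + qw + 1 = 0.
Proof. by rewrite expr2; congr pair; rewrite /=; ring. Qed.

Lemma qconjK : involutive qconj.
Proof. by move=> [a b]; congr pair; rewrite /=; ring. Qed.

Variable O : subringClosed K.
Definition quadO : {pred E} := fun x => (x.1 \in O) && (x.2 \in O).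

Lemma quadOE x : (x \in quadO) = (x.1 \in O) && (x.2 \in O). Proof. by []. Qed.

Fact quadO_subring : subring_closed quadO.
Proof.
split; first by rewrite quadOE rpred1 rpred0.
- by move=> x y; rewrite !quadOE => /andP [a b] /andP [c e]; rewrite !rpredB.
- move=> x y; rewrite !quadOE => /andP [a b] /andP [c e]; apply/andP; split.
    by apply: rpredB; apply: rpredM.
  by apply: rpredB; [apply: rpredD|]; apply: rpredM.
Qed.
HB.instance Definition _ := GRing.isSubringClosed.Build E quadO quadO_subring.

Lemma qconjO x : x \in quadO -> qconj x \in quadO.
Proof. by rewrite !quadOE => /andP [a b]; rewrite rpredB ?rpredN. Qed.

Lemma qnat k : k%:R = qemb k%:R.
Proof. by rewrite rmorph_nat. Qed.

Lemma qemb_nat_mul k (x : E) : k%:R * x = (k%:R * x.1, k%:R * x.2).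
Proof. by rewrite qnat; case: x => a b; congr pair; rewrite /=; ring. Qed.

Lemma qw_O : qw \in quadO. Proof. by rewrite quadOE rpred0 rpred1. Qed.
Lemma qemb_O a : (qemb a \in quadO) = (a \in O). Proof. by rewrite quadOE rpred0 andbT. Qed.

(* The ideal generated by x and its conjugate contains sqrt(-3) times both coordinates of x. *)
Lemma cop_coords T (x : E) : cop O T x.1 x.2 -> cop quadO (3 * T) x (qconj x).
Proof.
move=> [u [v [uO vO e]]].
(* [s3] is -1 - 2 w, a square root of -3, whence the factor 3. *)
pose s3 : E := (-1, -2%:R); pose y : E := (u + v, u); pose z : E := (- v, u).
exists (s3 * y), (s3 * z); split.
- by apply: rpredM; rewrite quadOE /= ?rpredD ?rpredN ?rpred_nat ?rpred1.
- by apply: rpredM; rewrite quadOE /= ?rpredD ?rpredN ?rpred_nat ?rpred1 ?vO ?uO.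
rewrite natrM (qnat T) -e; case: x {e} => a b; rewrite (qnat 3); congr pair; rewrite /=; ring.
Qed.

End QuadField.

(** * The order O + O w as a normed order of rank 2 n *)

Section QuadOrder.
Variables (R : realType) (K : fieldType) (O : subringClosed K).
Variables (nrm : K -> R) (box : R -> seq K) (n : nat) (C : R).
Hypothesis HO : is_order O nrm box n C.
Variable noroot : forall z : K, z ^+ 2 + z + 1 != 0.
Local Notation E := (quad noroot).
Local Notation OE := (@quadO K noroot O).

Let C1 : 1 <= C := order_const HO.
Let C0 : 0 < C := lt_le_trans ltr01 C1.
Let n0 := nrm_ge0 HO.

(** The term x.1 - x.2 makes the norm invariant under conjugation, which sends (a, b) to (a - b,
    -b). The factor 3 makes it submultiplicative, as each of the three terms of a product is bounded
    by the product of the sums. *)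
Definition nrmQ (x : E) : R := 3 * (nrm x.1 + nrm x.2 + nrm (x.1 - x.2)).
Definition boxQ (X : R) : seq E := [seq x <- [seq ((a, b) : E) | a <- box X, b <- box X] | nrmQ x <= X].
(** 12 C is the rounding error 3 (C + C + 2 C); the other term comes from the square of a box of
    size X / 12, which lies inside [boxQ X]. *)
Definition constQ : R := 12 * C + 144 ^+ n * C ^+ 2.

Lemma nrmQ_coord x : nrm x.1 <= nrmQ x /\ nrm x.2 <= nrmQ x.
Proof. by rewrite /nrmQ; have := n0 x.1; have := n0 x.2; have := n0 (x.1 - x.2); split; lra. Qed.

Lemma nrmQ_emb a : nrmQ (qemb noroot a) = 6 * nrm a.
Proof. by rewrite /nrmQ /= subr0 (nrm0 HO); ring. Qed.

Lemma nrmQ_conj x : nrmQ (qconj x) = nrmQ x.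
Proof.
rewrite /nrmQ /= (nrmN HO) opprK subrK; congr (_ * _); ring.
Qed.

Lemma box_lb0 X : 0 <= X -> X ^+ n <= C * (size (box X))%:R.
Proof.
move=> x0; have [x1|x1] := leP 1 X; first exact: (box_lb HO).
apply: le_trans (_ : 1 <= _); first by rewrite exprn_ile1 ?(ltW x1).
rewrite mulr_ege1 // ler1n; case e : (box X) => [|//].
by have := box0 HO x0; rewrite e.
Qed.

Lemma nrmQM x y : nrmQ (x * y) <= nrmQ x * nrmQ y.
Proof.
case: x y => a b [c e]; rewrite /nrmQ /=.
set P := nrm a + nrm b + nrm (a - b); set Q := nrm c + nrm e + nrm (c - e).
have a0 := n0 a; have b0 := n0 b; have ab0 := n0 (a - b).
have c0 := n0 c; have e0 := n0 e; have ce0 := n0 (c - e).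
have le u v w z : nrm u <= nrm w * nrm z -> nrm v <= nrm b * nrm z -> nrm (u + v) <= nrm w * nrm z + nrm b * nrm z.
  by move=> *; apply: le_trans (nrmD HO _ _) _; apply: lerD.
have M := nrmM HO.
have k1 : nrm (a * c - b * e) <= P * Q.
  apply: le_trans (nrmB HO _ _) _; apply: le_trans (lerD (M _ _) (M _ _)) _.
  by rewrite /P /Q; nra.
have k2 : nrm (a * e + b * c - b * e) <= P * Q.
  have -> : a * e + b * c - b * e = a * e + b * (c - e) by ring.
  apply: le_trans (nrmD HO _ _) _; apply: le_trans (lerD (M _ _) (M _ _)) _.
  by rewrite /P /Q; nra.
have k3 : nrm (a * c - b * e - (a * e + b * c - b * e)) <= P * Q.
  have -> : a * c - b * e - (a * e + b * c - b * e) = a * (c - e) - b * c by ring.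
  apply: le_trans (nrmB HO _ _) _; apply: le_trans (lerD (M _ _) (M _ _)) _.
  by rewrite /P /Q; nra.
by lra.
Qed.

Lemma boxQE X x : (x \in boxQ X) = (x \in OE) && (nrmQ x <= X).
Proof.
rewrite mem_filter andbC; case: (leP (nrmQ x) X) => h; rewrite ?andbF // !andbT.
have [h1 h2] := nrmQ_coord x.
rewrite quadOE; case: x h h1 h2 => a b /= h h1 h2; apply/allpairsP/andP.
  by move=> [[c e] /= []]; rewrite !(boxE HO) => /andP [aO _] /andP [bO _] [-> ->].
move=> [aO bO]; exists (a, b) => /=; rewrite !(boxE HO) aO bO.
by rewrite (le_trans h1 h) (le_trans h2 h).
Qed.

Lemma orderQ : is_order OE nrmQ boxQ (2 * n) constQ.
Proof.
have c0 : 0 <= C ^+ 2 by rewrite exprn_ge0 ?(ltW C0).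
have k0 : 0 <= 144 ^+ n :> R by rewrite exprn_ge0.
have k1 : 1 <= 144 ^+ n :> R by rewrite exprn_ege1 // ler1n.
split.
- by rewrite /constQ; have := mulr_ge0 k0 c0; have := C1; lra.
- by rewrite muln_gt0 (order_rank HO).
- move=> x y; rewrite /nrmQ -mulrDr ler_wpM2l //.
  have h1 := nrmD HO x.1 y.1; have h2 := nrmD HO x.2 y.2.
  have h3 := nrmD HO (x.1 - x.2) (y.1 - y.2).
  have -> : (x + y).1 - (x + y).2 = x.1 - x.2 + (y.1 - y.2) by case: (x) (y) => a b [c e] /=; ring.
  by rewrite [(x + y).1]/= [(x + y).2]/=; lra.
- by move=> [a b]; rewrite /nrmQ /= -opprD !(nrmN HO).
- exact: nrmQM.
- move=> k x; rewrite qemb_nat_mul /nrmQ /= -mulrBr !(nrmZ HO); ring.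
- move=> x; rewrite quadOE => /andP [aO bO] x0; rewrite /nrmQ.
  have := n0 x.1; have := n0 x.2; have := n0 (x.1 - x.2).
  have [a0|a0] := eqVneq x.1 0; last by have := nrm_int HO aO a0; lra.
  have b0 : x.2 != 0 by apply: contraNneq x0 => b0; case: (x) a0 b0 => a b /= -> ->.
  by have := nrm_int HO bO b0; lra.
- move=> [a b]; have [x xO hx] := nrm_round HO a; have [y yO hy] := nrm_round HO b.
  exists ((x, y) : E); first by rewrite quadOE xO.
  rewrite /nrmQ /=; have := nrmB HO (a - x) (b - y).
  have -> : a - x - (b - y) = (a - x) - (b - y) by [].
  by rewrite /constQ; have := mulr_ge0 k0 c0; lra.
- by move=> X; rewrite filter_uniq // allpairs_uniq ?(box_uniq HO) // => -[a b] [c e] _ _ /= [-> ->].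
- exact: boxQE.
- move=> X X1; set Y := X / 12.
  have Y0 : 0 <= Y by rewrite divr_ge0 ?(le_trans _ X1).
  have sub : (size (box Y) * size (box Y) <= size (boxQ X))%N.
    rewrite -(size_allpairs (fun a b => (a, b) : E)); apply: uniq_leq_size.
      by rewrite allpairs_uniq ?(box_uniq HO) // => -[a b] [c e] _ _ /= [-> ->].
    move=> x /allpairsP [[a b] /= []]; rewrite !(boxE HO) => /andP [aO ha] /andP [bO hb] ->.
    rewrite boxQE quadOE /= aO bO /nrmQ /=; have := nrmB HO a b.
    by move: ha hb; rewrite /Y; lra.
  have h := box_lb0 Y0.
  have XY : X ^+ (2 * n) = 144 ^+ n * (Y ^+ n * Y ^+ n).
    have -> : X = 12 * Y by rewrite /Y; field.
    by rewrite exprM (_ : (12 * Y) ^+ 2 = 144 * (Y * Y)); [rewrite !exprMn | ring].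
  rewrite XY /constQ mulrDl; apply: ler_wpDl; first by rewrite mulr_ge0 // mulr_ge0 // ltW.
  rewrite -mulrA ler_wpM2l //.
  apply: le_trans (ler_pM _ _ h h) _; rewrite ?exprn_ge0 //.
  by rewrite mulrACA -expr2 ler_wpM2l // -natrM ler_nat.
- move=> X X1; apply: le_trans (_ : (size (box X) * size (box X))%:R <= _).
    rewrite ler_nat -(size_allpairs (fun a b => (a, b) : E)) size_filter.
    exact: count_size.
  have h := box_ub HO X1; rewrite natrM.
  apply: le_trans (ler_pM _ _ h h) _ => //.
  rewrite mulrACA -expr2 -expr2 -exprM mulnC ler_wpM2r ?exprn_ge0 ?(le_trans _ X1) //.
  rewrite /constQ; have := C1; have := ler_peMl c0 k1; lra.
Qed.

Lemma condQ_emb a : cond nrmQ (qemb noroot a) = 36 * cond nrm a.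
Proof. by rewrite /cond -fmorphV !nrmQ_emb; ring. Qed.

Lemma bad_box_fam (U : eqType) (s : seq U) (P : U -> E -> bool) (e : R) :
  0 < e -> (forall Y, 1 <= Y -> (\sum_(g <- s) count (fun x : E => (x != 0%R) && P g x) (boxQ Y))%:R <= e * (size s)%:R * Y ^+ (2 * n)) ->
  forall G, 1 <= G -> (\sum_(g <- s) count (P g) (fam nrmQ boxQ G))%:R <=
    e * famK nrmQ ^+ (2 * n) / famc nrmQ (2 * n) constQ * ((size s)%:R * (size (fam nrmQ boxQ G))%:R).
Proof.
move=> e0 H G G1; have k1 := famK_ge1 orderQ; have c0 := famc_gt0 orderQ.
have kG : 1 <= famK nrmQ * G by rewrite mulr_ege1.
apply: le_trans (le_trans (H _ kG) _).
  rewrite ler_nat; apply: leq_sum => g _; rewrite -!size_filter; apply: uniq_leq_size.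
    by rewrite filter_uniq ?(fam_uniq orderQ).
  move=> x; rewrite mem_filter => /andP [Pg /(famP orderQ G1) [xO x0 xn _ _]].
  by rewrite mem_filter Pg x0 boxQE xO xn.
have h := fam_lb' orderQ G1; move: h c0; rewrite exprMn.
move: (famc _ _ _) (famK _ ^+ _) (exprn_ge0 (2 * n) (le_trans ler01 k1)) (size (fam _ _ _)) => c k k0 N h c0.
have -> : e * k / c * ((size s)%:R * N%:R) = e * (size s)%:R * k * (N%:R / c) by field; rewrite gt_eqF.
by rewrite -[_ * k * _]mulrA ler_wpM2l ?mulr_ge0 ?(ltW e0) // ler_wpM2l // ler_pdivlMr // mulrC.
Qed.

(** Elements of K form a thin subset of the quadratic extension, but [bad_pairs] requires only one
    power of nrm nu. Two elements of K divisible by nu differ by a constant times nrm nu, so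
    [packing] in K saves nrm nu ^ n. *)
Lemma emb_bad_box (eps : R) : 0 < eps -> exists2 T : nat, (0 < T)%N & forall G Y, 1 <= G -> 1 <= Y ->
  (\sum_(g <- fam nrm box G) count (fun x : E => (x != 0%R) && ~~ `[< cop OE T (qemb noroot g) x >]) (boxQ Y))%:R
     <= eps * (size (fam nrm box G))%:R * Y ^+ (2 * n).
Proof.
move=> e0; have f1 := famK_ge1 HO; have f0 : 0 < famK nrm := lt_le_trans ltr01 f1.
have c0 := famc_gt0 HO.
have [|t0 [K' [K2 [t00 K'1 K20 H]]]] := bad_pairs orderQ (K := 36 * (famK nrm * famK nrm)).
  by rewrite mulr_ege1 ?ler1n // mulr_ege1.
have K'0 : 0 < K' := lt_le_trans ltr01 K'1.
have t0R : 0 < t0%:R :> R by rewrite ltr0n.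
pose c1 := t0%:R * K' * 6 * famK nrm.
have [c1E c10] : c1 = t0%:R * K' * 6 * famK nrm /\ 0 < c1 by split=> //; rewrite /c1 !mulr_gt0.
pose c2 := 4 * C * famK nrm * (6 * t0%:R * K') + C * c1.
have [c2E c20] : c2 = 4 * C * famK nrm * (6 * t0%:R * K') + C * c1 /\ 0 < c2.
  by split=> //; rewrite /c2 addr_gt0 ?mulr_gt0.
pose m0 := C * c2 ^+ n.
have [m0E m00] : m0 = C * c2 ^+ n /\ 0 < m0 by split=> //; rewrite /m0 mulr_gt0 ?exprn_gt0.
clearbody c1 c2 m0.
pose U0 := Num.max 1 (K2 * m0 / (eps * famc nrm n C)).
have U01 : 1 <= U0 by rewrite le_max lexx.
have U00 : 0 < U0 := lt_le_trans ltr01 U01.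
have [T T0 HT] := H _ U01.
exists T => // G Y G1 Y1; have G0 : 0 < G := lt_le_trans ltr01 G1.
have := HT [seq qemb noroot g | g <- fam nrm box G] (m0 * G ^+ n) Y; rewrite big_map.
move=> Hs; apply: le_trans (Hs _ Y1 _ _) _.
- by rewrite mulr_ge0 ?exprn_ge0 // ltW.
- move=> _ /mapP [g /(famP HO G1) [gO g0 _ _ gc] ->].
  by rewrite qemb_O gO fmorph_eq0 g0 condQ_emb ler_wpM2l.
- move=> nu nuO nu0 nuc.
  have nu1 : 1 <= nrmQ nu := nrm_int orderQ nuO nu0.
  have nup : 0 < nrmQ nu := lt_le_trans ltr01 nu1.
  rewrite count_map -size_filter.
  set s := seq.filter _ _.
  case Es : s => [|z0 s0].
    by apply: divr_ge0; [rewrite mulr_ge0 ?exprn_ge0 ?(ltW m00) ?(ltW G0) | exact: ltW].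
  have nuG : nrmQ nu <= c1 * G.
    have : z0 \in s by rewrite Es mem_head.
    rewrite mem_filter => /andP [/= dz /(famP HO G1) [zO z0' zn _ _]].
    have h : nrmQ nu <= t0%:R * K' * nrmQ (qemb noroot z0).
      by apply: (dv_nrm orderQ _ _ t00 nu0 nuc dz); rewrite ?qemb_O ?fmorph_eq0.
    apply: le_trans h _; rewrite nrmQ_emb c1E -!mulrA ler_wpM2l ?(ltW t0R) // ler_wpM2l ?(ltW K'0) //.
    by rewrite ler_wpM2l.
  rewrite -Es; pose rho := nrmQ nu / (6 * t0%:R * K').
  have rho0 : 0 < rho by rewrite /rho divr_gt0 // mulr_gt0 // mulr_gt0.
  have P := packing HO (s := s) (Y := famK nrm * G) (rho := rho).
  apply: le_trans (P _ rho0 _ _ _) _.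
  + by rewrite filter_uniq ?(fam_uniq HO).
  + by rewrite mulr_ge0 // ltW.
  + by move=> z; rewrite mem_filter => /andP [_ /(famP HO G1) []].
  + move=> z w; rewrite !mem_filter => /andP [/= dz /(famP HO G1) [zO _ _ _ _]] /andP [/= dw /(famP HO G1) [wO _ _ _ _]] zw.
    have zw0 : z - w != 0 by rewrite subr_eq0.
    have h : nrmQ nu <= t0%:R * K' * nrmQ (qemb noroot (z - w)).
      apply: (dv_nrm orderQ _ _ t00 nu0 nuc); rewrite ?qemb_O ?fmorph_eq0 ?rpredB //.
      by rewrite rmorphB; apply: dvB.
    rewrite /rho ler_pdivrMr ?mulr_gt0 //; apply: le_trans h _; rewrite nrmQ_emb.
    by rewrite le_eqVlt; apply/predU1P; left; ring.
  have [x Ex] : exists x, x = G / nrmQ nu by eexists.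
  have x0 : 0 < x by rewrite Ex divr_gt0.
  have cx : 1 <= c1 * x by rewrite Ex mulrA ler_pdivlMr // mul1r.
  have b1 : 4 * C * (famK nrm * G) / rho + C <= c2 * x.
    have -> : c2 * x = 4 * C * famK nrm * (6 * t0%:R * K') * x + C * (c1 * x) by rewrite c2E; ring.
    rewrite /rho; apply: lerD; last by rewrite ler_peMr // ltW.
    rewrite Ex le_eqVlt; apply/predU1P; left; field.
    by rewrite !gt_eqF.
  apply: le_trans (_ : C * (c2 * x) ^+ n <= _).
    rewrite ler_wpM2l ?(ltW C0) // lerXn2r ?nnegrE //.
      apply: addr_ge0; last exact: ltW.
      apply: divr_ge0; last exact: ltW.
      by rewrite !mulr_ge0 ?(ltW C0) ?(ltW f0) ?(ltW G0).
    by rewrite mulr_ge0 // ltW.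
  have -> : C * (c2 * x) ^+ n = C * c2 ^+ n * x ^+ n by rewrite exprMn mulrA.
  rewrite m0E -[_ * G ^+ n / _]mulrA; apply: ler_wpM2l; first by rewrite mulr_ge0 ?exprn_ge0 ?(ltW C0) ?(ltW c20).
  rewrite Ex expr_div_n ler_wpM2l ?exprn_ge0 ?(ltW G0) // lef_pV2 ?posrE ?exprn_gt0 //.
  by rewrite ler_eXnr // (order_rank HO).
rewrite ler_wpM2r ?exprn_ge0 ?(le_trans _ Y1) //.
apply: le_trans (_ : eps * (famc nrm n C * G ^+ n) <= _); last by rewrite ler_wpM2l ?(fam_lb' HO) ?(ltW e0).
have key : K2 / U0 * m0 <= eps * famc nrm n C.
  rewrite mulrAC ler_pdivrMr // mulrC -ler_pdivrMl ?(mulr_gt0 e0 c0) // [X in X <= _]mulrC ?[m0 * K2]mulrC.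
  by rewrite le_max lexx orbT.
by rewrite (mulrA (K2 / U0)) (mulrA eps) ler_wpM2r ?exprn_ge0 ?(ltW G0).
Qed.

(** By [cop_coords] this reduces to coprimality of the two coordinates over K. The elements with
    second coordinate 0 are not covered by that count; there are O(Y^n) of them, negligible against
    Y^(2n) once Y >= G0. *)
Lemma coord_cop (K1 eps : R) : 1 <= K1 -> 0 < eps -> exists (T : nat) (G0 : R), [/\ (0 < T)%N, 1 <= G0 &
  forall Y, G0 <= Y -> (count (fun x : E => [&& x.1 != 0, (cond nrm x.1 <= K1)%R &
     ~~ `[< cop OE T x (qconj x) >]]) (boxQ Y))%:R <= eps * Y ^+ (2 * n)].
Proof.
move=> K11 e0; have [|T T0 H] := bad_pairs_box HO (K := K1) (eps := eps / 2) K11.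
  by rewrite divr_gt0.
exists (3 * T)%N, (Num.max 1 (2 * C / eps)); split; [by rewrite muln_gt0| by rewrite le_max lexx|].
move=> Y; rewrite ge_max => /andP [Y1 YC].
have Yn : Y <= Y ^+ n by rewrite ler_eXnr // (order_rank HO).
pose P (a b : K) := (a != 0) && (cond nrm a <= K1) && ~~ `[< cop O T a b >].
apply: le_trans (_ : (\sum_(a <- box Y) count (P a) (box Y))%:R <= _).
  rewrite ler_nat; apply: leq_trans (_ : (count (fun x : E => P x.1 x.2) [seq ((a, b) : E) | a <- box Y, b <- box Y] <= _)%N).
    rewrite /boxQ count_filter; apply: sub_count => x /=; rewrite /P => /andP [/and3P [-> -> /asboolPn h] _] /=.
    by apply/asboolPn => h'; apply: h; apply: cop_coords.
  have ac s t : count (fun x : E => P x.1 x.2) [seq ((a, b) : E) | a <- s, b <- t] = (\sum_(a <- s) count (P a) t)%N.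
    elim: s => [|a s IH]; first by rewrite big_nil.
    by rewrite allpairs_cons count_cat IH big_cons count_map.
  by rewrite ac.
apply: le_trans (_ : (\sum_(a <- box Y) 1 + \sum_(a <- box Y | (a != 0%R) && (cond nrm a <= K1)%R)
      count (fun b : K => (b != 0%R) && ~~ `[< cop O T a b >]) (box Y))%:R <= _).
  rewrite ler_nat [X in (_ <= _ + X)%N]big_mkcond -big_split /=; apply: leq_sum => a _.
  case: ifP => h; last by rewrite (eq_count (a2 := pred0)) ?count_pred0 // => b; rewrite /P h.
  rewrite (eq_count (a2 := fun b => ~~ `[< cop O T a b >])); last by move=> b; rewrite /P h.
  set Q := fun b => _.
  apply: leq_trans (_ : (count (predU (pred1 0%R) (fun b => (b != 0%R) && Q b)) (box Y) <= _)%N).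
    by apply: sub_count => b /= ->; case: eqP.
  rewrite -(leq_add2r (count (predI (pred1 0%R) (fun b => (b != 0%R) && Q b)) (box Y))).
  rewrite count_predUI -addnA; apply: leq_add; last exact: leq_addr.
  by rewrite count_uniq_mem ?(box_uniq HO) // leq_b1.
rewrite natrD; have e2 : eps * Y ^+ (2 * n) = eps / 2 * (Y ^+ n * Y ^+ n) + eps / 2 * Y ^+ n * Y ^+ n.
  by rewrite mul2n -addnn exprD; field.
rewrite e2; apply: lerD; last exact: H.
rewrite sum1_size; apply: le_trans (box_ub HO Y1) _.
rewrite mulrA ler_wpM2r ?exprn_ge0 ?(le_trans _ Y1) //.
apply: le_trans (_ : eps / 2 * Y <= _); last by rewrite ler_wpM2l // divr_ge0 // ltW.
by move: YC; rewrite ler_pdivrMr //; lra.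
Qed.

End QuadOrder.

(** * Euler's parametrisation and the generic fibre *)

Section EulerParametrisation.
Variable A : comPzRingType.
Implicit Types a b x y : A.

Definition nq x y := x ^+ 2 - x * y + y ^+ 2.
Definition gam0 (a0 a1 b0 b1 : A) := a0 * nq a0 a1 + b0 * nq b0 b1.
Definition gam1 (a0 a1 b0 b1 : A) := a1 * nq a0 a1 + b1 * nq b0 b1.
Definition eul0 (c0 c1 x y : A) := x * (c0 - c1) + y * c1.
Definition eul1 (c0 c1 x y : A) := y * c0 - x * c1.

(* x0 + x1 w = (1 - w) alpha conj(gamma) and x2 + x3 w = (1 - w) beta conj(gamma), where
   alpha = a0 + a1 w, beta = b0 + b1 w and gamma = alpha N(alpha) + beta N(beta). *)
Definition euler (a0 a1 b0 b1 : A) : seq A :=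
  let c0 := gam0 a0 a1 b0 b1 in let c1 := gam1 a0 a1 b0 b1 in
  [:: eul0 c0 c1 a0 a1 + eul1 c0 c1 a0 a1; 2%:R * eul1 c0 c1 a0 a1 - eul0 c0 c1 a0 a1;
      eul0 c0 c1 b0 b1 + eul1 c0 c1 b0 b1; 2%:R * eul1 c0 c1 b0 b1 - eul0 c0 c1 b0 b1].
Definition xeul (a0 a1 b0 b1 : A) (i : 'I_4) : A := nth 0 (euler a0 a1 b0 b1) i.

Lemma sum4 (f : 'I_4 -> A) : \sum_i f i = f 0 + f 1 + f (inord 2) + f (inord 3).
Proof.
rewrite !big_ord_recl big_ord0 addr0 !addrA; congr (_ + f _ + f _ + f _); apply: val_inj => /=;
  by rewrite ?inordK.
Qed.

Lemma xeul_cubes a0 a1 b0 b1 : \sum_i xeul a0 a1 b0 b1 i ^+ 3 = 0.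
Proof.
rewrite sum4 /xeul /= !inordK //=.
(* Each pair of cubes adds up to 9 N(c) N(x + y w) (y c0 - x c1). The two sums cancel, since c0 = a0
   N(alpha) + b0 N(beta) and c1 is the same expression in a1 and b1. *)
have cE x y c0 c1 : (eul0 c0 c1 x y + eul1 c0 c1 x y) ^+ 3 + (2%:R * eul1 c0 c1 x y - eul0 c0 c1 x y) ^+ 3
    = 9%:R * nq c0 c1 * nq x y * (y * c0 - x * c1).
  by rewrite /eul0 /eul1 /nq; ring.
rewrite cE -addrA cE /gam0 /gam1; ring.
Qed.

(** Euler's map fixes the points of the Fermat cubic surface up to the scalar 3 gam0. This shows
    that the parametrisation reaches a general point of the fibre. *)
Lemma xeul_of_cubes y0 y1 y2 y3 (i : 'I_4) : y0 ^+ 3 + y1 ^+ 3 + y2 ^+ 3 + y3 ^+ 3 = 0 ->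
  xeul y0 y1 y2 y3 i = 3%:R * gam0 y0 y1 y2 y3 * [:: y0; y1; y2; y3]`_i.
Proof.
move=> h.
have E : gam1 y0 y1 y2 y3 = - gam0 y0 y1 y2 y3.
  apply/eqP; rewrite -subr_eq0 opprK -h /gam0 /gam1 /nq; apply/eqP; ring.
rewrite /xeul /euler E; move: (gam0 y0 y1 y2 y3) => c.
by case: i => [[|[|[|[|]]]] //= _]; rewrite /eul0 /eul1; ring.
Qed.

(** Makes the nonvanishing of that scalar explicit in the coordinates of the point. *)
Lemma gam0_factor y0 y1 y2 y3 : y0 ^+ 3 + y1 ^+ 3 + y2 ^+ 3 + y3 ^+ 3 = 0 ->
  gam0 y0 y1 y2 y3 * ((y0 + y1) * (y2 + y3)) = (y0 ^+ 3 + y1 ^+ 3) * (y0 * y3 - y1 * y2).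
Proof.
move=> h; transitivity ((y0 ^+ 3 + y1 ^+ 3) * (y0 * y3 - y1 * y2) +
   (y0 ^+ 3 + y1 ^+ 3 + y2 ^+ 3 + y3 ^+ 3) * (y2 * (y0 + y1))); last by rewrite h mul0r addr0.
by rewrite /gam0 /nq; ring.
Qed.

End EulerParametrisation.

(** * The parametrisation in coordinates over a field containing w *)

Section OmegaForm.
Variables (F : fieldType) (w : F).
Hypothesis wP : w ^+ 2 + w + 1 = 0.
Local Notation w' := (-1 - w).

(** The element gamma with alpha and its conjugate treated as independent variables, so that the
    same formula serves the split case. *)
Definition gamE (al1 be1 al2 be2 : F) := al1 ^+ 2 * al2 + be1 ^+ 2 * be2.

Lemma w_cube : w ^+ 3 = 1.
Proof. by transitivity (1 + (w - 1) * (w ^+ 2 + w + 1)); [ring | rewrite wP mulr0 addr0]. Qed.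

Lemma gamE_coords a0 a1 b0 b1 :
  gamE (a0 + a1 * w) (b0 + b1 * w) (a0 + a1 * w') (b0 + b1 * w') =
  gam0 a0 a1 b0 b1 + gam1 a0 a1 b0 b1 * w.
Proof.
have nE x y : (x + y * w) * (x + y * w') = nq x y.
  transitivity (nq x y - y ^+ 2 * (w ^+ 2 + w + 1)); first by rewrite /nq; ring.
  by rewrite wP mulr0 subr0.
rewrite /gamE !expr2 -!mulrA !nE /gam0 /gam1; ring.
Qed.

Lemma gamE_coords' a0 a1 b0 b1 :
  gamE (a0 + a1 * w') (b0 + b1 * w') (a0 + a1 * w) (b0 + b1 * w) =
  gam0 a0 a1 b0 b1 + gam1 a0 a1 b0 b1 * w'.
Proof.
have nE x y : (x + y * w') * (x + y * w) = nq x y.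
  transitivity (nq x y - y ^+ 2 * (w ^+ 2 + w + 1)); first by rewrite /nq; ring.
  by rewrite wP mulr0 subr0.
rewrite /gamE !expr2 -!mulrA !nE /gam0 /gam1; ring.
Qed.

Lemma nq_coords x y : nq x y = (x + y * w) * (x + y * w').
Proof.
transitivity (nq x y - y ^+ 2 * (w ^+ 2 + w + 1)); last by rewrite /nq; ring.
by rewrite wP mulr0 subr0.
Qed.

Lemma eul_conj c0 c1 x y : (x + y * w) * (c0 + c1 * w') = eul0 c0 c1 x y + eul1 c0 c1 x y * w.
Proof.
transitivity (eul0 c0 c1 x y + eul1 c0 c1 x y * w - y * c1 * (w ^+ 2 + w + 1)).
  by rewrite /eul0 /eul1; ring.
by rewrite wP mulr0 subr0.
Qed.

Lemma eul_conj' c0 c1 x y : (x + y * w') * (c0 + c1 * w) = eul0 c0 c1 x y + eul1 c0 c1 x y * w'.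
Proof.
transitivity (eul0 c0 c1 x y + eul1 c0 c1 x y * w' - y * c1 * (w ^+ 2 + w + 1)).
  by rewrite /eul0 /eul1; ring.
by rewrite wP mulr0 subr0.
Qed.

Lemma eul_fst P Q : P + Q = - (w * (P + Q * w) + w' * (P + Q * w')).
Proof.
transitivity (P + Q - 2%:R * Q * (w ^+ 2 + w + 1)); first by rewrite wP mulr0 subr0.
by ring.
Qed.

Lemma eul_snd P Q : 2%:R * Q - P = w' * (P + Q * w) + w * (P + Q * w').
Proof.
transitivity (2%:R * Q - P - 2%:R * Q * (w ^+ 2 + w + 1)); first by rewrite wP mulr0 subr0.
by ring.
Qed.

Lemma eul_inv P Q : (1 - w) * (P + Q * w) = (P + Q) + (2%:R * Q - P) * w.
Proof.
transitivity ((P + Q) + (2%:R * Q - P) * w - Q * (w ^+ 2 + w + 1)); first by ring.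
by rewrite wP mulr0 subr0.
Qed.

Lemma eul_inv' P Q : (1 - w') * (P + Q * w') = (P + Q) + (2%:R * Q - P) * w'.
Proof.
transitivity ((P + Q) + (2%:R * Q - P) * w' - Q * (w ^+ 2 + w + 1)); first by ring.
by rewrite wP mulr0 subr0.
Qed.

Lemma w_norm3 : (1 - w) * (1 - w') = 3%:R.
Proof. by transitivity (3%:R - (w ^+ 2 + w + 1)); [ring | rewrite wP subr0]. Qed.

Hypothesis three : 3%:R != 0 :> F.

Lemma w1_neq0 : 1 - w != 0.
Proof. by apply: contraNneq three => h; rewrite -w_norm3 h mul0r. Qed.
Lemma w1'_neq0 : 1 - w' != 0.
Proof. by apply: contraNneq three => h; rewrite -w_norm3 h mulr0. Qed.

Section Coords.
Variables a0 a1 b0 b1 : F.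
Let al1 := a0 + a1 * w.
Let be1 := b0 + b1 * w.
Let al2 := a0 + a1 * w'.
Let be2 := b0 + b1 * w'.
Let g1 := gamE al1 be1 al2 be2.
Let g2 := gamE al2 be2 al1 be1.

Lemma xeulE (i : 'I_4) : xeul a0 a1 b0 b1 i =
  [:: - (w * (al1 * g2) + w' * (al2 * g1)); w' * (al1 * g2) + w * (al2 * g1);
      - (w * (be1 * g2) + w' * (be2 * g1)); w' * (be1 * g2) + w * (be2 * g1)]`_i.
Proof.
rewrite /xeul /euler /g1 /g2 gamE_coords gamE_coords' /al1 /al2 /be1 /be2 !eul_conj !eul_conj'.
by case: i => [[|[|[|[|]]]] //= _]; [apply: eul_fst | apply: eul_snd | apply: eul_fst | apply: eul_snd].
Qed.

Lemma xeul_inv : [/\ (1 - w) * (al1 * g2) = xeul a0 a1 b0 b1 0 + xeul a0 a1 b0 b1 1 * w,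
   (1 - w') * (al2 * g1) = xeul a0 a1 b0 b1 0 + xeul a0 a1 b0 b1 1 * w',
   (1 - w) * (be1 * g2) = xeul a0 a1 b0 b1 (inord 2) + xeul a0 a1 b0 b1 (inord 3) * w &
   (1 - w') * (be2 * g1) = xeul a0 a1 b0 b1 (inord 2) + xeul a0 a1 b0 b1 (inord 3) * w'].
Proof.
rewrite /xeul /euler !inordK //= /g1 /g2 gamE_coords gamE_coords' /al1 /al2 /be1 /be2 !eul_conj !eul_conj'.
by rewrite !eul_inv !eul_inv'.
Qed.

End Coords.

(** [xeul_inv] recovers alpha conj(gamma) and beta conj(gamma), and their conjugates, linearly from
    the x_i. So proportional solutions have proportional (alpha, beta), the factors gamma being
    cancelled because their norm is nonzero. *)
Lemma xeul_proj a0 a1 b0 b1 a0' a1' b0' b1' (c : F) :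
  let nrmv x0 x1 y0 y1 := nq (gam0 x0 x1 y0 y1) (gam1 x0 x1 y0 y1) in
  nrmv a0 a1 b0 b1 != 0 -> nrmv a0' a1' b0' b1' != 0 -> c != 0 ->
  (forall i, xeul a0' a1' b0' b1' i = c * xeul a0 a1 b0 b1 i) ->
  exists l m, [/\ l != 0, m != 0, a0' + a1' * w = l * (a0 + a1 * w) /\ b0' + b1' * w = l * (b0 + b1 * w) &
     a0' + a1' * w' = m * (a0 + a1 * w') /\ b0' + b1' * w' = m * (b0 + b1 * w')].
Proof.
move=> nrmv; rewrite /nrmv !nq_coords !mulf_eq0 !negb_or -!gamE_coords -!gamE_coords'.
have [h1 h2 h3 h4] := xeul_inv a0 a1 b0 b1; have [k1 k2 k3 k4] := xeul_inv a0' a1' b0' b1'.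
move: h1 h2 h3 h4 k1 k2 k3 k4.
move: (xeul a0 a1 b0 b1) (xeul a0' a1' b0' b1') => X X'.
move: (gamE (a0 + _) _ _ _) (gamE (a0 + _) _ _ _) (gamE (a0' + _) _ _ _) (gamE (a0' + _) _ _ _).
move=> g1 g2 g1' g2'.
move=> h1 h2 h3 h4 k1 k2 k3 k4 /andP [g10 g20] /andP [g10' g20'] c0 E.
exists (c * g2 / g2'), (c * g1 / g1'); rewrite !mulf_neq0 ?invr_neq0 //.
have go u v x y (t g g' : F) : t != 0 -> g' != 0 -> t * (x * g) = u -> t * (y * g') = v -> v = c * u -> y = c * g / g' * x.
  move=> t0 g0 <- hv e; apply: (mulfI t0); apply: (mulIf g0); rewrite -mulrA hv e; field.
  exact: g0.
split=> //; split.
- by apply: go w1_neq0 g20' h1 k1 _; rewrite !E; ring.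
- by apply: go w1_neq0 g20' h3 k3 _; rewrite !E; ring.
- by apply: go w1'_neq0 g10' h2 k2 _; rewrite !E; ring.
- by apply: go w1'_neq0 g10' h4 k4 _; rewrite !E; ring.
Qed.

(** The forms alpha + beta, w alpha + beta, w^2 alpha + beta, alpha, beta. The permutation [tau] of
    the last two matches each g_i with the form in (conj alpha, conj beta) that it divides. *)
Definition cf (i : 'I_5) : F * F := nth (1, 1) [:: (1, 1); (w, 1); (w', 1); (1, 0); (0, 1)] i.
Definition tau (i : 'I_5) : 'I_5 := nth i [:: inord 0; inord 1; inord 2; inord 4; inord 3] i.
Definition oth5 (i : 'I_5) : 'I_5 := if i == ord0 then inord 1 else ord0.

Lemma oth5P i : oth5 i != i.
Proof.
rewrite /oth5; case: ifP => [/eqP ->|/negbT]; last by rewrite eq_sym.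
by apply/eqP => /(congr1 val); rewrite /= inordK.
Qed.

Variable O : subringClosed F.
Hypothesis wO : w \in O.

Lemma w'O : w' \in O. Proof. by rewrite rpredB ?rpredN1. Qed.

Lemma cfO i : (cf i).1 \in O /\ (cf i).2 \in O.
Proof. by case: i => [[|[|[|[|[|]]]]] //= h]; rewrite /cf /= ?rpred0 ?rpred1 ?wO ?w'O. Qed.

(** Each determinant is a unit, or a unit times 1 - w or a conjugate, hence divides 3. The search
    supplies an explicit cofactor for each of the twenty pairs, with a multiple of w^2 + w + 1 to
    close the identity. *)
Lemma cf_det i j : i != j -> fdet cf i j != 0 /\ 3%:R / fdet cf i j \in O.
Proof.
move=> ij; suff [y yO [k E]] : exists2 y, y \in O & exists k, fdet cf i j * y = 3%:R + k * (w ^+ 2 + w + 1).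
  rewrite wP mulr0 addr0 in E.
  have f0 : fdet cf i j != 0 by apply: contraNneq three => h; rewrite -E h mul0r.
  by split=> //; rewrite -E mulrAC divff // mul1r.
have O1 := rpred1 O; have O3 : 3%:R \in O by rewrite rpred_nat.
have Oy1 : 1 - w \in O by rewrite rpredB.
have Oy2 : 2%:R + w \in O by rewrite rpredD ?rpred_nat.
have Oy3 : 1 + 2%:R * w \in O by rewrite rpredD // rpredM ?rpred_nat.
have O1w : 3%:R * w \in O by rewrite rpredM.
have O1w' : 3%:R * w' \in O by rewrite rpredM ?w'O.
have N x : x \in O -> - x \in O by rewrite rpredN.
move: ij; rewrite /fdet /cf.
case: i => [[|[|[|[|[|]]]]] //= h]; case: j => [[|[|[|[|[|]]]]] //= h'] // _;
  match goal with |- exists2 y, _ & exists k, ?f * y = _ =>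
   first [ (exists 3%:R; [by [] | by exists 0; ring])
         | (exists (- 3%:R); [exact: N | by exists 0; ring])
         | (exists (1 - w); [by [] | by exists 1; ring]) | (exists (1 - w); [by [] | by exists (-1); ring])
         | (exists (- (1 - w)); [exact: N | by exists 1; ring]) | (exists (- (1 - w)); [exact: N | by exists (-1); ring])
         | (exists (2%:R + w); [by [] | by exists 1; ring]) | (exists (2%:R + w); [by [] | by exists (-1); ring])
         | (exists (- (2%:R + w)); [exact: N | by exists 1; ring]) | (exists (- (2%:R + w)); [exact: N | by exists (-1); ring])
         | (exists (1 + 2%:R * w); [by [] | by exists 4%:R; ring]) | (exists (1 + 2%:R * w); [by [] | by exists (- 4%:R); ring])
         | (exists (- (1 + 2%:R * w)); [exact: N | by exists 4%:R; ring]) | (exists (- (1 + 2%:R * w)); [exact: N | by exists (- 4%:R); ring])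
         | (exists (3%:R * w); [by [] | by exists 3%:R; ring]) | (exists (3%:R * w); [by [] | by exists (- 3%:R); ring])
         | (exists (- (3%:R * w)); [exact: N | by exists 3%:R; ring]) | (exists (- (3%:R * w)); [exact: N | by exists (- 3%:R); ring])
         | (exists (3%:R * w'); [by [] | by exists 3%:R; ring]) | (exists (3%:R * w'); [by [] | by exists (- 3%:R); ring])
         | (exists (- (3%:R * w')); [exact: N | by exists 3%:R; ring]) | (exists (- (3%:R * w')); [exact: N | by exists (- 3%:R); ring]) ] end.
Qed.

Lemma tauK : involutive tau.
Proof. by case=> [[|[|[|[|[|]]]]] //= h]; apply: val_inj; rewrite /tau /= ?inordK //= ?inordK. Qed.

(** Modulo g_1, g_2, g_3 one has beta = - z alpha and beta' = - z alpha' with the same cube root of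
    unity z, so beta^2 beta' = - alpha^2 alpha'. For the last two, one factor of each term is
    divisible: alpha with beta', or beta with alpha'. *)
Lemma gamE_dv (g : 'I_5 -> F) (s p : F * F) (i : 'I_5) :
  s.1 \in O -> s.2 \in O -> p.1 \in O -> p.2 \in O ->
  (forall i, ell cf i s / g i \in O) -> (forall i, ell cf i p / g (tau i) \in O) ->
  gamE s.1 s.2 p.1 p.2 / g i \in O.
Proof.
move=> s1 s2 p1 p2 hs hp.
have key A1 A2 j k : A1 \in O -> A2 \in O -> g (tau k) = g j ->
  gamE s.1 s.2 p.1 p.2 = A1 * ell cf j s + A2 * ell cf k p -> gamE s.1 s.2 p.1 p.2 / g j \in O.
  move=> h1 h2 e ->; rewrite mulrDl -!mulrA; apply: rpredD; apply: rpredM => //.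
  by rewrite -e.
have O' := w'O.
case: s p s1 s2 p1 p2 {hs hp} key => [a1 b1] [a2 b2] /= a1O b1O a2O b2O key.
have i012 k : (k < 3)%N -> tau (inord k) = inord k.
  by case: k => [|[|[|]]] // _; apply: val_inj; rewrite /tau /= !inordK.
have -> : i = inord i by apply: val_inj; rewrite /= inordK.
case: i => [[|[|[|[|[|]]]]] //= _].
- apply: (key (a2 * (a1 - b1)) (b1 ^+ 2) _ (inord 0)); rewrite ?i012 //.
  + by rewrite rpredM // rpredB.
  + by rewrite rpredX.
  + by rewrite /gamE /ell /cf !inordK //=; ring.
- apply: (key (- (a2 * w * (b1 - w * a1))) (b1 ^+ 2) _ (inord 1)); rewrite ?i012 //.
  + by rewrite rpredN; apply: rpredM; [apply: rpredM|apply: rpredB => //; apply: rpredM].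
  + by rewrite rpredX.
  + rewrite /gamE /ell /cf !inordK //=.
    transitivity (a1 ^+ 2 * a2 * w ^+ 3 + b1 ^+ 2 * b2); first by rewrite w_cube mulr1.
    by ring.
- apply: (key (- (a2 * w' * (b1 - w' * a1))) (b1 ^+ 2) _ (inord 2)); rewrite ?i012 //.
  + by rewrite rpredN; apply: rpredM; [apply: rpredM|apply: rpredB => //; apply: rpredM].
  + by rewrite rpredX.
  + rewrite /gamE /ell /cf !inordK //=.
    transitivity (a1 ^+ 2 * a2 * w' ^+ 3 + b1 ^+ 2 * b2); last by ring.
    rewrite (_ : w' ^+ 3 = 1) ?mulr1 //.
    by transitivity (1 - (w + 2%:R) * (w ^+ 2 + w + 1)); [ring | rewrite wP mulr0 subr0].
- apply: (key (a1 * a2) (b1 ^+ 2) _ (inord 4)).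
  + by rewrite rpredM.
  + by rewrite rpredX.
  + by congr g; apply: val_inj; rewrite /tau /= !inordK.
  + by rewrite /gamE /ell /cf !inordK //=; ring.
- apply: (key (b1 * b2) (a1 ^+ 2) _ (inord 3)).
  + by rewrite rpredM.
  + by rewrite rpredX.
  + by congr g; apply: val_inj; rewrite /tau /= !inordK.
  + by rewrite /gamE /ell /cf !inordK //=; ring.
Qed.

End OmegaForm.

(** * Evaluating the equations of the complement of U *)

Section Evaluation.
Variable K : fieldType.

Lemma mmapE (A : nzRingType) (s : K -> A) (u : 'I_8 -> A) (p : mpoly.mpoly 8 K) :
  mpoly.mmap s u p = \sum_(m <- mpoly.msupp p) s (mpoly.mcoeff m p) * \prod_(i < 8) u i ^+ mpoly.fun_of_multinom m i.
Proof. by []. Qed.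

Lemma polyfun_mmap (A : fieldType) (V : lmodType A) (s : K -> A) (u : 'I_8 -> V -> A) (p : mpoly.mpoly 8 K) :
  (forall i, polyfun (u i)) -> polyfun (fun v => mpoly.mmap s (u^~ v) p).
Proof.
move=> h; apply: polyfun_ext (fun v => esym (mmapE s (u^~ v) p)) _.
apply: polyfun_sum => m; apply: polyfunM; first exact: polyfunC.
by apply: polyfun_prod => i; apply: polyfunX.
Qed.

Lemma mmap_rmorph (A : nzRingType) (s : {rmorphism K -> A}) (u : 'I_8 -> K) (p : mpoly.mpoly 8 K) :
  s (mpoly.meval u p) = mpoly.mmap s (fun i => s (u i)) p.
Proof.
rewrite /mpoly.meval !mmapE rmorph_sum; apply: eq_bigr => m _; rewrite rmorphM /=; congr (_ * _).
by rewrite rmorph_prod; apply: eq_bigr => i _; rewrite rmorphXn.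
Qed.

Lemma mmap_ext (A : nzRingType) (s : K -> A) (u u' : 'I_8 -> A) (p : mpoly.mpoly 8 K) : u =1 u' ->
  mpoly.mmap s u p = mpoly.mmap s u' p.
Proof. by move=> /funext ->. Qed.

End Evaluation.

Lemma mmap_bihomog (K : fieldExtType rat) (A : comNzRingType) (s : {rmorphism K -> A}) (a x : 'I_4 -> A)
    (l m : A) d1 d2 (p : mpoly.mpoly 8 K) : bihomog d1 d2 p ->
  mpoly.mmap s (concat8 (fun i => l * a i) (fun i => m * x i)) p = l ^+ d1 * m ^+ d2 * mpoly.mmap s (concat8 a x) p.
Proof.
move=> H; rewrite !mmapE mulr_sumr; apply: eq_bigr => mo _.
have [->|/H [<- <-]] := eqVneq (mpoly.mcoeff mo p) 0; first by rewrite rmorph0 !mul0r mulr0.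
rewrite mulrCA; congr (_ * _); rewrite !expr_sum (bigID (fun i : 'I_8 => (i < 4)%N)) /=.
rewrite [X in _ = _ * X](bigID (fun i : 'I_8 => (i < 4)%N)) /= mulrACA; congr (_ * _).
  rewrite -big_split; apply: eq_bigr => i /= i4.
  by rewrite /concat8 i4 exprMn.
have -> (g : 'I_8 -> A) : \prod_(i < 8 | (3 < i)%N) g i = \prod_(i < 8 | ~~ (i < 4)%N) g i.
  by apply: eq_bigl => i; rewrite leqNgt.
rewrite -big_split; apply: eq_bigr => i /= /negPf i4.
by rewrite /concat8 i4 exprMn.
Qed.

Lemma comb_delta (F : fieldType) n (t : seq F) : size t = n ->
  comb [seq delta_mx 0 i | i <- enum 'I_n] t = \row_(i < n) t`_i.
Proof.
move=> st; apply/rowP => k; rewrite mxE /comb summxE.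
rewrite (big_nth (0, 0)) size_zip size_map size_enum_ord st minnn big_mkord.
have E (i : 'I_n) : (nth (0, 0) (zip t [seq delta_mx 0 i | i <- enum 'I_n]) i) = (t`_i, delta_mx 0 i :> 'rV[F]_n).
  rewrite nth_zip; last by rewrite size_map size_enum_ord.
  congr pair; rewrite -[LHS]/(nth 0 _ _).
  rewrite (nth_map k) ?size_enum_ord // nth_ord_enum.
  by [].
rewrite (bigD1 k) //= big1 ?addr0 => [|i ik]; rewrite E !mxE !eqxx /= ?mulr1 //.
by rewrite eq_sym (negPf ik) mulr0.
Qed.

Lemma poly_nonroot (F : numFieldType) (p : {poly F}) : p != 0 -> exists k : nat, p.[k%:R] != 0.
Proof.
move=> p0; apply: contrapT => h.
have := max_poly_roots (rs := [seq (k%:R : F) | k <- iota 0 (size p)]) p0.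
rewrite map_inj_uniq ?iota_uniq ?size_map ?size_iota ?ltnn => [H|a b /eqP]; last by rewrite eqr_nat => /eqP.
have /H : all (root p) [seq (k%:R : F) | k <- iota 0 (size p)]; last by move=> /(_ isT).
apply/allP => _ /mapP [k _ ->]; apply: contraT => hk; exfalso; apply: h; exists k; exact: hk.
Qed.

Lemma polyfun_mul_nonzero (F : numFieldType) (f g : F^o -> F) x y : polyfun f -> polyfun g ->
  f x != 0 -> g y != 0 -> exists t, f t != 0 /\ g t != 0.
Proof.
move=> [D Hf] [D' Hg] fx gy; have [p _ Ep] := Hf 0 1; have [q _ Eq] := Hg 0 1.
have e t : (0 : F^o) + t *: 1 = t by rewrite add0r; apply: mulr1.
have p0 : p != 0 by apply: contraNneq fx => p0; rewrite -(e x) Ep p0 horner0.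
have q0 : q != 0 by apply: contraNneq gy => q0; rewrite -(e y) Eq q0 horner0.
have [k] := poly_nonroot (mulf_neq0 p0 q0); rewrite hornerM mulf_eq0 negb_or => /andP [h1 h2].
by exists (k%:R : F^o); rewrite -(e k%:R) Ep Eq.
Qed.

(** * A fibre with coefficients b_i^3 that meets U *)

Section Density.
Variables (R : realType) (K : fieldExtType rat) (m : nat) (f : 'I_m -> mpoly.mpoly 8 K).
Variables (d1 d2 : 'I_m -> nat).
Hypothesis Hf : forall j, bihomog (d1 j) (d2 j) (f j).
Local Notation L := R[i].

Definition xvec (A : comPzRingType) (v : 'I_4 -> A) (i : 'I_4) : A :=
  xeul (v 0) (v 1) (v (inord 2)) (v (inord 3)) i.
Definition nvec (A : comPzRingType) (v : 'I_4 -> A) : A :=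
  nq (gam0 (v 0) (v 1) (v (inord 2)) (v (inord 3))) (gam1 (v 0) (v 1) (v (inord 2)) (v (inord 3))).
Definition others (A : comPzRingType) (b : 'I_4 -> A) (i : 'I_4) : A := \prod_(k | k != i) b k.

(** An equation f_j at the point of the fibre a_i = b_i^3 given by Euler's map; x_i / b_i is
    multiplied by the product of all b_k to avoid denominators. The factor [nvec] also excludes
    gamma of norm 0. *)
Definition Geval (A : comNzRingType) (s : K -> A) (b v : 'I_4 -> A) j : A :=
  mpoly.mmap s (concat8 (fun i => b i ^+ 3) (fun i => xvec v i * others b i)) (f j) * nvec v.

Section Poly.
Variables (F : fieldType) (V : lmodType F) (v : 'I_4 -> V -> F).
Hypothesis pv : forall i, polyfun (v i).

Lemma polyfunB (g h : V -> F) : polyfun g -> polyfun h -> polyfun (fun x => g x - h x).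
Proof.
move=> pg ph; have := polyfunD pg (polyfunM (polyfunC V (-1)) ph).
by apply: polyfun_ext => x; rewrite mulN1r.
Qed.

Lemma polyfun_nq (g h : V -> F) : polyfun g -> polyfun h -> polyfun (fun x => nq (g x) (h x)).
Proof.
by move=> pg ph; apply: polyfunD (polyfunX 2 ph); apply: polyfunB (polyfunX 2 pg) (polyfunM pg ph).
Qed.

Lemma polyfun_gam0 : polyfun (fun x => gam0 (v 0 x) (v 1 x) (v (inord 2) x) (v (inord 3) x)).
Proof. by apply: polyfunD; apply: polyfunM => //; apply: polyfun_nq. Qed.

Lemma polyfun_gam1 : polyfun (fun x => gam1 (v 0 x) (v 1 x) (v (inord 2) x) (v (inord 3) x)).
Proof. by apply: polyfunD; apply: polyfunM => //; apply: polyfun_nq. Qed.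

Lemma polyfun_nvec : polyfun (fun x => nvec (v^~ x)).
Proof. by apply: polyfun_nq; [apply: polyfun_gam0 | apply: polyfun_gam1]. Qed.

Lemma polyfun_xvec i : polyfun (fun x => xvec (v^~ x) i).
Proof.
have p0 := polyfun_gam0; have p1 := polyfun_gam1.
have e0 g h : polyfun g -> polyfun h -> polyfun (fun x => eul0 (gam0 (v 0 x) (v 1 x) (v (inord 2) x) (v (inord 3) x))
    (gam1 (v 0 x) (v 1 x) (v (inord 2) x) (v (inord 3) x)) (g x) (h x)).
  by move=> pg ph; apply: polyfunD; apply: polyfunM => //; apply: polyfunB.
have e1 g h : polyfun g -> polyfun h -> polyfun (fun x => eul1 (gam0 (v 0 x) (v 1 x) (v (inord 2) x) (v (inord 3) x))
    (gam1 (v 0 x) (v 1 x) (v (inord 2) x) (v (inord 3) x)) (g x) (h x)).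
  by move=> pg ph; apply: polyfunB; apply: polyfunM.
rewrite /xvec /xeul /euler; case: i => [[|[|[|[|]]]] //= _].
- by apply: polyfunD; [apply: e0 | apply: e1].
- by apply: polyfunB; [apply: polyfunM (polyfunC _ _) _; apply: e1 | apply: e0].
- by apply: polyfunD; [apply: e0 | apply: e1].
- by apply: polyfunB; [apply: polyfunM (polyfunC _ _) _; apply: e1 | apply: e0].
Qed.

Lemma polyfun_Geval (s : K -> F) (b : 'I_4 -> V -> F) j : (forall i, polyfun (b i)) ->
  polyfun (fun x => Geval s (b^~ x) (v^~ x) j).
Proof.
move=> pb; apply: polyfunM; last exact: polyfun_nvec.
apply: polyfun_ext (polyfun_mmap s (u := concat8 (fun i x => b i x ^+ 3) (fun i x => xvec (v^~ x) i * others (b^~ x) i)) (f j) _).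
  by move=> x; congr mpoly.mmap; apply/funext => i; rewrite /concat8; case: ifP.
move=> i; rewrite /concat8; case: ifP => _; first exact: polyfunX.
by apply: polyfunM; [apply: polyfun_xvec | apply: polyfun_prod].
Qed.

End Poly.

Lemma nq_rmorph (A B : comPzRingType) (s : {rmorphism A -> B}) x y : s (nq x y) = nq (s x) (s y).
Proof. by rewrite /nq rmorphD rmorphB !rmorphXn rmorphM. Qed.

Lemma gam0_rmorph (A B : comPzRingType) (s : {rmorphism A -> B}) a b c e :
  s (gam0 a b c e) = gam0 (s a) (s b) (s c) (s e).
Proof. by rewrite /gam0 rmorphD !rmorphM !nq_rmorph. Qed.

Lemma gam1_rmorph (A B : comPzRingType) (s : {rmorphism A -> B}) a b c e :
  s (gam1 a b c e) = gam1 (s a) (s b) (s c) (s e).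
Proof. by rewrite /gam1 rmorphD !rmorphM !nq_rmorph. Qed.

Lemma xvec_rmorph (A B : comPzRingType) (s : {rmorphism A -> B}) (v : 'I_4 -> A) i :
  s (xvec v i) = xvec (fun i => s (v i)) i.
Proof.
have e0 a b c e : s (eul0 a b c e) = eul0 (s a) (s b) (s c) (s e).
  by rewrite /eul0 rmorphD !rmorphM rmorphB.
have e1 a b c e : s (eul1 a b c e) = eul1 (s a) (s b) (s c) (s e).
  by rewrite /eul1 rmorphB !rmorphM.
rewrite /xvec /xeul /euler.
case: i => [[|[|[|[|]]]] //= _].
- by rewrite rmorphD e0 e1 gam0_rmorph gam1_rmorph.
- by rewrite rmorphB rmorphM rmorph_nat e0 e1 gam0_rmorph gam1_rmorph.
- by rewrite rmorphD e0 e1 gam0_rmorph gam1_rmorph.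
- by rewrite rmorphB rmorphM rmorph_nat e0 e1 gam0_rmorph gam1_rmorph.
Qed.

Lemma Geval_rmorph (A : comNzRingType) (s : {rmorphism K -> A}) (b v : 'I_4 -> K) j :
  s (Geval idfun b v j) = Geval s (fun i => s (b i)) (fun i => s (v i)) j.
Proof.
rewrite /Geval rmorphM [s (mpoly.mmap _ _ _)]mmap_rmorph; congr (_ * _); last first.
by rewrite /nvec nq_rmorph gam0_rmorph gam1_rmorph.
congr mpoly.mmap; apply/funext => i; rewrite /concat8; case: ifP => _; first by rewrite rmorphXn.
rewrite rmorphM /others rmorph_prod; congr (_ * _).
exact: xvec_rmorph.
Qed.

(** With cube roots b_i of the a_i, the vector b_i x_i lies on the Fermat cubic and is returned by
    Euler's map up to a scalar, so the evaluated point is a rescaling of (a, x). The last two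
    hypotheses make the scalar nonzero, by [gam0_factor]. *)
Lemma Geval_neq0 (A : fieldType) (s : {rmorphism K -> A}) (a x b : 'I_4 -> A) j :
  3%:R != 0 :> A -> \sum_i a i * x i ^+ 3 = 0 -> mpoly.mmap s (concat8 a x) (f j) != 0 ->
  (forall i, b i ^+ 3 = a i) -> (forall i, a i != 0) -> a 0 * x 0 ^+ 3 + a 1 * x 1 ^+ 3 != 0 ->
  a 0 * a (inord 3) * (x 0 * x (inord 3)) ^+ 3 != a 1 * a (inord 2) * (x 1 * x (inord 2)) ^+ 3 ->
  Geval s b (fun i => b i * x i) j != 0.
Proof.
move=> c3 S f0 bE a0 h1 h2; set y := fun i => b i * x i.
have yE i : y i ^+ 3 = a i * x i ^+ 3 by rewrite exprMn bE.
have S3 : y 0 ^+ 3 + y 1 ^+ 3 + y (inord 2) ^+ 3 + y (inord 3) ^+ 3 = 0.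
  by rewrite !yE -S sum4.
have b0 i : b i != 0 by apply: contraNneq (a0 i) => z; rewrite -bE z expr0n.
set c := gam0 (y 0) (y 1) (y (inord 2)) (y (inord 3)).
have c0 : c != 0.
  have := gam0_factor S3; rewrite -/c => E; apply: contraTneq isT => z.
  have : (y 0 ^+ 3 + y 1 ^+ 3) * (y 0 * y (inord 3) - y 1 * y (inord 2)) = 0 by rewrite -E z mul0r.
  move/eqP; rewrite mulf_eq0 !yE (negPf h1) /= subr_eq0 => /eqP e.
  case/eqP: h2; have := congr1 (fun t => t ^+ 3) e; rewrite /y !exprMn !bE => E'.
  by transitivity (a 0 * x 0 ^+ 3 * (a (inord 3) * x (inord 3) ^+ 3)); [ring | rewrite E'; ring].
have xE i : xvec y i = 3%:R * c * y i.
  rewrite /xvec xeul_of_cubes //; congr (_ * _).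
  case: i => [[|[|[|[|]]]] //= h]; congr y; apply: val_inj; by rewrite /= ?inordK.
have c1 : gam1 (y 0) (y 1) (y (inord 2)) (y (inord 3)) = - c.
  apply/eqP; rewrite -subr_eq0 opprK -S3 /c /gam0 /gam1 /nq; apply/eqP; ring.
rewrite /Geval mulf_neq0 //; last first.
  rewrite /nvec c1 -/c /nq (_ : _ + _ = 3%:R * c ^+ 2) ?mulf_neq0 ?expf_neq0 //; ring.
set M := 3%:R * c * \prod_i b i.
have M0 : M != 0 by rewrite mulf_neq0 ?mulf_neq0 //; apply/prodf_neq0.
rewrite (@mmap_ext _ _ _ _ (concat8 (fun i => 1 * a i) (fun i => M * x i))).
  by rewrite (mmap_bihomog _ _ _ _ _ (@Hf j)) expr1n mul1r mulf_neq0 ?expf_neq0.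
move=> i; rewrite /concat8; case: ifP => _; first by rewrite bE mul1r.
by rewrite xE /M (bigD1 (inord (i - 4) : 'I_4)) //= /y /others; ring.
Qed.

Lemma Geval_nonzero_nat (A : numFieldType) (s : {rmorphism K -> A}) (b v : 'I_4 -> A) j :
  Geval s b v j != 0 -> (forall i, b i != 0) ->
  exists b' v' : 'I_4 -> nat, (forall i, (0 < b' i)%N) /\ Geval s (fun i => (b' i)%:R) (fun i => (v' i)%:R) j != 0.
Proof.
move=> G0 b0.
pose lo (i : 'I_4) : 'I_8 := inord i; pose hi (i : 'I_4) : 'I_8 := inord (4 + i).
pose F (u : 'rV[A]_8) := Geval s (fun i => u 0 (lo i)) (fun i => u 0 (hi i)) j * \prod_i u 0 (lo i).
have [D HD] : polyfun F.
  apply: polyfunM; last by apply: polyfun_prod => i; apply: polyfun_coord.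
  by apply: polyfun_Geval => i; apply: polyfun_coord.
pose t0 := [seq concat8 b v i | i <- enum 'I_8].
have st0 : size t0 = 8 by rewrite size_map size_enum_ord.
have e8 (i : 'I_8) : t0`_i = concat8 b v i.
  by rewrite (nth_map i) ?size_enum_ord // nth_ord_enum.
have lov (i : 'I_4) : (lo i : nat) = i by rewrite inordK // (leq_trans (ltn_ord i)).
have hiv (i : 'I_4) : (hi i : nat) = (4 + i)%N by rewrite inordK // ltn_add2l.
have [|||ms sm hms] := nonzero_at_nat (ws := [seq delta_mx 0 i | i <- enum 'I_8]) (u := 0) (t0 := t0) _ HD.
- by move=> k k0; rewrite pnatr_eq0 -lt0n.
- by rewrite st0 size_map size_enum_ord.
- rewrite add0r comb_delta // /F.
  have E1 : (fun i => (\row_(k < 8) t0`_k) 0 (lo i)) = b.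
    by apply/funext => i; rewrite mxE e8 /concat8 lov ltn_ord; congr b; apply: val_inj; rewrite /= inordK.
  have E2 : (fun i => (\row_(k < 8) t0`_k) 0 (hi i)) = v.
    apply/funext => i; rewrite mxE e8 /concat8 hiv.
    have -> : (4 + i < 4)%N = false by rewrite ltnNge leq_addr.
    by rewrite addKn; congr v; apply: val_inj; rewrite /= inordK.
  rewrite E1 E2 mulf_neq0 //; apply/prodf_neq0 => i _.
  by rewrite -[X in X != 0]/((fun i => (\row_(k < 8) t0`_k) 0 (lo i)) i) E1.
rewrite size_map size_enum_ord in sm.
rewrite add0r comb_delta ?size_map // /F mulf_eq0 negb_or in hms.
have E (i : 'I_8) : (\row_(k < 8) [seq (m%:R : A) | m <- ms]`_k) 0 i = (nth 0%N ms i)%:R.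
  by rewrite mxE (nth_map 0%N) ?sm.
have [h1 /prodf_neq0 h2] := andP hms.
exists (fun i => nth 0%N ms (lo i)), (fun i => nth 0%N ms (hi i)); split.
  by move=> i; have := h2 i isT; rewrite E pnatr_eq0 lt0n.
rewrite (_ : (fun i => (nth 0%N ms (lo i))%:R) = (fun i => (\row_(k < 8) [seq (m%:R : A) | m <- ms]`_k) 0 (lo i))).
  rewrite (_ : (fun i => (nth 0%N ms (hi i))%:R) = (fun i => (\row_(k < 8) [seq (m%:R : A) | m <- ms]`_k) 0 (hi i))) //.
  by apply/funext => i; rewrite E.
by apply/funext => i; rewrite E.
Qed.

(** A curve on Y joins the given complex point, where f_j is nonzero, to an explicit point where the
    genericity conditions hold. Both are polynomial conditions along the curve, so some point
    satisfies them together; this takes the place of irreducibility of Y. Complex values are then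
    replaced by natural numbers. *)
Lemma generic_fibre : open_dense R f -> exists j (b : 'I_4 -> nat), (forall i, (0 < b i)%N) /\
  exists v : 'I_4 -> K, Geval idfun (fun i => (b i)%:R : K) v j != 0.
Proof.
move=> [s0 [s0E [a [x [_ [[i0 xi0] [S [j fj]]]]]]]].
have [s Es] := embedding_rmorph s0E.
have {s0 s0E Es} fj : mpoly.mmap s (concat8 a x) (f j) != 0 by rewrite (_ : mpoly.mmap s = mpoly.mmap s0) // (funext Es).
exists j.
(* These coefficients sum to 0, so (1, 1, 1, 1) lies on the fibre. The other conditions hold as 1 +
   2 = 3 and 1 * (-6) - 2 * 3 = -12 are nonzero. *)
pose a' (i : 'I_4) : L := [:: 1; 2%:R; 3%:R; - 6%:R]`_i.
pose X (t : L) i := (1 - t) * x i + t.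
pose Al (t : L) i := (1 - t) * a i + t * a' i.
pose Sm (t : L) := \sum_k Al t k * X t k ^+ 3.
(* Straight interpolation leaves Y; the equation is linear in a, so correcting the coefficient at
   i0, where x is nonzero, and clearing X t i0 ^ 3 brings the curve back to Y. *)
pose at_ (t : L) i := X t i0 ^+ 3 * Al t i - (i == i0)%:R * Sm t.
have pid : polyfun (fun t : L^o => t : L) := polyfun_linear (idfun : {linear L^o -> L^o}).
have p1t : polyfun (fun t : L^o => 1 - (t : L)) by apply: polyfunB => //; apply: polyfunC.
have pX i : polyfun (fun t : L^o => X t i) by apply: polyfunD => //; apply: polyfunM => //; apply: polyfunC.
have pA i : polyfun (fun t : L^o => Al t i) by apply: polyfunD; apply: polyfunM => //; apply: polyfunC.
have pS : polyfun (fun t : L^o => Sm t) by apply: polyfun_sum => i; apply: polyfunM => //; apply: polyfunX.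
have pat i : polyfun (fun t : L^o => at_ t i).
  apply: polyfunB; apply: polyfunM => //; first exact: polyfunX.
  exact: polyfunC.
pose h1 (t : L^o) := mpoly.mmap s (concat8 (at_ t) (X t)) (f j).
pose h2 (t : L^o) := (\prod_i at_ t i) * (at_ t 0 * X t 0 ^+ 3 + at_ t 1 * X t 1 ^+ 3) *
  (at_ t 0 * at_ t (inord 3) * (X t 0 * X t (inord 3)) ^+ 3 - at_ t 1 * at_ t (inord 2) * (X t 1 * X t (inord 2)) ^+ 3).
have ph1 : polyfun h1.
  apply: polyfun_ext (polyfun_mmap s (u := concat8 (fun i (t : L^o) => at_ t i) (fun i (t : L^o) => X t i)) (f j) _).
    by move=> t; congr mpoly.mmap; apply/funext => i; rewrite /concat8; case: ifP.
  by move=> i; rewrite /concat8; case: ifP.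
have ph2 : polyfun h2.
  apply: polyfunM; first apply: polyfunM.
  - exact: polyfun_prod.
  - by apply: polyfunD; apply: polyfunM => //; apply: polyfunX.
  - apply: polyfunB; apply: polyfunM; try (by apply: polyfunM); apply: polyfunX; exact: polyfunM.
have h10 : h1 0 != 0.
  have eX : X 0 = x by apply/funext => i; rewrite /X; ring.
  have eA : Al 0 = a by apply/funext => i; rewrite /Al; ring.
  have eS : Sm 0 = 0 by rewrite /Sm eX eA.
  rewrite /h1 (@mmap_ext _ _ _ _ (concat8 (fun i => x i0 ^+ 3 * a i) (fun i => 1 * x i))).
    by rewrite (mmap_bihomog _ _ _ _ _ (@Hf j)) expr1n mulr1 mulf_neq0 ?expf_neq0.
  by move=> i; rewrite /concat8; case: ifP => _; rewrite ?eX ?mul1r // /at_ eS eA eX mulr0 subr0.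
have h21 : h2 1 != 0.
  have eX i : X 1 i = 1 by rewrite /X; ring.
  have eA i : Al 1 i = a' i by rewrite /Al; ring.
  have eS : Sm 1 = 0.
    rewrite /Sm (eq_bigr a') => [|i _]; last by rewrite eX eA expr1n mulr1.
    by rewrite sum4 /a' /= !inordK //=; ring.
  have ea i : at_ 1 i = a' i by rewrite /at_ eS eX eA; ring.
  have -> : h2 1 = (\prod_i a' i) * 3%:R * (- 12%:R).
    rewrite /h2; congr (_ * _ * _); first by apply: eq_bigr => i _.
      by rewrite !eX !ea /a' /=; ring.
    by rewrite !eX !ea /a' /= !inordK //=; ring.
  rewrite !mulf_neq0 ?oppr_eq0 ?pnatr_eq0 //; apply/prodf_neq0 => -[[|[|[|[|]]]] //= h] _;
    by rewrite /a' /= ?oppr_eq0 ?pnatr_eq0 ?oner_eq0.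
have [t [f1]] := polyfun_mul_nonzero ph1 ph2 h10 h21.
rewrite /h2 !mulf_eq0 !negb_or subr_eq0 => /andP [/andP [/prodf_neq0 q1 q2] q3].
have Sat : \sum_i at_ t i * X t i ^+ 3 = 0.
  transitivity (\sum_i (X t i0 ^+ 3 * (Al t i * X t i ^+ 3) - (i == i0)%:R * (Sm t * X t i ^+ 3))).
    by apply: eq_bigr => i _; rewrite /at_; ring.
  have Z : \sum_(i | i != i0) (i == i0)%:R * (Sm t * X t i ^+ 3) = 0.
    by apply: big1 => i ni; rewrite (negPf ni) mul0r.
  rewrite big_split /= -mulr_sumr sumrN [X in _ - X](bigD1 i0) //= eqxx mul1r Z addr0.
  by rewrite -/(Sm t); ring.
have three : 3%:R != 0 :> L by rewrite pnatr_eq0.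
have bE i : (3.-root (at_ t i)) ^+ 3 = at_ t i by apply: rootCK.
have at0 i : at_ t i != 0 by apply: q1.
have G0 := Geval_neq0 three Sat f1 bE at0 q2 q3.
have [|b [v [bp Gn]]] := Geval_nonzero_nat G0.
  by move=> i; apply: contraNneq (at0 i) => z; rewrite -bE z expr0n.
exists b; split=> //; exists (fun i => (v i)%:R); apply: contraNneq Gn => z.
have := Geval_rmorph s (fun i => (b i)%:R) (fun i => (v i)%:R) j; rewrite z rmorph0 => e.
have E (u : 'I_4 -> nat) : (fun i => s (u i)%:R) = (fun i => (u i)%:R) by apply/funext => i; rewrite rmorph_nat.
by rewrite -!E -e.
Qed.

End Density.

(** * Counting torsor points *)

Section Torsor.
Variables (R : realType) (F : fieldType) (O : subringClosed F).
Variables (nrm : F -> R) (box : R -> seq F) (n : nat) (C : R).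
Hypothesis HO : is_order O nrm box n C.
Variable w : F.
Hypothesis wP : w ^+ 2 + w + 1 = 0.
Hypothesis wO : w \in O.
Local Notation cop := (cop O).
Local Notation dv := (dv O).
Local Notation cf := (cf w).

Let C1 : 1 <= C := order_const HO.
Let C0 : 0 < C := lt_le_trans ltr01 C1.
Let n0 := nrm_ge0 HO.

Lemma three_neq0 : 3%:R != 0 :> F. Proof. exact: (natF_neq0 HO). Qed.

(** A vector on which the five forms are nonzero: they take the values 6, w + 5, 4 - w, 1, 5, and
    the second and third have product 21. *)
Definition v5 : F * F := (1, 5%:R).

Lemma v5O : v5.1 \in O /\ v5.2 \in O. Proof. by rewrite rpred1 rpred_nat. Qed.

Lemma v5P i : ell cf i v5 != 0.
Proof.
have nz k : (0 < k)%N -> k%:R != 0 :> F := natF_neq0 HO (k := k).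
have E : (w + 5%:R) * (-1 - w + 5%:R) = 21%:R.
  by transitivity (21%:R - (w ^+ 2 + w + 1)); [ring | rewrite wP subr0].
have /negbTE h21 := nz 21 isT; have := h21; rewrite -E => /negbT; rewrite mulf_eq0 negb_or => /andP [h1 h2].
case: i => [[|[|[|[|[|]]]]] //= h]; rewrite /ell /cf /v5 /= ?mul1r ?mulr1 ?mul0r ?addr0 ?add0r ?oner_eq0 //.
- have -> : (1 : F) + 5%:R = 6%:R by ring.
  exact: nz.

- exact: nz.
Qed.

Definition eta5 : R := (1 + \sum_i 2 * ((nrm (cf i).1 + nrm (cf i).2) * nrm (ell cf i v5)^-1))^-1.

Lemma eta5_term i : 0 <= (nrm (cf i).1 + nrm (cf i).2) * nrm (ell cf i v5)^-1.
Proof. by rewrite mulr_ge0 ?addr_ge0 ?n0. Qed.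

Lemma eta5_gt0 : 0 < eta5.
Proof. by rewrite invr_gt0 ltr_wpDr // sumr_ge0 // => i _; rewrite mulr_ge0 ?eta5_term. Qed.

Lemma eta5P i : eta5 * (nrm (cf i).1 + nrm (cf i).2) * nrm (ell cf i v5)^-1 <= 2^-1.
Proof.
have [Q EQ] : exists Q, Q = 1 + \sum_i 2 * ((nrm (cf i).1 + nrm (cf i).2) * nrm (ell cf i v5)^-1) by eexists.
have tQ : 2 * ((nrm (cf i).1 + nrm (cf i).2) * nrm (ell cf i v5)^-1) + 1 <= Q.
  rewrite EQ addrC lerD2l (bigD1 i) //= lerDl sumr_ge0 // => j _.
  by rewrite mulr_ge0 ?eta5_term.
have t0 := eta5_term i; rewrite -mulrA /eta5 -EQ.
have [t Et] : exists t, t = (nrm (cf i).1 + nrm (cf i).2) * nrm (ell cf i v5)^-1 by eexists.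
rewrite -Et in t0 tQ *.
have Q0 : 0 < Q by lra.
by rewrite mulrC ler_pdivrMr //; lra.
Qed.

Definition lam5 (g : 'I_5 -> F) (S : R) := lam O nrm box cf v5 eta5 g S.

Lemma lam5E g S : lam5 g S = lam O nrm box cf v5 eta5 g S. Proof. by []. Qed.

Let Kb := ellK HO v5P eta5_gt0 eta5P.
Definition K5 : R := Kb + 1 + \sum_i 2 * nrm (ell cf i v5)^-1.

Lemma K5_ge : Kb <= K5 /\ 1 <= K5.
Proof.
have k0 : 0 <= Kb by apply: ellK_ge0.
have s0 : 0 <= \sum_i 2 * nrm (ell cf i v5)^-1 by apply: sumr_ge0 => i _; rewrite mulr_ge0.
by rewrite /K5; split; lra.
Qed.

Lemma lam5P g S s : 1 <= S -> s \in lam5 g S ->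
  [/\ s.1 \in O, s.2 \in O, forall i, ell cf i s / g i \in O &
   forall i, [/\ ell cf i s != 0, nrm (ell cf i s) <= K5 * S & nrm (ell cf i s)^-1 <= K5 / S]].
Proof.
move=> S1; have S0 : 0 < S := lt_le_trans ltr01 S1.
move/(lamE HO _ _ _ _ _ (ltW S0)) => [s1 s2 [m nm] sg]; split=> // i.
have [z1 z2 _] := ellKP HO v5P eta5_gt0 eta5P i S1 nm.
have [kb k1] := K5_ge.
split=> //; first by apply: le_trans z2 _; rewrite ler_wpM2r ?(ltW S0).
case: nm => m1 m2 h1 h2.
have b : nrm (ell cf i s - m%:R * ell cf i v5) <= (eta5 * (nrm (cf i).1 + nrm (cf i).2)) * S.
  have -> : ell cf i s - m%:R * ell cf i v5 = (cf i).1 * (s.1 - m%:R * v5.1) + (cf i).2 * (s.2 - m%:R * v5.2).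
    by rewrite /ell; ring.
  apply: le_trans (nrmD HO _ _) _; apply: le_trans (lerD (nrmM HO _ _) (nrmM HO _ _)) _.
  apply: le_trans (lerD (ler_wpM2l (n0 _) h1) (ler_wpM2l (n0 _) h2)) _.
  by rewrite le_eqVlt; apply/predU1P; left; ring.
have [_ _ h] := near_bal HO S0 (v5P i) m1 m2 b (eta5P i).
apply: le_trans h _; rewrite ler_wpM2r ?invr_ge0 ?(ltW S0) // /K5 (bigD1 i) //=.
rewrite addrCA lerDl addr_ge0 ?sumr_ge0 // => [|j _]; last by rewrite mulr_ge0.
by rewrite addr_ge0 //; apply: ellK_ge0.
Qed.

Lemma ell3 s : ell cf (inord 3) s = s.1.
Proof. by rewrite /ell /cf inordK //=; ring. Qed.
Lemma ell4 s : ell cf (inord 4) s = s.2.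
Proof. by rewrite /ell /cf inordK //=; ring. Qed.
Lemma ellZ i l s s' : s'.1 = l * s.1 -> s'.2 = l * s.2 -> ell cf i s' = l * ell cf i s.
Proof. by move=> e1 e2; rewrite /ell e1 e2; ring. Qed.

(** The triple (g, s, p). *)
Definition data := ({ffun 'I_5 -> F} * (F * F) * (F * F))%type.

Definition dgood (T : nat) (d : data) := [/\ cop T d.1.2.1 d.1.2.2, cop T d.2.1 d.2.2 &
  forall i, cop T (ell cf i d.1.2 / d.1.1 i) (ell cf (tau i) d.2 / d.1.1 i)].

Definition dsize (Kg : R) (G : 'I_5 -> R) (S P : R) (d : data) :=
  [/\ gdata O nrm Kg G d.1.1, d.1.2 \in lam5 d.1.1 S & d.2 \in lam5 (fun i => d.1.1 (tau i)) P].

Lemma ratio_int1 T (s s' : F * F) (l : F) : s'.1 \in O -> s'.2 \in O ->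
  cop T s.1 s.2 -> s'.1 = l * s.1 -> s'.2 = l * s.2 -> T%:R * l \in O.
Proof.
move=> h1 h2 [u [v [uO vO <-]]] e1 e2.
have -> : (s.1 * u + s.2 * v) * l = s'.1 * u + s'.2 * v by rewrite e1 e2; ring.
by apply: rpredD; apply: rpredM.
Qed.

(** The x and y are the cofactors of one g_i in its two forms, and r is the ratio of two possible
    g_i. Coprimality of the cofactors makes g_i a greatest common divisor up to constants, which
    bounds r. *)
Lemma ratio_int2 T (x y x' y' l m r : F) : cop T x y -> l != 0 -> m != 0 -> r != 0 ->
  x' \in O -> y' \in O -> x' * r = l * x -> y' * r = m * y ->
  T%:R * l \in O -> T%:R * m \in O -> T%:R / l \in O -> T%:R / m \in O -> (T ^ 4)%:R / r \in O.
Proof.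
move=> [u [v [uO vO e]]] l0 m0 r0 xO yO ex ey lO mO lO' mO'.
have -> : (T ^ 4)%:R / r = T%:R / l * (T%:R / m) * (u * (T%:R * m) * x' + v * (T%:R * l) * y').
  have -> : x' = l * x / r by rewrite -ex mulfK.
  have -> : y' = m * y / r by rewrite -ey mulfK.
  rewrite natrX; transitivity (T%:R ^+ 3 * (x * u + y * v) / r); first by rewrite e; field.
  by field; rewrite r0 l0 m0.
apply: rpredM; first by apply: rpredM.
by apply: rpredD; apply: rpredM => //; apply: rpredM.
Qed.

Lemma nrm_quot (x y : F) (K A B : R) : 0 <= K -> 0 < B -> nrm x <= K * A -> nrm y^-1 <= K / B ->
  nrm (x / y) <= K * K * (A / B).
Proof.
move=> K0 B0 hx hy; apply: le_trans (nrmM HO _ _) _.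
by apply: le_trans (ler_pM (n0 _) (n0 _) hx hy) _; rewrite le_eqVlt; apply/predU1P; left; ring.
Qed.

Lemma quot_scale (x y : F) (K A B : R) (T : nat) : 0 <= K -> 0 < A -> 0 < B -> x != 0 -> y != 0 ->
  nrm x^-1 <= K / A -> nrm y <= K * B -> (0 < T)%N -> T%:R / (x / y) \in O -> A <= T%:R * (K * K) * B.
Proof.
move=> K0 A0 B0 x0 y0 hx hy T0 h.
have nz : T%:R / (x / y) != 0 by rewrite mulf_neq0 ?invr_neq0 ?mulf_neq0 ?invr_neq0 ?(natF_neq0 HO).
have := nrm_int HO h nz; rewrite (nrmZ HO) invfM invrK mulrC => h1.
have h2 := nrm_quot K0 A0 hy hx.
have h3 : 1 <= T%:R * (K * K * (B / A)).
  by apply: le_trans h1 _; rewrite [x^-1 * y]mulrC [leLHS]mulrC ler_wpM2l.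
have h4 := ler_wpM2l (ltW A0) h3; rewrite mulr1 in h4; apply: le_trans h4 _.
by rewrite le_eqVlt; apply/predU1P; left; field; rewrite gt_eqF.
Qed.

Lemma data_ratio T Kg G S P G' S' P' (d d' : data) (l m : F) : (0 < T)%N -> 1 <= S -> 1 <= P -> 1 <= S' -> 1 <= P' ->
  dsize Kg G S P d -> dsize Kg G' S' P' d' -> dgood T d -> dgood T d' -> l != 0 -> m != 0 ->
  d'.1.2.1 = l * d.1.2.1 -> d'.1.2.2 = l * d.1.2.2 -> d'.2.1 = m * d.2.1 -> d'.2.2 = m * d.2.2 ->
  [/\ T%:R * l \in O, T%:R / l \in O, T%:R * m \in O, T%:R / m \in O &
    forall i, (T ^ 4)%:R / (d'.1.1 i / d.1.1 i) \in O].
Proof.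
case: d => -[g s] p; case: d' => -[g' s'] p' /= T0 S1 P1 S1' P1' [/= gd sl pl] [/= gd' sl' pl'] [/= cs cp cx] [/= cs' cp' cx'] l0 m0 e1 e2 e3 e4.
have [sO1 sO2 sx sb] := lam5P S1 sl; have [sO1' sO2' sx' sb'] := lam5P S1' sl'.
have [pO1 pO2 px pb] := lam5P P1 pl; have [pO1' pO2' px' pb'] := lam5P P1' pl'.
have v x y (z : F) : z != 0 -> y = z * x -> x = z^-1 * y by move=> z0 ->; rewrite mulKf.
have h1 := ratio_int1 sO1' sO2' cs e1 e2.
have h2 := ratio_int1 sO1 sO2 cs' (v _ _ _ l0 e1) (v _ _ _ l0 e2).
have h3 := ratio_int1 pO1' pO2' cp e3 e4.
have h4 := ratio_int1 pO1 pO2 cp' (v _ _ _ m0 e3) (v _ _ _ m0 e4).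
split=> // i; have [_ _ g0 _ _] := gd i; have [_ _ g0' _ _] := gd' i.
apply: (ratio_int2 (cx i) l0 m0 _ (sx' i) (x' := _) (y' := ell cf (tau i) p' / g' i) _ _ _ h1 h3 h2 h4).
- by rewrite mulf_neq0 ?invr_neq0.
- by have := px' (tau i); rewrite tauK.
- by rewrite (ellZ i e1 e2); field; rewrite g0 g0'.
- by rewrite (ellZ (tau i) e3 e4); field; rewrite g0 g0'.
Qed.

Lemma lam5_coord g S s : 1 <= S -> s \in lam5 g S ->
  [/\ s.1 != 0, nrm s.1 <= K5 * S & nrm s.1^-1 <= K5 / S].
Proof. by move=> S1 /(lam5P S1) [_ _ _ /(_ (inord 3))]; rewrite ell3. Qed.

(** Two data over the same point differ by scalars l, m and ratios of the g_i; by [data_ratio] these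
    and their inverses are integral up to T or T^4. This bounds the quotients of the sizes, so the
    index k is determined, and then leaves finitely many ratios. *)
Theorem class_count (T : nat) (Kg : R) : (0 < T)%N -> 1 <= Kg -> exists (kap : R) (M : nat), 1 <= kap /\
  forall (U X : eqType) (ks : seq U) (G : U -> 'I_5 -> R) (S P : U -> R) (D : U -> seq data)
    (phi : data -> X) (Zs : seq X), uniq ks ->
  (forall k, k \in ks -> [/\ 1 <= S k, 1 <= P k, uniq (D k) & forall d, d \in D k ->
      [/\ dsize Kg (G k) (S k) (P k) d, dgood T d & phi d \in Zs]]) ->
  (forall k k', k \in ks -> k' \in ks -> S k <= kap * S k' -> S k' <= kap * S k ->
     (forall i, G k i <= kap * G k' i) -> (forall i, G k' i <= kap * G k i) -> k = k') ->
  (forall k k' d d', k \in ks -> k' \in ks -> d \in D k -> d' \in D k' -> phi d = phi d' -> exists l m, [/\ l != 0, m != 0,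
      d'.1.2.1 = l * d.1.2.1 /\ d'.1.2.2 = l * d.1.2.2 & d'.2.1 = m * d.2.1 /\ d'.2.2 = m * d.2.2]) ->
  (\sum_(k <- ks) size (D k) <= M * size Zs)%N.
Proof.
move=> T0 Kg1; have Kg0 : 0 <= Kg := le_trans ler01 Kg1.
have [_ k51] := K5_ge; have k50 : 0 <= K5 := le_trans ler01 k51.
have T1 : 1 <= T%:R :> R by rewrite ler1n.
have T41 : 1 <= (T ^ 4)%:R :> R by rewrite ler1n expn_gt0 T0.
have [Ka Ea] : exists x, x = T%:R * (K5 * K5) by eexists.
have [Kc Ec] : exists x, x = (T ^ 4)%:R * (Kg * Kg) by eexists.
have Ka1 : 1 <= Ka by rewrite Ea mulr_ege1 // mulr_ege1.
have Kc1 : 1 <= Kc by rewrite Ec mulr_ege1 // mulr_ege1.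
have Ka0 : 0 <= Ka := le_trans ler01 Ka1.
have Kc0 : 0 <= Kc := le_trans ler01 Kc1.
(* Boxes for the code of a datum relative to a fixed one: T l, T m and the five T^4 g_i / g0_i. *)
pose fs := [:: box Ka; box Ka; box Kc; box Kc; box Kc; box Kc; box Kc].
exists (Ka + Kc), (\prod_(s <- fs) size s)%N; split; first by lra.
move=> U X ks G S P D phi Zs uks HD sep Hphi.
pose al := [seq ((k, d) : U * data) | k <- ks, d <- D k].
have ual : uniq al.
  apply: allpairs_uniq_dep => //; first by move=> k /HD [].
  by move=> [k d] [k' d'] _ _ /= [-> ->].
have alP k d : (k, d) \in al -> k \in ks /\ d \in D k.
  by move/allpairsPdep => [k1 [d1 [h1 h2 [-> ->]]]].
have szal : (\sum_(k <- ks) size (D k) = size al)%N by rewrite size_allpairs_dep sumnE big_map.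
rewrite szal; case E : al => [//|x0 al0]; rewrite -E.
have [||u Hu] := pigeonhole_fibre (s := al) (f := fun x => phi x.2) (t := Zs).
- by rewrite E.
- by move=> [k d] /alP [kk dD]; have [_ _ _ /(_ d dD) []] := HD k kk.
apply: leq_trans Hu _; rewrite mulnC leq_mul2r -tup_size -size_filter; apply/orP; right.
set fb := seq.filter _ _; case Ef : fb => [//|[k0 d0] fb0].
have : (k0, d0) \in fb by rewrite Ef mem_head.
rewrite mem_filter => /andP [/eqP phi0 /alP [kk0 dD0]].
have [S01 P01 _ /(_ d0 dD0) [sz0 gd0 _]] := HD k0 kk0.
have S00 := lt_le_trans ltr01 S01; have P00 := lt_le_trans ltr01 P01.
pose enc (x : U * data) : seq F := [:: T%:R * (x.2.1.2.1 / d0.1.2.1), T%:R * (x.2.2.1 / d0.2.1) &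
   [seq (T ^ 4)%:R * (x.2.1.1 i / d0.1.1 i) | i <- enum 'I_5]].
have key x : x \in fb -> [/\ x.1 = k0, enc x \in tup fs & exists l m, [/\ l = x.2.1.2.1 / d0.1.2.1, m = x.2.2.1 / d0.2.1,
      x.2.1.2.1 = l * d0.1.2.1 /\ x.2.1.2.2 = l * d0.1.2.2 & x.2.2.1 = m * d0.2.1 /\ x.2.2.2 = m * d0.2.2]].
  case: x => k d; rewrite mem_filter /= => /andP [/eqP phid /alP [kk dD]].
  have [S1 P1 _ /(_ d dD) [sz gd _]] := HD k kk.
  have [l [m [l0 m0 [e1 e2] [e3 e4]]]] := Hphi k0 k d0 d kk0 kk dD0 dD (etrans phi0 (esym phid)).
  have S0 := lt_le_trans ltr01 S1; have P0 := lt_le_trans ltr01 P1.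
  have [h1 h2 h3 h4 h5] := data_ratio T0 S01 P01 S1 P1 sz0 sz gd0 gd l0 m0 e1 e2 e3 e4.
  have v x y (z : F) : z != 0 -> y = z * x -> x = z^-1 * y by move=> z0 ->; rewrite mulKf.
  have [_ _ _ _ h6] := data_ratio T0 S1 P1 S01 P01 sz sz0 gd gd0 (invr_neq0 l0) (invr_neq0 m0)
     (v _ _ _ l0 e1) (v _ _ _ l0 e2) (v _ _ _ m0 e3) (v _ _ _ m0 e4).
  have [gda sl pl] := sz; have [gda0 sl0 pl0] := sz0.
  have [a1 a2 a3] := lam5_coord S1 sl; have [b1 b2 b3] := lam5_coord S01 sl0.
  have [c1 c2 c3] := lam5_coord P1 pl; have [f1 f2 f3] := lam5_coord P01 pl0.
  have el : l = d.1.2.1 / d0.1.2.1 by rewrite e1 mulfK.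
  have em : m = d.2.1 / d0.2.1 by rewrite e3 mulfK.
  (* Integrality of T l, T / l and of both T^4-multiples bounds the ratios of S and of the G i in
     both directions; the separation hypothesis concludes. *)
  have kE : k = k0.
    apply: sep => //.
    - have : S k <= T%:R * (K5 * K5) * S k0.
        by apply: (quot_scale k50 S0 S00 a1 b1 a3 b2 T0); rewrite -el.
      by move=> h; apply: le_trans h _; rewrite -Ea ler_wpM2r ?(ltW S00) // lerDl.
    - have : S k0 <= T%:R * (K5 * K5) * S k.
        by apply: (quot_scale k50 S00 S0 b1 a1 b3 a2 T0); rewrite -invf_div -el invrK.
      by move=> h; apply: le_trans h _; rewrite -Ea ler_wpM2r ?(ltW S0) // lerDl.
    - move=> i; have [q1 q2 q3 q4 q5] := gda i; have [r1 r2 r3 r4 r5] := gda0 i.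
      have q0 := lt_le_trans ltr01 q1; have r0 := lt_le_trans ltr01 r1.
      have h : G k i <= (T ^ 4)%:R * (Kg * Kg) * G k0 i.
        apply: (quot_scale Kg0 q0 r0 q3 r3 q5 r4) => //; by rewrite expn_gt0 T0.
      by apply: le_trans h _; rewrite -Ec ler_wpM2r ?(ltW r0) // lerDr.
    - move=> i; have [q1 q2 q3 q4 q5] := gda i; have [r1 r2 r3 r4 r5] := gda0 i.
      have q0 := lt_le_trans ltr01 q1; have r0 := lt_le_trans ltr01 r1.
      have h : G k0 i <= (T ^ 4)%:R * (Kg * Kg) * G k i.
        apply: (quot_scale Kg0 r0 q0 r3 q3 r5 q4) => //; by rewrite expn_gt0 T0.
      by apply: le_trans h _; rewrite -Ec ler_wpM2r ?(ltW q0) // lerDr.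
  subst k; split=> //; last by exists l, m.
  apply/(@tupP F 0 fs); split; first by rewrite /= size_map size_enum_ord.
  have nb (x y : F) (A : R) (K : R) (q : nat) : 0 <= K -> 0 < A -> nrm x <= K * A -> nrm y^-1 <= K / A ->
     nrm (q%:R * (x / y)) <= q%:R * (K * K).
    move=> K0 A0 hx hy; rewrite (nrmZ HO) ler_wpM2l //.
    by have := nrm_quot K0 A0 hx hy; rewrite divff ?mulr1 // gt_eqF.
  have B1 : T%:R * (d.1.2.1 / d0.1.2.1) \in box Ka.
    by rewrite (boxE HO) -el h1 el Ea; apply: (nb _ _ (S k0)).
  have B2 : T%:R * (d.2.1 / d0.2.1) \in box Ka.
    by rewrite (boxE HO) -em h3 em Ea; apply: (nb _ _ (P k0)).
  have B3 i : (T ^ 4)%:R * (d.1.1 i / d0.1.1 i) \in box Kc.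
    have [q1 q2 q3 q4 q5] := gda i; have [r1 r2 r3 r4 r5] := gda0 i.
    rewrite (boxE HO) Ec (nb _ _ (G k0 i)) // ?(lt_le_trans ltr01 q1) // andbT.
    by have := h6 i; rewrite invf_div.
  have nE (j : nat) : (j < 5)%N -> nth 0 [seq (T ^ 4)%:R * (d.1.1 i / d0.1.1 i) | i <- enum 'I_5] j \in box Kc.
    by move=> j5; rewrite (nth_map (Ordinal j5)) ?size_enum_ord // nth_enum_ord.
  by case=> [|[|[|[|[|[|[|//]]]]]]] _; rewrite ?B1 ?B2 //=; [exact: (nE 0)|exact: (nE 1)|exact: (nE 2)|exact: (nE 3)|exact: (nE 4)].
rewrite -Ef -(size_map enc); apply: uniq_leq_size; last first.
  by move=> _ /mapP [x xf ->]; have [] := key x xf.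
rewrite map_inj_in_uniq; first by rewrite filter_uniq.
move=> [k [[g s] p]] [k' [[g' s'] p']] /key [/= -> _ [l [m [el em [e1 e2] [e3 e4]]]]] /key [/= -> _ [l' [m' [el' em' [e1' e2'] [e3' e4']]]]].
have Tn : T%:R != 0 :> F by apply: (natF_neq0 HO).
have T4n : (T ^ 4)%:R != 0 :> F by apply: (natF_neq0 HO); rewrite expn_gt0 T0.
rewrite /enc /= => -[/(mulfI Tn) E1 /(mulfI Tn) E2 /eq_in_map E3].
have ll : l = l' by rewrite el E1 el'.
have mm : m = m' by rewrite em E2 em'.
have -> : s = s' by case: (s) (s') e1 e2 e1' e2' => a b [c e] /= -> -> -> ->; rewrite ll.
have -> : p = p' by case: (p) (p') e3 e4 e3' e4' => a b [c e] /= -> -> -> ->; rewrite mm.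
have -> // : g = g'.
apply/ffunP => i; have [/(_ i) [_ _ g0 _ _] _ _] := sz0.
have := E3 i (mem_enum _ i); rewrite /= => /(mulfI T4n) /(congr1 ( *%R^~ (d0.1.1 i))).
by rewrite !divfK.
Qed.

End Torsor.

(** * Coprimality of g with s, and the size of the coordinates *)

Section TorsorCount.
Variables (R : realType) (F : fieldType) (O : subringClosed F).
Variables (nrm : F -> R) (box : R -> seq F) (n : nat) (C : R).
Hypothesis HO : is_order O nrm box n C.
Variable w : F.
Hypothesis wP : w ^+ 2 + w + 1 = 0.
Hypothesis wO : w \in O.
Local Notation cop := (cop O).
Local Notation cf := (cf w).
Local Notation lam5 := (lam5 O nrm box w).
Local Notation x_ := (xcoord cf).

Let C1 : 1 <= C := order_const HO.
Let C0 : 0 < C := lt_le_trans ltr01 C1.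
Let n0 := nrm_ge0 HO.
Let Kb := ellK HO (v5P HO wP) (eta5_gt0 HO w) (eta5P HO w).
Let K5' := K5 HO wP.

Lemma Kb_ge1 : 1 <= Kb. Proof. exact: ellK_ge1. Qed.

Definition okE (T2 : nat) (g : 'I_5 -> F) (s : F * F) :=
  [forall i, [forall j, (i != j) ==> `[< cop T2 (g i) (x_ g j s) >]]].

Lemma okEP T2 g s i j : okE T2 g s -> i != j -> cop T2 (g i) (x_ g j s).
Proof. by move/forallP/(_ i)/forallP/(_ j)/implyP => h /h /asboolP. Qed.

(** A condition on g alone, ensuring that most s in its lattice satisfy [okE]. It is needed because
    s is counted with g fixed, while the sieve only controls averages over g. *)
Definition fine (T2 : nat) (e Kg : R) (G : 'I_5 -> R) (g : 'I_5 -> F) (S : R) := forall i j, i != j ->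
  (count (fun x : F => (x != 0%R) && ~~ `[< cop T2 (g i) x >]) (box (Kb * Kg * S / G j)))%:R <= e * (S / G j) ^+ n.

Lemma wprod_le (G : 'I_5 -> R) j S : (forall i, 1 <= G i) -> \prod_i G i <= S -> 1 <= S / wprod G j.
Proof.
move=> G1 h; have w1 : 1 <= wprod G j by apply: prod_ge1.
rewrite ler_pdivlMr ?mul1r ?(lt_le_trans ltr01 w1) //; apply: le_trans h.
by rewrite (gprod_wprod G j) ler_peMl ?(le_trans ler01 w1).
Qed.

Lemma mainE (G : 'I_5 -> R) j S : (forall i, 1 <= G i) ->
  (S / G j) ^+ n * (S / wprod G j) ^+ n = S ^+ n * S ^+ n / (\prod_i G i) ^+ n.
Proof.
move=> G1; have w1 : 1 <= wprod G j by apply: prod_ge1.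
by rewrite (gprod_wprod G j) -exprMn mulrACA -invfM expr_div_n -exprMn.
Qed.

Lemma fibre5 (Kg : R) (T1 : nat) : 1 <= Kg -> (0 < T1)%N -> exists2 Cf : R, 1 <= Cf &
  forall G g S j (P : pred F), gdata O nrm Kg G g -> pcop O T1 g -> 1 <= S -> \prod_i G i <= S ->
  (count (fun s => P (x_ g j s)) (lam5 g S))%:R <=
   (count (fun x : F => (x != 0%R) && P x) (box (Kb * Kg * S / G j)%R))%:R * (Cf * (S / wprod G j) ^+ n).
Proof.
move=> Kg1 T10; have [Cf Cf1 H] := fibre_sum HO (@oth5P) (cfO wO) (isT : (0 < 3)%N)
  (cf_det wP (three_neq0 HO) wO) (v5P HO wP) (eta5_gt0 HO w) (eta5P HO w) Kg1 T10.
exists Cf => // G g S j P gd pc S1 GS; have G1 := gdata_ge1 gd.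
by have := H G g S j P gd pc S1; rewrite (max_r (wprod_le j G1 GS)).
Qed.

(** The proportion [e2] does not depend on [T2], so [T2] can later be chosen to make [fine] hold for
    most g. At most 25 pairs (i, j) occur. *)
Lemma fine_count (Kg eps : R) (T1 : nat) : 1 <= Kg -> (0 < T1)%N -> 0 < eps -> exists2 e2 : R, 0 < e2 &
  forall T2 G g S, gdata O nrm Kg G g -> pcop O T1 g -> 1 <= S -> \prod_i G i <= S -> fine T2 e2 Kg G g S ->
  (count (fun s => ~~ okE T2 g s) (lam5 g S))%:R <= eps * (S ^+ n * S ^+ n / (\prod_i G i) ^+ n).
Proof.
move=> Kg1 T10 e0; have [Cf Cf1 H] := fibre5 Kg1 T10; have Cf0 := lt_le_trans ltr01 Cf1.
exists (eps / (25%:R * Cf)); first by rewrite divr_gt0 ?mulr_gt0.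
move=> T2 G g S gd pc S1 GS fn; have G1 := gdata_ge1 gd.
pose r := [seq ij <- [seq (i, j) | i <- enum 'I_5, j <- enum 'I_5] | ij.1 != ij.2].
apply: le_trans (_ : (\sum_(ij <- r) count (fun s => ~~ `[< cop T2 (g ij.1) (x_ g ij.2 s) >]) (lam5 g S))%:R <= _).
  rewrite ler_nat; apply: leq_trans (count_has_le (fun (ij : 'I_5 * 'I_5) s => ~~ `[< cop T2 (g ij.1) (x_ g ij.2 s) >]) r (lam5 g S)).
  apply: sub_count => s; rewrite /okE => /forallPn [i /forallPn [j]].
  rewrite negb_imply => /andP [ij h]; apply/hasP; exists (i, j) => //.
  by rewrite mem_filter /= ij; apply/allpairsP; exists (i, j); rewrite !mem_enum.
set M := _ / _ ^+ n.
have M0 : 0 <= M by rewrite /M -(mainE (inord 0) S G1) mulr_ge0 ?exprn_ge0 ?divr_ge0 ?(le_trans ler01 S1) ?(le_trans ler01 (G1 _)) // (le_trans ler01) // prod_ge1.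
rewrite natr_sum; apply: le_trans (_ : \sum_(ij <- r) (eps / 25%:R * M) <= _).
  rewrite big_seq [leRHS]big_seq; apply: ler_sum => -[i j]; rewrite mem_filter => /andP [/= ij _].
  have := H G g S j (fun x => ~~ `[< cop T2 (g i) x >]) gd pc S1 GS.
  move=> h; apply: le_trans h _; have w0 : 0 <= Cf * (S / wprod G j) ^+ n.
    by rewrite mulr_ge0 ?exprn_ge0 ?(ltW Cf0) // (le_trans ler01) // wprod_le.
  apply: le_trans (ler_wpM2r w0 (fn i j ij)) _.
  rewrite /M -(mainE j S G1) le_eqVlt; apply/predU1P; left; field.
  by rewrite gt_eqF.
rewrite big_const_seq iter_addr_0 count_predT -[X in X <= _]mulr_natl.
have sr : (size r)%:R <= 25%:R :> R.
  rewrite ler_nat size_filter; apply: leq_trans (count_size _ _) _.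
  by rewrite size_allpairs !size_enum_ord.
apply: le_trans (_ : 25%:R * (eps / 25%:R * M) <= _).
  by rewrite ler_wpM2r // mulr_ge0 // divr_ge0 // ltW.
by rewrite le_eqVlt; apply/predU1P; left; field.
Qed.

(** s.1 = g_4 x_4 and s.2 = g_5 x_5 in the numbering from 1; the four coprimalities between these
    factors multiply. *)
Lemma s_cop (Kg : R) (T1 T2 T : nat) G g S s : gdata O nrm Kg G g -> pcop O T1 g -> 1 <= S -> s \in lam5 g S ->
  okE T2 g s -> cop T (x_ g (inord 3) s) (x_ g (inord 4) s) -> cop (T1 * T2 * (T2 * T)) s.1 s.2.
Proof.
move=> gd pc S1 sl ok c34.
have [sO1 sO2 sx _] := lam5P HO wP S1 sl.
have ne : inord 3 != inord 4 :> 'I_5 by apply/eqP => /(congr1 val); rewrite /= !inordK.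
have ne' : inord 4 != inord 3 :> 'I_5 by rewrite eq_sym.
have [_ g3O g30 _ _] := gd (inord 3); have [_ g4O g40 _ _] := gd (inord 4).
have E3 : s.1 = g (inord 3) * x_ g (inord 3) s by rewrite /xcoord ell3 mulrC divfK.
have E4 : s.2 = g (inord 4) * x_ g (inord 4) s by rewrite /xcoord ell4 mulrC divfK.
have x3O : x_ g (inord 3) s \in O := sx _.
have x4O : x_ g (inord 4) s \in O := sx _.
have c1 : cop (T1 * T2) s.1 (g (inord 4)).
  by rewrite E3; apply: cop_mul => //; [apply: pc | apply: cop_sym; apply: okEP ok _].
have c2 : cop (T2 * T) s.1 (x_ g (inord 4) s).
  by rewrite {1}E3; apply: cop_mul => //; apply: okEP ok _.
by apply: cop_sym; rewrite {1}E4; apply: cop_mul => //; apply: cop_sym.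
Qed.

(** Euler's coordinates in terms of s and p, by [xeulE], before division by the product of the
    g_i. *)
Definition xtor (s p : F * F) (i : 'I_4) : F :=
  let A1 := s.1 * gamE p.1 p.2 s.1 s.2 in let A2 := p.1 * gamE s.1 s.2 p.1 p.2 in
  let B1 := s.2 * gamE p.1 p.2 s.1 s.2 in let B2 := p.2 * gamE s.1 s.2 p.1 p.2 in
  [:: - (w * A1 + (-1 - w) * A2); (-1 - w) * A1 + w * A2; - (w * B1 + (-1 - w) * B2); (-1 - w) * B1 + w * B2]`_i.

(** Every g_i divides both gamma, hence their product does up to T1^25 ([dv_prod] with five
    factors). Each term has degree 2 in s and 2 in p, which gives the size. *)
Lemma xtor_bound (Kg : R) (T1 : nat) : 1 <= Kg -> (0 < T1)%N -> exists2 c : R, 1 <= c &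
  forall G S P d i, dsize O nrm box w Kg G S P d -> pcop O T1 d.1.1 -> 1 <= S -> 1 <= P ->
  (T1 ^ 25)%:R * xtor d.1.2 d.2 i / \prod_k d.1.1 k \in O /\
  nrm ((T1 ^ 25)%:R * xtor d.1.2 d.2 i / \prod_k d.1.1 k) <= c * (S ^+ 2 * P ^+ 2 / \prod_k G k).
Proof.
move=> Kg1 T10.
have Kg0 : 0 <= Kg := le_trans ler01 Kg1.
have [_ k51] := K5_ge HO wP; rewrite -/K5' in k51; have k50 : 0 <= K5' := le_trans ler01 k51.
have [W EW] : exists W, W = nrm w + nrm (-1 - w) by eexists.
have W0 : 0 <= W by rewrite EW addr_ge0.
have [c1 Ec1] : exists c1, c1 = (T1 ^ 25)%:R * (2 * K5' ^+ 4) * (nrm 1 * Kg ^+ 5) by eexists.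
have c10 : 0 <= c1 by rewrite Ec1 !mulr_ge0 ?exprn_ge0.
exists (1 + W * c1); first by rewrite lerDl mulr_ge0.
move=> G S P [[g s] p] i [/= gd sl pl] pc S1 P1.
have S0 := lt_le_trans ltr01 S1; have P0 := lt_le_trans ltr01 P1.
have G1 := gdata_ge1 gd.
have [sO1 sO2 sx sb] := lam5P HO wP S1 sl; have [pO1 pO2 px pb] := lam5P HO wP P1 pl.
have w'O : -1 - w \in O by rewrite rpredB ?rpredN1.
have gO k : g k \in O by have [] := gd k.
have g0 k : g k != 0 by have [] := gd k.
set Pg := \prod_k g k.
have PgE : Pg = \prod_(k <- enum 'I_5) g k by rewrite big_enum.
have gamO a b c e : a \in O -> b \in O -> c \in O -> e \in O -> gamE a b c e \in O.
  by move=> *; apply: rpredD; apply: rpredM => //; apply: rpredX.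
have h1 k : gamE s.1 s.2 p.1 p.2 / g k \in O by apply: (gamE_dv wP wO).
have h2 k : gamE p.1 p.2 s.1 s.2 / g k \in O.
  have := @gamE_dv F w wP O wO (fun k => g (tau k)) p s (tau k) pO1 pO2 sO1 sO2.
  by rewrite tauK; apply=> [j|j]; [apply: px | rewrite tauK; apply: sx].
have dvP z : z \in O -> (forall k, z / g k \in O) -> (T1 ^ 25)%:R * z / Pg \in O.
  move=> zO hz; have := dv_prod HO (T1 := T1) (D := 1) (r := enum 'I_5) zO (enum_uniq _) gO g0 _ _.
  rewrite /dv -PgE size_enum_ord exp1n mul1n; apply.
    by move=> a b _ _; apply: pc.
  by move=> k _; rewrite mul1r.
have nV : nrm Pg^-1 <= nrm 1 * Kg ^+ 5 / \prod_k G k.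
  have := @nrm_prodV _ _ _ _ _ _ _ HO _ g G Kg (enum 'I_5) _ G1 Kg0.
  by rewrite -PgE size_enum_ord big_enum; apply=> k; have [] := gd k.
have sb1 : nrm s.1 <= K5' * S by have [_] := sb (inord 3); rewrite ell3.
have sb2 : nrm s.2 <= K5' * S by have [_] := sb (inord 4); rewrite ell4.
have pb1 : nrm p.1 <= K5' * P by have [_] := pb (inord 3); rewrite ell3.
have pb2 : nrm p.2 <= K5' * P by have [_] := pb (inord 4); rewrite ell4.
have gb a b c e X Y : nrm a <= X -> nrm b <= X -> nrm c <= Y -> nrm e <= Y -> nrm (gamE a b c e) <= 2 * (X * X * Y).
  move=> ha hb hc he; have m3 u v : nrm u <= X -> nrm v <= Y -> nrm (u ^+ 2 * v) <= X * X * Y.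
    move=> hu hv; apply: le_trans (nrmM HO _ _) _; apply: ler_pM => //.
    by rewrite expr2; apply: le_trans (nrmM HO _ _) _; apply: ler_pM.
  apply: le_trans (nrmD HO _ _) _; apply: le_trans (lerD (m3 a c ha hc) (m3 b e hb he)) _.
  by rewrite le_eqVlt; apply/predU1P; left; ring.
have Pb z : nrm z <= 2 * K5' ^+ 4 * (S ^+ 2 * P ^+ 2) -> nrm ((T1 ^ 25)%:R * z / Pg) <= c1 * (S ^+ 2 * P ^+ 2 / \prod_k G k).
  move=> hz; rewrite -mulrA (nrmZ HO) Ec1.
  apply: le_trans (ler_wpM2l _ (nrmM HO _ _)) _ => //.
  apply: le_trans (ler_wpM2l _ (ler_pM (n0 _) (n0 _) hz nV)) _ => //.
  rewrite le_eqVlt; apply/predU1P; left; ring.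
have gS : nrm (gamE p.1 p.2 s.1 s.2) <= 2 * (K5' * P * (K5' * P) * (K5' * S)) by apply: gb.
have gP : nrm (gamE s.1 s.2 p.1 p.2) <= 2 * (K5' * S * (K5' * S) * (K5' * P)) by apply: gb.
have zS x : nrm x <= K5' * S -> nrm (x * gamE p.1 p.2 s.1 s.2) <= 2 * K5' ^+ 4 * (S ^+ 2 * P ^+ 2).
  move=> hx; apply: le_trans (nrmM HO _ _) _; apply: le_trans (ler_pM (n0 _) (n0 _) hx gS) _.
  rewrite le_eqVlt; apply/predU1P; left; ring.
have zP x : nrm x <= K5' * P -> nrm (x * gamE s.1 s.2 p.1 p.2) <= 2 * K5' ^+ 4 * (S ^+ 2 * P ^+ 2).
  move=> hx; apply: le_trans (nrmM HO _ _) _; apply: le_trans (ler_pM (n0 _) (n0 _) hx gP) _.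
  rewrite le_eqVlt; apply/predU1P; left; ring.
have iS x : x \in O -> (T1 ^ 25)%:R * (x * gamE p.1 p.2 s.1 s.2) / Pg \in O.
  by move=> xO; apply: dvP => [|k]; rewrite -?mulrA rpredM ?gamO.
have iP x : x \in O -> (T1 ^ 25)%:R * (x * gamE s.1 s.2 p.1 p.2) / Pg \in O.
  by move=> xO; apply: dvP => [|k]; rewrite -?mulrA rpredM ?gamO.
set X := S ^+ 2 * P ^+ 2 / \prod_k G k in Pb *.
have X0 : 0 <= X by rewrite divr_ge0 ?mulr_ge0 ?exprn_ge0 ?(ltW S0) ?(ltW P0) // (le_trans ler01) // prod_ge1.
have fin u v A B : nrm u + nrm v <= W -> u \in O -> v \in O ->
    (T1 ^ 25)%:R * A / Pg \in O -> (T1 ^ 25)%:R * B / Pg \in O ->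
    nrm ((T1 ^ 25)%:R * A / Pg) <= c1 * X -> nrm ((T1 ^ 25)%:R * B / Pg) <= c1 * X ->
    (T1 ^ 25)%:R * (u * A + v * B) / Pg \in O /\ nrm ((T1 ^ 25)%:R * (u * A + v * B) / Pg) <= (1 + W * c1) * X.
  move=> hW uO vO hA hB nA nB.
  have -> : (T1 ^ 25)%:R * (u * A + v * B) / Pg = u * ((T1 ^ 25)%:R * A / Pg) + v * ((T1 ^ 25)%:R * B / Pg) by ring.
  split; first by apply: rpredD; apply: rpredM.
  apply: le_trans (nrmD HO _ _) _; apply: le_trans (lerD (nrmM HO _ _) (nrmM HO _ _)) _.
  apply: le_trans (lerD (ler_wpM2l (n0 _) nA) (ler_wpM2l (n0 _) nB)) _.
  rewrite -mulrDl [leRHS]mulrDl mul1r; apply: le_trans (ler_wpM2r (mulr_ge0 c10 X0) hW) _.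
  by rewrite mulrA lerDr.
have neg z : (T1 ^ 25)%:R * (- z) / Pg = - ((T1 ^ 25)%:R * z / Pg) by ring.
rewrite /xtor; case: i => [[|[|[|[|]]]] //= _]; rewrite ?neg ?rpredN ?(nrmN HO).
- by apply: fin; rewrite ?EW ?iS ?iP // ?Pb ?zS ?zP.
- by apply: fin; rewrite ?EW ?iS ?iP // ?Pb ?zS ?zP // addrC.
- by apply: fin; rewrite ?EW ?iS ?iP // ?Pb ?zS ?zP.
- by apply: fin; rewrite ?EW ?iS ?iP // ?Pb ?zS ?zP // addrC.
Qed.

End TorsorCount.

(** * Exceptional sets on average: common factors and zeros *)

Section TorsorAverages.
Variables (R : realType) (F : fieldType) (O : subringClosed F).
Variables (nrm : F -> R) (box : R -> seq F) (n : nat) (C : R).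
Hypothesis HO : is_order O nrm box n C.
Variable w : F.
Hypothesis wP : w ^+ 2 + w + 1 = 0.
Hypothesis wO : w \in O.
Local Notation cop := (cop O).
Local Notation cf := (cf w).
Local Notation lam5 := (lam5 O nrm box w).
Local Notation x_ := (xcoord cf).

Let C1 : 1 <= C := order_const HO.
Let C0 : 0 < C := lt_le_trans ltr01 C1.
Let n0 := nrm_ge0 HO.
Let Kb := ellK HO (v5P HO wP) (eta5_gt0 HO w) (eta5P HO w).
Let Kb1 : 1 <= Kb := Kb_ge1 HO wP.

Definition fineg (T2 : nat) (e Kg : R) (G : 'I_5 -> R) (S : R) (a : F) := [forall j,
  (count (fun x : F => (x != 0%R) && ~~ `[< cop T2 a x >]) (box (Kb * Kg * S / G j)))%:R <= e * (S / G j) ^+ n].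

Lemma finegP T2 e Kg G g S : (forall i, fineg T2 e Kg G S (g i)) -> fine HO wP T2 e Kg G g S.
Proof. by move=> h i j _; have /forallP := h i; apply. Qed.

(** Markov's inequality turns the sieve bound on average into a bound on the number of bad elements;
    the 5 comes from the five indices j. *)
Lemma fineg_markov (U : eqType) (a : U -> F) (L : seq U) (T2 : nat) (e e3 Kg : R) G S : 1 <= Kg -> 0 < e ->
  (forall i, 1 <= G i) -> 1 <= S -> \prod_i G i <= S ->
  (forall Y, 1 <= Y -> (\sum_(g <- L) count (fun x : F => (x != 0%R) && ~~ `[< cop T2 (a g) x >]) (box Y))%:R
     <= e3 * (size L)%:R * Y ^+ n) ->
  (count (fun g => ~~ fineg T2 e Kg G S (a g)) L)%:R <= 5%:R * (e3 * (Kb * Kg) ^+ n / e) * (size L)%:R.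
Proof.
move=> Kg1 e0 G1 S1 GS H; have S0 := lt_le_trans ltr01 S1.
pose r := enum 'I_5.
pose W j g := count (fun x : F => (x != 0%R) && ~~ `[< cop T2 (a g) x >]) (box (Kb * Kg * S / G j)).
apply: le_trans (_ : (count (fun g => has (fun j => (e * (S / G j) ^+ n < (W j g)%:R)%R) r) L)%:R <= _).
  rewrite ler_nat; apply: sub_count => g /forallPn [j]; rewrite -ltNge => h.
  by apply/hasP; exists j; rewrite ?mem_enum.
have -> : 5%:R = (size r)%:R :> R by rewrite size_enum_ord.
apply: (@count_union _ _ _ (fun j g => (e * (S / G j) ^+ n < (W j g)%:R)%R)) => j _.
have Gj0 := lt_le_trans ltr01 (G1 j).
have SG : 1 <= S / G j.
  rewrite ler_pdivlMr // mul1r; apply: le_trans GS; rewrite (gprod_wprod G j) ler_peMr ?(ltW Gj0) //.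
  exact: prod_ge1.
apply: count_markov; first by rewrite mulr_gt0 ?exprn_gt0 // divr_gt0.
have Y1 : 1 <= Kb * Kg * S / G j by rewrite -mulrA mulr_ege1 // mulr_ege1.
apply: le_trans (H _ Y1) _; rewrite -[Kb * Kg * S / _]mulrA exprMn.
by rewrite le_eqVlt; apply/predU1P; left; field; rewrite gt_eqF.
Qed.

Lemma kap5_ge0 : 0 <= kap nrm (v5 F) (eta5 nrm w).
Proof. by rewrite /kap addr_ge0 ?mulr_ge0 ?addr_ge0 // ltW // (eta5_gt0 HO). Qed.

Lemma bigprod_le1 (G : 'I_5 -> R) k Cs S : (forall i, 1 <= G i) -> 1 <= Cs -> Cs * (\prod_i G i) ^+ k.+1 <= S ->
  [/\ 1 <= S, \prod_i G i <= S & Cs <= S].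
Proof.
move=> G1 Cs1 h; have p1 : 1 <= \prod_i G i by apply: prod_ge1.
have pk : 1 <= (\prod_i G i) ^+ k.+1 by rewrite exprn_ege1.
split.
- by apply: le_trans h; rewrite mulr_ege1.
- apply: le_trans h; apply: le_trans (ler_peMl _ Cs1); last by rewrite (le_trans ler01).
  by rewrite exprS ler_peMr ?exprn_ege1 // (le_trans ler01).
- by apply: le_trans h; rewrite ler_peMr // (le_trans ler01).
Qed.

(** Here s and p vary independently. The fibre bound shows that x_i(s) is divisible by nu with
    frequency O(nrm nu ^ -n), enough for [bad_pairs]; its box is the range of x_i'(p). *)
Lemma pair_bad (Kg eps : R) (T1 : nat) : 1 <= Kg -> (0 < T1)%N -> 0 < eps -> exists2 T : nat, (0 < T)%N &
  forall G g G' g' S P i i', gdata O nrm Kg G g -> pcop O T1 g -> gdata O nrm Kg G' g' -> pcop O T1 g' ->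
  1 <= S -> 1 <= P -> \prod_i G i <= S -> \prod_i G' i <= P ->
  (\sum_(s <- lam5 g S) count (fun p => ~~ `[< cop T (x_ g i s) (x_ g' i' p) >]) (lam5 g' P))%:R <=
    eps * (S ^+ n * S ^+ n / (\prod_i G i) ^+ n) * (P ^+ n * P ^+ n / (\prod_i G' i) ^+ n).
Proof.
move=> Kg1 T10 e0; have [Cf Cf1 H] := fibre5 HO wP wO Kg1 T10; have Cf0 := lt_le_trans ltr01 Cf1.
have Kg0 := lt_le_trans ltr01 Kg1; have Kb0 := lt_le_trans ltr01 Kb1.
have [|t0 [K' [K2 [t00 K'1 K20 HB]]]] := bad_pairs HO (K := Kb * (Kg * Kg)).
  by rewrite mulr_ege1 // mulr_ege1.
have K'0 := lt_le_trans ltr01 K'1.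
have [c6 Ec6] : exists x, x = C * (2 * t0%:R * K' * (Kb * Kg)) ^+ n * Cf by eexists.
have c60 : 0 < c6 by rewrite Ec6 !mulr_gt0 ?exprn_gt0 ?mulr_gt0 ?ltr0n.
have [c7 Ec7] : exists x, x = Cf * K2 * c6 * (Kb * Kg) ^+ n by eexists.
have c70 : 0 < c7 by rewrite Ec7 !mulr_gt0 ?exprn_gt0 ?mulr_gt0.
pose U0 := Num.max 1 (c7 / eps); have U01 : 1 <= U0 by rewrite le_max lexx.
have U00 := lt_le_trans ltr01 U01.
have [T T0 HT] := HB _ U01; exists T => // G g G' g' S P i i' gd pc gd' pc' S1 P1 GS GP.
have G1 := gdata_ge1 gd; have G1' := gdata_ge1 gd'.
have S0 := lt_le_trans ltr01 S1; have P0 := lt_le_trans ltr01 P1.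
have Gi0 := lt_le_trans ltr01 (G1 i); have Gi0' := lt_le_trans ltr01 (G1' i').
set MS := _ / _; set MP := P ^+ n * _ / _.
have w0 : 0 <= P / wprod G' i' by rewrite (le_trans ler01) // wprod_le.
have w0' : 0 <= S / wprod G i by rewrite (le_trans ler01) // wprod_le.
set Y := Kb * Kg * P / G' i'.
have Y1 : 1 <= Y.
  rewrite /Y -mulrA mulr_ege1 //; first by rewrite mulr_ege1.
  rewrite ler_pdivlMr // mul1r; apply: le_trans GP; rewrite (gprod_wprod G' i') ler_peMr ?(ltW Gi0') //.
  exact: prod_ge1.
apply: le_trans (_ : (\sum_(a <- [seq x_ g i s | s <- lam5 g S])
    count (fun x : F => (x != 0%R) && ~~ `[< cop T a x >]) (box Y))%:R * (Cf * (P / wprod G' i') ^+ n) <= _).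
  rewrite big_map !natr_sum mulr_suml; apply: ler_sum => s _.
  exact: (H G' g' P i' (fun x => ~~ `[< cop T (x_ g i s) x >])).
have mainS : MS = (S / G i) ^+ n * (S / wprod G i) ^+ n by rewrite mainE.
have mainP : MP = (P / G' i') ^+ n * (P / wprod G' i') ^+ n by rewrite mainE.
have MS0 : 0 <= MS by rewrite mainS mulr_ge0 ?exprn_ge0 // divr_ge0 // ltW.
have := HT [seq x_ g i s | s <- lam5 g S] (c6 * MS) Y _ Y1 _ _ => Hb.
have Cw0 : 0 <= Cf * (P / wprod G' i') ^+ n by rewrite mulr_ge0 ?exprn_ge0 // ltW.
apply: le_trans (ler_wpM2r Cw0 (Hb _ _ _)) _.
- by rewrite mulr_ge0 // ltW.
- move=> _ /mapP [s sl ->].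
  by have [] := xcoord_lam HO (v5P HO wP) (eta5_gt0 HO w) (eta5P HO w) i (ltW Kg0) S1 gd sl.
- move=> nu nuO nu0 nuc; have nu1 := nrm_int HO nuO nu0; have nup := lt_le_trans ltr01 nu1.
  rewrite count_map; apply: le_trans (H G g S i (dv O t0 nu) gd pc S1 GS) _.
  have YS0 : 0 <= Kb * Kg * S / G i by rewrite divr_ge0 ?mulr_ge0 ?ltW.
  have Cw0' : 0 <= Cf * (S / wprod G i) ^+ n by rewrite mulr_ge0 ?exprn_ge0 // ltW.
  apply: le_trans (ler_wpM2r Cw0' (dv_count HO t00 nu0 K'1 YS0 nuc)) _.
  have -> : C * (2 * t0%:R * K' * (Kb * Kg * S / G i) / nrm nu) ^+ n * (Cf * (S / wprod G i) ^+ n) = c6 * MS * (nrm nu)^-1 ^+ n.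
    rewrite Ec6 mainS.
    have -> : 2 * t0%:R * K' * (Kb * Kg * S / G i) / nrm nu = (2 * t0%:R * K' * (Kb * Kg)) * (S / G i) * (nrm nu)^-1 by ring.
    by rewrite !exprMn; ring.
  apply: ler_wpM2l; first by rewrite mulr_ge0 // ltW.
  rewrite exprVn lef_pV2 ?posrE ?exprn_gt0 //.
  by rewrite ler_eXnr // (order_rank HO).
have -> : K2 / U0 * (c6 * MS) * Y ^+ n * (Cf * (P / wprod G' i') ^+ n) = c7 / U0 * MS * MP.
  rewrite mainP Ec7 /Y.
  have -> : Kb * Kg * P / G' i' = (Kb * Kg) * (P / G' i') by ring.
  by rewrite exprMn; ring.
have MP0 : 0 <= MP by rewrite mainP mulr_ge0 ?exprn_ge0 // divr_ge0 // ltW.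
rewrite ler_wpM2r // ler_wpM2r // ler_pdivrMr // mulrC -ler_pdivrMr //.
by rewrite le_max lexx orbT.
Qed.

(** Schwartz-Zippel gives O(S^n P^n (S^n + P^n)) zeros, without using the congruences. Compared with
    S^(2n) P^(2n) / G^(2n), where G is the product of the G i, this is small once S^n and P^n exceed
    a large multiple of G^(2n). *)
Lemma zeros_bound (Psi : 'rV[F]_4 -> F) (u : 'rV[F]_4) (eps kp : R) : polyfun Psi -> Psi u != 0 -> 0 < eps -> 0 <= kp ->
  exists2 Cs : R, 1 <= Cs & forall G S P (Ls Lp : seq (F * F)), (forall i : 'I_5, 1 <= G i) ->
  Cs * (\prod_i G i) ^+ n.+1 <= S -> Cs * (\prod_i G i) ^+ n.+1 <= P -> uniq Ls -> uniq Lp ->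
  {in Ls, forall s, s.1 \in box (kp * S) /\ s.2 \in box (kp * S)} ->
  {in Lp, forall s, s.1 \in box (kp * P) /\ s.2 \in box (kp * P)} ->
  (count (fun sp => Psi (\row_(i < 4) [:: sp.1.1; sp.1.2; sp.2.1; sp.2.2]`_i) == 0) [seq (s, p) | s <- Ls, p <- Lp])%:R <=
    eps * (S ^+ n * S ^+ n / (\prod_i G i) ^+ n) * (P ^+ n * P ^+ n / (\prod_i G i) ^+ n).
Proof.
move=> [D HD] Pu e0 kp0.
have [kq Ekq] : exists x, x = 1 + kp by eexists.
have kq1 : 1 <= kq by rewrite Ekq lerDl.
have [A EA] : exists x, x = C * kq ^+ n by eexists.
have A0 : 0 < A by rewrite EA mulr_gt0 ?exprn_gt0 // (lt_le_trans ltr01).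
pose c8 := D%:R * (4 * (A * A * A)) / eps.
exists (Num.max 1 c8); first by rewrite le_max lexx.
move=> G S P Ls Lp G1 HS HP uS uP inS inP.
have M1 : 1 <= Num.max 1 c8 :> R by rewrite le_max lexx.
have [S1 GS cS] := bigprod_le1 G1 M1 HS; have [P1 GP cP] := bigprod_le1 G1 M1 HP.
have S0 := lt_le_trans ltr01 S1; have P0 := lt_le_trans ltr01 P1.
set Pi := \prod_i G i in HS HP GS GP *.
have Pi1 : 1 <= Pi by apply: prod_ge1.
have Pi0 := lt_le_trans ltr01 Pi1.
pose bS := box (kp * S); pose bP := box (kp * P).
have sz X : 1 <= X -> (size (box (kp * X)))%:R <= A * X ^+ n.
  move=> X1; apply: le_trans (box_ub_max HO _) _; rewrite EA -mulrA ler_wpM2l ?(ltW C0) // -exprMn.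
  rewrite lerXn2r ?nnegrE ?(le_trans ler01) ?le_max ?lexx //.
    by rewrite mulr_ege1.
  rewrite ge_max mulr_ege1 //= ler_wpM2r ?(le_trans ler01) // Ekq.
  by rewrite lerDr.
pose fs := [:: bS; bS; bP; bP]; pose ws := [seq delta_mx 0 i : 'rV[F]_4 | i <- enum 'I_4].
pose enc (sp : (F * F) * (F * F)) := [:: sp.1.1; sp.1.2; sp.2.1; sp.2.2].
apply: le_trans (_ : (D * zero_bound fs)%:R <= _).
  rewrite ler_nat; have H := schwartz_zippel (ws := ws) (fs := fs) (u := 0) (t0 := [seq u 0 i | i <- enum 'I_4]) HD.
  apply: leq_trans (H _ _ _ _).
  - rewrite -!size_filter -(size_map enc); apply: uniq_leq_size.
      rewrite map_inj_uniq; last by move=> [[a b] [c e]] [[a' b'] [c' e']] /= [-> -> -> ->].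
      by rewrite filter_uniq // allpairs_uniq // => -[x y] [x' y'] _ _ /= [-> ->].
    move=> _ /mapP [[s p] + ->]; rewrite !mem_filter => /andP [z /allpairsP [[s' p'] /= [ss pp [e1 e2]]]].
    subst s' p'; have [h1 h2] := inS s ss; have [h3 h4] := inP p pp.
    rewrite add0r comb_delta //; apply/andP; split; first exact: z.
    by apply/(@tupP F 0 fs); split=> // -[|[|[|[|//]]]].
  - by rewrite /= !(box_uniq HO).
  - by rewrite size_map size_enum_ord.
  - by rewrite size_map size_enum_ord.
  - have szu : size [seq u 0 i | i <- enum 'I_4] = 4 by rewrite size_map size_enum_ord.
    rewrite add0r (comb_delta szu).
    rewrite (_ : \row_i _ = u) //; apply/rowP => i; rewrite mxE (nth_map i) ?size_enum_ord //.
    by rewrite nth_ord_enum.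
rewrite /fs /= !big_cons !big_nil !muln0 !addn0 !muln1.
have s1 := sz S S1; have s2 := sz P P1; rewrite -/bS in s1; rewrite -/bP in s2.
move: (size bS) (size bP) s1 s2 => a b s1 s2.
have sa0 : 0 <= A * S ^+ n by rewrite mulr_ge0 ?exprn_ge0 // ltW.
have sb0 : 0 <= A * P ^+ n by rewrite mulr_ge0 ?exprn_ge0 // ltW.
have h3 u1 u2 u3 (v1 v2 v3 : R) : u1%:R <= v1 -> u2%:R <= v2 -> u3%:R <= v3 -> 
    (u1 * (u2 * u3))%:R <= v1 * (v2 * v3).
  by move=> *; rewrite !natrM ler_pM ?mulr_ge0 // ler_pM.
have hz : (a * (b * b) + a * (b * b + a * (b + b)))%:R <= 2 * ((A * S ^+ n) * ((A * P ^+ n) * (A * P ^+ n)) + (A * S ^+ n) * ((A * S ^+ n) * (A * P ^+ n))).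
  have -> : (a * (b * b) + a * (b * b + a * (b + b)) = 2 * (a * (b * b) + a * (a * b)))%N by ring.
  by rewrite natrM ler_wpM2l // natrD lerD // h3.
(* The threshold S >= Cs G^(n+1), raised to the power n, thus dominates G^(2n). *)
have nE : (2 * n <= n.+1 * n)%N by rewrite leq_mul2r; case: (n) (order_rank HO) => // k _; rewrite orbT.
have pw X : Num.max 1 c8 * Pi ^+ n.+1 <= X -> c8 * Pi ^+ (2 * n) <= X ^+ n.
  move=> hX; have X0 : 0 <= X by apply: le_trans hX; rewrite mulr_ge0 ?exprn_ge0 ?(ltW Pi0) // (le_trans ler01).
  apply: le_trans (_ : (Num.max 1 c8 * Pi ^+ n.+1) ^+ n <= _); last first.
    by rewrite lerXn2r ?nnegrE // mulr_ge0 ?exprn_ge0 ?(ltW Pi0) // (le_trans ler01).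
  rewrite exprMn -exprM; apply: ler_pM; rewrite ?exprn_ge0 ?(ltW Pi0) //.
  - by rewrite /c8 divr_ge0 ?(ltW e0) // !mulr_ge0 // ltW.
  - apply: le_trans (_ : Num.max 1 c8 <= _); first by rewrite le_max lexx orbT.
    by rewrite ler_eXnr // (order_rank HO).
  - by rewrite ler_weXn2l.
have q1 := pw _ HS; have q2 := pw _ HP.
rewrite natrM; apply: le_trans (ler_wpM2l (ler0n _ _) hz) _.
have P2 : 0 < Pi ^+ (2 * n) by rewrite exprn_gt0.
have -> : eps * (S ^+ n * S ^+ n / Pi ^+ n) * (P ^+ n * P ^+ n / Pi ^+ n) = eps * (S ^+ n * S ^+ n * (P ^+ n * P ^+ n)) / Pi ^+ (2 * n).
  by rewrite mul2n -addnn exprD; field; rewrite expf_neq0 // gt_eqF.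
rewrite ler_pdivlMr // {sa0 sb0 hz h3}.
have Sn0 : 0 <= S ^+ n by rewrite exprn_ge0 // ltW.
have Pn0 : 0 <= P ^+ n by rewrite exprn_ge0 // ltW.
have ce : D%:R * (4 * (A * A * A)) = eps * c8 by rewrite /c8; field; rewrite gt_eqF.
apply: le_trans (_ : eps / 2 * ((S ^+ n * (P ^+ n * P ^+ n)) * (c8 * Pi ^+ (2 * n)) + (S ^+ n * (S ^+ n * P ^+ n)) * (c8 * Pi ^+ (2 * n))) <= _).
  rewrite le_eqVlt; apply/predU1P; left.
  transitivity (D%:R * (4 * (A * A * A)) / 2 * (S ^+ n * (P ^+ n * P ^+ n) + S ^+ n * (S ^+ n * P ^+ n)) * Pi ^+ (2 * n)); first by field.
  by rewrite ce; ring.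
apply: le_trans (_ : eps / 2 * ((S ^+ n * (P ^+ n * P ^+ n)) * S ^+ n + (S ^+ n * (S ^+ n * P ^+ n)) * P ^+ n) <= _).
  by rewrite ler_wpM2l ?divr_ge0 ?(ltW e0) // lerD // ler_wpM2l ?mulr_ge0.
by rewrite le_eqVlt; apply/predU1P; left; field.
Qed.

End TorsorAverages.

Lemma count_or_le (T : Type) (a b : pred T) (s : seq T) : (count (fun x => a x || b x) s <= count a s + count b s)%N.
Proof. by rewrite -count_predUI leq_addr. Qed.

Lemma count_compl (R : numDomainType) (T : Type) (a b : pred T) (s : seq T) : (forall x, ~~ a x -> b x) ->
  (size s)%:R - (count b s)%:R <= (count a s)%:R :> R.
Proof.
move=> H; rewrite lerBlDr -natrD ler_nat -(count_predC a s) leq_add2l.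
by apply: sub_count => x /H.
Qed.

Definition pairs5 : seq (nat * nat) :=
  [:: (0, 1); (0, 2); (0, 3); (0, 4); (1, 2); (1, 3); (1, 4); (2, 3); (2, 4); (3, 4)]%N.

Lemma pairs5P jk : jk \in pairs5 -> (jk.1 < jk.2)%N /\ (jk.2 < 5)%N.
Proof. by case: jk => j k; rewrite !inE; do 9! (case/orP; [by move=> /eqP [-> ->]|]); move=> /eqP [-> ->]. Qed.

Lemma pairs5_mem (i k : 'I_5) : (i < k)%N -> ((i : nat), (k : nat)) \in pairs5.
Proof. by case: i k => [[|[|[|[|[|]]]]] //= h] [[|[|[|[|[|]]]]] //= h']. Qed.

Lemma half_le (R : realFieldType) (a b : R) : b <= 2^-1 * a -> 2^-1 * a <= a - b.
Proof. lra. Qed.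

Lemma half_sum (R : realFieldType) (a b c d e : R) : d <= 10%:R / 40 * e -> c <= 5%:R / 40 * e -> b <= 5%:R / 40 * e ->
  a <= c + b -> d + a <= 2^-1 * e.
Proof. lra. Qed.

Lemma quarter_left (R : realFieldType) (k M a b c d : R) : 9%:R / 16 * k * M <= a -> d <= k / 16 * M ->
  c <= k / 16 * M -> b <= d + c -> 0 <= k * M -> k / 4 * M <= a - b.
Proof. lra. Qed.

(** * Good data in one box when s and p are independent *)

Section CaseSplit.
Variables (R : realType) (F : fieldType) (O : subringClosed F).
Variables (nrm : F -> R) (box : R -> seq F) (n : nat) (C : R).
Hypothesis HO : is_order O nrm box n C.
Variable w : F.
Hypothesis wP : w ^+ 2 + w + 1 = 0.
Hypothesis wO : w \in O.
Local Notation cop := (cop O).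
Local Notation cf := (cf w).
Local Notation lam5 := (lam5 O nrm box w).
Local Notation x_ := (xcoord cf).

Let C1 : 1 <= C := order_const HO.
Let C0 : 0 < C := lt_le_trans ltr01 C1.
Let Kb := ellK HO (v5P HO wP) (eta5_gt0 HO w) (eta5P HO w).
Let Kb1 : 1 <= Kb := Kb_ge1 HO wP.
Let i3 : 'I_5 := inord 3.
Let i4 : 'I_5 := inord 4.

Lemma prod_tau (A : comPzRingType) (G : 'I_5 -> A) : \prod_i G (tau i) = \prod_i G i.
Proof. by rewrite [RHS](reindex_inj (inv_inj tauK)). Qed.

Lemma i34 : i3 != i4. Proof. by apply/eqP => /(congr1 val); rewrite /= !inordK. Qed.

(** From cl, the lower bound of [lam_lower], two exceptional sets of proportion cl / 8 are removed.
    The quantifiers matter: [e2] comes first, T2 may depend on it, and T3 on T2. *)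
Lemma good_points (Kg : R) (T1 : nat) : 1 <= Kg -> (0 < T1)%N -> exists cl e2 : R, [/\ 0 < cl, 0 < e2 &
  forall T2, (0 < T2)%N -> exists (T3 : nat) (Cs : R), [/\ (0 < T3)%N, 1 <= Cs &
  forall G g S, gdata O nrm Kg G g -> pcop O T1 g -> Cs * (\prod_i G i) ^+ n.+1 <= S ->
    (forall i, fineg HO wP T2 e2 Kg G S (g i)) ->
    3 / 4 * cl * (S ^+ n * S ^+ n / (\prod_i G i) ^+ n) <=
      (count (fun s => okE O w T2 g s && `[< cop T3 (x_ g i3 s) (x_ g i4 s) >]) (lam5 g S))%:R]].
Proof.
move=> Kg1 T10.
have [cl [Cs1 [cl0 Cs11 Hlow]]] := lam_lower HO (cfO wO) (v5O O) (eta5_gt0 HO w) Kg1.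
have es0 : 0 < cl / 8 by rewrite divr_gt0.
have [e2 e20 Hfine] := fine_count HO wP wO Kg1 T10 es0.
exists cl, e2; split=> // T2 T20.
have idK : involutive (idfun : F -> F) by [].
have [T3 [Cs3 [T30 Cs31 H3]]] := bad_in_lam HO (cfO wO) (isT : (0 < 3)%N) (cf_det wP (three_neq0 HO) wO)
  (v5P HO wP) (eta5_gt0 HO w) (eta5P HO w) (th := idfun) idK (fun x h => h) (fun x => erefl) Kg1 es0 T10 T20.
exists T3, (Cs1 + Cs3); split=> //; first by rewrite ler_wpDr // (le_trans ler01).
move=> G g S gd pc CS fn; have G1 := gdata_ge1 gd.
have Cs1' : 1 <= Cs1 + Cs3 by rewrite ler_wpDr // (le_trans ler01).
have [S1 GS _] := bigprod_le1 G1 Cs1' CS.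
have p1 : 1 <= \prod_i G i by apply: prod_ge1.
have p0 := lt_le_trans ltr01 p1.
have pn : (\prod_i G i) ^+ n <= (\prod_i G i) ^+ n.+1 by rewrite ler_weXn2l.
have CS1 : Cs1 * (\prod_i G i) ^+ n <= S.
  apply: le_trans CS; apply: ler_pM; rewrite ?exprn_ge0 ?(ltW p0) ?(le_trans ler01 Cs11) //.
  by rewrite lerDl (le_trans ler01).
have CS3 : Cs3 * (\prod_i G i) ^+ n.+1 <= S.
  apply: le_trans CS; rewrite ler_wpM2r ?exprn_ge0 ?(ltW p0) // lerDr (le_trans ler01) //.
have b1 := Hlow G g S gd CS1.
have b2 := Hfine T2 G g S gd pc S1 GS (finegP fn).
have b3 := H3 G g S i3 i4 i34 gd pc CS3.
rewrite -[cl * _ / _]mulrA in b1; rewrite -[cl / 8 * _ / _]mulrA in b3.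
apply: le_trans (_ : (size (lam5 g S))%:R - (count (fun s => ~~ okE O w T2 g s ||
   ([forall i, (i != i4) ==> `[< cop T2 (g i) (x_ g i4 s) >]] && ~~ `[< cop T3 (x_ g i3 s) (x_ g i4 s) >])) (lam5 g S))%:R <= _); last first.
  apply: count_compl => s; rewrite negb_and; case: (boolP (okE _ _ _ _ _)) => //= ok h.
  rewrite h andbT; apply/forallP => i; apply/implyP => ne; apply/asboolP; exact: okEP ok ne.
have b4 : (count (fun s => ~~ okE O w T2 g s ||
   ([forall i, (i != i4) ==> `[< cop T2 (g i) (x_ g i4 s) >]] && ~~ `[< cop T3 (x_ g i3 s) (x_ g i4 s) >])) (lam5 g S))%:R
    <= 2 * (cl / 8 * (S ^+ n * S ^+ n / (\prod_i G i) ^+ n)) :> R.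
  apply: le_trans (_ : (count (fun s => ~~ okE O w T2 g s) (lam5 g S) +
     count (fun s => [forall i, (i != i4) ==> `[< cop T2 (g i) (x_ g i4 s) >]] && ~~ `[< cop T3 (x_ g i3 s) (x_ g i4 s) >]) (lam5 g S))%:R <= _).
    by rewrite ler_nat; apply: count_or_le.
  by rewrite natrD; move: b2 b3; set M := S ^+ n * _ / _; lra.
move: b1 b4; set M := S ^+ n * _ / _; move: (size _)%:R (count _ _)%:R => a b b1 b4; lra.
Qed.

Definition gof (t : seq F) : {ffun 'I_5 -> F} := [ffun i : 'I_5 => t`_i].

(** At least half of the 5-tuples g are pairwise coprime and fine for both s and p. For such a g,
    the good s and p are paired freely and a small proportion of pairs is removed: those with a
    common factor of x_i(s) and x_tau(i)(p), and the zeros of Psi. *)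
Theorem caseA (Psi : 'rV[F]_4 -> F) (u0 : 'rV[F]_4) : polyfun Psi -> Psi u0 != 0 ->
  exists (T1 T : nat) (c Cs : R), [/\ (0 < T1)%N, (0 < T)%N, 0 < c, 1 <= Cs &
  forall G S P, (forall i, 1 <= G i) -> Cs * (\prod_i G i) ^+ n.+1 <= S -> Cs * (\prod_i G i) ^+ n.+1 <= P ->
  exists D : seq (data F), [/\ uniq D, forall d, d \in D -> [/\ dsize O nrm box w (famK nrm) G S P d, dgood O w T d, pcop O T1 d.1.1 &
     Psi (\row_(i < 4) [:: d.1.2.1; d.1.2.2; d.2.1; d.2.2]`_i) != 0] &
   c * ((\prod_i G i) ^+ n * (S ^+ n * S ^+ n / (\prod_i G i) ^+ n) * (P ^+ n * P ^+ n / (\prod_i G i) ^+ n)) <= (size D)%:R]].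
Proof.
move=> pPsi Pu; set Kg := famK nrm; have Kg1 : 1 <= Kg := famK_ge1 HO.
(* Twenty conditions are imposed on g: ten pairs, and five elements tested for s and for p. Each
   fails for at most 1/40 of the tuples, so half remain. *)
have q0 : 0 < 40^-1 :> R by rewrite invr_gt0.
have [T1 T10 H1] := fam_bad_fam HO q0.
have [cl [e2 [cl0 e20 Hgood]]] := good_points Kg1 T10.
have Kg0 := lt_le_trans ltr01 Kg1; have Kb0 := lt_le_trans ltr01 Kb1.
have Kn0 : 0 < (Kb * Kg) ^+ n by apply: exprn_gt0; apply: mulr_gt0.
(* Chosen so that the proportion 5 * e3 * (Kb Kg)^n / e2 of [fineg_markov] equals 1/40. *)
have e30 : 0 < e2 / (200 * (Kb * Kg) ^+ n) by apply: (divr_gt0 e20); apply: mulr_gt0 Kn0; rewrite ltr0n.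
have [T2 T20 H2] := fam_bad_box HO e30.
have [T3 [Cs3 [T30 Cs31 HgP]]] := Hgood T2 T20.
(* Five indices at cl^2 / 80 make cl^2 / 16, and the zeros cost the same; (3/4)^2 - 2/16 leaves more
   than 1/4. *)
have e40 : 0 < cl ^+ 2 / 80 by rewrite divr_gt0 ?exprn_gt0.
have [T4 T40 H4] := pair_bad HO wP wO Kg1 T10 e40.
have e50 : 0 < cl ^+ 2 / 16 by rewrite divr_gt0 ?exprn_gt0.
have [Cs5 Cs51 H5] := zeros_bound HO pPsi Pu e50 (kap5_ge0 HO w).
have fc0 : 0 < famc nrm n C by apply: (famc_gt0 HO).
exists T1, (T1 * T2 * (T2 * T3) * T4)%N, (famc nrm n C ^+ 5 * cl ^+ 2 / 8), (Cs3 + Cs5).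
split=> //; first by rewrite !muln_gt0 T10 T20 T30 T40.
- by rewrite divr_gt0 // mulr_gt0 ?exprn_gt0.
- by rewrite ler_wpDr // (le_trans ler01).
move=> G S P G1 HS HP.
have Csum1 : 1 <= Cs3 + Cs5 by rewrite ler_wpDr // (le_trans ler01).
have p1 : 1 <= \prod_i G i by apply: prod_ge1.
have p0 := lt_le_trans ltr01 p1.
have weak X : (Cs3 + Cs5) * (\prod_i G i) ^+ n.+1 <= X -> Cs3 * (\prod_i G i) ^+ n.+1 <= X /\ Cs5 * (\prod_i G i) ^+ n.+1 <= X.
  move=> h; split; apply: le_trans h; rewrite ler_wpM2r ?exprn_ge0 ?(ltW p0) //.
    by rewrite lerDl (le_trans ler01).
  by rewrite lerDr (le_trans ler01).
have [S1 GS _] := bigprod_le1 G1 Csum1 HS; have [P1 GP _] := bigprod_le1 G1 Csum1 HP.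
have [HS3 HS5] := weak _ HS; have [HP3 HP5] := weak _ HP.
set MS := S ^+ n * _ / _; set MP := P ^+ n * _ / _.
pose Gt i := G (tau i).
have Gt1 i : 1 <= Gt i by apply: G1.
have GtP : \prod_i Gt i = \prod_i G i by apply: prod_tau.
pose fs := [seq fam nrm box (G i) | i <- enum 'I_5].
have szfs : size fs = 5 by rewrite size_map size_enum_ord.
have nfs (i : 'I_5) : nth [::] fs i = fam nrm box (G i).
  by rewrite (nth_map i) ?size_enum_ord // nth_ord_enum.
have nfs' j (j5 : (j < 5)%N) : nth [::] fs j = fam nrm box (G (Ordinal j5)) by rewrite -nfs.
pose Npc (a b : F) := ~~ `[< cop T1 a b >].
pose bad t := [|| has (fun jk => Npc t`_jk.1 t`_jk.2) pairs5,
   has (fun j => ~~ fineg HO wP T2 e2 Kg G S t`_j) (iota 0 5) | has (fun j => ~~ fineg HO wP T2 e2 Kg Gt P t`_j) (iota 0 5)].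
have Hmk GG X j : (forall i, 1 <= GG i) -> 1 <= X -> \prod_i GG i <= X -> (j < 5)%N ->
    (count (fun t => ~~ fineg HO wP T2 e2 Kg GG X t`_j) (tup fs))%:R <= 40^-1 * (size (tup fs))%:R :> R.
  move=> GG1 X1 GX j5; apply: (@tup_count1 _ _ 0 (fun a => ~~ fineg HO wP T2 e2 Kg GG X a)); rewrite ?szfs ?(ltW q0) //.
  rewrite (nfs' j j5).
  have h := @fineg_markov _ _ _ _ _ _ _ HO w wP F id (fam nrm box (G (Ordinal j5))) T2 e2 (e2 / (200 * (Kb * Kg) ^+ n)) Kg GG X Kg1 e20 GG1 X1 GX.
  apply: le_trans (h _) _; first by move=> Y Y1; apply: H2.
  rewrite le_eqVlt; apply/predU1P; left; congr (_ * _); rewrite -/Kb; field.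
  by rewrite !gt_eqF.
have Hbad : (count bad (tup fs))%:R <= 2^-1 * (size (tup fs))%:R :> R.
  have h1 : (count (fun t => has (fun jk => Npc t`_jk.1 t`_jk.2) pairs5) (tup fs))%:R <= (size pairs5)%:R * 40^-1 * (size (tup fs))%:R :> R.
    apply: (@count_union _ _ _ (fun jk (t : seq F) => Npc t`_jk.1 t`_jk.2)) => -[j k] /pairs5P /= [jk k5].
    have j5 := ltn_trans jk k5.
    apply: (@tup_count2 _ _ 0 Npc) => //; rewrite ?szfs ?(ltW q0) //.
    by rewrite (nfs' j j5) (nfs' k k5); apply: H1.
  have h2 : (count (fun t => has (fun j => ~~ fineg HO wP T2 e2 Kg G S t`_j) (iota 0 5)) (tup fs))%:R <= (size (iota 0 5))%:R * 40^-1 * (size (tup fs))%:R :> R.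
    apply: (@count_union _ _ _ (fun j (t : seq F) => ~~ fineg HO wP T2 e2 Kg G S t`_j)) => j.
    by rewrite mem_iota => j5; apply: Hmk.
  have h3 : (count (fun t => has (fun j => ~~ fineg HO wP T2 e2 Kg Gt P t`_j) (iota 0 5)) (tup fs))%:R <= (size (iota 0 5))%:R * 40^-1 * (size (tup fs))%:R :> R.
    apply: (@count_union _ _ _ (fun j (t : seq F) => ~~ fineg HO wP T2 e2 Kg Gt P t`_j)) => j.
    by rewrite mem_iota => j5; apply: Hmk => //; rewrite GtP.
  have := count_or_le (fun t => has (fun jk => Npc t`_jk.1 t`_jk.2) pairs5) (fun t => has (fun j => ~~ fineg HO wP T2 e2 Kg G S t`_j) (iota 0 5) || has (fun j => ~~ fineg HO wP T2 e2 Kg Gt P t`_j) (iota 0 5)) (tup fs).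
  have := count_or_le (fun t => has (fun j => ~~ fineg HO wP T2 e2 Kg G S t`_j) (iota 0 5)) (fun t => has (fun j => ~~ fineg HO wP T2 e2 Kg Gt P t`_j) (iota 0 5)) (tup fs).
  rewrite -/bad; rewrite -(ler_nat R) natrD => k1; rewrite -(ler_nat R) natrD => k2.
  apply: le_trans k2 _; move: h1 h2 h3 k1; rewrite !size_iota /=.
  move: (count _ _)%:R (count _ _)%:R (count _ _)%:R (count _ _)%:R (size _)%:R => a b c d e z1 z2 z3 z4.
  exact: (half_sum z1 z2 z3 z4).
pose goodt := [seq t <- tup fs | ~~ bad t].
have szg : 2^-1 * (size (tup fs))%:R <= (size goodt)%:R :> R.
  rewrite size_filter; apply: le_trans (_ : (size (tup fs))%:R - (count bad (tup fs))%:R <= _).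
    exact: half_le.
  by apply: count_compl => t; rewrite negbK.
have sztup : famc nrm n C ^+ 5 * (\prod_i G i) ^+ n <= (size (tup fs))%:R.
  rewrite tup_size /fs big_map big_enum natr_prod -prodrXl -[X in _ ^+ X]card_ord -prodr_const -big_split /=.
  by apply: ler_prod => i _; rewrite (fam_lb' HO) // mulr_ge0 ?exprn_ge0 ?(ltW fc0) // (le_trans ler01).
have goodP t : t \in goodt -> [/\ size t = 5, gdata O nrm Kg G (gof t), pcop O T1 (gof t),
    forall i, fineg HO wP T2 e2 Kg G S (gof t i) & forall i, fineg HO wP T2 e2 Kg Gt P (gof t (tau i))].
  rewrite mem_filter => /andP [nb /(@tupP F 0 fs)]; rewrite szfs => -[st tin].
  move: nb; rewrite /bad negb_or => /andP [n1]; rewrite negb_or => /andP [n2 n3].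
  have h1 jk : jk \in pairs5 -> ~~ Npc t`_jk.1 t`_jk.2.
    by move=> h; apply: contra n1 => h'; apply/hasP; exists jk.
  have h2 j : j \in iota 0 5 -> fineg HO wP T2 e2 Kg G S t`_j.
    by move=> h; apply: contraNT n2 => h'; apply/hasP; exists j.
  have h3 j : j \in iota 0 5 -> fineg HO wP T2 e2 Kg Gt P t`_j.
    by move=> h; apply: contraNT n3 => h'; apply/hasP; exists j.
  split=> //.
  - move=> i; have := tin i (ltn_ord i); rewrite nfs => /(famP HO (G1 i)) [a1 a2 a3 a4 _].
    by rewrite ffunE.
  - move=> i k ik; rewrite !ffunE.
    wlog lt : i k ik / (i < k)%N.
      move=> W; have [l|l|e] := ltngtP i k; [exact: W | by apply: cop_sym; apply: W => //; rewrite eq_sym |].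
      by rewrite (val_inj e) eqxx in ik.
    by have := h1 _ (pairs5_mem lt); rewrite /Npc negbK => /asboolP.
  - by move=> i; rewrite ffunE; apply: h2; rewrite mem_iota /= add0n.
  - by move=> i; rewrite ffunE; apply: h3; rewrite mem_iota /= add0n.
pose T5 := (T1 * T2 * (T2 * T3))%N.
pose gtau (g : 'I_5 -> F) i := g (tau i).
pose Ls t := [seq s <- lam5 (gof t) S | okE O w T2 (gof t) s && `[< cop T3 (x_ (gof t) i3 s) (x_ (gof t) i4 s) >]].
pose Lp t := [seq s <- lam5 (gtau (gof t)) P | okE O w T2 (gtau (gof t)) s && `[< cop T3 (x_ (gtau (gof t)) i3 s) (x_ (gtau (gof t)) i4 s) >]].
have uLs t : uniq (Ls t) by apply: filter_uniq; apply: (lam_uniq HO).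
have uLp t : uniq (Lp t) by apply: filter_uniq; apply: (lam_uniq HO).
pose row (sp : (F * F) * (F * F)) : 'rV[F]_4 := \row_(i < 4) [:: sp.1.1; sp.1.2; sp.2.1; sp.2.2]`_i.
pose ci t (i : 'I_5) (sp : (F * F) * (F * F)) := `[< cop T4 (x_ (gof t) i sp.1) (x_ (gtau (gof t)) (tau i) sp.2) >].
pose Q t := [seq sp <- [seq (s, p) | s <- Ls t, p <- Lp t] | all (fun i => ci t i sp) (enum 'I_5) && (Psi (row sp) != 0)].
have gtau_data t : t \in goodt -> gdata O nrm Kg Gt (gtau (gof t)) /\ pcop O T1 (gtau (gof t)).
  move=> /goodP [_ gd pc _ _]; split; first by move=> i; apply: gd.
  by move=> i k ik; apply: pc; rewrite (inj_eq (inv_inj tauK)).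
have szQ t : t \in goodt -> cl ^+ 2 / 4 * MS * MP <= (size (Q t))%:R.
  move=> tg; have [st gd pc f1 f2] := goodP t tg; have [gd' pc'] := gtau_data t tg.
  have hS : 3 / 4 * cl * MS <= (size (Ls t))%:R by rewrite size_filter; apply: HgP.
  have hP : 3 / 4 * cl * MP <= (size (Lp t))%:R.
    by rewrite size_filter /MP -GtP; apply: HgP => //; rewrite GtP.
  have MS0 : 0 <= MS by rewrite /MS divr_ge0 ?mulr_ge0 ?exprn_ge0 ?(ltW p0) // (le_trans ler01).
  have MP0 : 0 <= MP by rewrite /MP divr_ge0 ?mulr_ge0 ?exprn_ge0 ?(ltW p0) // (le_trans ler01).
  have hprod : 9 / 16 * cl ^+ 2 * (MS * MP) <= (size [seq (s, p) | s <- Ls t, p <- Lp t])%:R.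
    have c34 : 0 <= 3 / 4 * cl by rewrite mulr_ge0 ?divr_ge0 // ltW.
    rewrite size_allpairs natrM; apply: le_trans (ler_pM (mulr_ge0 c34 MS0) (mulr_ge0 c34 MP0) hS hP).
    by rewrite le_eqVlt; apply/predU1P; left; field.
  have hc i : (count (fun sp => ~~ ci t i sp) [seq (s, p) | s <- Ls t, p <- Lp t])%:R <= cl ^+ 2 / 80 * (MS * MP).
    have ac (A B : seq (F * F)) (W : (F * F) -> (F * F) -> bool) :
       count (fun sp => W sp.1 sp.2) [seq (s, p) | s <- A, p <- B] = (\sum_(s <- A) count (W s) B)%N.
      elim: A => [|s A IH]; first by rewrite big_nil.
      by rewrite allpairs_cons count_cat IH big_cons count_map.
    rewrite (ac _ _ (fun s p => ~~ `[< cop T4 (x_ (gof t) i s) (x_ (gtau (gof t)) (tau i) p) >])).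
    apply: le_trans (_ : (\sum_(s <- lam5 (gof t) S) count (fun p => ~~ `[< cop T4 (x_ (gof t) i s) (x_ (gtau (gof t)) (tau i) p) >]) (lam5 (gtau (gof t)) P))%:R <= _).
      rewrite ler_nat big_filter big_mkcond /=; apply: leq_sum => s _; case: ifP => // _.
      by rewrite count_filter; apply: sub_count => p /= /andP [].
    have := H4 G (gof t) Gt (gtau (gof t)) S P i (tau i) gd pc gd' pc' S1 P1 GS.
    by rewrite GtP => /(_ GP) h; rewrite mulrA.
  have hz : (count (fun sp => Psi (row sp) == 0) [seq (s, p) | s <- Ls t, p <- Lp t])%:R <= cl ^+ 2 / 16 * (MS * MP).
    rewrite mulrA; apply: (H5 G S P (Ls t) (Lp t) G1 HS5 HP5 (uLs t) (uLp t)).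
      move=> s; rewrite mem_filter => /andP [_]; rewrite mem_filter => /andP [_ /allpairsP [[a b] /= [h1 h2 ->]]].
      by split.
    move=> s; rewrite mem_filter => /andP [_]; rewrite mem_filter => /andP [_ /allpairsP [[a b] /= [h1 h2 ->]]].
    by split.
  have hcu : (count (fun sp => has (fun i => ~~ ci t i sp) (enum 'I_5)) [seq (s, p) | s <- Ls t, p <- Lp t])%:R <= cl ^+ 2 / 16 * (MS * MP).
    apply: le_trans (_ : (\sum_(i <- enum 'I_5) count (fun sp => ~~ ci t i sp) [seq (s, p) | s <- Ls t, p <- Lp t])%:R <= _).
      by rewrite ler_nat (count_has_le (fun i sp => ~~ ci t i sp)).
    rewrite natr_sum; apply: le_trans (ler_sum _ (fun i _ => hc i)) _.
    rewrite big_const_seq count_predT size_enum_ord iter_addr_0 -[X in X <= _]mulr_natl.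
    by rewrite le_eqVlt; apply/predU1P; left; field.
  rewrite size_filter.
  apply: le_trans (_ : (size [seq (s, p) | s <- Ls t, p <- Lp t])%:R -
    (count (fun sp => has (fun i => ~~ ci t i sp) (enum 'I_5) || (Psi (row sp) == 0)) [seq (s, p) | s <- Ls t, p <- Lp t])%:R <= _); last first.
    by apply: count_compl => sp; rewrite negb_and -has_predC negbK.
  have := count_or_le (fun sp => has (fun i => ~~ ci t i sp) (enum 'I_5)) (fun sp => Psi (row sp) == 0) [seq (s, p) | s <- Ls t, p <- Lp t].
  rewrite -(ler_nat R) natrD; move: hprod hcu hz.
  have -> : cl ^+ 2 / 4 * MS * MP = cl ^+ 2 / 4 * (MS * MP) by exact: (esym (mulrA _ _ _)).
  move: (MS * MP) (mulr_ge0 MS0 MP0) (exprn_gt0 2 cl0) => M M0; move: (cl ^+ 2) => c2 c20.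
  move: (size _)%:R (count _ _)%:R (count _ _)%:R (count _ _)%:R => a b c d h1 h2 h3 h4.
  have h5 : 0 <= c2 * M by rewrite mulr_ge0 // ltW.
  exact: (quarter_left h1 h2 h3 h4 h5).
pose D := [seq ((gof t, sp.1), sp.2) : data F | t <- goodt, sp <- Q t].
exists D; split.
- apply: allpairs_uniq_dep.
  + by rewrite filter_uniq // tup_uniq //; apply/allP => _ /mapP [i _ ->]; apply: (fam_uniq HO).
  + move=> t tg; by apply: filter_uniq; apply: (allpairs_uniq (uLs t) (uLp t)) => -[a b] [c e] _ _ /= [-> ->].
  + move=> x x' /allpairsPdep [t [sp [tg _ ->]]] /allpairsPdep [t' [sp' [tg' _ ->]]] /= [E E1 E2].
    have [st _ _ _ _] := goodP _ tg; have [st' _ _ _ _] := goodP _ tg'.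
    have -> : t = t'.
      apply: (@eq_from_nth _ 0); rewrite st ?st' // => i i5.
      by have /ffunP/(_ (Ordinal i5)) := E; rewrite !ffunE.
    by have -> : sp = sp' by case: (sp) (sp') E1 E2 => a b [c e] /= -> ->.
- move=> _ /allpairsPdep [t [[s p] [tg + ->]]] /=.
  have [st gd pc f1 f2] := goodP t tg; have [gd' pc'] := gtau_data t tg.
  rewrite mem_filter => /andP [/andP [/allP hci hPsi] /allpairsP [[s' p'] /= [ss pp [E1 E2]]]]; subst s' p'.
  move: ss pp; rewrite !mem_filter -/lam5 => /andP [/andP [ok1 /asboolP c1] sl] /andP [/andP [ok2 /asboolP c2] pl].
  have sl' : s \in lam5 (gof t) S by rewrite lam5E /lam mem_filter.
  have pl' : p \in lam5 (gtau (gof t)) P by rewrite lam5E /lam mem_filter.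
  split=> //; split=> /=.
  + apply: (@cop_dvdn _ _ T5); first exact: dvdn_mulr.
    exact: (s_cop HO wP gd pc S1 sl' ok1 c1).
  + apply: (@cop_dvdn _ _ T5); first exact: dvdn_mulr.
    exact: (s_cop HO wP gd' pc' P1 pl' ok2 c2).
  + move=> i; apply: (@cop_dvdn _ _ T4); first exact: dvdn_mull.
    have /asboolP := hci i (mem_enum _ i); rewrite /xcoord /gtau tauK; exact: id.
- rewrite size_allpairs_dep sumnE big_map natr_sum.
  apply: le_trans (_ : \sum_(t <- goodt) cl ^+ 2 / 4 * MS * MP <= _); last first.
    by rewrite big_seq [leRHS]big_seq; apply: ler_sum => t; apply: szQ.
  rewrite big_const_seq count_predT iter_addr_0 -[leRHS]mulr_natl.
  have MS0 : 0 <= MS by rewrite /MS divr_ge0 ?mulr_ge0 ?exprn_ge0 ?(ltW p0) // (le_trans ler01).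
  have MP0 : 0 <= MP by rewrite /MP divr_ge0 ?mulr_ge0 ?exprn_ge0 ?(ltW p0) // (le_trans ler01).
  have k : 2^-1 * (famc nrm n C ^+ 5 * (\prod_i G i) ^+ n) <= (size goodt)%:R.
    by apply: le_trans szg; rewrite ler_wpM2l // invr_ge0.
  have X0 : 0 <= cl ^+ 2 / 4 * MS * MP by apply: (mulr_ge0 (mulr_ge0 _ MS0) MP0); rewrite divr_ge0 ?exprn_ge0 // ltW.
  apply: le_trans (ler_wpM2r X0 k).
  by rewrite le_eqVlt; apply/predU1P; left; field.
Qed.

End CaseSplit.

(** * Good data in one box when p is the conjugate of s *)

Section Conjugation.
Variables (R : realType) (K : fieldType) (O : subringClosed K).
Variables (nrm : K -> R) (box : R -> seq K) (n : nat) (C : R).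
Hypothesis HO : is_order O nrm box n C.
Variable noroot : forall z : K, z ^+ 2 + z + 1 != 0.
Local Notation E := (quad noroot).
Local Notation OE := (@quadO K noroot O).
Local Notation NE := (nrmQ nrm (noroot := noroot)).
Local Notation BE := (boxQ nrm box noroot).
Local Notation th := (@qconj K noroot).
Local Notation w := (qw noroot).
Local Notation HE := (orderQ HO noroot).
Local Notation copE := (cop OE).
Local Notation cf := (cf w).
Local Notation lamE5 := (lam5 OE NE BE w).
Local Notation x_ := (xcoord cf).

Lemma cop_conj T (a b : E) : copE T a b -> copE T (th a) (th b).
Proof.
move=> [u [v [uO vO e]]]; exists (th u), (th v); rewrite !qconjO //; split=> //.
by rewrite -!rmorphM -rmorphD e rmorph_nat.
Qed.

Lemma cop_conjE T (a b : E) : `[< copE T (th a) b >] = `[< copE T a (th b) >].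
Proof. by apply/asboolP/asboolP => /cop_conj; rewrite qconjK. Qed.

Lemma conj_box X : perm_eq [seq th x | x <- BE X] (BE X).
Proof.
have i := inv_inj (@qconjK K noroot); apply: uniq_perm; rewrite ?(map_inj_uniq i) ?(box_uniq HE) //.
move=> x; rewrite (boxE HE) -(nrmQ_conj HO); apply/mapP/andP => [[y]|[xO xn]].
  by rewrite (boxE HE) => /andP [yO yn] ->; rewrite qconjK qconjO.
by exists (th x); rewrite ?qconjK // (boxE HE) qconjO.
Qed.

Lemma conj_fam X : perm_eq [seq th x | x <- fam NE BE X] (fam NE BE X).
Proof.
rewrite /fam -map_comp (eq_map (g := (fun u => (Num.truncn X).+1%:R + u) \o th)).
  by rewrite map_comp; apply: perm_map; apply: conj_box.
by move=> u /=; rewrite rmorphD rmorph_nat.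
Qed.

Lemma fineg_conj (wP : w ^+ 2 + w + 1 = 0) T2 e Kg G S a :
  fineg HE wP T2 e Kg G S (th a) = fineg HE wP T2 e Kg G S a.
Proof.
have h X : count (fun x : E => (x != 0%R) && ~~ `[< copE T2 (th a) x >]) (BE X) =
    count (fun x : E => (x != 0%R) && ~~ `[< copE T2 a x >]) (BE X).
  rewrite -((permP (conj_box X)) _) count_map; apply: eq_count => x /=.
  by rewrite fmorph_eq0 cop_conjE qconjK.
by apply: eq_forallb => j; rewrite h.
Qed.

Lemma fam_conj_fam (eps : R) : 0 < eps -> exists2 T : nat, (0 < T)%N & forall G G', 1 <= G -> 1 <= G' ->
  (\sum_(g <- fam NE BE G) count (fun x : E => ~~ `[< copE T g (th x) >]) (fam NE BE G'))%:R
     <= eps * ((size (fam NE BE G))%:R * (size (fam NE BE G'))%:R).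
Proof.
move=> e0; have [T T0 H] := fam_bad_fam HE e0; exists T => // G G' G1 G1'.
apply: le_trans (H _ _ G1 G1'); rewrite ler_nat; apply: leq_sum => g _.
have := (permP (conj_fam G')) (fun x => ~~ `[< copE T g x >]).
by rewrite count_map => e; exact: eq_leq e.
Qed.

(** The first coordinate of a member is near a natural number, hence balanced over K, so [coord_cop]
    applies. *)
Lemma fam_cop_conj (eps : R) : 0 < eps -> exists (T : nat) (G0 : R), [/\ (0 < T)%N, 1 <= G0 & forall G, G0 <= G ->
  (count (fun x : E => ~~ `[< copE T x (th x) >]) (fam NE BE G))%:R <= eps * (size (fam NE BE G))%:R].
Proof.
move=> e0; have n0 := nrm_ge0 HO; have n1 : 1 <= nrm 1 := nrm1_ge1 HO.
have k1 := famK_ge1 HE; have c0 := famc_gt0 HE; have f0 := feta_gt0 HE.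
pose K1 := (2 * nrm 1 + feta NE) * (2 * nrm 1).
have K11 : 1 <= K1 by rewrite /K1; nra.
have kn : 0 < famK NE ^+ (2 * n) by rewrite exprn_gt0 // (lt_le_trans ltr01).
have e0' : 0 < eps * famc NE (2 * n) (constQ n C) / famK NE ^+ (2 * n) by rewrite divr_gt0 // mulr_gt0.
have [T [G0 [T0 G01 H]]] := coord_cop HO noroot K11 e0'.
exists T, G0; split=> // G hG; have G1 : 1 <= G := le_trans G01 hG; have Gp := lt_le_trans ltr01 G1.
have hY : G0 <= famK NE * G by apply: le_trans hG _; rewrite ler_peMl // ltW.
apply: le_trans (le_trans (H _ hY) _); last first.
  have h := fam_lb' HE G1; rewrite exprMn.
  apply: le_trans (ler_wpM2l (ltW e0) h).
  by rewrite le_eqVlt; apply/predU1P; left; field; rewrite gt_eqF.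
rewrite ler_nat -!size_filter; apply: uniq_leq_size; first by rewrite filter_uniq ?(fam_uniq HE).
move=> x; rewrite mem_filter => /andP [nc xf]; have [xO x0 xn _ _] := famP HE G1 xf.
rewrite mem_filter (boxE HE) xO xn nc !andbT /=.
move/mapP: xf => [u]; rewrite (boxE HE) => /andP [_ un] Ex.
have /andP [m1 m2] := truncn_itv (ltW Gp).
have mG : (Num.truncn G).+1%:R <= 2 * G by rewrite -addn1 natrD; move: m1 G1; lra.
have Ex1 : x.1 = (Num.truncn G).+1%:R + u.1 by rewrite Ex qnat.
have [||z0 zn zV] := near_bal HO (z := x.1) (w := 1) (x := feta NE) Gp (oner_neq0 _) (ltW m2) mG.
- by rewrite Ex1 mulr1 addrAC subrr add0r; apply: le_trans un; case: (nrmQ_coord HO noroot u).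
- have N1 : NE 1 = 6 * nrm 1 by rewrite -(nrmQ_emb HO noroot) rmorph1.
  rewrite /feta N1 invr1.
  by rewrite mulrC ler_pdivrMr; nra.
rewrite z0 /=; rewrite /cond; apply: le_trans (ler_pM (n0 _) (n0 _) zn zV) _.
by rewrite invr1 /K1 le_eqVlt; apply/predU1P; left; field; rewrite gt_eqF.
Qed.

(** The effect of conjugation on the five forms: it exchanges w and w^2. *)
Definition swap12 (i : 'I_5) : 'I_5 := nth i [:: inord 0; inord 2; inord 1; inord 3; inord 4] i.

Lemma swap12K : involutive swap12.
Proof. by case=> [[|[|[|[|[|]]]]] //= h]; apply: val_inj; rewrite /swap12 /= ?inordK //= ?inordK. Qed.

Lemma ell_conj i (s : E * E) : ell cf i (th s.1, th s.2) = th (ell cf (swap12 i) s).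
Proof.
have tw : th w = -1 - w by congr pair; rewrite /=; ring.
have tw' : th (-1 - w) = w by rewrite -tw qconjK.
have [e1 e2] : (cf i).1 = th (cf (swap12 i)).1 /\ (cf i).2 = th (cf (swap12 i)).2.
  by case: i => [[|[|[|[|[|]]]]] //= h]; rewrite /swap12 /cf /= !inordK //= ?tw ?tw' ?rmorph1 ?rmorph0.
by rewrite /ell e1 e2 rmorphD !rmorphM.
Qed.

(** The shape that makes the congruences for the conjugate of s follow from those for s: conjugation
    combined with [swap12] acts on g as [tau]. *)
Definition gconj (t : seq E) : {ffun 'I_5 -> E} :=
  [ffun i : 'I_5 => [:: t`_0; t`_1; th t`_1; t`_2; th t`_2]`_i].
Definition Gconj (G0 G1 G2 : R) (i : 'I_5) : R := [:: G0; G1; G1; G2; G2]`_i.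

Lemma gconj_tau t i : th t`_0 = t`_0 -> gconj t (tau i) = th (gconj t (swap12 i)).
Proof.
by move=> h0; rewrite !ffunE; case: i => [[|[|[|[|[|]]]]] //= h]; rewrite /tau /swap12 /= !inordK //= ?qconjK ?h0.
Qed.

Lemma prod_gconj t : th t`_0 = t`_0 -> th (\prod_i gconj t i) = \prod_i gconj t i.
Proof.
move=> t0; rewrite -[RHS]prod_tau rmorph_prod [LHS](reindex_inj (inv_inj swap12K)).
by apply: eq_bigr => i _; rewrite gconj_tau.
Qed.

Lemma lam5_conj t S s : th t`_0 = t`_0 -> 1 <= S -> s \in lamE5 (gconj t) S ->
  (th s.1, th s.2) \in lamE5 (fun i => gconj t (tau i)) S.
Proof.
move=> t0 S1 /(lamE HE _ _ _ _ _ (le_trans ler01 S1)) [s1 s2 [m [m1 m2 h1 h2]] sg].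
apply/(lamE HE _ _ _ _ _ (le_trans ler01 S1)); split; rewrite ?qconjO //.
- exists m; split=> //=.
    have -> : th s.1 - m%:R * 1 = th (s.1 - m%:R * 1) by rewrite rmorphB rmorphM rmorph_nat rmorph1.
    by rewrite (nrmQ_conj HO).
  have -> : th s.2 - m%:R * 5%:R = th (s.2 - m%:R * 5%:R) by rewrite rmorphB rmorphM !rmorph_nat.
  by rewrite (nrmQ_conj HO).
- by move=> i; rewrite ell_conj gconj_tau // -fmorph_div qconjO.
Qed.

(** Here g_1 lies in K, so the first coordinate of (alpha + beta) / g_1 is that of alpha + beta
    divided by an element of K; it is near 6 m, since [v5] takes the value 6 on this form. *)
Lemma x0_balanced : exists2 K1 : R, 1 <= K1 & forall (t : seq E) G0 S a s, 1 <= G0 -> 1 <= S ->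
  a \in fam nrm box G0 -> t`_0 = qemb noroot a -> s \in lamE5 (gconj t) S ->
  (x_ (gconj t) (inord 0) s).1 != 0 /\ cond nrm (x_ (gconj t) (inord 0) s).1 <= K1.
Proof.
have n0 := nrm_ge0 HO; have f1 := famK_ge1 HO; have eta0 := eta5_gt0 HE w.
have six0 : 6%:R != 0 :> K by apply: (natF_neq0 HO).
have [A EA] : exists A, A = (2 * nrm 6%:R + 2 * eta5 NE w) * (2 * nrm 6%:R^-1) by eexists.
have A0 : 0 <= A by rewrite EA !mulr_ge0 ?addr_ge0 ?mulr_ge0 // ltW.
exists (1 + A * (famK nrm * famK nrm)); first by rewrite lerDl !mulr_ge0 // (le_trans ler01).
move=> t G0 S a s G01 S1 af Et; have S0 := lt_le_trans ltr01 S1.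
move=> /(lamE HE _ _ _ _ _ (ltW S0)) [s1 s2 [m [m1 m2 h1 h2]] _].
have [aO a0 an aV ac] := famP HO G01 af.
have -> : (x_ (gconj t) (inord 0) s).1 = (s.1.1 + s.2.1) / a.
  have -> : x_ (gconj t) (inord 0) s = (s.1 + s.2) * qemb noroot a^-1.
    by rewrite fmorphV /xcoord /ell /cf ffunE !inordK //= Et; congr (_ / _); ring.
  by case: (s) => -[b c] [b' c'] /=; ring.
have [||z0 zn zV] := near_bal HO (z := s.1.1 + s.2.1) (w := 6%:R) (x := 2 * eta5 NE w) S0 six0 m1 m2.
- have -> : s.1.1 + s.2.1 - m%:R * 6%:R = (s.1.1 - m%:R) + (s.2.1 - m%:R * 5%:R) by ring.
  apply: le_trans (nrmD HO _ _) _; rewrite -mulrA mulr2n mulrDl mul1r.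
  apply: lerD.
    apply: le_trans h1; rewrite mulr1 (qnat noroot); by case: (nrmQ_coord HO noroot (s.1 - qemb noroot m%:R)).
  have e : s.2 - m%:R * (v5 E).2 = s.2 - qemb noroot (m%:R * 5%:R) by rewrite rmorphM !rmorph_nat.
  rewrite e in h2; apply: le_trans h2; by case: (nrmQ_coord HO noroot (s.2 - qemb noroot (m%:R * 5%:R))).
- have := eta5P HE w (inord 0).
  have -> : ell cf (inord 0) (v5 E) = qemb noroot 6%:R.
    by rewrite /ell /cf /v5 inordK //= (qnat noroot 5) -[1](rmorph1 (qemb noroot)) -!rmorphM -!rmorphD; congr (qemb _ _); ring.
  rewrite /cf inordK //= -[1](rmorph1 (qemb noroot)) -fmorphV !(nrmQ_emb HO) => h; apply: le_trans h.
  have := nrm1_ge1 HO; have := n0 6%:R^-1; move: (nrm _) (nrm 1) (eta5 NE w) eta0 => x y e e0 x0 y1.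
  have ex : 0 <= e * x by rewrite mulr_ge0 // ltW.
  have : 1 * (e * x) <= y * (e * x) by rewrite ler_wpM2r.
  by rewrite mulrDr; lra.
split; first by rewrite mulf_neq0 ?invr_neq0.
apply: le_trans (condM HO _ _) _; rewrite condV.
apply: le_trans (_ : A * (famK nrm * famK nrm) <= _); last by rewrite lerDr.
apply: ler_pM; rewrite ?mulr_ge0 //.
apply: le_trans (ler_pM (n0 _) (n0 _) zn zV) _.
by rewrite EA le_eqVlt; apply/predU1P; left; field; rewrite gt_eqF.
Qed.

Definition KgB : R := famK NE + 6 * famK nrm.

Lemma KgB_ge1 : 1 <= KgB.
Proof. by have := famK_ge1 HO; have := famK_ge1 HE; rewrite /KgB; lra. Qed.

Lemma prod_Gconj (G0 G1 G2 : R) : \prod_i Gconj G0 G1 G2 i = G0 * G1 ^+ 2 * G2 ^+ 2.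
Proof. by rewrite !big_ord_recl big_ord0 /Gconj /=; ring. Qed.

Lemma gdata_conj G0 G1 G2 t a : 1 <= G0 -> 1 <= G1 -> 1 <= G2 ->
  a \in fam nrm box G0 -> t`_0 = qemb noroot a -> t`_1 \in fam NE BE G1 -> t`_2 \in fam NE BE G2 ->
  gdata OE NE KgB (Gconj G0 G1 G2) (gconj t).
Proof.
move=> G01 G11 G21 /(famP HO G01) [aO a0 an aV _] E0 /(famP HE G11) [bO b0 bn bV _] /(famP HE G21) [cO c0 cn cV _].
have k1 := famK_ge1 HO; have kE := famK_ge1 HE.
have g0 := lt_le_trans ltr01 G01; have g1 := lt_le_trans ltr01 G11; have g2 := lt_le_trans ltr01 G21.
have w1 : famK NE <= KgB by rewrite /KgB; lra.
have w2 : 6 * famK nrm <= KgB by rewrite /KgB; lra.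
have m x y (z : R) : x <= y -> 0 < z -> x * z <= y * z by move=> *; rewrite ler_wpM2r // ltW.
have d x y (z : R) : x <= y -> 0 < z -> x / z <= y / z by move=> *; rewrite ler_wpM2r // invr_ge0 ltW.
have NV (x : E) : NE (th x)^-1 = NE x^-1 by rewrite -fmorphV (nrmQ_conj HO).
move=> i; rewrite ffunE /Gconj; case: i => [[|[|[|[|[|]]]]] //= h]; split=> //;
  rewrite ?E0 ?qemb_O ?qconjO ?fmorph_eq0 ?(nrmQ_conj HO) ?NV //.
- by rewrite (nrmQ_emb HO); apply: le_trans (m _ _ _ w2 g0); rewrite -mulrA ler_wpM2l.
- by rewrite -fmorphV (nrmQ_emb HO); apply: le_trans (d _ _ _ w2 g0); rewrite -mulrA ler_wpM2l.
- by apply: le_trans bn _; apply: m.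
- by apply: le_trans bV _; apply: d.
- by apply: le_trans bn _; apply: m.
- by apply: le_trans bV _; apply: d.
- by apply: le_trans cn _; apply: m.
- by apply: le_trans cV _; apply: d.
- by apply: le_trans cn _; apply: m.
- by apply: le_trans cV _; apply: d.
Qed.

Lemma pcop_conj (T : nat) t : th t`_0 = t`_0 -> copE T t`_0 t`_1 -> copE T t`_0 t`_2 -> copE T t`_1 t`_2 ->
  copE T t`_1 (th t`_2) -> copE T t`_1 (th t`_1) -> copE T t`_2 (th t`_2) -> pcop OE T (gconj t).
Proof.
move=> t0 c01 c02 c12 c12' c11 c22.
have k1 := cop_conj c01; have k2 := cop_conj c02; have k3 := cop_conj c12; have k4 := cop_conj c12'.
rewrite t0 in k1 k2; rewrite qconjK in k4.
have H (i k : 'I_5) : (i < k)%N -> copE T (gconj t i) (gconj t k).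
  by rewrite !ffunE; case: i => [[|[|[|[|[|]]]]] //= h]; case: k => [[|[|[|[|[|]]]]] //= h'].
move=> i k ik; have [l|l|e] := ltngtP i k; [exact: H | by apply: cop_sym; apply: H |].
by rewrite (val_inj e) eqxx in ik.
Qed.

Lemma conj0_count (Kg K1 eps : R) (T1 : nat) : 1 <= Kg -> (0 < T1)%N -> 1 <= K1 -> 0 < eps ->
  exists (T : nat) (Cs : R), [/\ (0 < T)%N, 1 <= Cs & forall G g S, gdata OE NE Kg G g -> pcop OE T1 g ->
  1 <= S -> \prod_i G i <= S -> Cs * G (inord 0) <= S ->
  (count (fun s => [&& (x_ g (inord 0) s).1 != 0, cond nrm (x_ g (inord 0) s).1 <= K1 &
      ~~ `[< copE T (x_ g (inord 0) s) (th (x_ g (inord 0) s)) >]]) (lamE5 g S))%:R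
    <= eps * (S ^+ (2 * n) * S ^+ (2 * n) / (\prod_i G i) ^+ (2 * n))].
Proof.
move=> Kg1 T10 K11 e0; have [Cf Cf1 H] := fibre5 HE (qwP noroot) (qw_O noroot O) Kg1 T10.
have Cf0 := lt_le_trans ltr01 Cf1.
have [A EA] : exists A, A = ellK HE (v5P HE (qwP noroot)) (eta5_gt0 HE w) (eta5P HE w) * Kg by eexists.
have A1 : 1 <= A by rewrite EA mulr_ege1 // ellK_ge1.
have Ap : 0 < A ^+ (2 * n) by rewrite exprn_gt0 // (lt_le_trans ltr01).
have [|T [G0 [T0 G01 HT]]] := coord_cop HO noroot K11 (eps := eps / (Cf * A ^+ (2 * n))).
  by rewrite divr_gt0 // mulr_gt0.
exists T, G0; split=> // G g S gd pc S1 GS hS; have G1 := gdata_ge1 gd.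
pose P (x : E) := [&& x.1 != 0, cond nrm x.1 <= K1 & ~~ `[< copE T x (th x) >]].
have W0 : 0 <= S / wprod G (inord 0) by apply: le_trans ler01 (wprod_le _ G1 GS).
apply: le_trans (H G g S (inord 0) P gd pc S1 GS) _.
have g0 := lt_le_trans ltr01 (G1 (inord 0)).
have hY : G0 <= A * (S / G (inord 0)).
  apply: le_trans (_ : S / G (inord 0) <= _); first by rewrite ler_pdivlMr.
  by rewrite ler_peMl // divr_ge0 ?(le_trans ler01 S1) // ltW.
have -> : ellK HE (v5P HE (qwP noroot)) (eta5_gt0 HE w) (eta5P HE w) * Kg * S / G (inord 0) = A * (S / G (inord 0)) by rewrite EA; exact: esym (mulrA _ _ _).
have k := HT _ hY.
have k' : (count (fun x : E => (x != 0) && P x) (BE (A * (S / G (inord 0)))))%:R <= eps / (Cf * A ^+ (2 * n)) * (A * (S / G (inord 0))) ^+ (2 * n).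
  by apply: le_trans k; rewrite ler_nat; apply: sub_count => x /andP [].
have C0 : 0 <= Cf * (S / wprod G (inord 0)) ^+ (2 * n) by rewrite mulr_ge0 ?exprn_ge0 // ltW.
apply: le_trans (ler_wpM2r C0 k') _; rewrite -(mainE (2 * n) (inord 0) S G1) exprMn.
by rewrite le_eqVlt; apply/predU1P; left; field; rewrite !gt_eqF.
Qed.

(** The composite of [tau] and [swap12] fixes the first form and pairs 1 with 2 and 3 with 4, so up
    to conjugation only three of the five coprimality conditions remain. *)
Lemma dgood_conj T t s : th t`_0 = t`_0 -> copE T s.1 s.2 ->
  copE T (x_ (gconj t) (inord 0) s) (th (x_ (gconj t) (inord 0) s)) ->
  copE T (x_ (gconj t) (inord 1) s) (th (x_ (gconj t) (inord 2) s)) ->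
  copE T (x_ (gconj t) (inord 3) s) (th (x_ (gconj t) (inord 4) s)) ->
  dgood OE w T ((gconj t, s), (th s.1, th s.2)).
Proof.
move=> t0 cs c0 c12 c34; split=> //=; first exact: cop_conj.
have c21 := cop_sym (cop_conj c12); have c43 := cop_sym (cop_conj c34); rewrite !qconjK in c21 c43.
move=> i; have -> : ell cf (tau i) (th s.1, th s.2) / gconj t i = th (x_ (gconj t) (swap12 (tau i)) s).
  by rewrite ell_conj -{2}(tauK i) gconj_tau // -fmorph_div.
rewrite -[ell _ _ _ / _]/(x_ (gconj t) i s).
have ei : i = inord i by apply: val_inj; rewrite /= inordK.
rewrite ei; case: i {ei} => [[|[|[|[|[|]]]]] //= h];
  rewrite /swap12 /tau /= ?inordK //= ?inordK //= ?inordK //.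
Qed.

Lemma sub_coprime_count (eps : R) : 0 < eps -> exists2 T : nat, (0 < T)%N &
  forall G0 G, 1 <= G0 -> 1 <= G ->
  (\sum_(g <- [seq qemb noroot a | a <- fam nrm box G0]) count (fun x : E => ~~ `[< copE T g x >]) (fam NE BE G))%:R
     <= eps * ((size [seq qemb noroot a | a <- fam nrm box G0])%:R * (size (fam NE BE G))%:R).
Proof.
move=> e0; have k1 := famK_ge1 HE; have c0 := famc_gt0 HE.
have kn : 0 < famK NE ^+ (2 * n) by rewrite exprn_gt0 // (lt_le_trans ltr01).
have e0' : 0 < eps * famc NE (2 * n) (constQ n C) / famK NE ^+ (2 * n) by rewrite divr_gt0 // mulr_gt0.
have [T T0 H] := emb_bad_box HO noroot e0'; exists T => // G0 G G01 G1.
rewrite big_map size_map.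
have := bad_box_fam HO e0' (fun Y => H _ Y G01) G1 => h; apply: le_trans h _.
by rewrite le_eqVlt; apply/predU1P; left; field; rewrite !gt_eqF.
Qed.

(** Since s alone determines p, the exceptional s are removed directly from its lattice. Coprimality
    of distinct x_i and conj x_j comes from [bad_in_lam] with conjugation; that of x_0 with its own
    conjugate is no relation between two coordinates and goes through [coord_cop]. *)
Theorem caseB (Psi : 'rV[K]_4 -> K) (u0 : 'rV[K]_4) : polyfun Psi -> Psi u0 != 0 ->
  exists (T1 T : nat) (c Cs : R), [/\ (0 < T1)%N, (0 < T)%N, 0 < c, 1 <= Cs &
  forall G0 G1 G2 S, Cs <= G0 -> Cs <= G1 -> Cs <= G2 -> Cs * (G0 * G1 ^+ 2 * G2 ^+ 2) ^+ (2 * n).+1 <= S ->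
  exists D : seq (data E), [/\ uniq D,
    forall d, d \in D -> [/\ dsize OE NE BE w KgB (Gconj G0 G1 G2) S S d, dgood OE w T d, pcop OE T1 d.1.1,
      d.2 = (th d.1.2.1, th d.1.2.2) /\ th (\prod_i d.1.1 i) = \prod_i d.1.1 i &
      Psi (\row_(i < 4) [:: d.1.2.1.1; d.1.2.1.2; d.1.2.2.1; d.1.2.2.2]`_i) != 0] &
   c * ((G0 * G1 ^+ 2 * G2 ^+ 2) ^+ n * (S ^+ (2 * n) * S ^+ (2 * n) / (G0 * G1 ^+ 2 * G2 ^+ 2) ^+ (2 * n))) <= (size D)%:R]].
Proof.
move=> pPsi Pu; have Kg1 := KgB_ge1; have wP := qwP noroot; have wO := qw_O noroot O.
have q0 : 0 < 40^-1 :> R by rewrite invr_gt0.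
have c940 : 9%:R * 40^-1 <= 2^-1 :> R by lra.
have [Ta Ta0 Ha] := sub_coprime_count q0.
have [Tb Tb0 Hb] := fam_bad_fam HE q0.
have [Tc Tc0 Hc] := fam_conj_fam q0.
have [Td [Gd [Td0 Gd1 Hd]]] := fam_cop_conj q0.
have [T1 ET1] : exists x, x = (Ta * Tb * (Tc * Td))%N by eexists.
have T10 : (0 < T1)%N by rewrite ET1 !muln_gt0 Ta0 Tb0 Tc0.
have dTa : (Ta %| T1)%N by rewrite ET1 -mulnA dvdn_mulr.
have dTb : (Tb %| T1)%N by rewrite ET1 [(Ta * Tb)%N]mulnC -mulnA dvdn_mulr.
have dTc : (Tc %| T1)%N by rewrite ET1 mulnCA dvdn_mulr.
have dTd : (Td %| T1)%N by rewrite ET1 mulnA dvdn_mull.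
have [cl [e2 [cl0 e20 Hgood]]] := good_points HE wP wO Kg1 T10.
pose Kb := ellK HE (v5P HE wP) (eta5_gt0 HE w) (eta5P HE w).
have Kb1 : 1 <= Kb := Kb_ge1 HE wP.
have Kg0 := lt_le_trans ltr01 Kg1; have Kb0 := lt_le_trans ltr01 Kb1.
have Kn0 : 0 < (Kb * KgB) ^+ (2 * n) by apply: exprn_gt0; apply: mulr_gt0.
have e30 : 0 < e2 / (200 * (Kb * KgB) ^+ (2 * n)) by apply: (divr_gt0 e20); apply: mulr_gt0 Kn0; rewrite ltr0n.
have [T2a T2a0 H2a] := emb_bad_box HO noroot e30.
have [T2b T2b0 H2b] := fam_bad_box HE e30.
have [T2 ET2] : exists x, x = (T2a * T2b)%N by eexists.
have T20 : (0 < T2)%N by rewrite ET2 muln_gt0 T2a0.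
have [T3 [Cs3 [T30 Cs31 HgP]]] := Hgood T2 T20.
have es0 : 0 < cl / 16 by rewrite divr_gt0.
have [T4 [Cs4 [T40 Cs41 H4]]] := bad_in_lam HE (cfO wO) (isT : (0 < 3)%N) (cf_det wP (three_neq0 HE) wO)
  (v5P HE wP) (eta5_gt0 HE w) (eta5P HE w) (th := qconj (noroot := noroot)) (@qconjK K noroot) (@qconjO K noroot O)
  (nrmQ_conj HO (noroot := noroot)) Kg1 es0 T10 T20.
have [K1 K11 Hbal] := x0_balanced.
have [T5 [Cs5 [T50 Cs51 H5]]] := conj0_count Kg1 T10 K11 es0.
have [Cs6 Cs61 H6] := zeros_bound HO pPsi Pu es0 (kap5_ge0 HE w).
have [cK EcK] : exists x, x = famc nrm n C by eexists.
have [cE EcE] : exists x, x = famc NE (2 * n) (constQ n C) by eexists.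
have cK0 : 0 < cK by rewrite EcK (famc_gt0 HO).
have cE0 : 0 < cE by rewrite EcE (famc_gt0 HE).
have [Cs [GdC C3 C4 C5 C6]] : exists x, [/\ Gd <= x, Cs3 <= x, Cs4 <= x, Cs5 <= x & Cs6 <= x].
  by exists (Num.max Gd (Num.max Cs3 (Num.max Cs4 (Num.max Cs5 Cs6)))); rewrite !le_max !lexx !orbT.
have Cs1 : 1 <= Cs := le_trans Gd1 GdC.
exists T1, (T1 * T2 * (T2 * T3) * (T4 * T5))%N, (cK * cE ^+ 2 * cl / 4), Cs.
split=> //; first by rewrite !muln_gt0 T10 T20 T30 T40.
  by rewrite divr_gt0 // !mulr_gt0 // exprn_gt0.
move=> G0 G1 G2 S hG0 hG1 hG2 HS.
have G01 : 1 <= G0 := le_trans Cs1 hG0; have G11 : 1 <= G1 := le_trans Cs1 hG1; have G21 : 1 <= G2 := le_trans Cs1 hG2.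
have [G EG] : exists x, x = Gconj G0 G1 G2 by eexists.
have Gge1 i : 1 <= G i by rewrite EG /Gconj; case: i => [[|[|[|[|[|]]]]] //=].
have GP : \prod_i G i = G0 * G1 ^+ 2 * G2 ^+ 2 by rewrite EG prod_Gconj.
rewrite -GP in HS *.
have p1 : 1 <= \prod_i G i by apply: prod_ge1.
have p0 := lt_le_trans ltr01 p1.
have [S1 GS CsS] := bigprod_le1 Gge1 Cs1 HS; have S0 := lt_le_trans ltr01 S1.
have weak X k : X <= Cs -> (k <= 2 * n)%N -> 0 <= X -> X * (\prod_i G i) ^+ k.+1 <= S.
  move=> h hk X0; apply: le_trans HS; apply: ler_pM; rewrite ?exprn_ge0 ?(ltW p0) //.
  by rewrite ler_weXn2l.
have nn : (n <= 2 * n)%N by rewrite leq_pmull.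
have HS3 : Cs3 * (\prod_i G i) ^+ (2 * n).+1 <= S by apply: weak => //; rewrite (le_trans ler01).
have HS4 : Cs4 * (\prod_i G i) ^+ (2 * n).+1 <= S by apply: weak => //; rewrite (le_trans ler01).
have HS6 : Cs6 * (\prod_i G i) ^+ n.+1 <= S by apply: weak => //; rewrite (le_trans ler01).
have HS5 : Cs5 * G (inord 0) <= S.
  apply: le_trans (weak Cs5 0 _ _ _) => //; rewrite ?(le_trans ler01 Cs51) //.
  rewrite expr1 ler_wpM2l ?(le_trans ler01 Cs51) //.
  by rewrite (gprod_wprod G (inord 0)) ler_peMr ?(le_trans ler01) // prod_ge1.
have [MS EMS] : exists x, x = S ^+ (2 * n) * S ^+ (2 * n) / (\prod_i G i) ^+ (2 * n) by eexists.
have MS0 : 0 <= MS by rewrite EMS divr_ge0 ?mulr_ge0 ?exprn_ge0 ?(ltW p0) ?(ltW S0).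
rewrite -EMS.
pose A0 := [seq qemb noroot a | a <- fam nrm box G0].
pose fs := [:: A0; fam NE BE G1; fam NE BE G2].
have uA0 : uniq A0 by rewrite map_inj_uniq ?(fam_uniq HO) //; apply: fmorph_inj.
pose fg t j := ~~ fineg HE wP T2 e2 KgB G S t`_j.
(* Nine conditions on the three free elements, each failing for at most 1/40 of the triples. *)
pose ev : seq (pred (seq E)) := [:: fun t => ~~ `[< copE Ta t`_0 t`_1 >]; fun t => ~~ `[< copE Ta t`_0 t`_2 >];
  fun t => ~~ `[< copE Tb t`_1 t`_2 >]; fun t => ~~ `[< copE Tc t`_1 (th t`_2) >];
  fun t => ~~ `[< copE Td t`_1 (th t`_1) >]; fun t => ~~ `[< copE Td t`_2 (th t`_2) >];
  fg^~ 0%N; fg^~ 1%N; fg^~ 2].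
have ncop T T' (a b : E) : (T %| T')%N -> ~~ `[< copE T' a b >] -> ~~ `[< copE T a b >].
  by move=> dT; apply: contra => /asboolP h; apply/asboolP; apply: cop_dvdn dT h.
have Hfm (L : seq E) : (forall Y, 1 <= Y -> (\sum_(g <- L) count (fun x : E => (x != 0%R) && ~~ `[< copE T2 g x >]) (BE Y))%:R
     <= e2 / (200 * (Kb * KgB) ^+ (2 * n)) * (size L)%:R * Y ^+ (2 * n)) ->
   (count (fun g => ~~ fineg HE wP T2 e2 KgB G S g) L)%:R <= 40^-1 * (size L)%:R :> R.
  move=> h; have k := @fineg_markov _ _ _ _ _ _ _ HE w wP E id L T2 e2 (e2 / (200 * (Kb * KgB) ^+ (2 * n))) KgB G S Kg1 e20 Gge1 S1 GS h.
  apply: le_trans k _.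
  rewrite le_eqVlt; apply/predU1P; left; congr (_ * _); rewrite -/Kb; field.
  by rewrite !gt_eqF.
have dT2a : (T2a %| T2)%N by rewrite ET2 dvdn_mulr.
have dT2b : (T2b %| T2)%N by rewrite ET2 dvdn_mull.
have f0 : (count (fun g => ~~ fineg HE wP T2 e2 KgB G S g) A0)%:R <= 40^-1 * (size A0)%:R :> R.
  apply: Hfm => Y Y1; rewrite big_map size_map; apply: le_trans (H2a _ Y G01 Y1).
  by rewrite ler_nat; apply: leq_sum => g _; apply: sub_count => x /andP [-> /(ncop _ _ _ _ dT2a)].
have f1 X : 1 <= X -> (count (fun g => ~~ fineg HE wP T2 e2 KgB G S g) (fam NE BE X))%:R <= 40^-1 * (size (fam NE BE X))%:R :> R.
  move=> X1; apply: Hfm => Y Y1; apply: le_trans (H2b _ Y X1 Y1).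
  by rewrite ler_nat; apply: leq_sum => g _; apply: sub_count => x /andP [-> /(ncop _ _ _ _ dT2b)].
have q0' := ltW q0.
have Hev k : (k < 9)%N -> (count (nth xpred0 ev k) (tup fs))%:R <= 40^-1 * (size (tup fs))%:R :> R.
  case: k => [|[|[|[|[|[|[|[|[|//]]]]]]]]] _ /=.
  - exact: (@tup_count2 _ _ 0 (fun a b => ~~ `[< copE Ta a b >]) fs 0 1 _ isT isT q0' (Ha _ _ G01 G11)).
  - exact: (@tup_count2 _ _ 0 (fun a b => ~~ `[< copE Ta a b >]) fs 0 2 _ isT isT q0' (Ha _ _ G01 G21)).
  - exact: (@tup_count2 _ _ 0 (fun a b => ~~ `[< copE Tb a b >]) fs 1 2 _ isT isT q0' (Hb _ _ G11 G21)).
  - exact: (@tup_count2 _ _ 0 (fun a b => ~~ `[< copE Tc a (th b) >]) fs 1 2 _ isT isT q0' (Hc _ _ G11 G21)).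
  - exact: (@tup_count1 _ _ 0 (fun a => ~~ `[< copE Td a (th a) >]) fs 1 _ isT q0' (Hd _ (le_trans GdC hG1))).
  - exact: (@tup_count1 _ _ 0 (fun a => ~~ `[< copE Td a (th a) >]) fs 2 _ isT q0' (Hd _ (le_trans GdC hG2))).
  - exact: (@tup_count1 _ _ 0 (fun a => ~~ fineg HE wP T2 e2 KgB G S a) fs 0 _ isT q0' f0).
  - exact: (@tup_count1 _ _ 0 (fun a => ~~ fineg HE wP T2 e2 KgB G S a) fs 1 _ isT q0' (f1 _ G11)).
  - exact: (@tup_count1 _ _ 0 (fun a => ~~ fineg HE wP T2 e2 KgB G S a) fs 2 _ isT q0' (f1 _ G21)).
pose bad t := has (fun k => nth xpred0 ev k t) (iota 0 9).
have Hbad : (count bad (tup fs))%:R <= 2^-1 * (size (tup fs))%:R :> R.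
  have h := @count_union _ _ _ (fun k t => nth xpred0 ev k t) (iota 0 9) (tup fs) (40^-1 : R).
  apply: le_trans (h _) _; first by move=> k; rewrite mem_iota => /Hev.
  by rewrite ler_wpM2r // size_iota.
pose goodt := [seq t <- tup fs | ~~ bad t].
have szg : 2^-1 * (size (tup fs))%:R <= (size goodt)%:R :> R.
  rewrite size_filter; apply: le_trans (_ : (size (tup fs))%:R - (count bad (tup fs))%:R <= _).
    exact: half_le.
  by apply: count_compl => t; rewrite negbK.
have sztup : cK * cE ^+ 2 * (\prod_i G i) ^+ n <= (size (tup fs))%:R.
  rewrite tup_size /fs !big_cons big_nil muln1 size_map !natrM GP.
  have l0 := fam_lb' HO G01; have l1 := fam_lb' HE G11; have l2 := fam_lb' HE G21.
  rewrite -EcK in l0; rewrite -EcE in l1 l2.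
  have Gn X k : 1 <= X -> 0 <= X ^+ k by move=> h; rewrite exprn_ge0 // (le_trans ler01).
  apply: le_trans (ler_pM _ _ l0 (ler_pM _ _ l1 l2)); rewrite ?mulr_ge0 ?Gn ?(ltW cK0) ?(ltW cE0) //.
  by rewrite le_eqVlt; apply/predU1P; left; rewrite 2!exprMn -!exprM; ring.
have goodP t : t \in goodt -> [/\ size t = 3, gdata OE NE KgB G (gconj t), pcop OE T1 (gconj t),
    forall i, fineg HE wP T2 e2 KgB G S (gconj t i) & th t`_0 = t`_0 /\ exists2 a, a \in fam nrm box G0 & t`_0 = qemb noroot a].
  rewrite mem_filter => /andP [nb /(@tupP E 0 fs)] /= [st tin].
  have /mapP [a af Ea] : t`_0 \in A0 := tin 0%N isT.
  have t1 : t`_1 \in fam NE BE G1 := tin 1%N isT.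
  have t2 : t`_2 \in fam NE BE G2 := tin 2%N isT.
  have th0 : th t`_0 = t`_0 by rewrite Ea; congr pair; rewrite /= ?subr0 ?oppr0.
  have ne k : (k < 9)%N -> ~~ nth xpred0 ev k t.
    by move=> h; apply: contra nb => h'; apply/hasP; exists k; rewrite ?mem_iota.
  have cpE T (x y : E) : (T %| T1)%N -> ~~ ~~ `[< copE T x y >] -> copE T1 x y.
    by rewrite negbK => dT /asboolP; apply: cop_dvdn.
  have fgE j (x : E) : ~~ fg t j -> t`_j = x -> fineg HE wP T2 e2 KgB G S x by rewrite negbK => h <-.
  split=> //; last by split=> //; exists a.
  - by rewrite EG; apply: (gdata_conj G01 G11 G21 af).
  - apply: pcop_conj => //.
    + exact: cpE dTa (ne 0%N isT).
    + exact: cpE dTa (ne 1%N isT).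
    + exact: cpE dTb (ne 2 isT).
    + exact: cpE dTc (ne 3 isT).
    + exact: cpE dTd (ne 4 isT).
    + exact: cpE dTd (ne 5 isT).
  - move=> i; rewrite ffunE; case: i => [[|[|[|[|[|]]]]] //= h]; rewrite ?fineg_conj.
    + exact: fgE (ne 6 isT) _.
    + exact: fgE (ne 7 isT) _.
    + exact: fgE (ne 7 isT) _.
    + exact: fgE (ne 8 isT) _.
    + exact: fgE (ne 8 isT) _.
have n12 : inord 1 != inord 2 :> 'I_5 by apply/eqP => /(congr1 val); rewrite /= !inordK.
have n34 : inord 3 != inord 4 :> 'I_5 by apply/eqP => /(congr1 val); rewrite /= !inordK.
pose row (s : E * E) : 'rV[K]_4 := \row_(i < 4) [:: s.1.1; s.1.2; s.2.1; s.2.2]`_i.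
pose b34 t s := okE OE w T2 (gconj t) s && `[< copE T3 (x_ (gconj t) (inord 3) s) (x_ (gconj t) (inord 4) s) >].
pose pp i j t s := `[< copE T4 (x_ (gconj t) i s) (th (x_ (gconj t) j s)) >].
pose p0' t s := `[< copE T5 (x_ (gconj t) (inord 0) s) (th (x_ (gconj t) (inord 0) s)) >].
pose good t s := [&& b34 t s, pp (inord 1) (inord 2) t s, pp (inord 3) (inord 4) t s, p0' t s & Psi (row s) != 0].
pose Q t := [seq s <- lamE5 (gconj t) S | good t s].
have szQ t : t \in goodt -> cl / 2 * MS <= (size (Q t))%:R.
  move=> tg; have [st gd pc f1' [th0 [a af Ea]]] := goodP t tg.
  have k1 : 3 / 4 * cl * MS <= (count (b34 t) (lamE5 (gconj t) S))%:R by rewrite EMS; apply: HgP.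
  pose z1 i j s := [forall k, (k != j) ==> `[< copE T2 (gconj t k) (x_ (gconj t) j s) >]] && ~~ pp i j t s.
  have k2 i j : i != j -> (count (z1 i j) (lamE5 (gconj t) S))%:R <= cl / 16 * MS.
    by move=> ij; rewrite EMS mulrA; apply: (H4 G (gconj t) S i j ij gd pc HS4).
  pose z2 s := [&& (x_ (gconj t) (inord 0) s).1 != 0, cond nrm (x_ (gconj t) (inord 0) s).1 <= K1 & ~~ p0' t s].
  have k3 : (count z2 (lamE5 (gconj t) S))%:R <= cl / 16 * MS.
    by rewrite EMS; apply: (H5 G (gconj t) S gd pc S1 GS HS5).
  pose z4 s := Psi (row s) == 0.
  (* Psi is polynomial in the four K-coordinates of s, so zeros are counted over K with rank n;
     S^(4n) / G^(2n) is the same main term as for rank 2 n. *)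
  have k4 : (count z4 (lamE5 (gconj t) S))%:R <= cl / 16 * MS.
    pose kp := kap NE (v5 E) (eta5 NE w) * S.
    pose Lb := [seq ((a, b) : E) | a <- box kp, b <- box kp].
    have uLb : uniq Lb by rewrite allpairs_uniq ?(box_uniq HO) // => -[? ?] [? ?] _ _ /= [-> ->].
    have inLb s : s \in Lb -> s.1 \in box kp /\ s.2 \in box kp by move=> /allpairsP [[x y] /= [? ? ->]].
    have h := H6 G S S Lb Lb Gge1 HS6 HS6 uLb uLb inLb inLb.
    apply: le_trans (le_trans h _).
      rewrite ler_nat -!size_filter; apply: uniq_leq_size; first by apply: filter_uniq; apply: (lam_uniq HE).
      move=> s; rewrite mem_filter => /andP [zs]; rewrite mem_filter => /andP [_ /allpairsP [[x y] /= [xb yb Es]]].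
      rewrite mem_filter; apply/andP; split; [exact: zs | apply/allpairsP; exists s; split=> //; last by case: (s)].
        rewrite Es; move: xb; rewrite (boxE HE) => /andP [/andP [i1 i2] xn]; have [q1 q2] := nrmQ_coord HO noroot x.
        by apply/allpairsP; exists x; split; rewrite ?(boxE HO) ?i1 ?i2 ?(le_trans q1 xn) ?(le_trans q2 xn) //; case: (x).
      rewrite Es; move: yb; rewrite (boxE HE) => /andP [/andP [i1 i2] xn]; have [q1 q2] := nrmQ_coord HO noroot y.
      by apply/allpairsP; exists y; split; rewrite ?(boxE HO) ?i1 ?i2 ?(le_trans q1 xn) ?(le_trans q2 xn) //; case: (y).
    rewrite le_eqVlt; apply/predU1P; left; rewrite EMS mul2n -addnn !exprD; field.
    by rewrite expf_neq0 // gt_eqF.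
  have sub s : s \in lamE5 (gconj t) S -> b34 t s -> ~~ good t s -> [|| z1 (inord 1) (inord 2) s, z1 (inord 3) (inord 4) s, z2 s | z4 s].
    move=> sl bs.
    have ok k j : k != j -> `[< copE T2 (gconj t k) (x_ (gconj t) j s) >].
      by move/andP: bs => [ok _] kj; apply/asboolP; exact: okEP ok kj.
    have okf j : [forall k, (k != j) ==> `[< copE T2 (gconj t k) (x_ (gconj t) j s) >]].
      by apply/forallP => k; apply/implyP; apply: ok.
    have [x00 xc] := Hbal t G0 S a s G01 S1 af Ea sl.
    case A : (pp (inord 1) (inord 2) t s); last by rewrite /z1 okf A.
    case B : (pp (inord 3) (inord 4) t s); last by rewrite /z1 !okf B orbT.
    case Z : (p0' t s); last by rewrite /z2 x00 xc Z !orbT.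
    by rewrite /good bs A B Z /z4 negbK => ->; rewrite !orbT.
  have cmp : (count (b34 t) (lamE5 (gconj t) S) <= size (Q t) + (count (z1 (inord 1) (inord 2)) (lamE5 (gconj t) S) +
     (count (z1 (inord 3) (inord 4)) (lamE5 (gconj t) S) + (count z2 (lamE5 (gconj t) S) + count z4 (lamE5 (gconj t) S)))))%N.
    rewrite size_filter.
    apply: leq_trans (_ : count (fun s => good t s || [|| z1 (inord 1) (inord 2) s, z1 (inord 3) (inord 4) s, z2 s | z4 s]) (lamE5 (gconj t) S) <= _)%N.
      rewrite -!size_filter; apply: uniq_leq_size; first by apply: filter_uniq; apply: (lam_uniq HE).
      move=> s; rewrite !mem_filter => /andP [bs sl']; rewrite sl' andbT.
      have sl : s \in lamE5 (gconj t) S by rewrite /lam5 /lam mem_filter.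
      by case: (boolP (good t s)) => //= /(sub s sl bs).
    apply: leq_trans (count_or_le _ _ _) _; rewrite leq_add2l.
    apply: leq_trans (count_or_le _ _ _) _; rewrite leq_add2l.
    apply: leq_trans (count_or_le _ _ _) _; rewrite leq_add2l.
    exact: count_or_le.
  move: cmp; rewrite -(ler_nat R) !natrD; have k2a := k2 _ _ n12; have k2b := k2 _ _ n34.
  move: k1 k2a k2b k3 k4; move: (count _ _)%:R (count _ _)%:R (count _ _)%:R (count _ _)%:R (count _ _)%:R (size _)%:R.
  move=> a1 a2 a3 a4 a5 a6; have : 0 <= cl * MS by rewrite mulr_ge0 // ltW.
  (* Four sets of proportion cl / 16 are removed from 3/4 cl, leaving cl / 2. *)
  by clear; lra.
pose D := [seq ((gconj t, s), (th s.1, th s.2)) : data E | t <- goodt, s <- Q t].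
exists D; split.
- apply: allpairs_uniq_dep.
  + apply: filter_uniq; apply: tup_uniq; rewrite /fs /= uA0; by rewrite !(fam_uniq HE).
  + by move=> t tg; apply: filter_uniq; apply: (lam_uniq HE).
  + move=> x x' /allpairsPdep [t [s [tg _ ->]]] /allpairsPdep [t' [s' [tg' _ ->]]] /= [EE E1 _ _].
    have [st _ _ _ _] := goodP _ tg; have [st' _ _ _ _] := goodP _ tg'.
    have -> : t = t'.
      have e j : (j < 5)%N -> gconj t (inord j) = gconj t' (inord j) by rewrite EE.
      have e0 := e 0%N isT; have e1 := e 1%N isT; have e3 := e 3 isT.
      rewrite !ffunE !inordK //= in e0 e1 e3.
      by apply: (@eq_from_nth _ 0); rewrite st ?st' // => -[|[|[|//]]].
    by rewrite E1.
- move=> _ /allpairsPdep [t [s [tg + ->]]] /=.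
  have [st gd pc f1' [th0 [a af Ea]]] := goodP t tg.
  rewrite mem_filter => /andP [/and5P [/andP [ok /asboolP c34] /asboolP cp12 /asboolP cp34 /asboolP cp0 hPsi] sl].
  split=> //; last by split=> //; apply: prod_gconj.
  + by split; rewrite -?EG //=; apply: lam5_conj.
  + apply: dgood_conj => //.
    * apply: (@cop_dvdn _ _ (T1 * T2 * (T2 * T3))%N); first exact: dvdn_mulr.
      exact: (s_cop HE wP gd pc S1 sl ok c34).
    * apply: cop_dvdn cp0; rewrite mulnA; exact: dvdn_mull.
    * apply: cop_dvdn cp12; rewrite mulnCA; exact: dvdn_mulr.
    * apply: cop_dvdn cp34; rewrite mulnCA; exact: dvdn_mulr.
- rewrite size_allpairs_dep sumnE big_map natr_sum.
  apply: le_trans (_ : \sum_(t <- goodt) cl / 2 * MS <= _); last first.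
    by rewrite big_seq [leRHS]big_seq; apply: ler_sum => t; apply: szQ.
  rewrite big_const_seq count_predT iter_addr_0 -[leRHS]mulr_natl.
  have k : 2^-1 * (cK * cE ^+ 2 * (\prod_i G i) ^+ n) <= (size goodt)%:R.
    by apply: le_trans szg; rewrite ler_wpM2l // invr_ge0.
  have X0 : 0 <= cl / 2 * MS by rewrite mulr_ge0 // divr_ge0 // ltW.
  apply: le_trans (ler_wpM2r X0 k).
  by rewrite le_eqVlt; apply/predU1P; left; field.
Qed.

End Conjugation.

(** * From torsor points to points of Y *)

Lemma ex_log (R : realType) (a x : R) : 2 <= a -> 1 <= x -> exists k : nat, a ^+ k <= x < a ^+ k.+1.
Proof.
move=> a2 x1; have a1 : 1 <= a by lra.
pose P k := x < a ^+ k.+1.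
have ex : exists k, P k.
  exists (Num.truncn x).+1; apply: lt_le_trans (truncnS_gt x) _.
  apply: le_trans (_ : 2 ^+ (Num.truncn x).+2 <= _).
    by rewrite -natrX ler_nat; apply: ltnW; apply: leq_trans (ltn_expl _ (isT : (1 < 2)%N)); rewrite ltnW.
  by rewrite lerXn2r ?nnegrE // ltW // (lt_le_trans ltr01).
exists (ex_minn ex); case: ex_minnP => k Pk kmin; rewrite [x < _]Pk andbT.
case: k Pk kmin => [|k] _ kmin; first by rewrite expr0.
by rewrite leNgt; apply/negP => /kmin; rewrite ltnn.
Qed.

Lemma divn_pred_bounds w y : (0 < w)%N -> (w < y)%N ->
  [/\ (1 + w * ((y - 1) %/ w) <= y)%N, (y <= 2 * (w * ((y - 1) %/ w)))%N & (y.+1 <= 4 * (w * ((y - 1) %/ w)))%N].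
Proof.
move=> w0 wy; have e := divn_eq (y - 1) w; have l0 := ltn_pmod (y - 1) w0.
have : (0 < (y - 1) %/ w)%N by rewrite divn_gt0 //; lia.
move=> a0; have := leq_pmull w a0; rewrite [(w * _)%N]mulnC.
by move: ((y - 1) %/ w * w)%N ((y - 1) %% w)%N e l0 => a b; split; lia.
Qed.

(** B is compared with the largest power kp q^(4 d y) below it, and L is the largest value allowed
    for that y; both y and L are then of order log B, so L^r produces the power of the logarithm. *)
Lemma growth (R : realType) (N : R -> R) (d r w : nat) (kp c q : R) : (0 < d)%N -> (0 < w)%N -> 0 < kp -> 0 < c -> 2 <= q ->
  (forall B y L, kp * (q ^+ y) ^+ (4 * d) <= B -> (1 + w * L <= y)%N -> c * L%:R ^+ r * (q ^+ y) ^+ (4 * d) <= N B) ->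
  exists c' : R, 0 < c' /\ exists B0 : R, forall B : R, B0 <= B -> c' * B * ln B ^+ r <= N B.
Proof.
move=> d0 w0 kp0 c0 q2 H; have q1 : 1 <= q by lra.
pose a := q ^+ (4 * d).
have a2 : 2 <= a by apply: le_trans q2 _; rewrite /a ler_eXnr // muln_gt0.
have a0 : 0 < a by lra.
have la0 : 0 < ln a by rewrite ln_gt0; lra.
have wR : 0 < w%:R :> R by rewrite ltr0n.
have W0 : 0 < 8 * w%:R * ln a by rewrite !mulr_gt0.
exists (c / ((8 * w%:R * ln a) ^+ r * (kp * a))); split.
  by rewrite divr_gt0 // !mulr_gt0 // exprn_gt0.
exists (Num.max 1 (Num.max (kp ^+ 2) (kp * a ^+ w.+1))) => B; rewrite !ge_max => /and3P [B1 Bk Ba].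
have B0 : 0 < B by lra.
have [x Ex] : exists x, x = B / kp by eexists.
have EB : B = kp * x by rewrite Ex mulrC divfK // gt_eqF.
have xa : a ^+ w.+1 <= x by rewrite Ex ler_pdivlMr // mulrC.
have x1 : 1 <= x by apply: le_trans xa; rewrite exprn_ege1 //; lra.
have [y /andP [y1 y2]] := ex_log a2 x1.
have wy : (w < y)%N.
  rewrite -ltnS -(ltr_eXn2l (x := a)) ?(le_lt_trans xa) //; lra.
pose L := ((y - 1) %/ w)%N.
have [L2 L1 L3] := divn_pred_bounds w0 wy; rewrite -/L in L1 L2 L3.
have qa : (q ^+ y) ^+ (4 * d) = a ^+ y by rewrite /a -!exprM mulnC.
have := H B y L; rewrite qa => h; apply: le_trans (h _ L2); last by rewrite EB ler_wpM2l // ltW.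
have x0 : 0 < x by lra.
have lnB : ln B <= 8 * w%:R * ln a * L%:R.
  have k1 : ln x <= y.+1%:R * ln a.
    by rewrite mulr_natl -lnXn //; apply: ltW; rewrite ltr_ln // posrE exprn_gt0.
  (* B >= kp^2 gives kp <= x, so ln B = ln kp + ln x is at most 2 ln x. *)
  have k2 : ln kp <= ln x.
    by rewrite ler_ln ?posrE // Ex ler_pdivlMr // -expr2.
  have k3 : y.+1%:R <= 4 * w%:R * L%:R :> R.
    by move: L3; rewrite -(ler_nat R) !natrM mulrA.
  rewrite EB lnM ?posrE //.
  have k4 := ler_wpM2r (ltW la0) k3.
  have -> : 8 * w%:R * ln a * L%:R = 2 * (4 * w%:R * L%:R * ln a) by ring.
  lra.
have lnB0 : 0 <= ln B by rewrite ln_ge0.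
have lnBr : ln B ^+ r <= (8 * w%:R * ln a) ^+ r * L%:R ^+ r.
  by rewrite -exprMn lerXn2r ?nnegrE // mulr_ge0 // ltW.
have xy : x <= a * a ^+ y by rewrite -exprS ltW.
have Wr : 0 < (8 * w%:R * ln a) ^+ r by rewrite exprn_gt0.
have -> : c / ((8 * w%:R * ln a) ^+ r * (kp * a)) * B * ln B ^+ r = c * (ln B ^+ r / (8 * w%:R * ln a) ^+ r) * (x / a).
  by rewrite EB; field; rewrite !gt_eqF.
apply: ler_pM; rewrite ?mulr_ge0 ?exprn_ge0 ?invr_ge0 ?(ltW c0) ?(ltW x0) ?(ltW a0) ?(ltW Wr) //.
  by rewrite ler_wpM2l ?(ltW c0) // ler_pdivrMr // mulrC.
by rewrite ler_pdivrMr // mulrC.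
Qed.

(** If all x_i vanish, so do alpha conj(gamma) and beta conj(gamma); as gamma has nonzero norm,
    alpha = beta = 0, and then gamma = 0. *)
Lemma xvec_neq0 (F : fieldType) (v : 'I_4 -> F) : 3%:R != 0 :> F -> nvec v != 0 -> exists i, xvec v i != 0.
Proof.
move=> three n0; apply: contrapT => H.
have z i : xvec v i = 0 by apply/eqP; apply: contrapT => /negP h; apply: H; exists i.
have z0 := z 0; have z1 := z 1; have z2 := z (inord 2); have z3 := z (inord 3).
move: z0 z1 z2 z3 n0; rewrite /xvec /xeul /euler !inordK //= /nvec.
have key (c0 c1 x y : F) : nq c0 c1 != 0 -> eul0 c0 c1 x y + eul1 c0 c1 x y = 0 -> 2%:R * eul1 c0 c1 x y - eul0 c0 c1 x y = 0 ->
    x = 0 /\ y = 0.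
  move=> n0 h1 h2.
  have e1 : eul1 c0 c1 x y = 0.
    by apply: (mulfI three); rewrite mulr0 -[RHS](addr0 0) -{1}h1 -h2; ring.
  have e0 : eul0 c0 c1 x y = 0 by move: h1; rewrite e1 addr0.
  split; apply: (mulfI n0); rewrite mulr0.
    transitivity (eul0 c0 c1 x y * c0 - eul1 c0 c1 x y * c1); last by rewrite e0 e1 !mul0r subrr.
    by rewrite /nq /eul0 /eul1; ring.
  transitivity (eul0 c0 c1 x y * c1 + eul1 c0 c1 x y * (c0 - c1)); last by rewrite e0 e1 !mul0r addr0.
  by rewrite /nq /eul0 /eul1; ring.
move: (v 0) (v 1) (v (inord 2)) (v (inord 3)) => a0 a1 b0 b1 h0 h1 h2 h3 n0.
have [ea0 ea1] := key _ _ _ _ n0 h0 h1; have [eb0 eb1] := key _ _ _ _ n0 h2 h3.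
by move: n0; rewrite ea0 ea1 eb0 eb1 /gam0 /gam1 /nq !(mul0r, mulr0, expr0n, subr0, addr0) eqxx.
Qed.

(** * Points of U on the chosen fibre, and their heights *)

Section Fibre.
Variables (R : realType) (K : fieldExtType rat) (m : nat) (f : 'I_m -> mpoly.mpoly 8 K).
Variables (H : rep K -> R) (j : 'I_m) (b : 'I_4 -> nat).
Hypothesis HH : anticanonical_height H.
Hypothesis b0 : forall i, (0 < b i)%N.
Local Notation d := (\dim {:K}).
Local Notation O := (@intO K).
Local Notation nrm := (@nrmK R K).
Local Notation HO := (orderK R K).
Local Notation bK := (fun i => (b i)%:R : K).
Local Notation Gv := (Geval f idfun bK).

Definition fpoint (v : 'I_4 -> K) : rep K := ((fun i => bK i ^+ 3), (fun i => xvec v i * others bK i)).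

Lemma bK_neq0 i : bK i != 0.
Proof. exact: (natF_neq0 HO). Qed.

Lemma others_neq0 i : others bK i != 0.
Proof. by rewrite /others; apply/prodf_neq0 => k _; apply: bK_neq0. Qed.

Lemma fpoint_in_U v : Gv v j != 0 -> in_U f (fpoint v).
Proof.
rewrite /Geval mulf_eq0 negb_or => /andP [f0 n0]; split; last by exists j.
split; first by exists ord0; rewrite expf_neq0 ?bK_neq0.
have [i xi] := xvec_neq0 (natF_neq0 HO (isT : (0 < 3)%N)) n0.
split; first by exists i; rewrite mulf_neq0 ?others_neq0.
transitivity ((\prod_k bK k) ^+ 3 * \sum_i xvec v i ^+ 3); last first.
  by rewrite /xvec xeul_cubes mulr0.
rewrite mulr_sumr; apply: eq_bigr => k _ /=; rewrite (bigD1 k) //= -/(others bK k).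
by rewrite !exprMn; ring.
Qed.

Lemma fpoint_class v v' : pclass (fpoint v) = pclass (fpoint v') ->
  exists2 c : K, c != 0 & forall i, xvec v' i = c * xvec v i.
Proof.
move=> e; have : pclass (fpoint v') (fpoint v').
  by exists 1, 1; rewrite oner_neq0; split=> //; split=> //; split; apply/funext => i; rewrite mul1r.
rewrite -e => -[l [c [_ [c0 [_ E]]]]]; exists c => // i.
by have /(congr1 (fun g => g i)) /= := E; rewrite mulrA => /(mulIf (others_neq0 i)).
Qed.

(** The first factor is a fixed point and contributes a constant. For the second any multiple l of
    the coordinates may be used; this is where division by the product of the g_i lowers the
    height. *)
Lemma fpoint_height : exists2 cH : R, 0 < cH & forall v l X, Gv v j != 0 -> l != 0 -> 1 <= X ->
  (forall i, l * xvec v i \in O /\ nrm (l * xvec v i) <= X) -> H (fpoint v) <= cH * X ^+ d.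
Proof.
have [Hinv [C [C0 HC]]] := HH; have [c c1 Hc] := height_upper R K.
have n0 := nrm_ge0 HO.
pose Pb := (\prod_k b k)%N.
have Pb1 : 1 <= Pb%:R :> R by rewrite ler1n prodn_gt0.
pose X1 : R := 1 + \sum_i nrm (bK i ^+ 3).
have X11 : 1 <= X1 by rewrite lerDl sumr_ge0.
have cp : 0 < c := lt_le_trans ltr01 c1.
have Xp : 0 < (c * X1) ^+ d by rewrite exprn_gt0 // mulr_gt0 // (lt_le_trans ltr01).
exists (C * (((c * X1) ^+ d) ^+ 3 * (c * Pb%:R) ^+ d)).
  by rewrite !mulr_gt0 ?exprn_gt0 // mulr_gt0 // (lt_le_trans ltr01).
move=> v l X Gn l0 X0 hl; have [yY _] := fpoint_in_U Gn.
pose z : rep K := ((fpoint v).1, fun i => l * (fpoint v).2 i).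
have yz : proj_equiv (fpoint v) z.
  by exists 1, l; rewrite oner_neq0; split=> //; split=> //; split=> //; apply/funext => i; rewrite mul1r.
have zY : on_Y z.
  have [n1 [[i n2] e]] := yY; split=> //; split; first by exists i; rewrite mulf_neq0.
  transitivity (l ^+ 3 * \sum_(i < 4) (fpoint v).1 i * (fpoint v).2 i ^+ 3); last by rewrite e mulr0.
  by rewrite mulr_sumr; apply: eq_bigr => k _ /=; rewrite exprMn; ring.
rewrite -(Hinv _ _ yY yz); have [_ h] := HC z zY; apply: le_trans h _.
have ax (u p : R) k : C * (u * (c * p) ^+ k) * X ^+ k = C * (u * (c * (p * X)) ^+ k).
  by rewrite !exprMn; ring.
rewrite ax ler_wpM2l ?(ltW C0) // /std_anticanonical_height.
have h1 : heightK R z.1 <= (c * X1) ^+ d.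
  apply: Hc => // i /=; split; first by rewrite rpredX ?rpred_nat.
  by rewrite /X1 (bigD1 i) //= addrCA lerDl addr_ge0 // sumr_ge0.
have h2 : heightK R z.2 <= (c * (Pb%:R * X)) ^+ d.
  apply: Hc; first by rewrite mulr_ege1.
  move=> i /=; have [lO ln] := hl i; rewrite /others -natr_prod mulrA.
  split; first by rewrite rpredM ?rpred_nat.
  rewrite [_ * _%:R]mulrC (nrmZ HO); apply: ler_pM => //.
  by rewrite ler_nat /Pb [leqRHS](bigD1 i) //=; apply: leq_pmull.
have hp (u : coords K) : 0 <= heightK R u.
  by rewrite divr_ge0 ?arch_partE ?prodr_ge0 // => [s _|]; rewrite ?arch_factor_ge0 // divr_ge0.
apply: ler_pM; rewrite ?exprn_ge0 ?hp //.
by rewrite lerXn2r ?nnegrE ?hp // ltW.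
Qed.

Lemma classes_below (B : R) : exists2 Zs : seq (set (rep K)), (size Zs)%:R = N_UH f H B &
  forall v, Gv v j != 0 -> H (fpoint v) <= B -> pclass (fpoint v) \in Zs.
Proof.
pose S := [set [set z | proj_equiv y z] | y in [set y | in_U f y /\ H y <= B]]%classic.
have fS : finite_set S.
  apply: sub_finite_set (northcott B HH) => _ [y [[yY _] yB] <-].
  by exists y.
exists (enum_fset (fset_set S)); first by [].
by move=> v Gn hv; rewrite in_fset_set //; apply/mem_set; exists (fpoint v) => //; split=> //; apply: fpoint_in_U.
Qed.

End Fibre.

Lemma main_sizeA (R : realType) (S P Pi X : R) n : 0 < Pi -> S ^+ 2 * P ^+ 2 = X * Pi ->
  Pi ^+ n * (S ^+ n * S ^+ n / Pi ^+ n) * (P ^+ n * P ^+ n / Pi ^+ n) = X ^+ n.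
Proof.
move=> p0 e; have pn : Pi ^+ n != 0 by rewrite expf_neq0 // gt_eqF.
transitivity (S ^+ n * S ^+ n * (P ^+ n * P ^+ n) / Pi ^+ n); first by field.
by rewrite -!exprMn -!expr2 e exprMn mulfK.
Qed.

Lemma main_sizeB (R : realType) (S Pi X : R) n : 0 < Pi -> S ^+ 2 * S ^+ 2 = X * Pi ->
  Pi ^+ n * (S ^+ (2 * n) * S ^+ (2 * n) / Pi ^+ (2 * n)) = X ^+ n.
Proof.
move=> p0 e; rewrite -(main_sizeA n p0 e) !mul2n -!addnn !exprD.
by field; rewrite expf_neq0 // gt_eqF.
Qed.

Lemma final_ineq (R : realType) (c X : R) (U : finType) (sz : U -> nat) (M Z : nat) : 0 < c ->
  (forall k, c * X <= (sz k)%:R) -> (\sum_(k <- enum U) sz k <= M * Z)%N -> c / M.+1%:R * #|U|%:R * X <= Z%:R.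
Proof.
move=> c0 h1 h2; have M0 : 0 < M.+1%:R :> R by rewrite ltr0n.
have -> : c / M.+1%:R * #|U|%:R * X = #|U|%:R * (c * X) / M.+1%:R by ring.
rewrite ler_pdivrMr //; apply: le_trans (_ : (\sum_(k <- enum U) sz k)%:R <= _).
  rewrite natr_sum; apply: le_trans (ler_sum _ (fun k _ => h1 k)).
  by rewrite big_const_seq count_predT iter_addr_0 -cardE mulr_natl.
by rewrite -natrM ler_nat; apply: leq_trans h2 _; rewrite mulnC leq_mul2l leqnSn orbT.
Qed.

Lemma ex_base (R : realType) (x y : R) : 1 <= x -> 1 <= y -> exists q, [/\ 2 <= q, 1 < q, x <= q & y < q].
Proof. by move=> x1 y1; exists (2 + x + y); split; lra. Qed.

Lemma pow_sep (R : realType) (q kap : R) a b : 1 < q -> kap < q -> q ^+ a <= kap * q ^+ b -> (a <= b)%N.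
Proof.
move=> q1 kq h; rewrite -ltnS -(ltr_eXn2l (x := q)) // exprS; apply: le_lt_trans h _.
by rewrite ltr_pM2r // exprn_gt0 // (lt_trans ltr01).
Qed.

Lemma sep_eq (R : realType) (q kap : R) a b : 1 < q -> kap < q ->
  q ^+ a <= kap * q ^+ b -> q ^+ b <= kap * q ^+ a -> a = b.
Proof. by move=> q1 kq h1 h2; apply/eqP; rewrite eqn_leq (pow_sep q1 kq h1) (pow_sep q1 kq h2). Qed.

Lemma pow_le (R : realType) (q c : R) a e : 1 <= q -> c <= q -> (1 + a <= e)%N -> c * q ^+ a <= q ^+ e.
Proof.
move=> q1 cq h; apply: le_trans (_ : q ^+ a.+1 <= _); last by rewrite ler_weXn2l.
by rewrite exprS ler_wpM2r // exprn_ge0 // (le_trans ler01).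
Qed.

Lemma exponent_boundA n L s t : (t <= L)%N -> (s <= 5 * L)%N ->
  (2 * t + 1 + 2 * s * n.+1 <= 1 + 12 * n.+2 * L)%N.
Proof. nia. Qed.

Lemma exponent_boundB n L s : (s <= 5 * L)%N -> (1 + 4 * s * (2 * n).+1 <= 1 + 20 * (2 * n).+1 * L)%N.
Proof. nia. Qed.

Lemma weighted_sum_le a0 a1 a2 L : (a0 <= L)%N -> (a1 <= L)%N -> (a2 <= L)%N -> (a0 + 2 * a1 + 2 * a2 <= 5 * L)%N.
Proof. lia. Qed.

Lemma pow_sizeA (F : pzRingType) (q : F) y t s : (2 * t <= y)%N ->
  (q ^+ (y + 2 * t)) ^+ 2 * (q ^+ (y - 2 * t + s)) ^+ 2 = q ^+ (4 * y) * q ^+ (2 * s).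
Proof. by move=> h; rewrite -!exprM -!exprD; congr (_ ^+ _); lia. Qed.

Lemma pow_sizeB (F : pzRingType) (q : F) y s :
  (q ^+ (y + s)) ^+ 2 * (q ^+ (y + s)) ^+ 2 = q ^+ (4 * y) * q ^+ (4 * s).
Proof. by rewrite -!exprM -!exprD; congr (_ ^+ _); lia. Qed.

Lemma pow_weighted (F : pzRingType) (q : F) a0 a1 a2 :
  q ^+ (4 * a0) * (q ^+ (4 * a1)) ^+ 2 * (q ^+ (4 * a2)) ^+ 2 = q ^+ (4 * (a0 + 2 * a1 + 2 * a2)).
Proof. by rewrite -!exprM -!exprD; congr (_ ^+ _); lia. Qed.

(** * Summation over six parameters when w lies in K *)

Section SplitCase.
Variables (R : realType) (K : fieldExtType rat) (m : nat) (f : 'I_m -> mpoly.mpoly 8 K).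
Variables (H : rep K -> R) (j : 'I_m) (b : 'I_4 -> nat).
Hypothesis HH : anticanonical_height H.
Hypothesis b0 : forall i, (0 < b i)%N.
Local Notation d := (\dim {:K}).
Local Notation O := (@intO K).
Local Notation nrm := (@nrmK R K).
Local Notation HO := (orderK R K).
Local Notation bK := (fun i => (b i)%:R : K).
Local Notation Gv := (Geval f idfun bK).
Variable w : K.
Hypothesis wP : w ^+ 2 + w + 1 = 0.
Hypothesis wO : w \in O.

Let sq : K := 1 + 2%:R * w.
Let three : 3%:R != 0 :> K := natF_neq0 HO (isT : (0 < 3)%N).

Lemma sqrtm3_neq0 : sq != 0.
Proof.
have e : sq ^+ 2 = - 3%:R.
  by transitivity (4%:R * (w ^+ 2 + w + 1) - 3%:R); [rewrite /sq; ring | rewrite wP mulr0 sub0r].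
by rewrite -sqrf_eq0 e oppr_eq0.
Qed.

(* Recovers a0, a1, b0, b1 from a0 + a1 w, b0 + b1 w and their conjugates. *)
Definition vsplit (r : 'rV[K]_4) (i : 'I_4) : K :=
  [:: r 0 0 - (r 0 0 - r 0 (inord 2)) / sq * w; (r 0 0 - r 0 (inord 2)) / sq;
      r 0 1 - (r 0 1 - r 0 (inord 3)) / sq * w; (r 0 1 - r 0 (inord 3)) / sq]`_i.

Lemma vsplitE (x y : K) : x - (x - y) / sq * w + (x - y) / sq * w = x /\
  x - (x - y) / sq * w + (x - y) / sq * (-1 - w) = y.
Proof.
split; first by rewrite subrK.
transitivity (x - (x - y) / sq * sq); first by rewrite /sq; ring.
by rewrite divfK ?sqrtm3_neq0 //; ring.
Qed.

Lemma vsplit_coords (r : 'rV[K]_4) :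
  [/\ vsplit r 0 + vsplit r 1 * w = r 0 0, vsplit r 0 + vsplit r 1 * (-1 - w) = r 0 (inord 2),
      vsplit r (inord 2) + vsplit r (inord 3) * w = r 0 1 & vsplit r (inord 2) + vsplit r (inord 3) * (-1 - w) = r 0 (inord 3)].
Proof.
by rewrite /vsplit !inordK //=; have [? ?] := vsplitE (r 0 0) (r 0 (inord 2)); have [? ?] := vsplitE (r 0 1) (r 0 (inord 3)).
Qed.

Definition row4 (s p : K * K) : 'rV[K]_4 := \row_(i < 4) [:: s.1; s.2; p.1; p.2]`_i.

Lemma row4E s p : [/\ row4 s p 0 0 = s.1, row4 s p 0 1 = s.2, row4 s p 0 (inord 2) = p.1 & row4 s p 0 (inord 3) = p.2].
Proof. by rewrite /row4 !mxE !inordK. Qed.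

Lemma xvec_split s p i : xvec (vsplit (row4 s p)) i = xtor w s p i.
Proof.
have [e1 e2 e3 e4] := row4E s p; have [h1 h2 h3 h4] := vsplit_coords (row4 s p).
by rewrite /xvec (xeulE wP) h1 h2 h3 h4 e1 e2 e3 e4.
Qed.

Lemma polyfun_vsplit i : polyfun (fun r => vsplit r i).
Proof.
have c k : polyfun (fun r : 'rV[K]_4 => r 0 k) by apply: polyfun_coord.
have q k l : polyfun (fun r : 'rV[K]_4 => (r 0 k - r 0 l) / sq).
  by apply: polyfunM; [apply: polyfunB | apply: polyfunC].
rewrite /vsplit; case: i => [[|[|[|[|]]]] //= h] //; apply: polyfunB => //; apply: polyfunM => //; exact: polyfunC.
Qed.

Lemma vsplit_surj (v : 'I_4 -> K) : exists r, vsplit r = v.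
Proof.
exists (row4 (v 0 + v 1 * w, v (inord 2) + v (inord 3) * w)
             (v 0 + v 1 * (-1 - w), v (inord 2) + v (inord 3) * (-1 - w))).
have key x y : (x + y * w - (x + y * (-1 - w))) / sq = y.
  have -> : x + y * w - (x + y * (-1 - w)) = y * sq by rewrite /sq; ring.
  by rewrite mulfK ?sqrtm3_neq0.
apply/funext => i; rewrite /vsplit /row4 !mxE !inordK //= !key.
case: i => [[|[|[|[|]]]] //= h]; rewrite ?addrK; congr v; apply: val_inj; rewrite /= ?inordK //.
Qed.

Lemma vsplit_proj s p s' p' (c : K) : nvec (vsplit (row4 s p)) != 0 -> nvec (vsplit (row4 s' p')) != 0 -> c != 0 ->
  (forall i, xvec (vsplit (row4 s' p')) i = c * xvec (vsplit (row4 s p)) i) ->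
  exists l m', [/\ l != 0, m' != 0, s'.1 = l * s.1 /\ s'.2 = l * s.2 & p'.1 = m' * p.1 /\ p'.2 = m' * p.2].
Proof.
move=> n1 n2 c0 E; have := xeul_proj wP three n1 n2 c0 E.
have [h1 h2 h3 h4] := vsplit_coords (row4 s p); have [k1 k2 k3 k4] := vsplit_coords (row4 s' p').
have [e1 e2 e3 e4] := row4E s p; have [e1' e2' e3' e4'] := row4E s' p'.
by rewrite h1 h2 h3 h4 k1 k2 k3 k4 e1 e2 e3 e4 e1' e2' e3' e4'.
Qed.

Theorem split_count (v0 : 'I_4 -> K) : Gv v0 j != 0 -> exists (kp c q : R) (W : nat),
  [/\ 0 < kp, 0 < c, 2 <= q, (0 < W)%N & forall B y L, kp * (q ^+ y) ^+ (4 * d) <= B -> (1 + W * L <= y)%N ->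
     c * L%:R ^+ 6 * (q ^+ y) ^+ (4 * d) <= N_UH f H B].
Proof.
move=> Gv0; pose Psi r := Gv (vsplit r) j.
have pPsi : polyfun Psi.
  apply: (polyfun_Geval f (v := fun i r => vsplit r i) polyfun_vsplit idfun (b := fun i _ => bK i)) => i.
  exact: polyfunC.
have [u0 Eu] := vsplit_surj v0.
have Pu : Psi u0 != 0 by rewrite /Psi Eu.
have [T1 [T [c [Cs [T10 T0 c0 Cs1 HD]]]]] := caseA HO wP wO pPsi Pu.
have Kg1 := famK_ge1 HO.
have [kap [M [kap1 HM]]] := class_count HO wP T0 Kg1.
have [cx cx1 Hx] := xtor_bound HO wP wO Kg1 T10.
have [cH cH0 Hh] := fpoint_height f j HH b0.
have [q [q2 q1' Cq kq]] := ex_base Cs1 kap1.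
have q1 := ltW q1'; have q0 := lt_trans ltr01 q1'.
have cx0 := lt_le_trans ltr01 cx1.
exists (cH * cx ^+ d), (c / M.+1%:R), q, (12 * d.+2)%N; split=> //.
- by rewrite mulr_gt0 // exprn_gt0.
- by rewrite divr_gt0 // ltr0n.
move=> B y L hB hy.
have [Zs <- HZ] := classes_below f j HH b0 B.
pose U : finType := {ffun 'I_6 -> 'I_L}.
have cU : #|U| = (L ^ 6)%N by rewrite card_ffun !card_ord.
pose e (k : U) (i : 'I_5) : nat := k (inord i).
pose t (k : U) : nat := k (inord 5).
pose sg (k : U) := (\sum_i e k i)%N.
have sgL k : (sg k <= 5 * L)%N.
  have h : (sg k <= \sum_(i < 5) L)%N by apply: leq_sum => i _; apply: ltnW; apply: ltn_ord.
  by move: h; rewrite sum_nat_const card_ord.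
have tL k : (t k <= L)%N by apply: ltnW; apply: ltn_ord.
(* Even exponents make the product of the G k i a square, so S^2 P^2 = q^(4 y) * prod G is solved in
   powers of q. The sixth parameter t shifts S against P, and X = q^(4 y) is common to all boxes. *)
pose G k i := q ^+ (2 * e k i).
pose S k := q ^+ (y + 2 * t k).
pose P k := q ^+ (y - 2 * t k + sg k).
have Gge1 k i : 1 <= G k i by rewrite exprn_ege1.
have GP k : \prod_i G k i = q ^+ (2 * sg k) by rewrite /G prodrXr /sg big_distrr.
(* With t <= L and sg <= 5 L, the bound on y leaves both S and P above Cs times the (d + 1)-st power
   of prod G; this fixes the factor 12 (d + 2). *)
have ty k : (2 * t k + 1 + 2 * sg k * d.+1 <= y)%N.
  apply: leq_trans hy; have := sgL k; have := tL k; move: (sg k) (t k) => s0 t0 h1 h2.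
  exact: exponent_boundA.
have ty' k : (2 * t k <= y)%N by apply: leq_trans (ty k); rewrite -addnA leq_addr.
have X4 : (q ^+ y) ^+ (4 * d) = (q ^+ (4 * y)) ^+ d by rewrite -!exprM; congr (_ ^+ _); rewrite mulnA [(y * 4)%N]mulnC.
have SPE k : S k ^+ 2 * P k ^+ 2 = q ^+ (4 * y) * \prod_i G k i.
  by rewrite GP; apply: pow_sizeA.
have cS k : Cs * (\prod_i G k i) ^+ d.+1 <= S k.
  by rewrite GP -exprM; apply: pow_le => //; apply: leq_trans (leq_trans (ty k) (leq_addr _ _)); rewrite leq_add2r leq_addl.
have cP k : Cs * (\prod_i G k i) ^+ d.+1 <= P k.
  rewrite GP -exprM; apply: pow_le => //; apply: leq_trans (leq_addr _ _).
  by rewrite leq_subRL // addnA ty.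
have /boolp.choice [D {}HD] := fun k => HD (G k) (S k) (P k) (Gge1 k) (cS k) (cP k).
have S1 k : 1 <= S k by rewrite exprn_ege1.
have P1 k : 1 <= P k by rewrite exprn_ege1.
pose vd (x : data K) := vsplit (row4 x.1.2 x.2).
pose phi (x : data K) := pclass (fpoint b (vd x)).
have vdG k x : x \in D k -> Gv (vd x) j != 0 by have [_ h _] := HD k; move/h => [].
have vdn k x : x \in D k -> nvec (vd x) != 0.
  by move/vdG; rewrite /Geval mulf_eq0 negb_or => /andP [].
have := HM U _ (enum U) G S P D phi Zs (enum_uniq _) _ _ _ => Hfin.
rewrite -natrX -cU X4; apply: (@final_ineq _ _ _ U (fun k => size (D k))) => //.
  move=> k; have [_ _ h] := HD k; rewrite -(main_sizeA d (lt_le_trans ltr01 (prod_ge1 _ (Gge1 k))) (SPE k)).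
  exact: h.
apply: Hfin.
- move=> k _; have [uD hD _] := HD k; split=> // x xD; have [sz gd pc _] := hD x xD; split=> //.
  apply: HZ; first exact: vdG xD.
  apply: le_trans hB; rewrite X4 -mulrA -exprMn.
  have [gdat _ _] := sz.
  have pg0 : \prod_i x.1.1 i != 0 by apply/prodf_neq0 => i _; have [] := gdat i.
  apply: (Hh _ ((T1 ^ 25)%:R / \prod_i x.1.1 i)); first exact: vdG xD.
  + by rewrite mulf_neq0 ?invr_neq0 // (natF_neq0 HO) // expn_gt0 T10.
  + by rewrite mulr_ege1 // exprn_ege1.
  + move=> i; have := Hx (G k) (S k) (P k) x i sz pc (S1 k) (P1 k).
    rewrite SPE mulfK; last by rewrite gt_eqF // (lt_le_trans ltr01) // prod_ge1.
    by rewrite /vd xvec_split mulrAC.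
- move=> k k' _ _ s1 s2 g1 g2; apply/ffunP => i.
  have [i5|i5] := ltnP i 5.
    have := sep_eq q1' kq (g1 (Ordinal i5)) (g2 (Ordinal i5)).
    move/eqP; rewrite eqn_mul2l /= /e /= => /eqP h; apply: val_inj.
    by move: h; rewrite (_ : inord i = i) //; apply: val_inj; rewrite /= inordK.
  have ei : i = inord 5.
    by apply: val_inj; rewrite /= inordK //; apply/eqP; rewrite eqn_leq i5 andbT -ltnS.
  have := sep_eq q1' kq s1 s2; move/eqP; rewrite eqn_add2l eqn_mul2l /= => /eqP h.
  by apply: val_inj; rewrite ei.
- move=> k k' x x' _ _ xD xD' /(fpoint_class R b0) [c' c'0 E].
  exact: vsplit_proj (vdn _ _ xD) (vdn _ _ xD') c'0 E.
Qed.

End SplitCase.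

(** * Summation over three parameters when w does not lie in K *)

Section InertCase.
Variables (R : realType) (K : fieldExtType rat) (m : nat) (f : 'I_m -> mpoly.mpoly 8 K).
Variables (H : rep K -> R) (j : 'I_m) (b : 'I_4 -> nat).
Hypothesis HH : anticanonical_height H.
Hypothesis b0 : forall i, (0 < b i)%N.
Local Notation d := (\dim {:K}).
Local Notation O := (@intO K).
Local Notation nrm := (@nrmK R K).
Local Notation HO := (orderK R K).
Local Notation bK := (fun i => (b i)%:R : K).
Local Notation Gv := (Geval f idfun bK).
Variable noroot : forall z : K, z ^+ 2 + z + 1 != 0.
Local Notation E := (quad noroot).
Local Notation HE := (orderQ HO noroot).
Local Notation th := (@qconj K noroot).
Local Notation w := (qw noroot).
Local Notation em := (qemb noroot).

Definition vinert (s : E * E) (i : 'I_4) : K := [:: s.1.1; s.1.2; s.2.1; s.2.2]`_i.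

Lemma vinert_coords s : [/\ em (vinert s 0) + em (vinert s 1) * w = s.1,
   em (vinert s 0) + em (vinert s 1) * (-1 - w) = th s.1,
   em (vinert s (inord 2)) + em (vinert s (inord 3)) * w = s.2 &
   em (vinert s (inord 2)) + em (vinert s (inord 3)) * (-1 - w) = th s.2].
Proof.
by rewrite /vinert !inordK //=; case: s => -[a0 a1] [c0 c1] /=; split; congr pair; rewrite /=; ring.
Qed.

Lemma xvec_inert s i : em (xvec (vinert s) i) = xtor w s (th s.1, th s.2) i.
Proof.
have [h1 h2 h3 h4] := vinert_coords s.
by rewrite xvec_rmorph /xvec (xeulE (qwP noroot)) h1 h2 h3 h4.
Qed.

Lemma nvec_rmorph (A B : comPzRingType) (g : {rmorphism A -> B}) (v : 'I_4 -> A) :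
  g (nvec v) = nvec (fun i => g (v i)).
Proof. by rewrite /nvec nq_rmorph gam0_rmorph gam1_rmorph. Qed.

Lemma vinert_proj s s' (c : K) : nvec (vinert s) != 0 -> nvec (vinert s') != 0 -> c != 0 ->
  (forall i, xvec (vinert s') i = c * xvec (vinert s) i) ->
  exists l m', [/\ l != 0, m' != 0, s'.1 = l * s.1 /\ s'.2 = l * s.2 & th s'.1 = m' * th s.1 /\ th s'.2 = m' * th s.2].
Proof.
move=> n1 n2 c0 eE.
have N v : nvec v != 0 -> nvec (fun i => em (v i)) != 0 by move=> h; rewrite -nvec_rmorph fmorph_eq0.
have c0' : em c != 0 by rewrite fmorph_eq0.
have eE' i : xvec (fun i => em (vinert s' i)) i = em c * xvec (fun i => em (vinert s i)) i.
  by rewrite -!xvec_rmorph eE rmorphM.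
have := xeul_proj (qwP noroot) (three_neq0 HE) (N _ n1) (N _ n2) c0' eE'.
have [h1 h2 h3 h4] := vinert_coords s; have [k1 k2 k3 k4] := vinert_coords s'.
by rewrite h1 h2 h3 h4 k1 k2 k3 k4.
Qed.

Lemma conj_fixed (x : E) : th x = x -> x = em x.1.
Proof.
case: x => x1 x2 [_ /esym e]; have : 2%:R * x2 = 0 by rewrite mulr_natl mulr2n {2}e subrr.
by move=> /eqP; rewrite mulf_eq0 (negPf (natF_neq0 HO (isT : (0 < 2)%N))) => /eqP ->.
Qed.

Theorem inert_count (v0 : 'I_4 -> K) : Gv v0 j != 0 -> exists (kp c q : R) (W : nat),
  [/\ 0 < kp, 0 < c, 2 <= q, (0 < W)%N & forall B y L, kp * (q ^+ y) ^+ (4 * d) <= B -> (1 + W * L <= y)%N ->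
     c * L%:R ^+ 3 * (q ^+ y) ^+ (4 * d) <= N_UH f H B].
Proof.
move=> Gv0; pose Psi (r : 'rV[K]_4) := Gv (fun i => r 0 i) j.
have pPsi : polyfun Psi.
  apply: (polyfun_Geval f (v := fun i (r : 'rV[K]_4) => r 0 i) (@polyfun_coord K 4) idfun (b := fun i _ => bK i)) => i.
  exact: polyfunC.
have vr : (fun i => (\row_i v0 i : 'rV[K]_4) 0 i) = v0 by apply/funext => i; rewrite mxE.
have Pu : Psi (\row_i v0 i) != 0 by rewrite /Psi vr.
have [T1 [T [c [Cs [T10 T0 c0 Cs1 HD]]]]] := caseB HO noroot pPsi Pu.
have Kg1 := KgB_ge1 HO noroot.
have [kap [M [kap1 HM]]] := class_count HE (qwP noroot) T0 Kg1.
have [cx cx1 Hx] := xtor_bound HE (qwP noroot) (qw_O noroot O) Kg1 T10.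
have [cH cH0 Hh] := fpoint_height f j HH b0.
have [q [q2 q1' Cq kq]] := ex_base Cs1 kap1.
have q1 := ltW q1'; have q0 := lt_trans ltr01 q1'.
have cx0 := lt_le_trans ltr01 cx1.
exists (cH * cx ^+ d), (c / M.+1%:R), q, (20 * (2 * d).+1)%N; split=> //.
- by rewrite mulr_gt0 // exprn_gt0.
- by rewrite divr_gt0 // ltr0n.
move=> B y L hB hy.
have [Zs <- HZ] := classes_below f j HH b0 B.
pose U : finType := {ffun 'I_3 -> 'I_L}.
have cU : #|U| = (L ^ 3)%N by rewrite card_ffun !card_ord.
(* The shift by 1 makes every g k i at least q >= Cs, as [caseB] requires. *)
pose e (k : U) (i : nat) : nat := (k (inord i)).+1.
have eL k i : (e k i <= L)%N by apply: ltn_ord.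
pose sg (k : U) := (e k 0 + 2 * e k 1 + 2 * e k 2)%N.
have sgL k : (sg k <= 5 * L)%N.
  exact: weighted_sum_le.
(* Exponents divisible by 4 let S^4 = q^(4 y) * prod G be solved in powers of q: here s and p have
   the same size, so no parameter shifts them. *)
pose g k i := q ^+ (4 * e k i).
pose G k := Gconj (g k 0%N) (g k 1%N) (g k 2).
pose S k := q ^+ (y + sg k).
have gP k : g k 0%N * g k 1%N ^+ 2 * g k 2 ^+ 2 = q ^+ (4 * sg k).
  exact: pow_weighted.
have GP k : \prod_i G k i = q ^+ (4 * sg k) by rewrite prod_Gconj gP.
have Cg k i : Cs <= g k i by apply: le_trans Cq _; rewrite ler_eXnr.
have sy k : (1 + 4 * sg k * (2 * d).+1 <= y)%N.
  by apply: leq_trans hy; apply: exponent_boundB.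
have X4 : (q ^+ y) ^+ (4 * d) = (q ^+ (4 * y)) ^+ d by rewrite -!exprM; congr (_ ^+ _); rewrite mulnA [(y * 4)%N]mulnC.
have SSE k : S k ^+ 2 * S k ^+ 2 = q ^+ (4 * y) * \prod_i G k i.
  by rewrite GP; apply: pow_sizeB.
have cS k : Cs * (g k 0%N * g k 1%N ^+ 2 * g k 2 ^+ 2) ^+ (2 * d).+1 <= S k.
  by rewrite gP -exprM; apply: pow_le => //; apply: leq_trans (sy k) (leq_addr _ _).
have /boolp.choice [D {}HD] := fun k => HD (g k 0%N) (g k 1%N) (g k 2) (S k) (Cg k 0%N) (Cg k 1%N) (Cg k 2) (cS k).
have S1 k : 1 <= S k by rewrite exprn_ege1.
have vE (s : E * E) : (fun i => (\row_(i < 4) [:: s.1.1; s.1.2; s.2.1; s.2.2]`_i : 'rV[K]_4) 0 i) = vinert s.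
  by apply/funext => i; rewrite mxE.
pose phi (x : data E) := pclass (fpoint b (vinert x.1.2)).
have vdG k x : x \in D k -> Gv (vinert x.1.2) j != 0.
  by have [_ h _] := HD k; move/h => [_ _ _ _]; rewrite /Psi vE.
have vdn k x : x \in D k -> nvec (vinert x.1.2) != 0.
  by move/vdG; rewrite /Geval mulf_eq0 negb_or => /andP [].
have := HM U _ (enum U) G S S D phi Zs (enum_uniq _) _ _ _ => Hfin.
rewrite -natrX -cU X4; apply: (@final_ineq _ _ _ U (fun k => size (D k))) => //.
  move=> k; have [_ _ h] := HD k.
  have p0 : 0 < \prod_i G k i by rewrite GP exprn_gt0.
  by rewrite -(main_sizeB d p0 (SSE k)) GP -gP; exact: h.
apply: Hfin.
- move=> k _; have [uD hD _] := HD k; split=> // x xD; have [sz gd pc [ex ep] _] := hD x xD; split=> //.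
  apply: HZ; first exact: vdG xD.
  apply: le_trans hB; rewrite X4 -mulrA -exprMn.
  have [gdat _ _] := sz.
  have pg0 : \prod_i x.1.1 i != 0 by apply/prodf_neq0 => i _; have [] := gdat i.
  (* The product of the g_i is fixed by conjugation, hence lies in K, so dividing by it rescales the
     point over K. *)
  have [gm Egm] : exists gm, \prod_i x.1.1 i = em gm by exists (\prod_i x.1.1 i).1; apply: conj_fixed.
  have gm0 : gm != 0 by move: pg0; rewrite Egm fmorph_eq0.
  apply: (Hh _ ((T1 ^ 25)%:R / gm)); first exact: vdG xD.
  + by rewrite mulf_neq0 ?invr_neq0 // (natF_neq0 HO) // expn_gt0 T10.
  + by rewrite mulr_ege1 // exprn_ege1.
  + move=> i; have := Hx (G k) (S k) (S k) x i sz pc (S1 k) (S1 k).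
    rewrite SSE mulfK; last by rewrite GP gt_eqF // exprn_gt0.
    rewrite ex -xvec_inert Egm -fmorphV -(rmorph_nat em) -!rmorphM qemb_O (nrmQ_emb HO).
    rewrite mulrAC => -[-> h]; split=> //; apply: le_trans h.
    by rewrite ler_peMl ?(nrm_ge0 HO) // ler1n.
- move=> k k' _ _ _ _ g1 g2; apply/ffunP => i.
  have key l (l5 : (l < 5)%N) r : Gconj (g k 0%N) (g k 1%N) (g k 2) (Ordinal l5) = g k r ->
      Gconj (g k' 0%N) (g k' 1%N) (g k' 2) (Ordinal l5) = g k' r -> k (inord r) = k' (inord r).
    move=> e1 e2; have := sep_eq q1' kq (a := (4 * e k r)%N) (b := (4 * e k' r)%N).
    rewrite -![q ^+ _]/(g _ _) -e1 -e2 => h; have := h (g1 _) (g2 _).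
    by move/eqP; rewrite eqn_mul2l /= eqSS => /eqP h'; apply: val_inj.
  have -> : i = inord i by apply: val_inj; rewrite /= inordK.
  case: i => [[|[|[|//]]] h] /=; [exact: (key 0%N isT)|exact: (key 1%N isT)|exact: (key 3 isT)].
- move=> k k' x x' kU kU' xD xD' /(fpoint_class R b0) [c' c'0 eE].
  have [_ hD _] := HD k; have [_ _ _ [ex _] _] := hD x xD.
  have [_ hD' _] := HD k'; have [_ _ _ [ex' _] _] := hD' x' xD'.
  rewrite ex ex'; exact: vinert_proj (vdn _ _ xD) (vdn _ _ xD') c'0 eE.
Qed.

End InertCase.

Theorem theorem1p3 (R : realType) (K : fieldExtType rat)
    (m : nat) (f : 'I_m -> mpoly.mpoly 8 K) (d1 d2 : 'I_m -> nat)
    (Hf : forall j, bihomog (d1 j) (d2 j) (f j))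
    (HU : open_dense R f)
    (H : rep K -> R) (HH : anticanonical_height H) :
  exists c : R, 0 < c /\ exists B0 : R, forall B : R, B0 <= B ->
    c * B * ln B ^+ (if `[< exists z : K, z ^+ 2 = - 3%:R >] then 6%N else 3%N)
      <= N_UH f H B.
Proof.
have [j [b [b0 [v0 Gv0]]]] := generic_fibre Hf HU.
have nz k : (0 < k)%N -> k%:R != 0 :> K := natF_neq0 (orderK R K) (k := k).
case: asboolP => [[z z2]|nz3].
  (* A square root of -3 in K gives a primitive cube root of unity, integral as a root of X^2 + X +
     1. *)
  pose w : K := (z - 1) / 2%:R.
  have wP : w ^+ 2 + w + 1 = 0.
    transitivity ((z ^+ 2 + 3%:R) / 4%:R); last by rewrite z2 addNr mul0r.
    rewrite /w; field; by rewrite !nz.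
  have wO : w \in @intO K.
    apply/intO_set; exists ('X^2 + 'X + 1); split.
      rewrite monicE /lead_coef.
      have -> : size ('X^2 + 'X + 1 : {poly int}) = 3.
        rewrite -addrA size_polyDl size_polyXn // size_polyDl size_polyX // size_poly1 //.
      by rewrite !coefE.
    by rewrite rootE !rmorphD /= map_polyXn map_polyX rmorph1 !hornerE wP.
  have [kp [c [q [W [kp0 c0 q2 W0 h]]]]] := split_count HH b0 wP wO Gv0.
  exact: (growth (d_gt0 K) W0 kp0 c0 q2 h).
have noroot (z : K) : z ^+ 2 + z + 1 != 0.
  apply/eqP => e; apply: nz3; exists (2%:R * z + 1).
  transitivity (4%:R * (z ^+ 2 + z + 1) - 3%:R); first by ring.
  by rewrite e mulr0 sub0r.
have [kp [c [q [W [kp0 c0 q2 W0 h]]]]] := inert_count HH b0 noroot Gv0.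
exact: (growth (d_gt0 K) W0 kp0 c0 q2 h).
Qed.
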